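(* For every $\gamma\in(0,1]$ satisfying $\gamma<\alpha$, the following properties hold. 1. The phase transition in temperature of $-\log Df$ is nonpersistent in $C^\gamma(\mathbb{R})$, and $\beta_{\mathrm{crit},\gamma}$ is discontinuous at $-\log Df$. 2. The potential $-\log Df$ is in $\partial\mathcal{G}(\gamma)$, and for each $\beta\in(0,+\infty)$ the potential $-\beta\log Df$ is in $\mathcal{PT}(\gamma)$ if and only if $\beta\in[1,+\infty)$. 3. The phase transition locus $\mathcal{PT}(\gamma)$ fails to be a co-dimension $1$ real-analytic subset of $C^\gamma(\mathbb{R})$ at $-\log Df$. In particular, the set $\mathcal{PT}(\gamma)$ is not contained in $\operatorname{int}(\mathcal{G}(\gamma))$, the function $\beta_{\mathrm{crit},\gamma}$ is discontinuous, and $\beta_{\mathrm{crit},\gamma}^{-1}(1)$ is strictly contained in $\mathcal{PT}(\gamma)$.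
   Context: Fix $\alpha\in(0,+\infty)$ and let $f\colon[0,1]\to[0,1]$ be the intermittent map given by $f(x)=x(1+x^{\alpha})$ if $x(1+x^{\alpha})\le 1$, and $f(x)=x(1+x^{\alpha})-1$ otherwise; its derivative is $Df(x)=1+(1+\alpha)x^\alpha$ (also at the discontinuity point of $f$, where the one-sided branch derivative is used). Let $\mathscr{M}$ be the set of Borel probability measures on $[0,1]$ invariant by $f$; for $\nu\in\mathscr{M}$ let $h_\nu$ be its measure-theoretic entropy. For $\gamma\in(0,1]$, $C^{\gamma}(\mathbb{R})$ (resp. $C^\gamma(\mathbb{C})$) is the Banach space of real-valued (resp. complex-valued) $\gamma$-Hölder continuous functions on $[0,1]$ with norm $\|\varphi\|_\gamma=\|\varphi\|+|\varphi|_\gamma$, where $\|\varphi\|=\sup_{[0,1]}|\varphi|$ and $|\varphi|_\gamma=\sup_{x\ne y}|\varphi(x)-\varphi(y)|/|x-y|^\gamma$; interiors ($\operatorname{int}$) and boundaries ($\partial$) are taken in $C^\gamma(\mathbb{R})$. For a continuous $\varphi\colon[0,1]\to\mathbb{R}$ (a potential), the pressure is $P(\varphi)=\sup\{h_\nu+\int\varphi\,d\nu:\nu\in\mathscr{M}\}$, and a Gibbs state of $f$ for $\varphi$ is a measure in $\mathscr{M}$ attaining this supremum. $\delta_0$ is the Dirac mass at $0$. A measure $\nu\in\mathscr{M}$ is exponentially mixing if there are $C\in(0,+\infty)$ and $\rho\in(0,1)$ such that for every bounded measurable $\psi\colon[0,1]\to\mathbb{R}$, every Lipschitz $\tilde\psi\colon[0,1]\to\mathbb{R}$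 and every $n\in\mathbb{N}$, $|\int\psi\circ f^n\cdot\tilde\psi\,d\nu-\int\psi\,d\nu\int\tilde\psi\,d\nu|\le C\|\psi\|\,|\tilde\psi|_1\,\rho^n$. The intermittent phase $\mathcal{I}(\gamma)$ is the set of $\varphi\in C^\gamma(\mathbb{R})$ for which there is an exponentially mixing Gibbs state of strictly positive entropy. The stationary phase $\mathcal{S}(\gamma)$ is the interior of the set of $\varphi\in C^\gamma(\mathbb{R})$ for which $\delta_0$ is the unique Gibbs state. For $\gamma\in(0,\min\{\alpha,1\}]$, the phase transition locus $\mathcal{PT}(\gamma)$ is the common boundary $\partial\mathcal{I}(\gamma)=\partial\mathcal{S}(\gamma)$ (these two boundaries coincide). A ground state of $f$ for a continuous potential $\varphi$ is a measure $\nu\in\mathscr{M}$ with $\int\varphi\,d\nu=\sup_{\nu'\in\mathscr{M}}\int\varphi\,d\nu'$. $\mathcal{G}(\gamma)$ is the set of $\varphi\in C^\gamma(\mathbb{R})$ for which $\delta_0$ is a ground state. A Hölder continuous potential $\varphi$ undergoes a phase transition in temperature if the function $\beta\mapsto P(\beta\varphi)$ fails to be real-analytic on $(0,+\infty)$; in that case there is a unique point of $(0,+\infty)$ at which this function fails to be real-analytic, called the phase transition parameter of $\varphi$. The potential $-\log Df$, which belongs to $C^\gamma(\mathbb{R})$ for $\gamma\le\min\{\alpha,1\}$, is known to undergo a phase transition in temperature, with parameter $1$. The phase transition in temperature of $\varphi\in C^\gamma(\mathbb{R})$ is persistent in $C^\gamma(\mathbb{R})$ if all potentials in a neighborhood of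 $\varphi$ in $C^\gamma(\mathbb{R})$ undergo a phase transition in temperature and the phase transition parameter, as a function on this neighborhood, is continuous at $\varphi$; otherwise it is nonpersistent. For $\varphi\in C^\gamma(\mathbb{R})$, $\beta_{\mathrm{crit},\gamma}(\varphi)\in(0,+\infty]$ is the phase transition parameter of $\varphi$ if $\varphi$ undergoes a phase transition in temperature, and $+\infty$ otherwise. Real-analyticity: for an open $\Delta\subseteq\mathbb{C}$, $H\colon\Delta\to C^\gamma(\mathbb{C})$ is holomorphic if it is complex-differentiable in $\|\cdot\|_\gamma$ at every point. For an open $\mathcal{U}\subseteq C^\gamma(\mathbb{C})$, $h\colon\mathcal{U}\to\mathbb{C}$ is holomorphic if $h\circ H$ is holomorphic for every open $\Delta\subseteq\mathbb{C}$ and every holomorphic $H\colon\Delta\to\mathcal{U}$. A real-valued function on an open subset of $C^\gamma(\mathbb{R})$ is real-analytic if it extends to a complex-valued holomorphic function on an open subset of $C^\gamma(\mathbb{C})$. A subset $\mathcal{T}$ of $C^\gamma(\mathbb{R})$ is a co-dimension $1$ real-analytic subset if for every $\varphi\in\mathcal{T}$ there are an open neighborhood $\mathcal{U}$ of $\varphi$ in $C^\gamma(\mathbb{R})$ and a nonconstant real-analytic function $\mathcal{U}\to\mathbb{R}$ vanishing precisely on $\mathcal{U}\cap\mathcal{T}$; it fails to be so at a given $\varphi\in\mathcal{T}$ if no such $\mathcal{U}$ and function exist for that $\varphi$. *)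

(* Defs.v *)
From HB Require Import structures.
From mathcomp Require Import all_boot all_order all_algebra.
From mathcomp Require Import all_classical all_reals all_analysis.
From mathcomp Require Import ring lra.
From mathcomp Require Import complex.

Set Implicit Arguments.
Unset Strict Implicit.
Unset Printing Implicit Defensive.

Import Order.TTheory GRing.Theory Num.Theory.
Import numFieldNormedType.Exports.

Local Open Scope classical_set_scope.
Local Open Scope ring_scope.

Definition unit_interval (R : realType) : Type := set_type [set` `[0 : R, 1]].

Section unit_interval.
Variable R : realType.
Local Notation I := (unit_interval R).

Definition ival (x : I) : R := sval x.

Lemma ival_itv (x : I) : 0 <= ival x <= 1.
Proof. by case: x => x /= /set_mem /=; rewrite in_itv. Qed.

Lemma ival_inj : injective ival.
Proof. exact: val_inj. Qed.

Lemma Imk_subproof (x : R) : 0 <= x <= 1 -> x \in [set` `[0 : R, 1]].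
Proof. by move=> hx; apply/mem_set; rewrite /= in_itv. Qed.

Definition Imk (x : R) (hx : 0 <= x <= 1) : I := exist _ x (Imk_subproof hx).

Lemma ImkK x hx : ival (@Imk x hx) = x. Proof. by []. Qed.

Definition I0 : I := Imk (introT andP (conj (lexx _) ler01)).
Definition I1 : I := Imk (introT andP (conj ler01 (lexx _))).

HB.instance Definition _ := Topological.copy I (set_type [set` `[0 : R, 1]]).
HB.instance Definition _ := isPointed.Build I I0.
HB.instance Definition _ := Measurable.copy I (g_sigma_algebraType (@open I)).

End unit_interval.

(* R or R[i]: the norm of a normedModType over a numFieldType K is K-valued,
   whereas the suprema below have to be taken in R. *)
Record scalars (R : realType) := Scalars {
  scalar :> numFieldType ;
  of_real : {rmorphism R -> scalar} ;
  abs : scalar -> R ;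
  absE : forall z, of_real (abs z) = `|z| ;
  ler_of_real : forall x y, (of_real x <= of_real y) = (x <= y) }.

Definition real_scalars (R : realType) : scalars R :=
  @Scalars R R idfun Num.norm (fun=> erefl) (fun _ _ => erefl).

Definition complex_scalars (R : realType) : scalars R :=
  @Scalars R R[i] (real_complex R) (@ComplexField.Normc.normc R)
    (fun=> erefl) (@lecR R).

Section scalars_theory.
Variables (R : realType) (K : scalars R).
Implicit Types z w : K.

Lemma of_real_inj : injective (of_real K).
Proof. by move=> x y xy; apply/le_anti; rewrite -!(@ler_of_real _ K) xy lexx. Qed.

Lemma abs_ge0 z : 0 <= abs z.
Proof. by rewrite -(@ler_of_real _ K) absE rmorph0. Qed.

Lemma abs0 : abs (0 : K) = 0.
Proof. by apply: of_real_inj; rewrite absE normr0 rmorph0. Qed.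

Lemma abs_eq0 z : abs z = 0 -> z = 0.
Proof. by move=> z0; apply/normr0_eq0; rewrite -absE z0 rmorph0. Qed.

Lemma absD z w : abs (z + w) <= abs z + abs w.
Proof. by rewrite -(@ler_of_real _ K) rmorphD/= !absE ler_normD. Qed.

Lemma absM z w : abs (z * w) = abs z * abs w.
Proof. by apply: of_real_inj; rewrite rmorphM/= !absE normrM. Qed.

Lemma abs_of_real x : abs (of_real K x) = `|x|.
Proof.
apply: of_real_inj; rewrite absE; have [x0|/ltW x0] := leP 0 x.
- by rewrite !ger0_norm// -(rmorph0 (of_real K)) ler_of_real.
- by rewrite !ler0_norm ?rmorphN// -(rmorph0 (of_real K)) ler_of_real.
Qed.

End scalars_theory.

Section holder_space.
Variables (R : realType) (K : scalars R) (g : {posnum R}).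
Local Notation I := (unit_interval R).
Implicit Types phi psi : I -> K.

Definition is_holder phi : Prop := exists C : R,
  forall x y, abs (phi x - phi y) <= C * `|ival x - ival y| `^ g%:num.

Definition sup_norm phi : R := sup [set abs (phi x) | x in setT].

Definition holder_seminorm phi : R :=
  sup [set abs (phi p.1 - phi p.2) / `|ival p.1 - ival p.2| `^ g%:num
      | p in [set p : I * I | p.1 <> p.2]].

Definition holder_norm phi : R := sup_norm phi + holder_seminorm phi.

Definition holder_pred : {pred I -> K} := mem [set phi | is_holder phi].

Record holder := Holder {
  holder_fun :> I -> K ;
  _ : holder_fun \in holder_pred }.

HB.instance Definition _ := [isSub for holder_fun].
HB.instance Definition _ := [Choice of holder by <:].

Lemma holderP (phi : holder) : is_holder phi.
Proof. by case: phi => phi /= /set_mem. Qed.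

Lemma holder_submod_closed : submod_closed holder_pred.
Proof.
split=> [|a phi psi /set_mem[C hC] /set_mem[D hD]]; apply/mem_set.
  by exists 0 => x y; rewrite subrr abs0 mul0r.
exists (abs a * C + D) => x y.
have -> : (a *: phi + psi) x - (a *: phi + psi) y
    = a * (phi x - phi y) + (psi x - psi y).
  by rewrite mulrBr opprD addrACA.
rewrite (le_trans (absD _ _))// absM mulrDl lerD// -mulrA.
by rewrite ler_wpM2l// abs_ge0.
Qed.

HB.instance Definition _ :=
  GRing.isSubmodClosed.Build _ _ holder_pred holder_submod_closed.
HB.instance Definition _ := [SubChoice_isSubLmodule of holder by <:].

Let diag : set (I * I) := [set p | p.1 <> p.2].

Let diag0 : diag (I1 R, I0 R).
Proof. by move=> /= /(congr1 (@ival R)) /= /eqP; rewrite oner_eq0. Qed.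

Lemma dist_le1 (x y : I) : `|ival x - ival y| <= 1.
Proof.
have /andP[x0 x1] := ival_itv x; have /andP[y0 y1] := ival_itv y.
by rewrite ler_norml; apply/andP; split; lra.
Qed.

Lemma dist_powR_gt0 (x y : I) : x <> y -> 0 < `|ival x - ival y| `^ g%:num.
Proof.
move=> xy; apply: powR_gt0; rewrite normr_gt0 subr_eq0.
by apply/eqP => /ival_inj.
Qed.

Lemma dist_powR_le1 (x y : I) : `|ival x - ival y| `^ g%:num <= 1.
Proof.
have -> : 1 = 1 `^ g%:num :> R by rewrite powR1.
by rewrite ge0_ler_powR// ?nnegrE// dist_le1.
Qed.

Lemma sup_norm_ub (phi : holder) x : abs (phi x) <= sup_norm phi.
Proof.
apply: ub_le_sup; last by exists x.
have [C hC] := holderP phi; exists (`|C| + abs (phi (I0 R))) => _ [y _ <-].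
rewrite -[in leLHS](subrK (phi (I0 R)) (phi y)) (le_trans (absD _ _))// lerD2r.
rewrite (le_trans (hC _ _))// (le_trans (ler_wpM2r _ (ler_norm C))) ?powR_ge0//.
by rewrite ler_piMr// dist_powR_le1.
Qed.

Lemma sup_norm_le phi (M : R) : (forall x, abs (phi x) <= M) -> sup_norm phi <= M.
Proof.
by move=> hM; apply: ge_sup => [|_ [x _ <-]//]; exists (abs (phi (I0 R))), (I0 R).
Qed.

Lemma holder_seminorm_ub (phi : holder) x y :
  abs (phi x - phi y) <= holder_seminorm phi * `|ival x - ival y| `^ g%:num.
Proof.
have [->|/eqP xy] := eqVneq x y.
  by rewrite !subrr abs0 normr0 powR0 ?mulr0// gt_eqF.
rewrite -ler_pdivrMr ?dist_powR_gt0//; apply: ub_le_sup; last by exists (x, y).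
have [C hC] := holderP phi; exists C => _ [[u v] /= uv <-].
by rewrite ler_pdivrMr ?dist_powR_gt0.
Qed.

Lemma holder_seminorm_le phi (M : R) :
  (forall x y, abs (phi x - phi y) <= M * `|ival x - ival y| `^ g%:num) ->
  holder_seminorm phi <= M.
Proof.
move=> hM; apply: ge_sup => [|_ [[u v] /= uv <-]].
  by eexists; exists (I1 R, I0 R).
by rewrite ler_pdivrMr ?dist_powR_gt0.
Qed.

Lemma sup_norm_ge0 (phi : holder) : 0 <= sup_norm phi.
Proof. exact: le_trans (abs_ge0 _) (sup_norm_ub phi (I0 R)). Qed.

Lemma holder_seminorm_ge0 (phi : holder) : 0 <= holder_seminorm phi.
Proof.
have := holder_seminorm_ub phi (I1 R) (I0 R).
rewrite subr0 normr1 powR1 mulr1; exact/le_trans/abs_ge0.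
Qed.

Lemma holder_normD (phi psi : holder) :
  holder_norm (phi + psi) <= holder_norm phi + holder_norm psi.
Proof.
rewrite /holder_norm addrACA lerD//.
  apply: sup_norm_le => x; rewrite (le_trans (absD _ _))//.
  by rewrite lerD// sup_norm_ub.
apply: holder_seminorm_le => x y; 
  rewrite -[X in abs X]/((phi x + psi x) - (phi y + psi y)) opprD addrACA.
rewrite (le_trans (absD _ _))// mulrDl.
by rewrite lerD// holder_seminorm_ub.
Qed.

Let holder_normZ_le (a : K) (phi : holder) :
  holder_norm (a *: phi) <= abs a * holder_norm phi.
Proof.
rewrite mulrDr lerD//.
  apply: sup_norm_le => x; rewrite absM ler_wpM2l ?abs_ge0//.
  exact: sup_norm_ub.
apply: holder_seminorm_le => x y.
rewrite -[X in abs X]/(a * phi x - a * phi y).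
by rewrite -mulrBr absM -mulrA ler_wpM2l ?abs_ge0// holder_seminorm_ub.
Qed.

Lemma holder_normZ (a : K) (phi : holder) :
  holder_norm (a *: phi) = abs a * holder_norm phi.
Proof.
apply/le_anti; rewrite holder_normZ_le /=.
have [->|a0] := eqVneq a 0.
  rewrite abs0 mul0r; apply: addr_ge0; [exact: (sup_norm_ge0 (0 *: phi))|].
  exact: (holder_seminorm_ge0 (0 *: phi)).
have aa : abs a^-1 * abs a = 1.
  by rewrite -absM mulVf//; have := abs_of_real K 1; rewrite rmorph1 normr1.
rewrite -{1}[phi](scalerK a0).
rewrite (le_trans (ler_wpM2l (abs_ge0 _) (holder_normZ_le _ _)))//.
by rewrite mulrA [_ * abs a^-1]mulrC aa mul1r.
Qed.

Lemma holder_norm_eq0 (phi : holder) : holder_norm phi = 0 -> phi = 0.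
Proof.
move=> /eqP; rewrite paddr_eq0 ?sup_norm_ge0 ?holder_seminorm_ge0//.
move=> /andP[/eqP phi0 _]; apply/val_inj/funext => x.
by apply/abs_eq0/le_anti; rewrite abs_ge0 -phi0 sup_norm_ub.
Qed.

Let holder_Knorm (phi : holder) : K := of_real K (holder_norm phi).

Let holder_KnormD (phi psi : holder) :
  holder_Knorm (phi + psi) <= holder_Knorm phi + holder_Knorm psi.
Proof. by rewrite -rmorphD ler_of_real holder_normD. Qed.

Let holder_KnormZ (a : K) (phi : holder) : holder_Knorm (a *: phi) = `|a| * holder_Knorm phi.
Proof. by rewrite /holder_Knorm holder_normZ rmorphM/= absE. Qed.

Let holder_Knorm_eq0 (phi : holder) : holder_Knorm phi = 0 -> phi = 0.
Proof.
by rewrite -(rmorph0 (of_real K)) => /of_real_inj/holder_norm_eq0.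
Qed.

HB.instance Definition _ := @Lmodule_isNormed.Build K holder
  holder_Knorm holder_KnormD holder_KnormZ holder_Knorm_eq0.

Lemma holder_KnormE (phi : holder) : `|phi| = of_real K (holder_norm phi).
Proof. by []. Qed.

End holder_space.

Definition holderR (R : realType) (g : {posnum R}) : Type :=
  holder (real_scalars R) g.
Definition holderC (R : realType) (g : {posnum R}) : Type :=
  holder (complex_scalars R) g.

HB.instance Definition _ (R : realType) (g : {posnum R}) :=
  NormedModule.copy (holderR g) (holder (real_scalars R) g).
HB.instance Definition _ (R : realType) (g : {posnum R}) :=
  NormedModule.copy (holderC g) (holder (complex_scalars R) g).

Section complexification.
Variables (R : realType) (K : scalars R) (g : {posnum R}).

Lemma holder_of_real_subproof (phi : holderR g) :
  (fun x => of_real K (phi x)) \in holder_pred (K := K) g.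
Proof.
have [C hC] := holderP phi; apply/mem_set; exists C => x y.
by rewrite -rmorphB abs_of_real; exact: hC.
Qed.

Definition holder_of_real (phi : holderR g) : holder K g :=
  Holder (holder_of_real_subproof phi).

End complexification.

Definition complexify (R : realType) (g : {posnum R}) (phi : holderR g) :
  holderC g := holder_of_real (complex_scalars R) phi.

Lemma complexifyE (R : realType) (g : {posnum R}) (phi : holderR g) x :
  complexify phi x = (phi x)%:C%C.
Proof. by []. Qed.

Definition boundary (T : topologicalType) (A : set T) : set T :=
  closure A `\` A°.

Definition analytic_at (R : realType) (h : R -> R) (x : R) : Prop :=
  exists (a : nat -> R) (r : R), 0 < r /\
    forall y, `|y - x| < r -> series (fun n => a n * (y - x) ^+ n) @ \oo --> h y.

Section real_analytic.
Variables (R : realType) (g : {posnum R}).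
Local Notation C := (R[i]^o).
Local Notation CR := (holderR g).
Local Notation CC := (holderC g).

(* Total functions stand for functions on D or U; [derivable _ z 1] only depends
   on the germ at z. *)
Definition holomorphic_curve (D : set C) (H : C -> CC) : Prop :=
  forall z, D z -> derivable H z 1.

Definition holomorphic_on (D : set C) (h : C -> C) : Prop :=
  forall z, D z -> derivable h z 1.

Definition holomorphic (U : set CC) (h : CC -> C) : Prop :=
  forall (D : set C) (H : C -> CC), open D -> holomorphic_curve D H ->
    (forall z, D z -> U (H z)) -> holomorphic_on D (h \o H).

Definition real_analytic (U : set CR) (h : CR -> R) : Prop :=
  exists (W : set CC) (h' : CC -> C), [/\ open W, holomorphic W h' &
    forall phi, U phi -> W (complexify phi) /\
      h' (complexify phi) = (h phi)%:C%C].

Definition codim1_at (T : set CR) (phi : CR) : Prop :=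
  exists (U : set CR) (h : CR -> R), [/\ open U, U phi, real_analytic U h,
    (exists psi1 psi2, [/\ U psi1, U psi2 & h psi1 <> h psi2]) &
    forall psi, U psi -> (h psi = 0 <-> T psi)].

Definition fails_codim1_at (T : set CR) (phi : CR) : Prop :=
  T phi /\ ~ codim1_at T phi.

End real_analytic.

Section intermittent.
Variables (R : realType) (alpha : {posnum R}).
Local Notation I := (unit_interval R).

Definition branch (x : R) : R :=
  let y := x * (1 + x `^ alpha%:num) in if y <= 1 then y else y - 1.

Lemma branch_itv (x : I) : 0 <= branch (ival x) <= 1.
Proof.
have /andP[x0 x1] := ival_itv x; rewrite /branch.
have p0 : 0 <= ival x `^ alpha%:num by exact: powR_ge0.
have p1 : ival x `^ alpha%:num <= 1.
  have -> : 1 = 1 `^ alpha%:num :> R by rewrite powR1.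
  by rewrite ge0_ler_powR ?nnegrE.
have y0 : 0 <= ival x * (1 + ival x `^ alpha%:num) by rewrite mulr_ge0// addr_ge0.
have y2 : ival x * (1 + ival x `^ alpha%:num) <= 1 * 2.
  by rewrite ler_pM// ?addr_ge0//; lra.
by case: ifPn => [->|]; rewrite ?y0// -ltNge => y1; apply/andP; split; lra.
Qed.

Definition intermittent_map (x : I) : I := Imk (branch_itv x).
Local Notation f := intermittent_map.

Definition Df (x : I) : R := 1 + (1 + alpha%:num) * ival x `^ alpha%:num.

Definition invariant_measure (nu : probability I R) : Prop :=
  forall A, measurable A -> nu (f @^-1` A) = nu A.

Section entropy.
Variable nu : probability I R.
Local Open Scope ereal_scope.

(* A finite partition into at most k pieces is given by its labelling
   xi : I -> 'I_k; w ranges over the length n itineraries. *)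
Definition cylinder k (xi : I -> 'I_k) n (w : {ffun 'I_n -> 'I_k}) : set I :=
  [set x | forall j : 'I_n, xi (iter j f x) = w j].

(* By convention [ln 0 = 0], so that empty cylinders contribute 0. *)
Definition partition_entropy k (xi : I -> 'I_k) (n : nat) : R :=
  (\sum_(w : {ffun 'I_n -> 'I_k})
     - (fine (nu (cylinder xi w)) * ln (fine (nu (cylinder xi w)))))%R.

Definition entropy_wrt k (xi : I -> 'I_k) : \bar R :=
  limn (fun n => (partition_entropy xi n / n%:R)%:E).

Definition entropy : \bar R :=
  ereal_sup [set h | exists k (xi : I -> 'I_k),
    (forall i, measurable (xi @^-1` [set i])) /\ h = entropy_wrt xi].

End entropy.

Definition pressure (phi : I -> R) : \bar R :=
  ereal_sup [set (entropy nu + \int[nu]_x (phi x)%:E)%E | nu in invariant_measure].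

Definition gibbs_state (phi : I -> R) (nu : probability I R) : Prop :=
  invariant_measure nu /\ (entropy nu + \int[nu]_x (phi x)%:E)%E = pressure phi.

Definition ground_state (phi : I -> R) (nu : probability I R) : Prop :=
  invariant_measure nu /\ (\int[nu]_x (phi x)%:E)%E =
    ereal_sup [set (\int[nu']_x (phi x)%:E)%E | nu' in invariant_measure].

Definition exponentially_mixing (nu : probability I R) : Prop :=
  exists C rho : R, [/\ 0 < C, 0 < rho < 1 &
    forall (psi psi' : I -> R) (n : nat),
      measurable_fun setT psi -> bounded_fun psi ->
      is_holder (K := real_scalars R) 1%:pos psi' ->
      `| \int[nu]_x (psi (iter n f x) * psi' x)
         - (\int[nu]_x psi x) * (\int[nu]_x psi' x) |
      <= C * sup_norm (K := real_scalars R) psi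
           * holder_seminorm (K := real_scalars R) 1%:pos psi' * rho ^+ n].

Definition delta0 : probability I R := \d_(I0 R).

Definition unique_gibbs_delta0 (phi : I -> R) : Prop :=
  gibbs_state phi delta0 /\
  forall nu, gibbs_state phi nu -> forall A, measurable A -> nu A = delta0 A.

Section phases.
Variable g : {posnum R}.
Local Notation CR := (holderR g).

Definition intermittent_phase : set CR :=
  [set phi | exists nu, [/\ gibbs_state phi nu, exponentially_mixing nu
                          & (0 < entropy nu)%E]].

Definition stationary_phase : set CR :=
  [set phi : CR | unique_gibbs_delta0 phi]°.

(* The paper's phase transition locus is the common boundary of
   [intermittent_phase] and [stationary_phase]. *)
Definition transition_locus : set CR := boundary intermittent_phase.

Definition ground_delta0 : set CR := [set phi : CR | ground_state phi delta0].

Definition transition_param_set (phi : CR) : set R :=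
  [set b : R | 0 < b /\ ~ analytic_at (fun t : R => fine (pressure (t *: phi))) b].

Definition undergoes_transition (phi : CR) : Prop :=
  ~ forall b : R, 0 < b -> analytic_at (fun t : R => fine (pressure (t *: phi))) b.

(* [transition_param_set phi] has at most one element; 0 is a junk value used
   when [phi] does not undergo a phase transition. *)
Definition transition_param (phi : CR) : R := xget 0 (transition_param_set phi).

Definition persistent (phi : CR) : Prop :=
  (\forall psi \near phi, undergoes_transition psi) /\
  {for phi, continuous transition_param}.

(* [nonpersistent] speaks of the phase transition of [phi], which must exist. *)
Definition nonpersistent (phi : CR) : Prop :=
  undergoes_transition phi /\ ~ persistent phi.

Definition beta_crit (phi : CR) : \bar R :=
  if `[< undergoes_transition phi >] then (transition_param phi)%:E else +oo%E.

End phases.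

End intermittent.

Arguments transition_locus {R} alpha g.
Arguments ground_delta0 {R} alpha g.
Arguments beta_crit {R} alpha g.

Section geometric_potential.
Variable R : realType.

Lemma ln_dist (u v : R) : 1 <= u -> 1 <= v -> `|ln u - ln v| <= `|u - v|.
Proof.
wlog vu : u v / v <= u => [hw u1 v1|u1 v1].
  have [|/ltW uv] := leP v u; first by move/hw; exact.
  by rewrite distrC (distrC u) hw.
have v0 : 0 < v by lra.
have u0 : 0 < u by lra.
rewrite !ger0_norm ?subr_ge0 ?ler_ln ?posrE//.
rewrite -ln_div ?posrE// (_ : u / v = 1 + (u - v) / v); last by field; lra.
rewrite (le_trans (le_ln1Dx _))//.
  by rewrite (lt_le_trans (ltrN10 _))// divr_ge0//; lra.
by rewrite ler_pdivrMr// ler_peMr//; lra.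
Qed.

Lemma bernoulli_le (t : R) n : 0 <= t <= 1 -> 1 - t ^+ n <= n%:R * (1 - t).
Proof.
move=> /andP[t0 t1]; elim: n => [|n ih]; first by rewrite expr0 subrr mul0r.
rewrite exprS -natr1 mulrDl mul1r.
have -> : 1 - t * t ^+ n = t * (1 - t ^+ n) + (1 - t) by ring.
rewrite lerD2r (le_trans _ ih)// ler_piMl// subr_ge0.
exact: exprn_ile1.
Qed.

Lemma powR_dist (a g x y : R) : 0 < g -> g <= 1 -> g <= a ->
    0 <= x <= 1 -> 0 <= y <= 1 ->
  `|x `^ a - y `^ a| <= (Num.truncn a).+1%:R * `|x - y| `^ g.
Proof.
move=> g0 g1 ga.
wlog yx : x y / y <= x => [hw x1 y1|/andP[x0 x1] /andP[y0 y1]].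
  have [|/ltW xy] := leP y x; first by move/hw; exact.
  by rewrite distrC (distrC x) hw.
have a0 : 0 < a by lra.
set N := _.+1; have Na : a <= N%:R by rewrite ltW// truncnS_gt.
have N1 : 1 <= N%:R :> R by rewrite ler1n.
have [->|xy] := eqVneq y x; first by rewrite !subrr normr0 mulr_ge0 ?powR_ge0// ler0n.
have {xy yx} yx : y < x by rewrite lt_neqAle xy.
have {x0} x0 : 0 < x by lra.
rewrite ger0_norm; last by rewrite subr_ge0 ge0_ler_powR ?nnegrE// ltW.
rewrite [X in X `^ g]ger0_norm; last by rewrite subr_ge0 ltW.
pose t := y / x.
have t0 : 0 <= t by rewrite divr_ge0// ltW.
have t1 : t < 1 by rewrite ltr_pdivrMr// mul1r.
have yE : y = x * t by rewrite /t mulrCA divff ?mulr1// gt_eqF.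
have xB : x - y = x * (1 - t) by rewrite mulrBr mulr1 -yE.
have -> : x `^ a - y `^ a = x `^ a * (1 - t `^ a).
  by rewrite [in LHS]yE powRM ?(ltW x0)// mulrBr mulr1.
have ta1 : t `^ a <= 1.
  have -> : 1 = 1 `^ a :> R by rewrite powR1.
  by rewrite ge0_ler_powR ?nnegrE// ltW.
have xy0 : 0 < x - y by rewrite subr_gt0.
have [a1|/ltW a1] := leP a 1.
  have tt : t <= t `^ a.
    move: t0; rewrite le_eqVlt => /predU1P[<-|tp]; first exact: powR_ge0.
    by rewrite ger1_powR// tp ltW.
  apply: (@le_trans _ _ ((x - y) `^ g)); last by rewrite ler_peMl ?powR_ge0.
  apply: (@le_trans _ _ ((x - y) `^ a)); last by rewrite ger_powR//; lra.
  rewrite xB powRM ?subr_ge0 ?(ltW x0) ?(ltW t1)// ler_wpM2l ?powR_ge0//.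
  apply: (@le_trans _ _ (1 - t)); first by rewrite lerD2l lerN2.
  by rewrite ger1_powR//; lra.
apply: (@le_trans _ _ (N%:R * (x - y))); last first.
  by rewrite ler_wpM2l ?ler0n// ger1_powR//; lra.
rewrite xB mulrCA ler_pM ?powR_ge0 ?subr_ge0//.
  rewrite -[leRHS]powRr1 ?(ltW x0)// ger_powR//; lra.
rewrite (le_trans _ (@bernoulli_le t N _)) ?t0 ?(ltW t1)// lerD2l lerN2 -powR_mulrn//.
move: t0; rewrite le_eqVlt => /predU1P[<-|tp].
  by rewrite !powR0 ?gt_eqF// ltr0n.
by rewrite ger_powR// tp ltW.
Qed.

Variables alpha g : {posnum R}.
Local Notation I := (unit_interval R).

Lemma Df_ge1 (x : I) : 1 <= Df alpha x.
Proof. by rewrite lerDl mulr_ge0 ?powR_ge0// addr_ge0. Qed.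

Hypotheses (g1 : g%:num <= 1) (ga : g%:num <= alpha%:num).

Lemma neg_log_Df_subproof :
  (fun x => - ln (Df alpha x)) \in holder_pred (K := real_scalars R) g.
Proof.
apply/mem_set.
exists ((1 + alpha%:num) * (Num.truncn alpha%:num).+1%:R) => x y /=.
rewrite -opprD normrN (le_trans (ln_dist (Df_ge1 _) (Df_ge1 _)))//.
rewrite /Df opprD addrACA subrr add0r -mulrBr normrM ger0_norm ?addr_ge0//.
by rewrite -mulrA ler_wpM2l ?addr_ge0// powR_dist ?ival_itv.
Qed.

Definition neg_log_Df : holderR g := Holder neg_log_Df_subproof.

Lemma neg_log_DfE x : neg_log_Df x = - ln (Df alpha x).
Proof. by []. Qed.

End geometric_potential.

(* Main.v *)
(** The inverse branches of [f] contract cylinders, so the top exponential growth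
    rate [Ptop phi] of the transfer operator of a Hölder potential [phi] can be
    studied by hand. It equals the variational pressure: the upper bound is Gibbs'
    inequality, and when [phi 0 < Ptop phi] the operator has a positive
    eigenfunction and a spectral gap, which produce an exponentially mixing Gibbs
    state of positive entropy and make [t |-> Ptop (t phi)] analytic at [1].
    Comparing with [phi +- e x^gamma] shows that the interior of the intermittent
    phase is exactly the open set [H] where [phi 0 < Ptop phi], and that the
    transition locus is [closure H \ H]. For [phi0 = - log Df] one has
    [Ptop (t phi0) = 0] exactly when [t >= 1]. Since [gamma < alpha], the
    potentials [phi0 + log Df (min (x, d))], which vanish on [0, d], tend to [phi0]
    as [d -> 0]; all their positive multiples are in [H], since their pressure is
    positive, so they have no phase transition.
    Finally, a holomorphic function along [z |-> z phi0] that vanishes on [1, 1 + r)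
    also vanishes at some [t < 1], where [t phi0] is in [H]. *)

From HB Require Import structures.
Require Import Defs.
From mathcomp Require Import all_boot all_order all_algebra.
From mathcomp Require Import all_classical all_reals all_analysis.
From mathcomp Require Import measurable_realfun.
From mathcomp Require Import zify ring lra.
From mathcomp Require Import complex.

Set Implicit Arguments.
Unset Strict Implicit.
Unset Printing Implicit Defensive.

Import Order.TTheory GRing.Theory Num.Theory.
Import numFieldNormedType.Exports.

Local Open Scope classical_set_scope.
Local Open Scope ring_scope.

(** * Inverse branches *)

(** The obstacle is the neutral fixed point 0: cylinders do not shrink at a uniform exponential
    rate, so a Lasota-Yorke inequality does not follow from the geometry. It comes from the
    potential: when [phi 0 < Ptop phi], long stays near 0 are exponentially light compared with the
    total mass, and most of the mass lies on words with enough letters of the expanding branch.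
    Distortion sums are only sublinear, which suffices for exponential rates. The eigenfunction is a
    limit of normalised resolvents; dividing by it gives a Markov operator whose iterates tend to
    constants, and the invariant measure is read off from these constants through its distribution
    function. The function x^gamma is the yardstick near 0: Gibbs' inequality for - log Df, of
    pressure 0, bounds the entropy of an invariant measure by a multiple of the integral of x^gamma.
    The pressure of - log Df is 0 because its transfer operator sums derivatives of branches whose
    images tile [0, 1]. *)

Section branches.
Variables (R : realType) (alpha : {posnum R}).
Local Notation I := (unit_interval R).
Local Notation al := (alpha%:num).

(** The lift of the map: [branch] is [lft] reduced modulo 1, and the inverse branches solve
    [lft y = x] and [lft y = x + 1]. *)
Definition lft (y : R) : R := y * (1 + y `^ al).

Lemma ival_ge0 (x : I) : 0 <= ival x.
Proof. by case/andP: (ival_itv x). Qed.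

Lemma ival_le1 (x : I) : ival x <= 1.
Proof. by case/andP: (ival_itv x). Qed.

Lemma powR_al_le1 (y : R) : 0 <= y <= 1 -> y `^ al <= 1.
Proof.
move=> /andP[y0 y1]; have -> : 1 = 1 `^ al :> R by rewrite powR1.
by rewrite ge0_ler_powR ?nnegrE.
Qed.

(** Follows from v^al <= u^al. It gives a definite factor when [u] is at least [cut], and, since
    [u - v <= u], the comparison with [lft (u - v)] that is used near 0. *)
Lemma lft_expand (u v : R) : 0 <= v -> v <= u ->
  (u - v) * (1 + u `^ al) <= lft u - lft v.
Proof.
move=> v0 vu; have : v * v `^ al <= v * u `^ al.
  by rewrite ler_wpM2l// ge0_ler_powR ?nnegrE//; lra.
by rewrite /lft; lra.
Qed.

Lemma lft_lt (u v : R) : 0 <= v -> v < u -> lft v < lft u.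
Proof.
move=> v0 vu; rewrite -subr_gt0 (lt_le_trans _ (lft_expand v0 (ltW vu)))//.
by rewrite mulr_gt0 ?subr_gt0// ltr_wpDr ?powR_ge0.
Qed.

Lemma lft_le (u v : R) : 0 <= v -> 0 <= u -> (lft v <= lft u) = (v <= u).
Proof.
move=> v0 u0; apply/idP/idP => [|]; last first.
  by rewrite le_eqVlt => /predU1P[->//|/(lft_lt v0)/ltW].
by apply: contraTT; rewrite -!ltNge => /(lft_lt u0).
Qed.

Lemma lft_inj (u v : R) : 0 <= v -> 0 <= u -> lft v = lft u -> v = u.
Proof. by move=> v0 u0 e; apply/le_anti; rewrite -lft_le// -[X in _ && X]lft_le// e lexx. Qed.

Lemma lft0 : lft 0 = 0. Proof. by rewrite /lft mul0r. Qed.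
Lemma lft1 : lft 1 = 2. Proof. by rewrite /lft powR1 mul1r. Qed.

Lemma lft_surj (t : R) : 0 <= t <= 2 -> exists y : I, lft (ival y) = t.
Proof.
move=> t02.
suff [y] : exists2 y, y \in `[0, 1] & lft y = t.
  by rewrite in_itv /= => y01 <-; exists (Imk y01).
apply: IVT => //; last by rewrite lft0 lft1 min_l// max_r//; lra.
have cont x : 0 < x -> {for x, continuous lft}.
  move=> x0; have cpow : {for x, continuous (fun y : R => y `^ al)}.
    apply: differentiable_continuous; apply/derivable1_diffP/derivable_powR.
    by rewrite in_itv /= andbT.
  by apply: cvgM; [exact: cvg_id|apply: cvgD; [exact: cvg_cst|exact: cpow]].
apply/continuous_within_itvP => //; split.
- by move=> x; rewrite in_itv /= => /andP[x0 _]; exact: cont.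
- rewrite [in X in _ --> X]/lft; apply: cvgM.
    exact: (cvg_at_right_filter cvg_id).
  apply: cvgD; first exact: cvg_cst.
  by rewrite powR0 ?gt_eqF//; exact: powR_cvg0.
- exact/cvg_at_left_filter/cont.
Qed.

Lemma branch_target (a : bool) (x : I) : 0 <= ival x + a%:R <= 2.
Proof. by have := ival_itv x; case: a => /=; lra. Qed.

Definition inv_branch (a : bool) (x : I) : I :=
  sval (cid (lft_surj (branch_target a x))).
Local Notation g := inv_branch.

Lemma inv_branchK a x : lft (ival (g a x)) = ival x + a%:R.
Proof. exact: svalP (cid (lft_surj (branch_target a x))). Qed.

Lemma inv_branchP (a : bool) (x : I) (y : R) : 0 <= y -> lft y = ival x + a%:R -> ival (g a x) = y.
Proof. by move=> y0 e; apply: lft_inj; rewrite ?ival_ge0// e inv_branchK. Qed.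

(** The premise excludes [g true 0]: this is the discontinuity point, which the map sends to 1 and
    not to 0. Identities between the map and its inverse branches thus hold off 0 only, whence the
    later care about the mass of 0. *)
Lemma map_inv_branch a x : (a ==> (0 < ival x)) ->
  intermittent_map alpha (g a x) = x.
Proof.
move=> ax; apply: ival_inj; rewrite /= /branch -/(lft _) inv_branchK.
have := ival_itv x.
by case: a ax => /= ax; case: ifP; lra.
Qed.

Definition itin1 (y : I) : bool := 1 < lft (ival y).

Lemma lft_itv (y : I) : 0 <= lft (ival y) <= 2.
Proof. by rewrite -{1}lft0 -lft1 !lft_le ?ival_ge0 ?ival_le1. Qed.

Lemma inv_branch_map y : g (itin1 y) (intermittent_map alpha y) = y.
Proof.
apply/ival_inj/inv_branchP; first exact: ival_ge0.
have := lft_itv y.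
by rewrite /= /branch -/(lft _) /itin1; case: ifP; case: ltP => //=; lra.
Qed.

Definition cut : R := ival (g true (I0 R)).

Lemma cut_lft : lft cut = 1. Proof. by rewrite inv_branchK /= add0r. Qed.

Lemma cut_gt0 : 0 < cut.
Proof.
rewrite lt_neqAle ival_ge0 andbT; apply/eqP => c0.
by have := cut_lft; rewrite -c0 lft0 => /eqP; rewrite eq_sym oner_eq0.
Qed.

Lemma cut_le_true x : cut <= ival (g true x).
Proof. by rewrite -lft_le ?ival_ge0 ?(ltW cut_gt0)// cut_lft inv_branchK lerDr ival_ge0. Qed.

Lemma inv_branch_mono a x y : (ival (g a x) <= ival (g a y)) = (ival x <= ival y).
Proof. by rewrite -lft_le ?ival_ge0// !inv_branchK lerD2r. Qed.

Lemma inv_branch_lt a x y : (ival (g a x) < ival (g a y)) = (ival x < ival y).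
Proof. by rewrite !ltNge inv_branch_mono. Qed.

Lemma inv_branch0 : g false (I0 R) = I0 R.
Proof. by apply/ival_inj/inv_branchP; rewrite ?ival_ge0//= lft0 addr0. Qed.

Lemma inv_branch1 : g true (I1 R) = I1 R.
Proof. by apply/ival_inj/inv_branchP; rewrite ?ival_ge0//= lft1. Qed.

Lemma cut_false1 : ival (g false (I1 R)) = cut.
Proof. by apply: inv_branchP; [exact: ival_ge0|rewrite cut_lft/= addr0]. Qed.

(** Lipschitz constants of the inverse branches; that of [false] is 1, because 0 is a neutral fixed
    point. *)
Definition kap (a : bool) : R := if a then (1 + cut `^ al)^-1 else 1.

Lemma kap_gt0 a : 0 < kap a.
Proof. by case: a => //=; rewrite invr_gt0 ltr_wpDr ?powR_ge0. Qed.

Lemma kap_lt1 : kap true < 1.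
Proof.
have c0 : 0 < cut `^ al by rewrite powR_gt0// cut_gt0.
by rewrite /= invf_lt1; lra.
Qed.

Lemma kap_le1 a : kap a <= 1.
Proof. by case: a => //; exact: ltW kap_lt1. Qed.

Lemma inv_branch_kap a x y :
  `|ival (g a x) - ival (g a y)| <= kap a * `|ival x - ival y|.
Proof.
wlog yx : x y / ival y <= ival x => [hw|].
  by case/orP: (le_total (ival y) (ival x)) => /hw //; rewrite distrC [X in _ * X]distrC.
rewrite !ger0_norm ?subr_ge0 ?inv_branch_mono//.
have := @lft_expand (ival (g a x)) (ival (g a y)) (ival_ge0 _).
rewrite inv_branch_mono !inv_branchK => /(_ yx).
rewrite opprD addrACA subrr addr0 => h.
have d0 : 0 <= ival (g a x) - ival (g a y) by rewrite subr_ge0 inv_branch_mono.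
case: a h d0 => /= h d0; last first.
  rewrite mul1r (le_trans _ h)// ler_peMr// lerDl powR_ge0//.
rewrite mulrC ler_pdivlMr ?ltr_wpDr ?powR_ge0// (le_trans _ h)//.
by rewrite ler_wpM2l// lerD2l ge0_ler_powR ?nnegrE ?ival_ge0 ?cut_le_true// ltW// cut_gt0.
Qed.

Lemma inv_branch_contr a x y :
  `|ival (g a x) - ival (g a y)| <= `|ival x - ival y|.
Proof. by rewrite (le_trans (inv_branch_kap _ _ _))// ler_piMl// kap_le1. Qed.

(** The distance of the two preimages is at most the larger of them, so [lft_expand] bounds [lft] of
    this distance. Hence distances decrease under every branch at least as fast as the orbit of 1
    under the branch [false]. *)
Lemma inv_branch_lft a x y :
  lft `|ival (g a x) - ival (g a y)| <= `|ival x - ival y|.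
Proof.
wlog yx : x y / ival y <= ival x => [hw|].
  by case/orP: (le_total (ival y) (ival x)) => /hw //; rewrite distrC [X in _ <= X]distrC.
rewrite !ger0_norm ?subr_ge0 ?inv_branch_mono//.
have := @lft_expand (ival (g a x)) (ival (g a y)) (ival_ge0 _).
rewrite inv_branch_mono !inv_branchK => /(_ yx).
rewrite opprD addrACA subrr addr0; apply: le_trans.
rewrite /lft ler_wpM2l ?subr_ge0 ?inv_branch_mono// lerD2l.
by rewrite ge0_ler_powR ?nnegrE ?subr_ge0 ?inv_branch_mono ?ival_ge0// gerBl ival_ge0.
Qed.

Fixpoint gw (w : seq bool) (x : I) : I := if w is a :: w' then g a (gw w' x) else x.

(** Backward orbit of 1 towards the neutral fixed point; by [gw_contr] it bounds the diameters of
    all cylinders. *)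
Definition xs n : R := ival (gw (nseq n false) (I1 R)).

Lemma xs_ge0 n : 0 <= xs n. Proof. exact: ival_ge0. Qed.
Lemma xsS n : lft (xs n.+1) = xs n.
Proof. by rewrite /xs /= inv_branchK addr0. Qed.

Lemma xsS_le n : xs n.+1 <= xs n.
Proof. by rewrite -[leRHS]xsS /lft ler_peMr ?xs_ge0// lerDl powR_ge0. Qed.

Lemma xs_antitone m n : (m <= n)%N -> xs n <= xs m.
Proof.
move=> /subnK <-; elim: (n - m)%N => // k ih.
exact: le_trans (xsS_le _) ih.
Qed.

Lemma xs_small e : 0 < e -> exists n, xs n < e.
Proof.
move=> e0; apply: contrapT => /forallNP h.
have {}h n : e <= xs n by rewrite leNgt; apply/negP/h.
have d0 : 0 < e * e `^ al by rewrite mulr_gt0// powR_gt0.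
(* If the sequence stayed above [e], each step would subtract at least e * e^al. *)
have hn n : xs n <= 1 - n%:R * (e * e `^ al).
  elim: n => [|n ih]; first by rewrite mul0r subr0 ival_le1.
  rewrite -natr1 mulrDl mul1r opprD addrA lerBrDr (le_trans _ ih)//.
  rewrite -(xsS n) /lft mulrDr mulr1 lerD2l ler_pM ?powR_ge0//; first exact: ltW.
  by rewrite ge0_ler_powR ?nnegrE ?xs_ge0// ltW.
pose N := (Num.truncn (e * e `^ al)^-1).+1.
have : 1 < N%:R * (e * e `^ al).
  by rewrite -ltr_pdivrMr// mul1r truncnS_gt.
by have := hn N; have := xs_ge0 N; lra.
Qed.

Lemma gw_contr w x y : `|ival (gw w x) - ival (gw w y)| <= xs (size w).
Proof.
elim: w => [|a w ih]; first by rewrite dist_le1.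
rewrite -lft_le ?xs_ge0//= xsS.
exact: le_trans (inv_branch_lft _ _ _) ih.
Qed.

Fixpoint itin n (y : I) : seq bool :=
  if n is n'.+1 then itin1 y :: itin n' (intermittent_map alpha y) else [::].

Lemma size_itin n y : size (itin n y) = n.
Proof. by elim: n y => //= n ih y; rewrite ih. Qed.

Lemma gw_itin n y : gw (itin n y) (iter n (intermittent_map alpha) y) = y.
Proof.
elim: n y => //= n ih y.
by rewrite -iterS iterSr ih inv_branch_map.
Qed.

End branches.

(** * Transfer operators *)

Section transfer_operator.
Variables (R : realType) (alpha : {posnum R}).
Local Notation I := (unit_interval R).
Local Notation g := (inv_branch alpha).
Local Notation gw := (gw alpha).
Implicit Types (W : bool -> I -> R) (psi u v : I -> R).

(** The weight is a function of the branch and of the base point: the same operator serves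
    [expR phi], its Markov normalisation and the auxiliary weights [kapw] and [tagw]. *)
Definition transfer W psi (x : I) : R :=
  W false x * psi (g false x) + W true x * psi (g true x).

Definition one_fun : I -> R := fun=> 1.

Definition tr1 W n (x : I) : R := iter n (transfer W) one_fun x.

Lemma iter_transferS W n psi x :
  iter n.+1 (transfer W) psi x = W false x * iter n (transfer W) psi (g false x)
     + W true x * iter n (transfer W) psi (g true x).
Proof. by []. Qed.

Lemma tr1S W n x :
  tr1 W n.+1 x = W false x * tr1 W n (g false x) + W true x * tr1 W n (g true x).
Proof. by []. Qed.

Lemma eq_iter_transfer W W' n psi psi' : (forall a x, W a x = W' a x) ->
  psi =1 psi' -> iter n (transfer W) psi =1 iter n (transfer W') psi'.
Proof.
by move=> eW e; elim: n => // n ih x; rewrite !iter_transferS !eW !ih.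
Qed.

Lemma iter_transfer_lin W n (c d : R) u v x :
  iter n (transfer W) (fun y => c * u y + d * v y) x =
  c * iter n (transfer W) u x + d * iter n (transfer W) v x.
Proof. by elim: n x => // n ih x; rewrite !iter_transferS !ih; ring. Qed.

Lemma iter_transferZ W n (c : R) u x :
  iter n (transfer W) (fun y => c * u y) x = c * iter n (transfer W) u x.
Proof. by elim: n x => // n ih x; rewrite !iter_transferS !ih; ring. Qed.

Lemma iter_transfer_cst W n (c : R) x :
  iter n (transfer W) (fun=> c) x = c * tr1 W n x.
Proof.
rewrite -iter_transferZ; apply: eq_iter_transfer => // y.
by rewrite /one_fun mulr1.
Qed.

Lemma iter_transfer_scale W n (c : R) psi x :
  iter n (transfer (fun a y => c * W a y)) psi x = c ^+ n * iter n (transfer W) psi x.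
Proof.
elim: n x => [|n ih] x; first by rewrite expr0 mul1r.
by rewrite !iter_transferS !ih exprS; ring.
Qed.

Lemma iter_transfer_comp W m n psi x :
  iter (m + n) (transfer W) psi x = iter m (transfer W) (iter n (transfer W) psi) x.
Proof. by rewrite iterD. Qed.

Definition nonneg W : Prop := forall a x, 0 <= W a x.

Lemma iter_transfer_le W n u v : nonneg W -> (forall x, u x <= v x) ->
  forall x, iter n (transfer W) u x <= iter n (transfer W) v x.
Proof.
move=> W0 uv; elim: n => // n ih x; rewrite !iter_transferS.
by rewrite lerD ?ler_wpM2l.
Qed.

Lemma iter_transfer_le2 W W' n u : nonneg W -> (forall a x, W a x <= W' a x) ->
  (forall x, 0 <= u x) ->
  forall x, iter n (transfer W) u x <= iter n (transfer W') u x.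
Proof.
move=> W0 WW u0.
have u0' k x : 0 <= iter k (transfer W) u x.
  elim: k x => // k ih x; rewrite iter_transferS addr_ge0// mulr_ge0//.
elim: n => // n ih x; rewrite !iter_transferS.
by rewrite lerD ?ler_pM.
Qed.

Lemma iter_transfer_ge0 W n u : nonneg W -> (forall x, 0 <= u x) ->
  forall x, 0 <= iter n (transfer W) u x.
Proof.
move=> W0 u0; elim: n => // n ih x; rewrite iter_transferS.
by rewrite addr_ge0// mulr_ge0.
Qed.

Lemma tr1_ge0 W n x : nonneg W -> 0 <= tr1 W n x.
Proof. by move=> W0; apply: iter_transfer_ge0. Qed.

Lemma iter_transfer_bnd W n u (B : R) : nonneg W -> (forall x, `|u x| <= B) ->
  forall x, `|iter n (transfer W) u x| <= B * tr1 W n x.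
Proof.
move=> W0 uB x; rewrite ler_norml -mulNr -!iter_transfer_cst.
apply/andP; split; apply: iter_transfer_le => // y.
- by have := uB y; rewrite ler_norml => /andP[].
- exact: le_trans (ler_norm _) (uB y).
Qed.

Lemma tr1_comp_le W m n (B : R) x : nonneg W -> (forall y, tr1 W n y <= B) ->
  tr1 W (m + n) x <= B * tr1 W m x.
Proof.
move=> W0 hB; rewrite /tr1 iter_transfer_comp -iter_transfer_cst.
exact: iter_transfer_le.
Qed.

Lemma subeigen_bound W (th U : R) u : nonneg W -> 0 <= th ->
  (forall x, transfer W u x <= th * u x) ->
  (forall x, 1 <= u x <= U) -> forall n x, tr1 W n x <= U * th ^+ n.
Proof.
move=> W0 th0 hu u1 n x.
have h k y : iter k (transfer W) u y <= th ^+ k * u y.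
  elim: k y => [|k ih] y; first by rewrite expr0 mul1r.
  rewrite iter_transferS (@le_trans _ _ (th ^+ k * transfer W u y))//.
    rewrite /transfer mulrDr !(mulrCA (th ^+ k)).
    by rewrite lerD// ler_wpM2l.
  by rewrite exprSr -mulrA ler_wpM2l// exprn_ge0.
apply: (@le_trans _ _ (iter n (transfer W) u x)).
  by apply: iter_transfer_le => // y; have /andP[] := u1 y.
rewrite (le_trans (h _ _))// mulrC ler_wpM2r// ?exprn_ge0//.
by have /andP[] := u1 x.
Qed.

Fixpoint wt W (w : seq bool) (x : I) : R :=
  if w is a :: w' then wt W w' x * W a (gw w' x) else 1.

Fixpoint words n : seq (seq bool) :=
  if n is n'.+1 then
    [seq false :: w | w <- words n'] ++ [seq true :: w | w <- words n'] else [:: [::]].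

Lemma size_words n w : w \in words n -> size w = n.
Proof.
elim: n w => [|n ih] w /=; first by rewrite inE => /eqP->.
by rewrite mem_cat => /orP[] /mapP[v /ih <- ->].
Qed.

Lemma mem_words n w : size w = n -> w \in words n.
Proof.
elim: n w => [|n ih] [|a w] //= [/ih wn]; rewrite mem_cat.
by case: a; rewrite map_f ?orbT.
Qed.

Lemma uniq_words n : uniq (words n).
Proof.
elim: n => //= n ih; rewrite cat_uniq !map_inj_uniq ?ih ?andbT/=; last 2 first.
- by move=> ? ? [].
- by move=> ? ? [].
by apply/hasPn => _ /mapP[v _ ->]; apply/mapP => -[].
Qed.

Lemma sum_wordsS n (F : seq bool -> R) : \sum_(w <- words n.+1) F w =
  \sum_(w <- words n) F (false :: w) + \sum_(w <- words n) F (true :: w).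
Proof. by rewrite /= big_cat /= !big_map. Qed.

Lemma iter_transferE W n psi x :
  iter n (transfer W) psi x = \sum_(w <- words n) wt W w x * psi (gw w x).
Proof.
elim: n psi => [|n ih] psi; first by rewrite big_seq1 mul1r.
rewrite iterSr ih sum_wordsS -big_split /=; apply: eq_bigr => w _.
by rewrite /transfer mulrDr !mulrA.
Qed.

Lemma tr1E W n x : tr1 W n x = \sum_(w <- words n) wt W w x.
Proof. by rewrite /tr1 iter_transferE; apply: eq_bigr => w _; rewrite mulr1. Qed.

Lemma wt_ge0 W w x : nonneg W -> 0 <= wt W w x.
Proof. by move=> W0; elim: w => //= a w ih; rewrite mulr_ge0. Qed.

Lemma wt_gt0 W w x : (forall a y, 0 < W a y) -> 0 < wt W w x.
Proof. by move=> W0; elim: w => //= a w ih; rewrite mulr_gt0. Qed.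

Lemma wt_ge W w x (m : R) : 0 <= m -> (forall a y, m <= W a y) ->
  m ^+ size w <= wt W w x.
Proof.
move=> m0 mW; elim: w => //= a w ih; rewrite exprSr ler_pM// exprn_ge0//.
Qed.

Lemma wt_le W w x (m : R) : nonneg W -> (forall a y, W a y <= m) ->
  wt W w x <= m ^+ size w.
Proof.
by move=> m0 mW; elim: w => //= a w ih; rewrite exprSr ler_pM// wt_ge0.
Qed.

Lemma wt_mul W (c : bool -> R) w x :
  wt (fun a y => W a y * c a) w x = wt W w x * \prod_(a <- w) c a.
Proof.
elim: w => [|a w ih] /=; first by rewrite big_nil mulr1.
by rewrite ih big_cons; ring.
Qed.

Lemma tr1_ge_word W n w x : nonneg W -> size w = n -> wt W w x <= tr1 W n x.
Proof.
move=> W0 wn; rewrite tr1E (big_rem w) ?mem_words//= lerDl.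
by apply: sumr_ge0 => v _; exact: wt_ge0.
Qed.

Lemma iter_transfer_ge_word W n w u x : nonneg W -> (forall y, 0 <= u y) ->
  size w = n -> wt W w x * u (gw w x) <= iter n (transfer W) u x.
Proof.
move=> W0 u0 wn; rewrite iter_transferE (big_rem w) ?mem_words//= lerDl.
by apply: sumr_ge0 => v _; rewrite mulr_ge0// wt_ge0.
Qed.

Definition growth W (p : R) : Prop :=
  exists C, forall n x, tr1 W n x <= C * expR (n%:R * p).

Lemma growth_le W p q : p <= q -> nonneg W -> growth W p -> growth W q.
Proof.
move=> pq W0 [C hC]; exists C => n x; rewrite (le_trans (hC _ _))//.
have C0 : 0 <= C.
  by have := hC 0%N x; rewrite mul0r expR0 mulr1 => /(le_trans _); apply; rewrite tr1_ge0.
by rewrite ler_wpM2l// ler_expR ler_wpM2l.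
Qed.

(** Submultiplicativity of [tr1]: with [n = q m + r], the [q] full blocks give the rate and the
    finitely many remainders are absorbed by the constant. *)
Lemma growth_block W m (th : R) : nonneg W -> 0 < th ->
  (0 < m)%N -> (forall x, tr1 W m x <= th ^+ m) ->
  (exists K, forall a x, W a x <= K) ->
  growth W (ln th).
Proof.
move=> W0 th0 m0 hm [K hK].
pose K' := Num.max 1 (2 * K).
have K'1 : 1 <= K' by rewrite le_max lexx.
have K'0 : 0 <= K' by rewrite (le_trans ler01).
have hr r x : tr1 W r x <= K' ^+ r.
  elim: r x => [|r ih] x //; rewrite tr1S.
  have kk y : tr1 W r y <= K' ^+ r by [].
  apply: (@le_trans _ _ (K * K' ^+ r + K * K' ^+ r)).
    by rewrite lerD// ler_pM// ?tr1_ge0.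
  by rewrite exprS -mulrDl ler_wpM2r ?exprn_ge0// le_max; apply/orP; right; lra.
have hq q r x : tr1 W (q * m + r) x <= th ^+ (q * m) * K' ^+ r.
  elim: q x => [|q ih] x; first by rewrite mul0n add0n expr0 mul1r.
  rewrite mulSn -addnA (le_trans (@tr1_comp_le _ _ _ (th ^+ (q * m) * K' ^+ r) _ _ _))//.
  have -> : th ^+ (m + q * m) * K' ^+ r = th ^+ (q * m) * K' ^+ r * th ^+ m.
    by rewrite exprD; ring.
  by rewrite ler_wpM2l// mulr_ge0// exprn_ge0// ltW.
exists (\sum_(r < m) (K' / th) ^+ r) => n x.
rewrite (mulrC n%:R) expRM_natr lnK ?posrE// {1 2}(divn_eq n m).
rewrite (le_trans (hq _ _ _))// exprD mulrCA ler_wpM2l ?(exprn_ge0 _ (ltW th0))//.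
have hrm : (n %% m < m)%N by rewrite ltn_mod.
rewrite (bigD1 (Ordinal hrm))//= -ler_pdivrMr ?exprn_gt0// -expr_div_n lerDl.
by rewrite sumr_ge0// => i _; rewrite exprn_ge0// divr_ge0// ltW.
Qed.

(** Partial sums of the Neumann series of (1 - t L)^-1 applied to 1, written recursively so that the
    limit satisfies [u = 1 + t L u] by continuity. *)
Fixpoint resolv W (t : R) n : I -> R :=
  if n is n'.+1 then fun x => 1 + t * transfer W (resolv W t n') x else fun=> 0.

Lemma resolvE W t n x : resolv W t n x = \sum_(j < n) t ^+ j * tr1 W j x.
Proof.
elim: n x => [|n ih] x; first by rewrite big_ord0.
rewrite big_ord_recl expr0 mul1r /= /transfer !ih; congr (_ + _).
rewrite !mulr_sumr -big_split /= mulr_sumr; apply: eq_bigr => j _.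
rewrite -[bump 0 j]/(j.+1) exprS add0n; ring.
Qed.

Lemma resolvD W t m n x :
  resolv W t (m + n) x = resolv W t m x + t ^+ m * iter m (transfer W) (resolv W t n) x.
Proof.
elim: m x => [|m ih] x; first by rewrite expr0 mul1r add0r.
by rewrite addSn /= /transfer !ih exprS; ring.
Qed.

Lemma resolvent W (t U : R) : nonneg W -> 0 <= t ->
  (forall n x, resolv W t n x <= U) ->
  exists u, [/\ forall x, 1 <= u x <= U, forall x, t * transfer W u x = u x - 1
    & forall x, resolv W t n x @[n --> \oo] --> u x].
Proof.
move=> W0 t0 hU.
have nd x : nondecreasing_seq (fun n => resolv W t n x).
  apply/nondecreasing_seqP => n; rewrite !resolvE big_ord_recr /= lerDl.
  by rewrite mulr_ge0 ?exprn_ge0 ?tr1_ge0.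
have ub x : has_ubound (range (fun n => resolv W t n x)).
  by exists U => _ [n _ <-].
have cv x : resolv W t n x @[n --> \oo] --> limn (fun n => resolv W t n x).
  exact: nondecreasing_is_cvgn.
exists (fun x => limn (fun n => resolv W t n x)); split => //.
- move=> x; apply/andP; split; last first.
    by apply: limr_le; [exact: cv|apply: nearW => n].
  apply: (@le_trans _ _ (resolv W t 1 x)).
    by rewrite /= /transfer !mulr0 addr0 mulr0 addr0.
  exact: (nondecreasing_cvgn_le (nd x) (cv x)).
- move=> x; apply/eqP; rewrite eq_sym subr_eq; apply/eqP.
  apply: cvg_lim => //; rewrite -(cvg_shiftS (fun n => resolv W t n x)) /= -/(transfer _ _ _).
  rewrite (addrC _ 1).
  apply: cvgD; first exact: cvg_cst.
  apply: cvgM; first exact: cvg_cst.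
  by apply: cvgD; apply: cvgM; [exact: cvg_cst|exact: cv|exact: cvg_cst|exact: cv].
Qed.

Lemma geometric_sum_le (q : R) n : 0 <= q < 1 -> \sum_(j < n) q ^+ j <= (1 - q)^-1.
Proof.
move=> /andP[q0 q1]; rewrite -[leRHS]mul1r ler_pdivlMr ?subr_gt0// mulrC.
have -> : (1 - q) * \sum_(j < n) q ^+ j = 1 - q ^+ n.
  by rewrite -opprB mulNr -subrX1 opprB.
by rewrite gerBl exprn_ge0.
Qed.

Lemma resolvent_growth W (t q C : R) : nonneg W -> 0 <= t -> 0 <= q < 1 -> 0 <= C ->
  (forall n x, t ^+ n * tr1 W n x <= C * q ^+ n) ->
  exists u, (forall x, 1 <= u x <= C * (1 - q)^-1) /\
    forall x, t * transfer W u x = u x - 1.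
Proof.
move=> W0 t0 q01 C0 h.
have [|u [u1 u2 _]] := @resolvent W t (C * (1 - q)^-1) W0 t0; last by exists u.
move=> n x; rewrite resolvE (@le_trans _ _ (\sum_(j < n) C * q ^+ j))//.
  by apply: ler_sum => j _.
by rewrite -mulr_sumr ler_wpM2l// geometric_sum_le.
Qed.

End transfer_operator.

(** * Hölder estimates for iterated transfer operators *)

Section holder_estimates.
Variables (R : realType) (alpha gam : {posnum R}).
Local Notation I := (unit_interval R).
Local Notation g := (inv_branch alpha).
Local Notation transfer := (@transfer R alpha).
Implicit Types (W : bool -> I -> R) (psi u v : I -> R).

Definition gdist (x y : I) : R := `|ival x - ival y| `^ gam%:num.
Definition hol (A : R) psi : Prop := forall x y, `|psi x - psi y| <= A * gdist x y.

Lemma gdist_ge0 x y : 0 <= gdist x y. Proof. exact: powR_ge0. Qed.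
Lemma gdist_le1 x y : gdist x y <= 1. Proof. exact: dist_powR_le1. Qed.
Lemma gdistC x y : gdist x y = gdist y x. Proof. by rewrite /gdist distrC. Qed.

Lemma gdist_inv a x y : gdist (g a x) (g a y) <= kap alpha a `^ gam%:num * gdist x y.
Proof.
rewrite /gdist -powRM ?(ltW (kap_gt0 _ _))//.
by rewrite ge0_ler_powR ?nnegrE ?mulr_ge0 ?(ltW (kap_gt0 _ _))// inv_branch_kap.
Qed.

Lemma hol_le A B psi : A <= B -> hol A psi -> hol B psi.
Proof.
by move=> AB h x y; rewrite (le_trans (h x y))// ler_wpM2r// gdist_ge0.
Qed.

Lemma hol_ge0 A psi : hol A psi -> 0 <= A.
Proof.
move=> /(_ (I1 R) (I0 R)); rewrite /gdist /= subr0 normr1 powR1 mulr1.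
exact: le_trans.
Qed.

Lemma hol_cst c : hol 0 (fun=> c).
Proof. by move=> x y; rewrite subrr normr0 mul0r. Qed.

Lemma holM A B C D u v : hol A u -> hol B v -> (forall x, `|u x| <= C) ->
  (forall x, `|v x| <= D) -> hol (A * D + C * B) (fun x => u x * v x).
Proof.
move=> hA hB hC hD x y.
have -> : u x * v x - u y * v y = (u x - u y) * v x + u y * (v x - v y) by ring.
rewrite (le_trans (ler_normD _ _))// !normrM mulrDl lerD//.
  by rewrite mulrAC ler_pM.
by rewrite -mulrA ler_pM.
Qed.

Lemma holD A B u v : hol A u -> hol B v -> hol (A + B) (fun x => u x + v x).
Proof.
move=> hA hB x y; rewrite opprD addrACA mulrDl.
by rewrite (le_trans (ler_normD _ _))// lerD.
Qed.

Lemma holZ A c u : hol A u -> hol (`|c| * A) (fun x => c * u x).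
Proof. by move=> hA x y; rewrite -mulrBr normrM -mulrA ler_wpM2l. Qed.

Lemma hol_inv_branch A a u : hol A u -> hol A (fun x => u (g a x)).
Proof.
move=> hA x y; rewrite (le_trans (hA _ _))// ler_wpM2l ?(hol_ge0 hA)//.
by rewrite ge0_ler_powR ?nnegrE// inv_branch_contr.
Qed.

Lemma holV A c u : 0 < c -> hol A u -> (forall x, c <= u x) ->
  hol (A / c ^+ 2) (fun x => (u x)^-1).
Proof.
move=> c0 hA hc x y.
have ux := lt_le_trans c0 (hc x); have uy := lt_le_trans c0 (hc y).
have -> : (u x)^-1 - (u y)^-1 = (u y - u x) / (u x * u y).
  by field; rewrite !gt_eqF.
rewrite normrM distrC normfV (gtr0_norm (mulr_gt0 ux uy)) mulrAC ler_pM ?invr_ge0//.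
  by rewrite mulr_ge0// ltW.
by rewrite lef_pV2 ?posrE ?mulr_gt0 ?exprn_gt0// expr2 ler_pM// ltW.
Qed.

Lemma hol_bound A u : hol A u -> forall x, `|u x| <= A + `|u (I0 R)|.
Proof.
move=> hA x; rewrite -[u x in leLHS](subrK (u (I0 R))) (le_trans (ler_normD _ _))//.
by rewrite lerD2r (le_trans (hA _ _))// ler_piMr ?gdist_le1// (hol_ge0 hA).
Qed.

Lemma hol_expR A B u : hol A u -> (forall x, u x <= B) ->
  hol (expR B * A) (fun x => expR (u x)).
Proof.
move=> hA hB.
have key x y : expR (u x) - expR (u y) <= expR B * A * gdist x y.
  have -> : expR (u x) - expR (u y) = expR (u x) * (1 - expR (u y - u x)).
    by rewrite mulrBr mulr1 -expRD addrCA subrr addr0.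
  have h1 : 1 - expR (u y - u x) <= u x - u y.
    by have := expR_ge1Dx (u y - u x); lra.
  apply: (@le_trans _ _ (expR (u x) * `|u x - u y|)).
    by rewrite ler_wpM2l ?expR_ge0// (le_trans h1)// ler_norm.
  by rewrite -mulrA ler_pM ?expR_ge0// ler_expR.
move=> x y; rewrite ler_norml key andbT lerNl opprB gdistC; exact: key.
Qed.

(** The extra factor is what the branch [a] does to [gdist]. The iterates of 1 for these weights are
    the leading coefficient of the Lasota-Yorke inequality. *)
Definition kapw W a (x : I) : R := W a x * kap alpha a `^ gam%:num.

Lemma kapw_ge0 W : nonneg W -> nonneg (kapw W).
Proof. by move=> W0 a x; rewrite mulr_ge0// powR_ge0. Qed.

Lemma iter_transfer_hol W (H K : R) n : nonneg W -> (forall a, hol H (W a)) ->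
  (forall a x, W a x <= K) -> exists2 C, 0 <= C &
  forall A B psi, hol A psi -> (forall x, `|psi x| <= B) -> forall x y,
  `|iter n (transfer W) psi x - iter n (transfer W) psi y|
    <= (tr1 alpha (kapw W) n x * A + C * B) * gdist x y.
Proof.
move=> W0 hH hK.
have K0 : 0 <= K by exact: le_trans (hK false (I0 R)).
have H0 : 0 <= H := hol_ge0 (hH false).
have tK m x : tr1 alpha W m x <= (2 * K) ^+ m.
  elim: m x => [|m ih] x //; rewrite tr1S.
  have -> : (2 * K) ^+ m.+1 = K * (2 * K) ^+ m + K * (2 * K) ^+ m.
    by rewrite exprS; ring.
  by rewrite lerD// ler_pM// tr1_ge0.
have kp1 a : kap alpha a `^ gam%:num <= 1.
  have -> : 1 = 1 `^ gam%:num :> R by rewrite powR1.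
  by rewrite ge0_ler_powR ?nnegrE ?kap_le1// ltW// kap_gt0.
elim: n => [|n [C C0 ih]].
  exists 0 => // A B psi hA hB x y.
  by rewrite mul0r addr0 [tr1 _ _ _ _]/(1 : R) mul1r.
exists (2 * K * C + 2 * H * (2 * K) ^+ n).
  by rewrite addr_ge0// !mulr_ge0// exprn_ge0// mulr_ge0.
move=> A B psi hA hB x y.
have B0 : 0 <= B by exact: le_trans (hB (I0 R)).
have A0 := hol_ge0 hA.
pose u := iter n (transfer W) psi.
have one a : `|W a x * u (g a x) - W a y * u (g a y)| <=
   (kapw W a x * tr1 alpha (kapw W) n (g a x) * A + (K * C + H * (2 * K) ^+ n) * B)
     * gdist x y.
  (* The first summand carries the seminorm through the branch, the second one charges the variation
     of the weight to the sup norm. *)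
  have -> : W a x * u (g a x) - W a y * u (g a y) =
    W a x * (u (g a x) - u (g a y)) + (W a x - W a y) * u (g a y) by ring.
  rewrite (le_trans (ler_normD _ _))// !normrM (ger0_norm (W0 _ _)).
  have h1 : `|u (g a y)| <= B * (2 * K) ^+ n.
    by rewrite (le_trans (iter_transfer_bnd _ _ W0 hB _))// ler_wpM2l.
  have h2 : `|W a x - W a y| * `|u (g a y)| <= H * (2 * K) ^+ n * B * gdist x y.
    have -> : H * (2 * K) ^+ n * B * gdist x y =
      (H * gdist x y) * (B * (2 * K) ^+ n) by ring.
    by rewrite ler_pM//; exact: hH.
  have h3 : W a x * `|u (g a x) - u (g a y)| <=
    (kapw W a x * tr1 alpha (kapw W) n (g a x) * A + K * C * B) * gdist x y.
    have t0 : 0 <= tr1 alpha (kapw W) n (g a x) by rewrite tr1_ge0//; exact: kapw_ge0.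
    apply: (@le_trans _ _ (W a x * ((tr1 alpha (kapw W) n (g a x) * A + C * B)
       * (kap alpha a `^ gam%:num * gdist x y)))).
      rewrite ler_wpM2l// (le_trans (ih A B psi hA hB _ _))// ler_wpM2l ?gdist_inv//.
      by rewrite addr_ge0 ?mulr_ge0.
    have -> : W a x * ((tr1 alpha (kapw W) n (g a x) * A + C * B) *
        (kap alpha a `^ gam%:num * gdist x y)) =
      (kapw W a x * tr1 alpha (kapw W) n (g a x) * A +
       W a x * kap alpha a `^ gam%:num * (C * B)) * gdist x y by rewrite /kapw; ring.
    rewrite ler_wpM2r ?gdist_ge0// lerD2l -[K * C * B]mulrA ler_wpM2r ?mulr_ge0//.
    by rewrite (le_trans _ (hK a x))// ler_piMr.
  by rewrite (le_trans (lerD h3 h2))// le_eqVlt; apply/orP; left; apply/eqP; ring.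
rewrite !iter_transferS -/u opprD addrACA (le_trans (ler_normD _ _))//.
rewrite (le_trans (lerD (one false) (one true)))//.
by rewrite le_eqVlt; apply/orP; left; apply/eqP; rewrite tr1S; ring.
Qed.

End holder_estimates.

(** * Topological pressure *)

Section pressure.
Variables (R : realType) (alpha : {posnum R}).
Local Notation I := (unit_interval R).
Local Notation g := (inv_branch alpha).
Local Notation gw := (gw alpha).
Local Notation al := (alpha%:num).
Local Notation transfer := (@transfer R alpha).
Local Notation tr1 := (@tr1 R alpha).
Local Notation wt := (@wt R alpha).
Local Notation growth := (@growth R alpha).
Local Notation xs := (@xs R alpha).
Implicit Types (W : bool -> I -> R) (psi u v phi : I -> R).

Lemma expR_unbounded (d C : R) : 0 < d -> exists n, C < expR (n%:R * d).
Proof.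
move=> d0; exists (Num.truncn (C / d)).+1.
apply: (@lt_le_trans _ _ (1 + (Num.truncn (C / d)).+1%:R * d)); last exact: expR_ge1Dx.
by rewrite ltr_wpDl// -ltr_pdivrMr// truncnS_gt.
Qed.

Lemma pow_unbounded (th C : R) : 1 < th -> exists n, C < th ^+ n.
Proof.
move=> th1; have [n hn] := @expR_unbounded (ln th) C (ln_gt0 th1).
by exists n; move: hn; rewrite expRM_natl lnK// posrE (lt_trans ltr01).
Qed.

Definition wexp phi (a : bool) (x : I) : R := expR (phi (g a x)).

Lemma wexp_gt0 phi a x : 0 < wexp phi a x. Proof. exact: expR_gt0. Qed.
Lemma wexp_ge0 phi : nonneg (wexp phi). Proof. by move=> a x; exact: expR_ge0. Qed.

Definition bdd phi : Prop := exists B, forall x, `|phi x| <= B.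

(** The logarithm of the spectral radius on bounded functions, as an infimum of admissible rates:
    upper bounds amount to exhibiting one constant, lower bounds to refuting [growth]. *)
Definition Ptop phi : R := inf [set p | growth (wexp phi) p].

Lemma gw_false0 n : gw (nseq n false) (I0 R) = I0 R.
Proof. by elim: n => //= n ->; exact: inv_branch0. Qed.

Lemma gw_false_le n y : ival (gw (nseq n false) y) <= xs n.
Proof.
have := gw_contr alpha (nseq n false) y (I0 R).
by rewrite gw_false0 subr0 size_nseq ger0_norm// ival_ge0.
Qed.

Lemma growth_exists phi : bdd phi -> exists p, growth (wexp phi) p.
Proof.
move=> [B hB]; exists (ln (2 * expR B)).
have wB a x : wexp phi a x <= expR B.
  by rewrite ler_expR (le_trans (ler_norm _)).
apply: (@growth_block _ _ _ 1%N) => //.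
- exact: wexp_ge0.
- by rewrite mulr_gt0// expR_gt0.
- move=> x; rewrite expr1 /tr1 /= /one_fun /transfer !mulr1.
  by have := wB false x; have := wB true x; lra.
- by exists (expR B).
Qed.

(** The word [false^n] fixes 0, and its weight there is [expR (n * phi 0)]. *)
Lemma growth_ge phi p : growth (wexp phi) p -> phi (I0 R) <= p.
Proof.
move=> [C hC]; rewrite leNgt; apply/negP => hlt.
have [n] := @expR_unbounded (phi (I0 R) - p) C (ltac:(by rewrite subr_gt0)).
rewrite ltNge => /negP; apply.
have h : wt (wexp phi) (nseq n false) (I0 R) = expR (n%:R * phi (I0 R)).
  elim: n => [|n ih] /=; first by rewrite mul0r expR0.
  by rewrite ih gw_false0 /wexp inv_branch0 -natr1 mulrDl mul1r expRD.
have := le_trans (tr1_ge_word alpha (I0 R) (@wexp_ge0 phi) (size_nseq n false)) (hC n (I0 R)).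
rewrite h mulrBr expRD expRN.
by rewrite ler_pdivrMr// expR_gt0.
Qed.

Lemma Ptop_ge0 phi : bdd phi -> phi (I0 R) <= Ptop phi.
Proof.
move=> b; apply: lb_le_inf; first exact: growth_exists.
by move=> p /growth_ge.
Qed.

Lemma Ptop_le phi p : growth (wexp phi) p -> Ptop phi <= p.
Proof.
by move=> h; apply: ge_inf => //; exists (phi (I0 R)) => q /growth_ge.
Qed.

Lemma Ptop_growth phi p : bdd phi -> Ptop phi < p -> growth (wexp phi) p.
Proof.
move=> b h; have [q hq qp] := inf_lt (growth_exists b) h.
by apply: (growth_le (ltW qp)) => //; exact: wexp_ge0.
Qed.

Lemma Ptop_lip phi psi e : bdd psi -> (forall x, phi x <= psi x + e) ->
  Ptop phi <= Ptop psi + e.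
Proof.
move=> b h; apply/ler_addgt0Pr => d d0; apply: Ptop_le.
have [|C hC] := @Ptop_growth psi (Ptop psi + d) b; first by rewrite ltrDl.
exists C => n x.
apply: (@le_trans _ _ (tr1 (fun a y => expR e * wexp psi a y) n x)).
  apply: iter_transfer_le2 => //; first exact: wexp_ge0.
  by move=> a y; rewrite -expRD ler_expR addrC.
have -> : C * expR (n%:R * (Ptop psi + e + d)) =
    expR e ^+ n * (C * expR (n%:R * (Ptop psi + d))).
  by rewrite -expRM_natl mulrCA -expRD; congr (_ * expR _); ring.
by rewrite [leLHS]iter_transfer_scale ler_wpM2l ?exprn_ge0 ?expR_ge0//; exact: hC.
Qed.

Fixpoint Sop W (t : R) m psi : I -> R :=
  if m is m'.+1 then fun x => psi x + t * W false x * Sop W t m' psi (g false x)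
  else fun=> 0.

(* Inducing on the second branch: [blockop] sums over the return words
   false^j true with [j < m], each letter being weighted by [t]. *)
Definition blockop W (t : R) m psi (x : I) : R :=
  t * W true x * Sop W t m psi (g true x).

Lemma Sop_le W (t : R) m u v : nonneg W -> 0 <= t -> (forall x, u x <= v x) ->
  forall x, Sop W t m u x <= Sop W t m v x.
Proof.
move=> W0 t0 uv; elim: m => // m ih x /=.
by rewrite lerD// ler_wpM2l// mulr_ge0.
Qed.

Lemma SopZ W (t c : R) m u x : Sop W t m (fun y => c * u y) x = c * Sop W t m u x.
Proof. by elim: m x => [|m ih] x /=; [rewrite mulr0|rewrite ih; ring]. Qed.

Lemma blockop_le W (t : R) m u v : nonneg W -> 0 <= t -> (forall x, u x <= v x) ->
  forall x, blockop W t m u x <= blockop W t m v x.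
Proof. by move=> W0 t0 uv x; rewrite /blockop ler_wpM2l ?mulr_ge0// Sop_le. Qed.

Lemma blockopZ W (t c : R) m u x :
  blockop W t m (fun y => c * u y) x = c * blockop W t m u x.
Proof. by rewrite /blockop SopZ; ring. Qed.

(** Expanding the iterates of [blockop] meets each word at most once, with the discount [t] per
    letter, so they are dominated by the resolvent at [t], which is bounded since [q < p]. Used
    contrapositively: growing block iterates bound the pressure from below. *)
Lemma blockop_bounded W p q m : nonneg W -> growth W q -> q < p ->
  exists K, forall k x, iter k (blockop W (expR (- p)) m) (fun=> 1) x <= K.
Proof.
move=> W0 [C hC] qp; set t := expR (- p).
have t0 : 0 <= t by exact: expR_ge0.
have C0 : 0 <= C.
  by have := hC 0%N (I0 R); rewrite mul0r expR0 mulr1 => /(le_trans _); apply; rewrite tr1_ge0.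
have [||u [u1 u2]] := @resolvent_growth R alpha W t (expR (q - p)) C W0 t0 _ C0.
- by rewrite expR_ge0 expR_lt1 subr_lt0.
- move=> n x; apply: (@le_trans _ _ (t ^+ n * (C * expR (n%:R * q)))).
    by rewrite ler_wpM2l// exprn_ge0.
  by rewrite /t -!expRM_natl mulrCA -expRD mulrBr mulrN addrC.
set U := C * _ in u1.
have u0 x : 0 <= u x by have /andP[/(le_trans ler01)] := u1 x.
have S0 k v x : (forall x, 0 <= v x) -> 0 <= Sop W t k v x.
  move=> v0; elim: k x => // k ih x /=.
  by rewrite addr_ge0// mulr_ge0// mulr_ge0.
(* The identity [u = 1 + t L u] is unfolded along the leading letters [false], keeping only the
   exits through [true]. *)
have hS k x : Sop W t k (fun y => t * W true y * u (g true y)) x <= u x.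
  elim: k x => [|k ih] x //=.
  have := u2 x; rewrite -[transfer W u x]/(W false x * u (g false x) + W true x * u (g true x)).
  have : t * W false x * Sop W t k (fun y => t * W true y * u (g true y)) (g false x)
    <= t * W false x * u (g false x) by rewrite ler_wpM2l// mulr_ge0.
  by lra.
have [K0 K00 hK0] : exists2 K, 0 <= K & forall x, Sop W t m (fun=> 1) x <= K * u x.
  elim: m => [|k [K K0 ih]]; first by exists 0 => // x; rewrite mul0r.
  exists (K + 1); first by rewrite addr_ge0.
  move=> x /=; rewrite mulrDl mul1r addrC lerD//; last by have /andP[] := u1 x.
  apply: (@le_trans _ _ (t * W false x * (K * u (g false x)))).
    by rewrite ler_wpM2l ?mulr_ge0.
  rewrite mulrCA ler_wpM2l//.
  have := u2 x; rewrite -[transfer W u x]/(W false x * u (g false x) + W true x * u (g true x)).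
  by have := mulr_ge0 (mulr_ge0 t0 (W0 true x)) (u0 (g true x)); lra.
have b0 k x : 0 <= iter k (blockop W t m) (fun=> 1) x.
  elim: k x => // k ih x; rewrite iterS /blockop mulr_ge0 ?S0 ?mulr_ge0//.
have hk k x : Sop W t m (iter k (blockop W t m) (fun=> 1)) x <= K0 * u x.
  elim: k x => [|k ih] x //.
  apply: (@le_trans _ _ (Sop W t m (fun y => K0 * (t * W true y * u (g true y))) x)).
    apply: Sop_le => // y; rewrite iterS /blockop mulrCA.
    by rewrite ler_wpM2l ?mulr_ge0.
  by rewrite SopZ ler_wpM2l.
exists (1 + K0 * U) => -[|k] x; first by rewrite lerDl mulr_ge0// (le_trans (u0 x))//; have /andP[] := u1 x.
rewrite iterS {1}/blockop.
apply: (@le_trans _ _ (t * W true x * (K0 * u (g true x)))).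
  by rewrite ler_wpM2l ?mulr_ge0.
rewrite mulrCA; apply: (@le_trans _ _ (K0 * U)); last by rewrite lerDr.
rewrite ler_wpM2l//.
have := u2 x; rewrite -[transfer W u x]/(W false x * u (g false x) + W true x * u (g true x)).
have := mulr_ge0 (mulr_ge0 t0 (W0 false x)) (u0 (g false x)).
by have /andP[] := u1 x; lra.
Qed.

Lemma gw_falseS n y : gw (nseq n false) (g false y) = g false (gw (nseq n false) y).
Proof. by elim: n => //= n ->. Qed.

Lemma wt_falseS W n x : wt W (nseq n false) (g false x) * W false x =
  wt W (nseq n false) x * W false (gw (nseq n false) x).
Proof.
elim: n => [|n ih] /=; first by rewrite mul1r.
by rewrite gw_falseS mulrAC ih.
Qed.

Lemma SopE W (t : R) m x :
  Sop W t m (fun=> 1) x = \sum_(j < m) t ^+ j * wt W (nseq j false) x.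
Proof.
elim: m x => [|m ih] x /=; first by rewrite big_ord0.
rewrite big_ord_recl expr0 mul1r /= ih mulr_sumr; congr (_ + _).
apply: eq_bigr => j _; rewrite -[bump 0 j]/(j.+1) exprS /=.
by rewrite -wt_falseS; ring.
Qed.

(** Each of the [m] return words weighs at least [c0 * c1], so the undiscounted block operator
    multiplies by at least [m c0 c1 >= 4]. The discount over [m] letters is set to 1/2, which leaves
    a factor 2. *)
Lemma pressure_lower W c0 c1 : nonneg W -> 0 < c0 -> 0 < c1 ->
  (forall j y, c0 <= wt W (nseq j false) y) -> (forall x, c1 <= W true x) ->
  exists2 p, 0 < p & forall q, q < p -> ~ growth W q.
Proof.
move=> W0 c00 c10 h0 h1.
pose m := (Num.truncn (4 / (c0 * c1))).+1.
have m4 : 4 <= m%:R * (c0 * c1).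
  by rewrite -ler_pdivrMr ?mulr_gt0// ltW// truncnS_gt.
pose p := ln 2 / m%:R : R.
have m0 : 0 < m%:R :> R by rewrite ltr0n.
have p0 : 0 < p by rewrite divr_gt0// ln_gt0// ltr1n.
exists p => // q qp hq.
have [K hK] := blockop_bounded m W0 hq qp.
set t := expR (- p) in hK.
have t01 : 0 <= t <= 1 by rewrite expR_ge0 expR_le1 oppr_le0 ltW.
have tm : t ^+ m = 2^-1.
  rewrite /t -expRM_natl mulrN expRN /p mulrCA divff ?gt_eqF// mulr1 lnK//.
  by rewrite posrE.
have b1 x : 2 <= blockop W t m (fun=> 1) x.
  rewrite /blockop SopE mulr_sumr.
  apply: (@le_trans _ _ (\sum_(j < m) t ^+ m * (c0 * c1))).
    by rewrite sumr_const card_ord -mulr_natl tm; lra.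
  apply: ler_sum => j _.
  have -> : t * W true x * (t ^+ j * wt W (nseq j false) (g true x)) =
    t ^+ j.+1 * (wt W (nseq j false) (g true x) * W true x) by rewrite exprS; ring.
  rewrite ler_pM ?exprn_ge0 ?mulr_ge0//.
  - by case/andP: t01.
  - exact: ltW.
  - exact: ltW.
  - by rewrite ler_wiXn2l//; [case/andP: t01|case/andP: t01].
  - by rewrite ler_pM// ltW.
have bk k x : 2 ^+ k <= iter k (blockop W t m) (fun=> 1) x.
  elim: k x => [|k ih] x //.
  rewrite iterS exprSr.
  apply: (@le_trans _ _ (blockop W t m (fun=> 2 ^+ k * 1) x)).
    by rewrite blockopZ ler_wpM2l ?exprn_ge0.
  by apply: blockop_le => //; [case/andP: t01|move=> y; rewrite mulr1].
have [k] := @pow_unbounded 2 K (ltac:(by rewrite ltr1n)).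
by rewrite ltNge => /negP; apply; exact: le_trans (bk k (I0 R)) (hK k _).
Qed.

Lemma pressure_lower_flat phi delta : bdd phi -> 0 < delta ->
  (forall x, ival x <= delta -> 0 <= phi x) -> 0 < Ptop phi.
Proof.
move=> b d0 hd; have [B hB] := b.
have B0 : 0 <= B := le_trans (normr_ge0 _) (hB (I0 R)).
have [N hN] := @xs_small R alpha delta d0.
have wB a x : expR (- B) <= wexp phi a x.
  by rewrite ler_expR; have := hB (g a x); rewrite ler_norml => /andP[].
have e1 : expR (- B) <= 1 by rewrite expR_le1 oppr_le0.
(* After [N] steps along [false] the points lie in [0, delta], where the factors are at least 1; the
   earlier factors are at least [expR (- B)]. *)
have [|||||p p0 hp] := @pressure_lower (wexp phi) (expR (- B) ^+ N) (expR (- B)).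
- exact: wexp_ge0.
- by rewrite exprn_gt0// expR_gt0.
- exact: expR_gt0.
- move=> j y; apply: (@le_trans _ _ (expR (- B) ^+ minn j N)).
    by rewrite ler_wiXn2l ?expR_ge0// geq_minr.
  elim: j => [|j ih]; first by rewrite min0n.
  rewrite -[X in _ <= X]/(wt (wexp phi) (nseq j false) y *
    expR (phi (gw (nseq j.+1 false) y))).
  have [jN|jN] := leqP N j.
    rewrite (minn_idPr (leqW jN)) -[X in X <= _]mulr1 ler_pM ?exprn_ge0 ?expR_ge0//.
      by move: ih; rewrite (minn_idPr jN).
    rewrite -[leLHS]expR0 ler_expR hd//.
    rewrite (le_trans (gw_false_le _ _))// (le_trans _ (ltW hN))//.
    by rewrite xs_antitone// leqW.
  rewrite (minn_idPl jN) exprSr ler_pM ?exprn_ge0 ?expR_ge0//.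
    by move: ih; rewrite (minn_idPl (ltnW jN)).
  exact: (wB false (gw (nseq j false) y)).
- by move=> x; exact: wB.
apply: (lt_le_trans p0); rewrite leNgt; apply/negP => h.
have [q /andP[q1 q2]] : exists q, Ptop phi < q < p by exists ((Ptop phi + p) / 2); lra.
by apply: (hp q q2); exact: Ptop_growth.
Qed.

End pressure.

(** * Pressure of the geometric potential *)

Section geometric_pressure.
Variables (R : realType) (alpha : {posnum R}).
Local Notation I := (unit_interval R).
Local Notation g := (inv_branch alpha).
Local Notation gw := (gw alpha).
Local Notation al := (alpha%:num).
Local Notation tr1 := (@tr1 R alpha).
Local Notation growth := (@growth R alpha).
Local Notation xs := (@xs R alpha).
Local Notation lft := (@lft R alpha).
Local Notation cut := (cut alpha).

Definition geo (x : I) : R := - ln (Df alpha x).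

(** The derivative of [lft], on the whole line. *)
Definition dfr (y : R) : R := 1 + (1 + al) * y `^ al.

Lemma dfr_ge1 y : 1 <= dfr y.
Proof. by rewrite lerDl mulr_ge0 ?powR_ge0// addr_ge0. Qed.

Lemma dfr_gt0 y : 0 < dfr y. Proof. exact: lt_le_trans (dfr_ge1 y). Qed.

Lemma dfr_le u v : 0 <= u -> u <= v -> dfr u <= dfr v.
Proof.
move=> u0 uv; rewrite lerD2l ler_wpM2l// ?addr_ge0//.
by rewrite ge0_ler_powR ?nnegrE// (le_trans u0).
Qed.

Lemma geo_le0 x : geo x <= 0.
Proof. by rewrite oppr_le0 ln_ge0// dfr_ge1. Qed.

Lemma geo0 : geo (I0 R) = 0.
Proof. by rewrite /geo /Df /= powR0 ?gt_eqF// mulr0 addr0 ln1 oppr0. Qed.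

Lemma expR_geo x : expR (geo x) = (dfr (ival x))^-1.
Proof. by rewrite expRN lnK// posrE dfr_gt0. Qed.

Lemma geo_bdd : bdd geo.
Proof.
exists (ln (dfr 1)) => x; rewrite ler0_norm ?geo_le0// opprK.
by rewrite ler_ln ?posrE ?dfr_gt0// dfr_le ?ival_ge0 ?ival_le1.
Qed.

(** Young's inequality for the exponents [p] and [p / (p - 1)], applied to [x] and 1. *)
Lemma bernoulli_powR (x p : R) : 0 <= x -> 1 < p -> 1 + p * (x - 1) <= x `^ p.
Proof.
move=> x0 p1; have p0 : 0 < p by lra.
have := @conjugate_powR R x 1 p (p / (p - 1)) x0 ler01 p0.
rewrite divr_gt0 ?subr_gt0// => /(_ isT).
have -> : p^-1 + (p / (p - 1))^-1 = 1.
  by field; rewrite !gt_eqF ?subr_gt0.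
move=> /(_ erefl); rewrite powR1 mulr1 => h.
have -> : x `^ p = p * (x `^ p / p) by field; rewrite gt_eqF.
have -> : 1 + p * (x - 1) = p * (x - 1 / (p / (p - 1))).
  by field; rewrite !gt_eqF ?subr_gt0.
by rewrite ler_wpM2l ?(ltW p0)//; lra.
Qed.

(** The power y^(1+al), in the form in which it occurs in [lft] and vanishes at 0 by computation. *)
Definition pw (y : R) : R := y * y `^ al.

Lemma pw_ge0 y : 0 <= y -> 0 <= pw y.
Proof. by move=> y0; rewrite mulr_ge0// powR_ge0. Qed.

Lemma pwM x y : 0 <= x -> 0 <= y -> pw (x * y) = pw x * pw y.
Proof. by move=> x0 y0; rewrite /pw powRM//; ring. Qed.

Lemma pw_le x y : 0 <= x -> x <= y -> pw x <= pw y.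
Proof.
move=> x0 xy; have y0 := le_trans x0 xy.
by rewrite ler_pM ?powR_ge0// ge0_ler_powR ?nnegrE.
Qed.

(** Convexity of y^(1+al): by homogeneity, the tangent at [u] reduces to Bernoulli's inequality at
    [v / u]. *)
Lemma pw_tangent u v : 0 <= u -> 0 <= v ->
  pw u + (1 + al) * u `^ al * (v - u) <= pw v.
Proof.
move=> u0 v0; move: u0; rewrite le_eqVlt => /predU1P[<-|u0].
  by rewrite /pw powR0 ?gt_eqF// !mulr0 mul0r addr0 mulr_ge0// powR_ge0.
have := @bernoulli_powR (v / u) (1 + al) (divr_ge0 v0 (ltW u0)).
have a0 : 0 < al by [].
rewrite ltrDl => /(_ a0).
have e y : 0 < y -> pw y = y `^ (1 + al).
  by move=> y0; rewrite powRD ?gt_eqF ?implybT// powRr1 ?ltW.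
have pu : 0 < pw u by rewrite mulr_gt0// powR_gt0.
have -> : (v / u) `^ (1 + al) = pw v / pw u.
  have [->|v1] := eqVneq v 0.
    by rewrite mul0r powR0 ?gt_eqF ?addr_gt0// /pw !mul0r.
  have {}v0 : 0 < v by rewrite lt_neqAle eq_sym v1.
  rewrite -e ?divr_gt0// pwM ?invr_ge0// ?(ltW u0)// ?(ltW v0)//; congr (_ * _).
  apply: (mulIf (negbT (gt_eqF pu))); rewrite mulVf ?gt_eqF// -pwM ?invr_ge0 ?(ltW u0)//.
  by rewrite mulVf ?gt_eqF// /pw powR1 mulr1.
rewrite ler_pdivlMr//; apply: le_trans.
rewrite /pw le_eqVlt; apply/orP; left; apply/eqP; field.
by rewrite gt_eqF.
Qed.

Lemma lft_pw y : lft y = y + pw y.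
Proof. by rewrite /lft /pw mulrDr mulr1. Qed.

Lemma lft_diff_le u v : 0 <= v -> v <= u -> lft u - lft v <= dfr u * (u - v).
Proof.
move=> v0 vu; have := @pw_tangent u v (le_trans v0 vu) v0.
by rewrite !lft_pw /dfr; lra.
Qed.

Lemma lft_diff_ge u v : 0 <= v -> v <= u -> dfr v * (u - v) <= lft u - lft v.
Proof.
move=> v0 vu; have := @pw_tangent v u v0 (le_trans v0 vu).
by rewrite !lft_pw /dfr; lra.
Qed.

(* With [p = 1 + al] and [t = u^al] this is the monotonicity of
   [x^p / (u^p Df u)] where [x = lft u - a], see [good_step]. *)
Lemma pw_ratio (s t : R) : 0 <= t -> t <= s ->
  pw (1 + t) * (1 + (1 + al) * s) <= pw (1 + s) * (1 + (1 + al) * t).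
Proof.
move=> t0 ts; have a0 : 0 < al by [].
have := @pw_tangent (1 + t) (1 + s); rewrite !addr_ge0 ?(le_trans t0 ts)// => /(_ isT isT) h.
apply: (le_trans _ (ler_wpM2r _ h)); last by rewrite addr_ge0// mulr_ge0// addr_ge0.
rewrite -subr_ge0 /pw.
have -> : ((1 + t) * (1 + t) `^ al + (1 + al) * (1 + t) `^ al * (1 + s - (1 + t))) *
    (1 + (1 + al) * t) - (1 + t) * (1 + t) `^ al * (1 + (1 + al) * s) =
    (1 + t) `^ al * ((1 + al) * (s - t) * (al * t)) by ring.
rewrite mulr_ge0 ?powR_ge0// !mulr_ge0// ?subr_ge0// addr_ge0//.
Qed.

Local Notation W := (wexp alpha geo).

Lemma WE a x : W a x = (dfr (ival (g a x)))^-1.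
Proof. by rewrite /wexp expR_geo. Qed.

(* [G] is a sum of inverse branches of iterates and [D] is its derivative;
   the clauses express that [G] is concave, and that [x^(1+al) D x] increases,
   which bounds the distortion away from [0]. *)
Definition good (G D : I -> R) : Prop := [/\
  forall x y, ival x <= ival y ->
    D y * (ival y - ival x) <= G y - G x <= D x * (ival y - ival x),
  forall x, 0 <= D x, forall x y, ival x <= ival y -> D y <= D x &
  forall x y, ival x <= ival y -> pw (ival x) * D x <= pw (ival y) * D y].

Lemma good_id : good (@ival R) (fun=> 1).
Proof.
split => // [x y _|x y xy]; first by rewrite mul1r lexx.
by rewrite !mulr1 pw_le// ival_ge0.
Qed.

Lemma good_zero : good (fun=> 0) (fun=> 0).
Proof. by split => // *; rewrite ?subrr ?mul0r ?mulr0 ?lexx. Qed.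

Lemma good_add G D G' D' : good G D -> good G' D' ->
  good (fun x => G x + G' x) (fun x => D x + D' x).
Proof.
move=> [a1 a2 a3 a4] [b1 b2 b3 b4]; split => [x y xy|x|x y xy|x y xy].
- by have := a1 x y xy; have := b1 x y xy; rewrite !mulrDl; lra.
- by rewrite addr_ge0.
- by rewrite lerD ?a3 ?b3.
- by rewrite !mulrDr lerD ?a4 ?b4.
Qed.

Lemma good_step a G D : good G D ->
  good (fun x => G (g a x)) (fun x => W a x * D (g a x)).
Proof.
move=> [h1 h2 h3 h4].
have W0 x : 0 <= W a x by exact: wexp_ge0.
have mono x y : ival x <= ival y -> ival (g a x) <= ival (g a y).
  by rewrite inv_branch_mono.
split => [x y xy|x|x y xy|x y xy].
- have [l1 l2] := andP (h1 _ _ (mono _ _ xy)).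
  have := lft_diff_le (ival_ge0 _) (mono _ _ xy).
  have := lft_diff_ge (ival_ge0 _) (mono _ _ xy).
  rewrite !inv_branchK opprD addrACA subrr addr0.
  move=> e2 e1.
  have f2 : ival (g a y) - ival (g a x) <= W a x * (ival y - ival x).
    by rewrite WE ler_pdivlMl ?dfr_gt0.
  have f1 : W a y * (ival y - ival x) <= ival (g a y) - ival (g a x).
    by rewrite WE ler_pdivrMl ?dfr_gt0.
  apply/andP; split.
    by apply: le_trans l1; rewrite -mulrA mulrCA ler_wpM2l.
  by apply: (le_trans l2); rewrite -mulrA mulrCA ler_wpM2l.
- by rewrite mulr_ge0.
- apply: ler_pM; [exact: W0|exact: h2| |exact: h3 (mono _ _ xy)].
  rewrite (WE a y) (WE a x) lef_pV2 ?posrE ?dfr_gt0//.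
  by rewrite dfr_le ?ival_ge0// mono.
- pose u := ival (g a x); pose v := ival (g a y).
  have uv : u <= v := mono _ _ xy.
  have lu : lft u = ival x + a%:R := inv_branchK _ _ _.
  have lv : lft v = ival y + a%:R := inv_branchK _ _ _.
  have [u0|u1] := eqVneq u 0.
    have -> : ival x = 0.
      have := lu; rewrite u0 lft0 => /eqP; rewrite eq_sym paddr_eq0 ?ival_ge0//.
      by case/andP => /eqP.
    rewrite {1}/pw !mul0r; apply: mulr_ge0; first exact: pw_ge0 (ival_ge0 _).
    by apply: mulr_ge0; [exact: W0|exact: h2].
  have u0 : 0 < u by rewrite lt_neqAle eq_sym u1 ival_ge0.
  have v0 := lt_le_trans u0 uv.
  (* With [u = g a x] one has [ival x = lft u * k u] and lft u = u (1 + u^al), so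
     [pw (ival x) * W a x] splits as [r u * pw (k u) * pw u]. Here [r] increases by [pw_ratio], and
     [k] because [lft] does. *)
  pose r (z : R) := pw (1 + z `^ al) / dfr z.
  pose k (z : R) := 1 - a%:R / lft z.
  have lgt z : 0 < z -> 0 < lft z.
    by move=> z0; rewrite mulr_gt0// ltr_wpDr// powR_ge0.
  have key z x' : 0 < z -> lft z = ival x' + a%:R ->
      pw (ival x') / dfr z = r z * pw (k z) * pw z /\ 0 <= k z.
    move=> z0 e; have ex : ival x' = lft z * k z.
      by rewrite /k mulrBr mulr1 mulrCA divff ?mulr1 ?gt_eqF ?lgt// e addrK.
    have k0 : 0 <= k z by rewrite -(pmulr_rge0 _ (lgt _ z0)) -ex ival_ge0.
    split => //; rewrite ex pwM//; last exact: ltW (lgt _ z0).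
    by rewrite /lft pwM ?addr_ge0 ?powR_ge0 ?(ltW z0)// /r; ring.
  have [eu ku] := key u x u0 lu; have [ev kv] := key v y v0 lv.
  have ex : pw (ival x) * (W a x * D (g a x)) =
      r u * (pw (k u) * (pw u * D (g a x))).
    have -> : W a x = (dfr u)^-1 := WE a x.
    by rewrite mulrA eu -!mulrA.
  have ey : pw (ival y) * (W a y * D (g a y)) =
      r v * (pw (k v) * (pw v * D (g a y))).
    have -> : W a y = (dfr v)^-1 := WE a y.
    by rewrite mulrA ev -!mulrA.
  rewrite ex ey.
  have r0 z : 0 <= r z.
    by rewrite divr_ge0 ?pw_ge0 ?(ltW (dfr_gt0 _))// addr_ge0 ?powR_ge0.
  have q0 : 0 <= pw u * D (g a x) by rewrite mulr_ge0 ?pw_ge0 ?(ltW u0).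
  apply: ler_pM; [exact: r0|by rewrite mulr_ge0 ?pw_ge0| |].
    rewrite /r ler_pdivrMr ?dfr_gt0// mulrAC ler_pdivlMr ?dfr_gt0//.
    by rewrite pw_ratio ?powR_ge0// ge0_ler_powR ?nnegrE ?(ltW u0) ?(ltW v0).
  apply: ler_pM; [exact: pw_ge0|exact: q0| |exact: h4 (mono _ _ xy)].
  apply: pw_le; [exact: ku|]; rewrite lerD2l lerN2 ler_wpM2l// lef_pV2 ?posrE ?lgt//.
  by rewrite lft_le// ?(ltW u0) ?(ltW v0).
Qed.

Lemma eq_good G D G' D' : G =1 G' -> D =1 D' -> good G D -> good G' D'.
Proof.
move=> eG eD [h1 h2 h3 h4]; split => *; rewrite -?eG -?eD; auto.
Qed.

(** The primitive is the sum of all inverse branches of order [n]. Their images tile [0, 1], as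
    [g false 1 = g true 0], so the total increment stays 1: the operator of [geo] preserves Lebesgue
    integrals. *)
Lemma good_tr1 n : exists G, good G (tr1 W n) /\ G (I1 R) - G (I0 R) = 1.
Proof.
elim: n => [|n [G [hG G1]]].
  by exists (@ival R); split; [exact: good_id|rewrite /= subr0].
exists (fun x => G (g false x) + G (g true x)); split.
  exact: good_add (good_step false hG) (good_step true hG).
rewrite inv_branch0 inv_branch1 -G1.
have -> : g false (I1 R) = g true (I0 R).
  by apply: ival_inj; rewrite cut_false1.
ring.
Qed.

Lemma pw_cut_gt0 : 0 < pw cut.
Proof. by rewrite mulr_gt0 ?powR_gt0 ?cut_gt0. Qed.

Lemma good_cut G D x : good G D -> cut <= ival x -> D x <= D (I1 R) / pw cut.
Proof.
move=> [_ h2 h3 h4] cx; rewrite ler_pdivlMr ?pw_cut_gt0// mulrC.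
apply: (@le_trans _ _ (pw (ival x) * D x)).
  by rewrite ler_wpM2r// pw_le// ltW// cut_gt0.
rewrite (le_trans (h4 x (I1 R) (ival_le1 x)))//.
by rewrite /pw /= powR1 !mul1r.
Qed.

Lemma W_le1 a x : W a x <= 1.
Proof. by rewrite expR_le1 geo_le0. Qed.

Lemma W_false0 : W false (I0 R) = 1.
Proof. by rewrite /wexp inv_branch0 geo0 expR0. Qed.

(** At 0 the branch [false] has weight 1, and [true] lands at [cut], where [good_cut] compares the
    density with its value at 1, which is at most the total increment 1. So [tr1] at 0, its maximum,
    grows at most linearly in [n]. *)
Lemma Ptop_geo : Ptop alpha geo = 0.
Proof.
apply/le_anti/andP; split; last by rewrite -geo0 Ptop_ge0//; exact: geo_bdd.
apply/ler_addgt0Pr => e e0; rewrite add0r; apply: Ptop_le.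
set C := (pw cut)^-1; have C0 : 0 < C by rewrite invr_gt0 pw_cut_gt0.
exists (1 + C / e) => n x.
have h k : tr1 W k (I0 R) <= 1 + k%:R * C.
  elim: k => [|k ih]; first by rewrite mul0r addr0.
  rewrite tr1S inv_branch0 W_false0 mul1r -natr1 mulrDl mul1r addrA lerD//.
  have [G [hG G1]] := good_tr1 k.
  apply: (@le_trans _ _ (tr1 W k (g true (I0 R)))).
    by rewrite ler_piMl ?W_le1// tr1_ge0//; exact: wexp_ge0.
  rewrite (le_trans (good_cut hG (lexx _)))// ler_piMl// ?(ltW C0)//.
  case: hG => /(_ (I0 R) (I1 R) (ival_ge0 _)) + _ _ _.
  by rewrite G1 /= subr0 mulr1 => /andP[].
have [G [hG _]] := good_tr1 n.
apply: (@le_trans _ _ (1 + n%:R * C)).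
  by rewrite (le_trans _ (h n))//; case: hG => _ _ hd _; rewrite hd// ival_ge0.
rewrite mulrDl mul1r lerD//; first by rewrite -expR0 ler_expR mulr_ge0// ltW.
have -> : n%:R * C = C / e * (n%:R * e) by field; rewrite gt_eqF.
rewrite ler_wpM2l ?divr_ge0 ?(ltW C0) ?(ltW e0)// (le_trans _ (expR_ge1Dx _))//.
by rewrite lerDr.
Qed.

(** Built to be a primitive of [Sop] at [t = 1], see [good_SG]. *)
Fixpoint SG m (G : I -> R) : I -> R :=
  if m is m'.+1 then fun x => G x + SG m' G (g false x) else fun=> 0.

Lemma good_SG m G D : good G D -> good (SG m G) (Sop alpha W 1 m D).
Proof.
move=> hG; elim: m => [|m ih]; first exact: good_zero.
apply: (eq_good _ _ (good_add hG (good_step false ih))) => //= x.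
by rewrite mul1r.
Qed.

Definition ys j : I := gw (nseq j false) (I1 R).

Lemma SG_telescope m G j :
  SG m G (ys j) - SG m G (ys j.+1) = G (ys j) - G (ys (j + m)).
Proof.
elim: m j => [|m ih] j /=; first by rewrite addn0 !subrr.
have e k : g false (ys k) = ys k.+1 by [].
by rewrite !e opprD addrACA ih addSnnS; ring.
Qed.

Definition geo_blocks m k : I -> R := iter k (blockop alpha W 1 m) (fun=> 1).

Lemma geo_blocksS m k x : geo_blocks m k.+1 x =
  W true x * Sop alpha W 1 m (geo_blocks m k) (g true x).
Proof. by rewrite /geo_blocks iterS {1}/blockop mul1r. Qed.

(** The truncated return words miss [0, xs m]; by the distortion bound [C] this loses at most the
    fraction [C * xs m] of the increment at each step. The bound compares the densities at 0 and 1: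
    [good_cut] contributes [1 / pw cut], and the weight of [true] at 1 contributes [dfr 1]. *)
Lemma good_blocks m k (C : R) : 1 <= C -> dfr 1 / pw cut <= C ->
  C * xs m <= 1 -> exists G, [/\ good G (geo_blocks m k),
    geo_blocks m k (I0 R) <= C * geo_blocks m k (I1 R) &
    (1 - C * xs m) ^+ k <= G (I1 R) - G (I0 R)].
Proof.
move=> C1 C2 Cx; have C0 : 0 < C by lra.
set q := 1 - C * xs m; have q0 : 0 <= q by rewrite subr_ge0.
elim: k => [|k [G [hG hD hl]]].
  exists (@ival R); split; first exact: good_id.
    by rewrite /geo_blocks /= mulr1.
  by rewrite expr0 subr0.
have hG' := good_SG m hG.
exists (fun x => SG m G (g true x)); split.
- apply: eq_good (good_step true hG') => x; first reflexivity.
  by rewrite geo_blocksS.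
- rewrite !geo_blocksS inv_branch1.
  set S := Sop _ _ _ _ _ in hG' *.
  have S0 x : 0 <= S x by case: hG'.
  apply: (@le_trans _ _ (S (g true (I0 R)))).
    by rewrite ler_piMl ?W_le1.
  rewrite (le_trans (good_cut hG' (lexx _)))//.
  rewrite WE inv_branch1 mulrA [S _ * _]mulrC ler_wpM2r//.
  by rewrite /= ler_pdivlMr ?dfr_gt0// mulrC.
- rewrite inv_branch1 exprS.
  have -> : SG m G (I1 R) - SG m G (g true (I0 R)) = G (I1 R) - G (ys m).
    have -> : g true (I0 R) = ys 1 by apply: ival_inj; rewrite [RHS]cut_false1.
    exact: (SG_telescope m G 0).
  case: hG => /[dup] /(_ (I0 R) (ys m) (ival_ge0 _)) /andP[_ e1].
  move=> /(_ (I0 R) (I1 R) (ival_ge0 _)) /andP[e2 _] _ _ _.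
  rewrite /= !subr0 mulr1 in e1 e2.
  have e3 : geo_blocks m k (I0 R) * ival (ys m) <= C * (G (I1 R) - G (I0 R)) * xs m.
    rewrite ler_wpM2r ?xs_ge0// (le_trans hD)// ler_wpM2l// ltW//.
  have e4 : q * q ^+ k <= q * (G (I1 R) - G (I0 R)) by rewrite ler_wpM2l.
  have e5 : q * (G (I1 R) - G (I0 R)) =
    (G (I1 R) - G (I0 R)) - C * (G (I1 R) - G (I0 R)) * xs m by rewrite /q; ring.
  by lra.
Qed.

(** Every return word contains a letter [true], on which passing from [geo] to [beta * geo] gains at
    least [rho > 1]. The truncation loses only the factor [q], close to 1 for large [m], so the
    block operator still expands. *)
Lemma Ptop_beta_geo (beta : R) : 0 < beta < 1 ->
  0 < Ptop alpha (fun x => beta * geo x).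
Proof.
move=> /andP[b0 b1].
have bb : bdd (fun x => beta * geo x).
  have [B hB] := geo_bdd; exists (beta * B) => x.
  by rewrite normrM gtr0_norm// ler_wpM2l// ltW.
set Wb := wexp alpha (fun x => beta * geo x).
pose C := Num.max 1 (dfr 1 / pw cut).
have C1 : 1 <= C by rewrite le_max lexx.
have C0 : 0 < C by lra.
pose rho := expR ((1 - beta) * ln (dfr cut)).
have rho1 : 1 < rho.
  rewrite expR_gt1 mulr_gt0 ?subr_gt0// ln_gt0// ltrDl mulr_gt0 ?addr_gt0//.
  by rewrite powR_gt0// cut_gt0.
have rho0 : 0 < rho by lra.
have [m hm] := @xs_small R alpha ((1 - rho^-1) / (2 * C))
  (ltac:(by rewrite divr_gt0 ?mulr_gt0// subr_gt0 invf_lt1)).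
pose q := 1 - C * xs m.
have q1 : q <= 1 by rewrite gerBl mulr_ge0 ?xs_ge0// ltW.
have rq : 1 < rho * q.
  have h : C * xs m < (1 - rho^-1) / 2.
    rewrite mulrC -ltr_pdivlMr// (lt_le_trans hm)// le_eqVlt; apply/orP; left.
    by apply/eqP; field; rewrite !gt_eqF.
  have r1 : rho^-1 < 1 by rewrite invf_lt1.
  by rewrite mulrC -ltr_pdivrMr// mul1r /q; lra.
have q0 : 0 < q by rewrite -(pmulr_rgt0 _ rho0); lra.
have C2 : dfr 1 / pw cut <= C by rewrite le_max lexx orbT.
have Cx : C * xs m <= 1 by rewrite -subr_ge0 ltW.
pose DD k := geo_blocks m k.
have hlow k x : q ^+ k / C <= DD k x.
  have [G [[h1 h2 h3 _] hD hl]] := good_blocks k C1 C2 Cx.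
  rewrite ler_pdivrMr// (le_trans hl)//.
  have := h1 (I0 R) (I1 R) (ival_ge0 _); rewrite /= subr0 !mulr1 => /andP[_ e].
  apply: (le_trans e); apply: (le_trans hD); rewrite mulrC.
  by apply: ler_wpM2r; [exact: ltW|exact: (h3 x (I1 R) (ival_le1 x))].
(* With this [p], [t ^+ m.+1] is (rho q)^(-1/2), so the discounted block operator still gains (rho
   q)^(1/2) per step. *)
pose p := ln (rho * q) / (2 * m.+1%:R).
have p0 : 0 < p by rewrite divr_gt0 ?ln_gt0// mulr_gt0// ltr0n.
suff hp s : s < p -> ~ growth Wb s.
  rewrite (lt_le_trans p0)// leNgt; apply/negP => h.
  apply: (hp ((Ptop alpha (fun x => beta * geo x) + p) / 2)); first by lra.
  by apply: Ptop_growth => //; lra.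
move=> sp hs.
have [K hK] := blockop_bounded m (@wexp_ge0 _ _ _) hs sp.
set t := expR (- p) in hK.
have t0 : 0 <= t by exact: expR_ge0.
have t1 : t <= 1 by rewrite expR_le1 oppr_le0 ltW.
have WbW a x : W a x <= Wb a x.
  rewrite ler_expR -subr_ge0 -[X in _ - X]mul1r -mulrBl.
  by rewrite mulr_le0 ?geo_le0// subr_le0 ltW.
have WbW1 x : rho * W true x <= Wb true x.
  rewrite /W /Wb /wexp -expRD ler_expR -lerBrDr -{2}(mul1r (geo _)) -mulrBl.
  have -> : (beta - 1) * geo (g true x) = (1 - beta) * ln (dfr (ival (g true x))).
    by rewrite /geo /Df /dfr; ring.
  rewrite ler_wpM2l ?subr_ge0 ?(ltW b1)//.
  by rewrite ler_ln ?posrE ?dfr_gt0// dfr_le ?cut_le_true// ltW// cut_gt0.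
have hS j psi x : (forall y, 0 <= psi y) -> t ^+ j * Sop alpha W 1 j psi x <= Sop alpha Wb t j psi x.
  move=> psi0.
  have S0 i y : 0 <= Sop alpha W 1 i psi y.
    elim: i y => // i ih y /=; rewrite addr_ge0// mulr_ge0// mul1r; exact: wexp_ge0.
  elim: j x => [|j ih] x /=; first by rewrite mulr0.
  rewrite mulrDr lerD//.
    by rewrite ler_piMl// exprn_ile1.
  rewrite mul1r exprS.
  have -> : t * t ^+ j * (W false x * Sop alpha W 1 j psi (g false x)) =
    t * W false x * (t ^+ j * Sop alpha W 1 j psi (g false x)) by ring.
  rewrite ler_pM ?mulr_ge0 ?exprn_ge0//; first exact: wexp_ge0.
  by rewrite ler_wpM2l.
have D0 k x : 0 <= DD k x.
  by rewrite (le_trans _ (hlow k x))// divr_ge0 ?exprn_ge0// ltW.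
pose th := t ^+ m.+1 * rho.
have th0 : 0 <= th by rewrite mulr_ge0 ?exprn_ge0// ltW.
have hkb k x : th ^+ k * DD k x <= iter k (blockop alpha Wb t m) (fun=> 1) x.
  elim: k x => [|k ih] x; first by rewrite expr0 mul1r.
  apply: (@le_trans _ _ (blockop alpha Wb t m (fun y => th ^+ k * DD k y) x)); last first.
    by apply: blockop_le => //; exact: wexp_ge0.
  rewrite blockopZ exprSr -mulrA ler_wpM2l ?exprn_ge0//.
  rewrite /DD geo_blocksS -/(DD k) /blockop /th exprS.
  have -> : t * t ^+ m * rho * (W true x * Sop alpha W 1 m (DD k) (g true x)) =
    t * (rho * W true x) * (t ^+ m * Sop alpha W 1 m (DD k) (g true x)) by ring.
  rewrite ler_pM ?mulr_ge0 ?exprn_ge0 ?(ltW rho0)//.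
  - exact: wexp_ge0.
  - elim: (m) (g true x) => // i ihi y /=; rewrite addr_ge0// mulr_ge0// mul1r; exact: wexp_ge0.
  - by rewrite ler_wpM2l.
  - exact: hS.
have thq : 1 < th * q.
  have -> : th * q = expR (ln (rho * q) / 2).
    have e : rho * q = expR (ln (rho * q)) by rewrite lnK// posrE; lra.
    rewrite /th /t -expRM_natl -mulrA [X in _ * X = _]e.
    rewrite -expRD; congr expR; rewrite /p; field.
    by rewrite gt_eqF// ltr0n.
  by rewrite expR_gt1 divr_gt0// ln_gt0.
have [k] := @pow_unbounded _ _ (K * C) thq.
rewrite ltNge => /negP; apply.
rewrite exprMn -ler_pdivrMr// -mulrA.
apply: (le_trans _ (hK k (I0 R))); apply: le_trans (hkb k _).
by rewrite ler_wpM2l ?exprn_ge0.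
Qed.

End geometric_pressure.

(** * Eigenfunction of the transfer operator *)

Section ultra_limits.
Variable R : realType.

Lemma ultra_fmap (T S : Type) (U : set_system T) (f : T -> S) :
  UltraFilter U -> UltraFilter (f @ U).
Proof.
move=> UU; split; first exact: fmap_proper_filter.
move=> G GP sG; apply/seteqP; split => // A GA.
have [//|UC] := in_ultra_setVsetC (f @^-1` A) UU.
have GC : G (~` A) by apply: sG.
by have [x [/= Ax nAx]] := filter_ex (filterI GA GC).
Qed.

(** Takes the place of compactness in a function space: one ultrafilter makes a bounded sequence of
    functions converge at all points simultaneously. *)
Lemma ultra_bounded_cvg (T : Type) (U : set_system T) (f : T -> R) (a b : R) :
  UltraFilter U -> (forall t, a <= f t <= b) -> exists l : R, f @ U --> l.
Proof.
move=> UU fab.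
have := @segment_compact R a b; rewrite compact_ultra => /(_ (f @ U)).
move=> /(_ (ultra_fmap f UU)) []; last by move=> l [_ h]; exists l.
by apply: (@filterE _ U) => t /=; rewrite in_itv /= fab.
Qed.

End ultra_limits.

Section eigenfunction.
Variables (R : realType) (alpha gam : {posnum R}).
Local Notation I := (unit_interval R).
Local Notation g := (inv_branch alpha).
Local Notation gw := (gw alpha).
Local Notation transfer := (@transfer R alpha).
Local Notation tr1 := (@tr1 R alpha).
Local Notation wt := (@wt R alpha).
Local Notation growth := (@growth R alpha).
Local Notation xs := (@xs R alpha).
Local Notation hol := (@hol R gam).
Local Notation gdist := (@gdist R gam).
Local Notation kapw := (@kapw R alpha gam).
Implicit Types (W : bool -> I -> R) (psi u v phi : I -> R).

Lemma powR_small e : 0 < e -> exists2 r : R, 0 < r &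
  forall d, 0 <= d -> d <= r -> d `^ gam%:num <= e.
Proof.
move=> e0; exists (e `^ (gam%:num)^-1); first exact: powR_gt0.
move=> d d0 dr; rewrite (le_trans (ge0_ler_powR _ _ _ dr)) ?nnegrE ?powR_ge0//.
by rewrite -powRrM mulVf ?gt_eqF// powRr1// ltW.
Qed.

Lemma hol_bdd A psi : hol A psi -> bdd psi.
Proof. by move=> /hol_bound h; eexists; exact: h. Qed.

Variables (A0 : R) (phi : I -> R).
Hypotheses (phi_hol : hol A0 phi) (phi_P : Ptop alpha phi = 0) (phi_neg : phi (I0 R) < 0).
Local Notation W := (wexp alpha phi).

Let W0 : nonneg W. Proof. exact: wexp_ge0. Qed.

Lemma phi_bdd : bdd phi. Proof. exact: hol_bdd phi_hol. Qed.

Lemma wexp_bounds : exists2 K, 1 <= K & forall a x, K^-1 <= W a x <= K.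
Proof.
have [B hB] := phi_bdd; exists (expR `|B|); first by rewrite -expR0 ler_expR.
move=> a x; rewrite -expRN !ler_expR -ler_norml.
by rewrite (le_trans (hB _))// ler_norm.
Qed.

Lemma tr1_subexp e : 0 < e -> exists2 C, 0 < C & forall n x, tr1 W n x <= C * expR (n%:R * e).
Proof.
move=> e0; have [|C hC] := @Ptop_growth R alpha phi e phi_bdd; first by rewrite phi_P.
exists C => //.
have := hC 0%N (I0 R); rewrite mul0r expR0 mulr1; exact: lt_le_trans.
Qed.

Lemma not_tr1_exp th C : 0 < th < 1 -> ~ forall n x, tr1 W n x <= C * th ^+ n.
Proof.
move=> /andP[t0 t1] h.
suff /Ptop_le : growth W (ln th) by rewrite phi_P leNgt ln_lt0// t0.
by exists C => n x; rewrite expRM_natl lnK.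
Qed.

(** Near 0 the potential is below [- d], and after [N] steps the points of [false^m] are that close
    to 0: from there on the weights decay geometrically. *)
Lemma false_word_small e : 0 < e -> exists m, forall x, wt W (nseq m false) x <= e.
Proof.
move=> e0; pose d := - phi (I0 R) / 2; have d0 : 0 < d by rewrite divr_gt0// oppr_gt0.
have A00 : 0 <= A0 := hol_ge0 phi_hol.
have [r r0 hr] := @powR_small (d / (A0 + 1)) (ltac:(by rewrite divr_gt0// ltr_wpDl)).
have [N hN] := @xs_small R alpha r r0.
have hphi y : ival y <= xs N -> phi y <= - d.
  move=> yN; have := phi_hol y (I0 R); rewrite /gdist /= subr0 (ger0_norm (ival_ge0 _)) => h.
  have : A0 * ival y `^ gam%:num <= d.
    apply: (@le_trans _ _ ((A0 + 1) * (d / (A0 + 1)))).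
      rewrite ler_pM ?powR_ge0//; first by rewrite lerDl.
      by rewrite hr ?ival_ge0// (le_trans yN)// ltW.
    by rewrite mulrCA divff ?mulr1// gt_eqF// ltr_wpDl.
  have := le_trans (ler_norm _) h; rewrite /d; lra.
have [K K1 hK] := wexp_bounds.
have K0 : 0 < K by lra.
have key j x : wt W (nseq (N + j) false) x <= K ^+ N * expR (- d) ^+ j.
  elim: j => [|j ih].
    rewrite addn0 expr0 mulr1; have := @wt_le R alpha W (nseq N false) x K W0.
    by rewrite size_nseq; apply => a y; have /andP[] := hK a y.
  rewrite addnS exprSr mulrA; change (wt W (nseq (N + j) false) x *
    expR (phi (gw (nseq (N + j).+1 false) x)) <= K ^+ N * expR (- d) ^+ j * expR (- d)).
  rewrite ler_pM ?wt_ge0 ?expR_ge0// ler_expR hphi//.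
  by rewrite (le_trans (gw_false_le _ _ _))// xs_antitone// -addnS leq_addr.
have [j hj] := @pow_unbounded _ (expR d) (K ^+ N / e) (ltac:(by rewrite expR_gt1)).
exists (N + j)%N => x; rewrite (le_trans (key j x))// expRN exprVn ler_pdivrMr ?exprn_gt0 ?expR_gt0//.
by rewrite -ler_pdivrMl// mulrC ltW.
Qed.

Lemma prod_bool_word (c : R) (w : seq bool) :
  \prod_(a <- w) (if a then c else 1) = c ^+ count id w.
Proof.
elim: w => [|a w ih]; first by rewrite big_nil.
by rewrite big_cons ih /=; case: a; rewrite ?mul1r// add1n exprS.
Qed.

Definition tagw (c : R) W (a : bool) x := W a x * (if a then c else 1).

Lemma tr1_tagw c n x : tr1 (tagw c W) n x =
  \sum_(w <- words n) wt W w x * c ^+ count id w.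
Proof. by rewrite tr1E; apply: eq_bigr => w _; rewrite wt_mul prod_bool_word. Qed.

Lemma tagw_ge0 c : 0 <= c -> nonneg (tagw c W).
Proof. by move=> c0 a x; rewrite mulr_ge0//; case: a. Qed.

Lemma count_id0 (w : seq bool) : count id w = 0%N -> w = nseq (size w) false.
Proof. by elim: w => //= -[]//= w ih /ih ->; rewrite size_nseq. Qed.

(** At [c = 0] only the word [false^m] would survive, with weight at most 1/4. For this fixed [m]
    every other word contains a letter [true], and [c] is taken small against their total weight. *)
Lemma tagw_small : exists2 c : R, 0 < c < 1 &
  exists2 m, (0 < m)%N & forall x, tr1 (tagw c W) m x <= 2^-1.
Proof.
have [m' hm'] := @false_word_small (1 / 4) (ltac:(lra)).
have [m m0 hm] : exists2 m, (0 < m)%N & forall x, wt W (nseq m false) x <= 1 / 4.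
  case: m' hm' => [|m'] h; last by exists m'.+1.
  by have := h (I0 R); rewrite /=; lra.
have [C C0 hC] := @tr1_subexp 1 ltr01.
pose D := C * expR (m%:R * 1) + 1.
have D0 : 0 < D by rewrite addr_gt0// mulr_gt0// expR_gt0.
have D1 : 1 < D by rewrite ltrDr mulr_gt0// expR_gt0.
have c4 : (4 * D)^-1 <= 4^-1 by rewrite lef_pV2 ?posrE ?mulr_gt0//; lra.
have c0 : 0 < (4 * D)^-1 by rewrite invr_gt0 mulr_gt0.
exists (4 * D)^-1; first by apply/andP; split => //; lra.
exists m => // x; rewrite tr1_tagw (big_rem (nseq m false)) ?mem_words ?size_nseq//=.
have -> : 2^-1 = 1 / 4 + 1 / 4 :> R by field.
rewrite lerD//.
  by rewrite count_nseq mul0n expr0 mulr1.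
apply: (@le_trans _ _ (\sum_(w <- rem (nseq m false) (words m)) wt W w x * (4 * D)^-1)).
  rewrite big_seq [leRHS]big_seq; apply: ler_sum => w.
  rewrite (mem_rem_uniq _ (uniq_words m)) inE => /andP[wn wm].
  rewrite ler_wpM2l ?wt_ge0//.
  case cw : (count id w) => [|k].
    by move: wn; rewrite (count_id0 cw) (size_words wm) eqxx.
  rewrite exprS ler_piMr ?(ltW c0)// exprn_ile1 ?(ltW c0)//; lra.
rewrite -mulr_suml; apply: (@le_trans _ _ (tr1 W m x * (4 * D)^-1)).
  rewrite ler_wpM2r ?(ltW c0)// tr1E (big_rem (nseq m false) (r := words m)) ?mem_words ?size_nseq//=.
  by rewrite lerDr wt_ge0.
rewrite ler_pdivrMr ?mulr_gt0// (le_trans (hC m x))// /D.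
by rewrite mulrA mul1r mulVf ?mul1r ?lerDl// gt_eqF.
Qed.

(* A word with at least a proportion [e] of letters [true] contracts
   exponentially; the words with fewer such letters have small total weight. *)
Lemma kapw_small eta : 0 < eta -> exists2 n, (0 < n)%N & forall x, tr1 (kapw W) n x <= eta.
Proof.
move=> eta0; have [c /andP[c0 c1] [m m0 hm]] := tagw_small.
have k0 := kap_gt0 alpha true; have k1 := kap_lt1 alpha.
pose k := kap alpha true `^ gam%:num.
have kk0 : 0 < k by rewrite powR_gt0.
have kk1 : k < 1.
  have -> : 1 = 1 `^ gam%:num :> R by rewrite powR1.
  by rewrite gt0_ltr_powR// ?nnegrE// ltW.
pose s := - ln k; have s0 : 0 < s by rewrite oppr_gt0 ln_lt0// kk0.
pose S := - ln c; have S0 : 0 < S by rewrite oppr_gt0 ln_lt0// c0.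
have m0' : 0 < m%:R :> R by rewrite ltr0n.
(* Chosen so that the factor [expR (S * e * m)] lost per block of length [m] is 3/2, against the
   gain 1/2 of [half]. *)
pose e := ln (3 / 2) / (S * m%:R).
have l32 : 0 < ln (3 / 2 : R) by rewrite ln_gt0//; lra.
have e0 : 0 < e by rewrite divr_gt0 ?mulr_gt0.
(* The total mass is allowed to grow at half of the rate [s * e] won by contraction. *)
have [C C0 hC] := @tr1_subexp (s * e / 2) (ltac:(by apply: divr_gt0 => //; apply: mulr_gt0)).
have tagk x n : tr1 (kapw W) n x = \sum_(w <- words n) wt W w x * k ^+ count id w.
  rewrite -tr1_tagw; apply: eq_iter_transfer => // a y.
  by rewrite /kapw /tagw; case: a => //=; rewrite powR1.
(* A Chernoff bound with threshold [b]: one of the two terms suffices, according to whether [n]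
   reaches [b]. *)
have split_pow (n : nat) (b : R) : k ^+ n <= expR (- (s * b)) + expR (S * b) * c ^+ n.
  have -> : k ^+ n = expR (- (s * n%:R)).
    by rewrite -{1}(lnK kk0) -expRM_natl /s; congr expR; ring.
  have -> : c ^+ n = expR (- (S * n%:R)).
    by rewrite -{1}(lnK c0) -expRM_natl /S; congr expR; ring.
  rewrite -expRD; have [bn|nb] := leP b n%:R.
    by rewrite ler_wpDr ?expR_ge0// ler_expR lerN2 ler_wpM2l// ltW.
  rewrite ler_wpDl ?expR_ge0// (@le_trans _ _ 1)//.
    by rewrite expR_le1 oppr_le0 mulr_ge0// ltW.
  by rewrite -[leLHS]expR0 ler_expR subr_ge0 ler_wpM2l ?(ltW S0) ?(ltW nb).
have half j x : tr1 (tagw c W) (j * m) x <= 2^-1 ^+ j.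
  elim: j x => [|j ih] x; first by rewrite mul0n expr0.
  rewrite mulSn (le_trans (@tr1_comp_le R alpha _ m (j * m) (2^-1 ^+ j) x _ ih))//.
    exact: tagw_ge0 (ltW c0).
  by rewrite exprSr ler_wpM2l// exprn_ge0.
pose th1 := expR (- (s * e * m%:R / 2)).
have main j x : tr1 (kapw W) (j * m) x <= C * th1 ^+ j + (3 / 4) ^+ j.
  pose b := e * (j * m)%:R.
  rewrite tagk; apply: (@le_trans _ _ (\sum_(w <- words (j * m))
      (expR (- (s * b)) * wt W w x + expR (S * b) * (wt W w x * c ^+ count id w)))).
    apply: ler_sum => w _.
    have -> : expR (- (s * b)) * wt W w x + expR (S * b) * (wt W w x * c ^+ count id w)
      = wt W w x * (expR (- (s * b)) + expR (S * b) * c ^+ count id w) by ring.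
    by rewrite ler_wpM2l ?wt_ge0.
  rewrite big_split /= -!mulr_sumr -tr1_tagw -tr1E lerD//.
    apply: (@le_trans _ _ (expR (- (s * b)) * (C * expR ((j * m)%:R * (s * e / 2))))).
      by rewrite ler_wpM2l ?expR_ge0.
    rewrite mulrCA -expRD /th1 -expRM_natl ler_wpM2l ?(ltW C0)// ler_expR.
    by rewrite /b natrM le_eqVlt; apply/orP; left; apply/eqP; field.
  have -> : expR (S * b) = (3 / 2) ^+ j.
    rewrite -[X in _ = X ^+ j](@lnK R) ?posrE; last lra.
    rewrite -expRM_natl; congr expR; rewrite /b /e natrM; field.
    by rewrite !gt_eqF.
  apply: (@le_trans _ _ ((3 / 2) ^+ j * 2^-1 ^+ j)).
    by rewrite ler_wpM2l// exprn_ge0//; lra.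
  by rewrite (_ : 3 / 4 = 3 / 2 * 2^-1 :> R) ?exprMn//; field.
pose th := Num.max th1 (3 / 4).
have th1_1 : th1 < 1.
  rewrite expR_lt1 oppr_lt0; apply: divr_gt0 => //; apply: mulr_gt0 => //.
  exact: mulr_gt0.
have th0 : 0 < th by rewrite lt_max; apply/orP; right; lra.
have thl1 : th < 1 by rewrite gt_max th1_1; lra.
have [j hj] := @pow_unbounded R th^-1 ((C + 1) / eta) (ltac:(by rewrite invf_gt1)).
have hj' i : (j <= i)%N -> C * th1 ^+ i + (3 / 4) ^+ i <= eta.
  move=> ji; apply: (@le_trans _ _ ((C + 1) * th ^+ j)).
    have pw r : 0 <= r -> r <= th -> r ^+ i <= th ^+ j.
      move=> r0 rth; apply: (@le_trans _ _ (th ^+ i)); first by rewrite lerXn2r ?nnegrE// ltW.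
      by rewrite ler_wiXn2l// ltW.
    have -> : (C + 1) * th ^+ j = C * th ^+ j + th ^+ j by ring.
    apply: lerD.
      by rewrite ler_wpM2l ?(ltW C0)// pw// ?expR_ge0// le_max lexx.
    by rewrite pw// ?le_max ?lexx ?orbT//; lra.
  move: hj; rewrite exprVn => hj.
  have thj : 0 < th ^+ j by rewrite exprn_gt0.
  move: hj => /ltW; rewrite ler_pdivrMr// => hj.
  by rewrite -ler_pdivlMr// mulrC.
exists (j.+1 * m)%N; first by rewrite muln_gt0.
by move=> x; rewrite (le_trans (main _ _))// hj'.
Qed.

Lemma wexp_hol : exists H, forall a, hol H (W a).
Proof.
have [B hB] := phi_bdd; exists (expR B * A0) => a.
apply: (hol_expR (u := fun x => phi (g a x))); first exact: hol_inv_branch.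
by move=> x; rewrite (le_trans (ler_norm _)).
Qed.

Lemma lasota_yorke : exists n0, (0 < n0)%N /\ exists2 C, 0 <= C & forall A B psi,
  hol A psi -> (forall x, `|psi x| <= B) -> hol (A / 2 + C * B) (iter n0 (transfer W) psi).
Proof.
have [n0 n00 h] := @kapw_small 2^-1 (ltac:(by rewrite invr_gt0)).
exists n0; split => //.
have [H hH] := wexp_hol; have [K K1 hK] := wexp_bounds.
have [|C C0 hC] := @iter_transfer_hol R alpha gam W H K n0 W0 hH.
  by move=> a x; have /andP[] := hK a x.
exists C => // A B psi hA hB x y.
rewrite (le_trans (hC A B psi hA hB x y))// ler_wpM2r ?gdist_ge0// lerD2r mulrC.
by rewrite ler_wpM2l// (hol_ge0 hA).
Qed.

Lemma resolv_le t n u x : 0 <= t -> (forall y, 0 <= u y) ->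
  (forall y, t * transfer W u y = u y - 1) -> resolv alpha W t n x <= u x.
Proof.
move=> t0 u0 hu; elim: n x => [|n ih] x //=.
rewrite -[u x](subrK 1) -hu addrC lerD2r ler_wpM2l// lerD// ler_wpM2l//.
Qed.

Lemma resolv_ge0 t n x : 0 <= t -> 0 <= resolv alpha W t n x.
Proof.
by move=> t0; rewrite resolvE sumr_ge0// => j _; rewrite mulr_ge0 ?exprn_ge0 ?tr1_ge0.
Qed.

Lemma resolv_hol : exists2 K, 0 <= K & forall t U, 0 <= t <= 1 -> 1 <= U ->
  (forall n x, resolv alpha W t n x <= U) -> forall n, hol (K * U) (resolv alpha W t n).
Proof.
have [n0 [n00 [C C0 hC]]] := lasota_yorke.
have [H hH] := wexp_hol; have [K1 K11 hK1] := wexp_bounds.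
have [K0 K00 hK0] : exists2 K0, 0 <= K0 & forall t r, 0 <= t <= 1 -> (r <= n0)%N ->
    hol K0 (resolv alpha W t r).
  have hj j : exists2 Hj, 0 <= Hj & hol Hj (tr1 W j).
    have [|D D0 hD] := @iter_transfer_hol R alpha gam W H K1 j W0 hH.
      by move=> a x; have /andP[] := hK1 a x.
    exists (D * 1); first by rewrite mulr1.
    move=> x y.
    have := hD 0 1 (@one_fun R) (@hol_cst R gam 1) (fun=> ltac:(by rewrite normr1)) x y.
    by rewrite mulr0 add0r.
  elim: (n0) => [|n [K K00 ih]].
    by exists 0 => // t [|r] // _ _ x y; rewrite subrr normr0 mul0r.
  have [Hn Hn0 hn] := hj n.
  exists (K + Hn); first by rewrite addr_ge0.
  move=> t r t01; rewrite leq_eqVlt => /predU1P[->|rn]; last first.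
    by apply: hol_le (ih t r t01 rn); rewrite lerDl.
  have t0 : 0 <= t by case/andP: t01.
  have eS z : resolv alpha W t n.+1 z = resolv alpha W t n z + t ^+ n * tr1 W n z.
    by rewrite !resolvE big_ord_recr.
  move=> x y; rewrite !eS.
  apply: (holD (ih t n t01 (leqnn n)) (B := Hn) (v := fun z => t ^+ n * tr1 W n z)).
  apply: hol_le (holZ (t ^+ n) hn).
  rewrite ger0_norm ?exprn_ge0// ler_piMl// exprn_ile1//; by case/andP: t01.
(* Invariance of the bound under [Z -> K0 * U + Z / 2 + C * U], the effect of one block of [n0]
   steps on the seminorm. *)
exists (2 * (K0 + C)); first by rewrite mulr_ge0// addr_ge0.
move=> t U t01 U1 hU n; rewrite (divn_eq n n0).
have t0 : 0 <= t by case/andP: t01.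
have t1 : t <= 1 by case/andP: t01.
have rn0 : (n %% n0 <= n0)%N by rewrite ltnW// ltn_mod.
elim: (n %/ n0)%N => [|q ih].
  rewrite mul0n add0n; apply: hol_le (hK0 t _ t01 rn0).
  rewrite -mulrA mulrCA (le_trans _ (ler_wpM2l _ (_ : 2 <= 2 * U)))//.
  - by rewrite mulrDl ler_wpDr ?mulr_ge0// ler_peMr// ler1n.
  - by rewrite addr_ge0.
  - by rewrite ler_peMr.
rewrite mulSn -addnA.
have hv x : `|resolv alpha W t (q * n0 + n %% n0) x| <= U.
  by rewrite ger0_norm ?resolv_ge0.
have h := hC _ _ _ ih hv.
have h2 := holD (hK0 t n0 t01 (leqnn _)) (holZ (t ^+ n0) h).
move=> x y; rewrite !resolvD.
have h3 := h2 x y; rewrite (le_trans h3)// ler_wpM2r ?gdist_ge0//.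
have tn : `|t ^+ n0| <= 1 by rewrite ger0_norm ?exprn_ge0// exprn_ile1.
set Z := 2 * (K0 + C) * U.
have Z0 : 0 <= Z / 2 + C * U by rewrite /Z !addr_ge0 ?mulr_ge0 ?addr_ge0//; lra.
have h4 : `|t ^+ n0| * (Z / 2 + C * U) <= Z / 2 + C * U by rewrite ler_piMl.
have h5 : K0 <= K0 * U by rewrite ler_peMr.
have h6 : Z = 2 * (K0 * U) + 2 * (C * U) by rewrite /Z; ring.
lra.
Qed.

(* At the critical parameter the resolvent blows up; normalising it produces
   approximate eigenfunctions with a uniform Hölder bound. *)
Lemma approx_eigenfunction : exists2 K, 0 <= K & forall k : nat, exists v,
  [/\ forall x, 0 <= v x <= 1, hol K v, exists x, 2^-1 <= v x,
    forall x, `|transfer W v x - v x| <= K / k.+1%:R &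
    forall x, 2^-1 * transfer W v x <= v x].
Proof.
have [K K0 hK] := resolv_hol.
have [K1 K11 hK1] := wexp_bounds.
have K10 : 0 <= K1 by lra.
exists (K + 2 * K1 + 1); first by rewrite !addr_ge0 ?mulr_ge0.
move=> k.
have ex_bound t : 0 <= t < 1 -> exists2 U, 1 <= U & forall n x, resolv alpha W t n x <= U.
  move=> /andP[t0 t1]; have [t00|t00] := eqVneq t 0.
    exists 1 => // -[|n] x //=; rewrite t00 mul0r addr0//.
  have tp : 0 < t by rewrite lt_neqAle eq_sym t00.
  have l0 : 0 < - ln t / 2 by rewrite divr_gt0// oppr_gt0 ln_lt0// tp.
  have [C C0 hC] := tr1_subexp l0.
  have [||u [u1 u2]] := @resolvent_growth R alpha W t (expR (- (- ln t / 2))) C W0 t0 _ (ltW C0).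
  - by rewrite expR_ge0 expR_lt1 oppr_lt0.
  - move=> n x; apply: (@le_trans _ _ (t ^+ n * (C * expR (n%:R * (- ln t / 2))))).
      by rewrite ler_wpM2l ?exprn_ge0.
    rewrite mulrCA ler_wpM2l ?(ltW C0)// -expRM_natl -{1}(lnK tp) -expRM_natl -expRD.
    by rewrite ler_expR; lra.
  set U := C * _ in u1.
  exists U; first by have /andP[a b] := u1 (I0 R); exact: le_trans a b.
  move=> n x; apply: (@le_trans _ _ (u x)); last by have /andP[] := u1 x.
  by apply: resolv_le => // y; have /andP[/(le_trans ler01)] := u1 y.
(* Otherwise the resolvent is bounded by some [U] at [t0 < 1], and [L u = (u - 1) / t0 <= (1 - 1 /
   U) / t0 * u]. As [t0] is at least [1 - 1 / (2 U)], this is exponential decay, against pressure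
   0. *)
have big (k0 : nat) : exists2 t, 1 - k0.+2%:R^-1 <= t < 1 & exists n x, k0%:R < resolv alpha W t n x.
  apply: contrapT => hno.
  pose U : R := k0%:R + 1; have U1 : 1 <= U by rewrite lerDr.
  have U0 : 0 < U by lra.
  pose t0 : R := Num.max (1 - k0.+2%:R^-1) (1 - (2 * U)^-1).
  have tlt : t0 < 1.
    by rewrite gt_max !gtrBl !invr_gt0 ltr0n/= mulr_gt0.
  have tge : 1 - (2 * U)^-1 <= t0 by rewrite le_max lexx orbT.
  have iU : (2 * U)^-1 <= 2^-1 by rewrite lef_pV2 ?posrE ?mulr_gt0// ler_peMr.
  have iU0 : 0 < (2 * U)^-1 by rewrite invr_gt0 mulr_gt0.
  have tp : 0 < t0 by lra.
  have hU n x : resolv alpha W t0 n x <= U.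
    rewrite leNgt; apply/negP => h; apply: hno; exists t0; first by rewrite tlt le_max lexx.
    by exists n, x; apply: lt_trans h; rewrite ltrDl.
  have [u [u1 u2 _]] := resolvent W0 (ltW tp) hU.
  apply: (@not_tr1_exp (Num.max (2^-1) ((1 - U^-1) / t0)) U).
    rewrite lt_max gt_max invr_gt0 ltr0n /= invf_lt1// ltr1n /=.
    rewrite ltr_pdivrMr// mul1r (lt_le_trans _ tge)// ltrD2l ltrN2 invfM.
    by have : 0 < U^-1 := ltac:(by rewrite invr_gt0); lra.
  apply: (@subeigen_bound R alpha W _ U u W0) => //.
    by rewrite le_max invr_ge0 ler0n.
  move=> x; have /andP[a b] := u1 x.
  apply: (@le_trans _ _ ((1 - U^-1) / t0 * u x)); last first.
    by rewrite ler_wpM2r ?(le_trans ler01 a)// le_max lexx orbT.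
  have -> : transfer W u x = (u x - 1) / t0.
    by rewrite -u2 mulrAC divff ?mul1r// gt_eqF.
  rewrite [leRHS]mulrAC ler_wpM2r ?invr_ge0 ?(ltW tp)// mulrBl mul1r lerD2l lerN2.
  by rewrite mulrC ler_pdivrMr// mul1r.
have [t /andP[tk t1] [n [x0 hx0]]] := big k.+1.
have k3 : 0 < k.+3%:R^-1 :> R by rewrite invr_gt0 ltr0n.
have k32 : k.+3%:R^-1 <= 2^-1 :> R by rewrite lef_pV2 ?posrE ?ltr0n// ler_nat.
set z3 : R := k.+3%:R^-1 in tk k3 k32.
have th : 2^-1 <= t by lra.
have t0 : 0 < t by lra.
have [U0 U01 hU0] := ex_bound t (ltac:(by rewrite t1 ltW)).
have hs : has_sup [set resolv alpha W t p.1 p.2 | p in [set: nat * I]].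
  split; first by exists (resolv alpha W t n x0); exists (n, x0).
  by exists U0 => _ [[i y] _ <-]; exact: hU0.
pose U := sup [set resolv alpha W t p.1 p.2 | p in [set: nat * I]].
have hU i y : resolv alpha W t i y <= U.
  by apply: ub_le_sup; [case: hs|exists (i, y)].
have kU : k.+1%:R < U by exact: lt_le_trans hx0 (hU n x0).
have U1 : 1 <= U by rewrite (le_trans _ (ltW kU))// ler1n.
have Up : 0 < U by lra.
have [u [u1 u2 u3]] := resolvent W0 (ltW t0) hU.
have [n1 [x1 hx1]] : exists n1 x1, U / 2 < resolv alpha W t n1 x1.
  have Uh : U / 2 < U by rewrite ltr_pdivrMr// ltr_pMr// ltr1n.
  have [_ [[i y] _ <-] h] := sup_gt hs.1 Uh.
  by exists i, y.
have t01 : 0 <= t <= 1 by rewrite !ltW.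
have huK : hol (K * U) u.
  move=> x y.
  have c : `|resolv alpha W t n x - resolv alpha W t n y| @[n --> \oo] --> `|u x - u y|.
    by apply: cvg_norm; apply: cvgB; exact: u3.
  by apply: (cvgr_to_le c); apply: nearW => i; exact: (hK t U t01 U1 hU i x y).
have u0 y : 0 <= u y by have /andP[/(le_trans ler01)] := u1 y.
pose v y := U^-1 * u y.
have Tv y : transfer W v y = U^-1 * transfer W u y.
  exact: (iter_transferZ alpha W 1 U^-1 u y).
have v01 y : 0 <= v y <= 1.
  apply/andP; split; first by rewrite mulr_ge0// invr_ge0 ltW.
  rewrite /v mulrC ler_pdivrMr// mul1r.
  by have /andP[] := u1 y.
have Tv0 y : 0 <= transfer W v y <= 2 * K1.
  have e1 a : 0 <= W a y * v (g a y) <= K1.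
    have /andP[va vb] := v01 (g a y); have /andP[_ wb] := hK1 a y.
    by rewrite mulr_ge0//= -[leRHS]mulr1 ler_pM.
  have -> : transfer W v y = W false y * v (g false y) + W true y * v (g true y) by [].
  by have := e1 false; have := e1 true; lra.
have tTv y : t * transfer W v y = v y - U^-1.
  by rewrite Tv mulrCA u2 mulrBr mulr1.
have iU : U^-1 <= k.+1%:R^-1 by rewrite lef_pV2 ?posrE ?ltr0n// ltW.
have iU0 : 0 < U^-1 by rewrite invr_gt0.
have k31 : z3 <= k.+1%:R^-1 :> R by rewrite lef_pV2 ?posrE ?ltr0n// ler_nat ltnW.
set z1 : R := k.+1%:R^-1 in iU k31.
exists v; split => //.
- apply: hol_le (holZ U^-1 huK); rewrite gtr0_norm// mulrCA mulVf ?gt_eqF// mulr1.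
  by rewrite -addrA lerDl addr_ge0// mulr_ge0.
- exists x1; rewrite /v mulrC ler_pdivlMr// mulrC (le_trans (ltW hx1))//.
  by apply: resolv_le => //; exact: ltW.
- move=> y; have -> : transfer W v y - v y = (1 - t) * transfer W v y - U^-1.
    by have := tTv y; rewrite mulrBl mul1r; lra.
  have /andP[a b] := Tv0 y.
  have : (1 - t) * transfer W v y <= z1 * (2 * K1) by rewrite ler_pM//; lra.
  have : 0 <= (1 - t) * transfer W v y by rewrite mulr_ge0//; lra.
  have : 0 <= K * z1 by rewrite mulr_ge0// (le_trans (ltW iU0)).
  have -> : (K + 2 * K1 + 1) / k.+1%:R = K * z1 + z1 * (2 * K1) + z1.
    by rewrite -/z1; ring.
  by move=> *; rewrite ler_norml; apply/andP; split; lra.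
- move=> y; have /andP[a b] := Tv0 y.
  have : 2^-1 * transfer W v y <= t * transfer W v y by rewrite ler_wpM2r.
  by rewrite tTv; lra.
Qed.

Lemma eigenfunction : exists h, exists2 c, 0 < c & exists2 K, 0 <= K &
  [/\ forall x, c <= h x <= 1, hol K h & forall x, transfer W h x = h x].
Proof.
have [K K0 hv] := approx_eigenfunction.
have [K1 K11 hK1] := wexp_bounds.
have K10 : 0 < K1 by lra.
have [r r0 hr] := @powR_small (4 * (K + 1))^-1 (ltac:(rewrite invr_gt0; lra)).
have [m hm] := @xs_small R alpha r r0.
(* Within [m] steps every point has a preimage where [v] is at least 1/4, near a point with
   [v >= 1/2]; each step costs 1/2, from [2^-1 * L v <= v], and [K1^-1] from the weight. *)
pose c := (2 * K1) ^- m / 4.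
have c0 : 0 < c by rewrite divr_gt0 ?invr_gt0 ?exprn_gt0 ?mulr_gt0.
have [v hv1] := choice hv.
have vc k x : c <= v k x.
  have [v01 vK [x1 hx1] _ hT] := hv1 k.
  have v0 y : 0 <= v k y by have /andP[] := v01 y.
  have vm j y : 2^-1 ^+ j * iter j (transfer W) (v k) y <= v k y.
    elim: j y => [|j ih] y; first by rewrite expr0 mul1r.
    apply: le_trans (hT y).
    rewrite -iter_transferZ exprS.
    have -> : iter j.+1 (transfer W) (fun z => 2^-1 * 2^-1 ^+ j * v k z) y =
      2^-1 * transfer W (fun z => 2^-1 ^+ j * iter j (transfer W) (v k) z) y.
      rewrite iter_transferZ -mulrA; congr (_ * _).
      exact: esym (iter_transferZ alpha W 1 _ _ _).
    rewrite ler_wpM2l ?invr_ge0//.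
    exact: (@iter_transfer_le R alpha W 1 _ (v k) W0 ih).
  pose w := itin alpha m x1.
  have hw : `|ival (gw w x) - ival x1| <= r.
    rewrite -[in X in _ - X](gw_itin alpha m x1) (le_trans (gw_contr _ _ _ _))//.
    by rewrite size_itin ltW.
  have v4 : 1 / 4 <= v k (gw w x).
    have := vK (gw w x) x1; rewrite /gdist ler_norml => /andP[e _].
    have e2 : K * `|ival (gw w x) - ival x1| `^ gam%:num <= 1 / 4.
      apply: (@le_trans _ _ ((K + 1) * (4 * (K + 1))^-1)).
        by rewrite ler_pM ?powR_ge0 ?lerDl// hr.
      by rewrite le_eqVlt; apply/orP; left; apply/eqP; field; rewrite gt_eqF//; lra.
    by lra.
  apply: (le_trans _ (vm m x)).
  have -> : c = 2^-1 ^+ m * (K1^-1 ^+ m * (1 / 4)).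
    by rewrite /c -exprVn invfM exprMn; field.
  rewrite ler_wpM2l ?exprn_ge0//.
  apply: le_trans (@iter_transfer_ge_word R alpha W m w (v k) x W0 v0 (size_itin _ _ _)).
  apply: ler_pM; [by rewrite exprn_ge0// invr_ge0 ltW|lra| |exact: v4].
  rewrite -(size_itin alpha m x1); apply: wt_ge; first by rewrite invr_ge0 ltW.
  by move=> a y; have /andP[] := hK1 a y.
(* Pointwise limits along an ultrafilter finer than the cofinite filter: the bounds and the
   eigenvalue equation involve finitely many points at a time, so they pass to the limit. *)
have [U [UU sU]] := ultraFilterLemma (@eventually_filter).
have UP : ProperFilter U by exact: ultra_proper.
have hl x : exists l : R, v k x @[k --> U] --> l.
  apply: (@ultra_bounded_cvg R nat U (fun k => v k x) 0 1 UU) => k.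
  by have [] := hv1 k.
have [h hh] := choice hl.
exists h, c => //; exists K => //; split.
- move=> x; apply/andP; split.
    by apply: (cvgr_to_ge (hh x)); apply: filterE => k; exact: vc.
  by apply: (cvgr_to_le (hh x)); apply: filterE => k; have [/(_ x)/andP[]] := hv1 k.
- move=> x y.
  have cn : `|v k x - v k y| @[k --> U] --> `|h x - h y|.
    by apply: cvg_norm; apply: cvgB; exact: hh.
  by apply: (cvgr_to_le cn); apply: filterE => k; have [_ /(_ x y)] := hv1 k.
- move=> x.
  have c1 : transfer W (v k) x - v k x @[k --> U] --> transfer W h x - h x.
    by apply: cvgB; [apply: cvgD; apply: cvgM => //; exact: cvg_cst|exact: hh].
  have c2 : transfer W (v k) x - v k x @[k --> U] --> 0.
    have h0 : K / k.+1%:R @[k --> \oo] --> (0 : R).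
      by rewrite -[X in _ --> X](mulr0 K); apply: cvgM; [exact: cvg_cst|exact: cvg_harmonic].
    have h0U : K / k.+1%:R @[k --> U] --> (0 : R) by apply: cvg_trans h0; exact: cvg_app.
    apply/cvgr0Pnorm_le => e e0.
    have /cvgr0Pnorm_le /(_ e e0) := h0U; apply: filterS => k hk.
    by have [_ _ _ /(_ x) hx _] := hv1 k; rewrite (le_trans hx)// (le_trans (ler_norm _)).
  by apply/eqP; rewrite -subr_eq0; apply/eqP; exact: cvg_unique c1 c2.
Qed.

End eigenfunction.

(** * Spectral gap *)

Section spectral_gap.
Variables (R : realType) (alpha gam : {posnum R}).
Local Notation I := (unit_interval R).
Local Notation g := (inv_branch alpha).
Local Notation gw := (gw alpha).
Local Notation transfer := (@transfer R alpha).
Local Notation tr1 := (@tr1 R alpha).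
Local Notation wt := (@wt R alpha).
Local Notation xs := (@xs R alpha).
Local Notation hol := (@hol R gam).
Local Notation gdist := (@gdist R gam).
Local Notation kapw := (@kapw R alpha gam).
Implicit Types (psi u v phi : I -> R).

Definition markov (G : bool -> I -> R) : Prop := forall x, G false x + G true x = 1.

Section markov.
Variable G : bool -> I -> R.
Hypotheses (G0 : nonneg G) (G1 : markov G).
Local Notation N := (transfer G).

Lemma iter_markov_cst n (c : R) x : iter n N (fun=> c) x = c.
Proof. by elim: n x => // n ih x; rewrite iter_transferS !ih -mulrDl G1 mul1r. Qed.

Lemma tr1_markov n x : tr1 G n x = 1. Proof. exact: iter_markov_cst. Qed.

Lemma iter_markov_shift n (c : R) psi x :
  iter n N (fun y => psi y - c) x = iter n N psi x - c.
Proof.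
have := iter_transfer_lin alpha G n 1 (- 1) psi (fun=> c) x.
rewrite iter_markov_cst mul1r mulN1r => <-.
by apply: eq_iter_transfer => // y; ring.
Qed.

Lemma iter_markov_ub n (M : R) psi x : (forall y, psi y <= M) -> iter n N psi x <= M.
Proof. by move=> h; rewrite -[leRHS](iter_markov_cst n M x) iter_transfer_le. Qed.

Lemma iter_markov_lb n (M : R) psi x : (forall y, M <= psi y) -> M <= iter n N psi x.
Proof. by move=> h; rewrite -[leLHS](iter_markov_cst n M x) iter_transfer_le. Qed.

Definition oscle (o : R) psi : Prop := forall x y, psi x - psi y <= o.

Lemma iter_markov_osc n (o : R) psi : oscle o psi -> oscle o (iter n N psi).
Proof.
move=> h x y; rewrite lerBlDr; apply: iter_markov_ub => z.
rewrite addrC -lerBlDr; apply: iter_markov_lb => w.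
by rewrite lerBlDr addrC -lerBlDr.
Qed.

Variables (d : R).
Hypotheses (d0 : 0 < d) (dG : forall a x, d <= G a x).

Lemma markov_floor_le : d <= 1 / 2.
Proof. by have := dG false (I0 R); have := dG true (I0 R); have := G1 (I0 R); lra. Qed.

(** Doeblin's argument: the word [false^m] alone carries mass at least [d ^+ m] and brings any two
    points within [xs m], where [psi] varies by at most [o / 2]. *)
Lemma iter_markov_contract m (o A : R) psi : oscle o psi -> hol A psi ->
  A * xs m `^ gam%:num <= o / 2 -> oscle ((1 - d ^+ m / 2) * o) (iter m N psi).
Proof.
move=> ho hA hAo x y.
pose S := sup (range psi); pose s := inf (range psi).
have ub : has_ubound (range psi).
  by exists (psi (I0 R) + o) => _ [z _ <-]; rewrite addrC -lerBlDr.
have lb : has_lbound (range psi).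
  by exists (psi (I0 R) - o) => _ [z _ <-]; rewrite lerBlDr addrC -lerBlDr.
have hS z : psi z <= S by apply: ub_le_sup => //; exists z.
have hs z : s <= psi z by apply: ge_inf => //; exists z.
have Sso : S - s <= o.
  rewrite lerBlDr; apply: ge_sup => [|_ [z _ <-]]; first by exists (psi (I0 R)), (I0 R).
  rewrite addrC -lerBlDr; apply: lb_le_inf => [|_ [w _ <-]].
    by exists (psi (I0 R)), (I0 R).
  by rewrite lerBlDr addrC -lerBlDr.
pose w := nseq m false; have sw : size w = m by rewrite size_nseq.
have wd z : d ^+ m <= wt G w z.
  by rewrite -[m in _ ^+ m]sw; apply: wt_ge => //; exact: ltW.
have up z : iter m N psi z <= S - d ^+ m * (S - psi (gw w z)).
  have := @iter_transfer_ge_word R alpha G m w (fun z => S - psi z) z G0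
    (fun y => ltac:(by rewrite subr_ge0)) sw.
  have -> : iter m N (fun z => S - psi z) z = S - iter m N psi z.
    have := iter_transfer_lin alpha G m 1 (- 1) (fun=> S) psi z.
    rewrite iter_markov_cst mul1r mulNr mul1r => <-.
    by apply: eq_iter_transfer => // v; ring.
  have : d ^+ m * (S - psi (gw w z)) <= wt G w z * (S - psi (gw w z)).
    by rewrite ler_wpM2r ?subr_ge0.
  by lra.
have lo z : s + d ^+ m * (psi (gw w z) - s) <= iter m N psi z.
  have := @iter_transfer_ge_word R alpha G m w (fun z => psi z - s) z G0
    (fun y => ltac:(by rewrite subr_ge0)) sw.
  rewrite iter_markov_shift.
  have : d ^+ m * (psi (gw w z) - s) <= wt G w z * (psi (gw w z) - s).
    by rewrite ler_wpM2r ?subr_ge0.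
  by lra.
have close : psi (gw w x) - psi (gw w y) <= o / 2.
  rewrite (le_trans (ler_norm _))// (le_trans (hA _ _))// (le_trans _ hAo)//.
  rewrite ler_wpM2l ?(hol_ge0 hA)// ge0_ler_powR ?nnegrE ?xs_ge0//.
  by rewrite (le_trans (gw_contr _ _ _ _))// sw.
have dm0 : 0 <= d ^+ m by rewrite exprn_ge0// ltW.
have dm1 : d ^+ m <= 1.
  by rewrite exprn_ile1 ?(ltW d0)//; have := markov_floor_le; lra.
have e1 : d ^+ m * (psi (gw w x) - psi (gw w y)) <= d ^+ m * (o / 2) by rewrite ler_wpM2l.
have e2 : (1 - d ^+ m) * (S - s) <= (1 - d ^+ m) * o by rewrite ler_wpM2l// subr_ge0.
by have := up x; have := lo y; lra.
Qed.

Variables (n0 : nat) (C0 : R).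
Hypotheses (n00 : (0 < n0)%N) (C00 : 0 <= C0)
  (LY : forall A B psi, hol A psi -> (forall x, `|psi x| <= B) ->
    hol (A / 2 + C0 * B) (iter n0 N psi)).

(** A Markov operator fixes constants, so the sup norm can be replaced by the oscillation, which is
    what contracts. *)
Lemma LY_osc A o psi : hol A psi -> oscle o psi -> hol (A / 2 + C0 * o) (iter n0 N psi).
Proof.
move=> hA ho.
pose v y := psi y - psi (I0 R).
have hv : hol A v by move=> x y; rewrite opprB addrA addrNK.
have hb x : `|v x| <= o by rewrite ler_norml ho andbT lerNl opprB ho.
by move=> x y; have := LY hv hb x y; rewrite !iter_markov_shift opprB addrA addrNK.
Qed.

Lemma LY_iter j A o psi : hol A psi -> oscle o psi ->
  hol (A / 2 ^+ j + 2 * C0 * o) (iter (n0 * j) N psi).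
Proof.
move=> hA ho.
have o0 : 0 <= o by have := ho (I0 R) (I0 R); rewrite subrr.
elim: j => [|j ih].
  by rewrite muln0 expr0 divr1; apply: hol_le hA; rewrite lerDl !mulr_ge0.
rewrite mulnS iterD.
apply: hol_le (LY_osc ih (iter_markov_osc _ ho)).
by rewrite exprS invfM; lra.
Qed.

(** If the seminorm is at most [4 * C1 * o], Doeblin's argument lowers the oscillation; otherwise
    Lasota-Yorke lowers the seminorm by enough to pay for the term in [o]. A weighted sum of both
    quantities contracts in either case. *)
Lemma gap_step : exists k eps rho, [/\ (0 < k)%N, 0 < eps, 0 < rho < 1 &
  forall o A psi, 0 <= o -> hol A psi -> oscle o psi -> exists o' A',
    [/\ 0 <= o', hol A' (iter k N psi), oscle o' (iter k N psi) &
     o' + eps * A' <= rho * (o + eps * A)]].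
Proof.
pose C1 := 2 * C0 + 1; have C11 : 1 <= C1 by rewrite lerDr mulr_ge0.
have C10 : 0 < C1 by lra.
have [r r0 hr] := @powR_small R gam (8 * C1)^-1 (ltac:(by rewrite invr_gt0 mulr_gt0)).
have [m hm] := @xs_small R alpha r r0.
pose del := d ^+ m / 2.
have dh := markov_floor_le.
have del0 : 0 < del by rewrite divr_gt0// exprn_gt0.
have del1 : del <= 1 / 2.
  rewrite /del -[leRHS]/(1 / 2 : R) ler_wpM2r ?invr_ge0// exprn_ile1 ?(ltW d0)//; lra.
(* With this weight, the growth [C1 * o] of the seminorm counts for half of the gain [del * o]. *)
exists (n0 * m.+1)%N, (del / (2 * C1)), (1 - del / 8); split.
- by rewrite muln_gt0 n00.
- by rewrite divr_gt0// mulr_gt0.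
- by apply/andP; split; lra.
move=> o A psi o0 hA ho.
have A0 := hol_ge0 hA.
have hA1 : hol (A / 2 + C1 * o) (iter (n0 * m.+1) N psi).
  apply: hol_le (LY_iter m.+1 hA ho); rewrite lerD//.
    by rewrite ler_wpM2l// lef_pV2 ?posrE ?exprn_gt0// exprS ler_peMr// exprn_ege1// ler1n.
  by rewrite ler_wpM2r// /C1; lra.
set eps := del / (2 * C1).
have epsC : eps * C1 = del / 2 by rewrite /eps; field; rewrite gt_eqF.
have eps0 : 0 < eps by rewrite divr_gt0// mulr_gt0.
have [AB|AB] := leP A (4 * C1 * o).
  exists ((1 - del) * o), (A / 2 + C1 * o); split => //.
  - by rewrite mulr_ge0// subr_ge0; lra.
  - have mk : (m <= n0 * m.+1)%N.
      by rewrite (leq_trans (leqnSn m))// leq_pmull.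
    rewrite -(subnK mk) iterD; apply: iter_markov_osc.
    apply: iter_markov_contract => //.
    apply: (@le_trans _ _ ((4 * C1 * o) * (8 * C1)^-1)).
      by rewrite ler_pM ?powR_ge0// hr ?xs_ge0// ltW.
    by rewrite le_eqVlt; apply/orP; left; apply/eqP; field; rewrite gt_eqF.
  - have -> : eps * (A / 2 + C1 * o) = eps * A / 2 + del / 2 * o.
      by rewrite -epsC; ring.
    have h1 : 0 <= del * o by rewrite mulr_ge0// ltW.
    have h2 : 0 <= eps * A * (1 / 2 - del / 8).
      by rewrite mulr_ge0 ?(mulr_ge0 (ltW eps0))//; lra.
    by lra.
exists o, (A / 2 + C1 * o); split => //; first exact: iter_markov_osc.
have -> : eps * (A / 2 + C1 * o) = eps * A / 2 + del / 2 * o.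
  by rewrite -epsC; ring.
have h1 : del * o <= eps * A / 2.
  have : eps * (4 * C1 * o) <= eps * A by rewrite ler_wpM2l ?ltW.
  have -> : eps * (4 * C1 * o) = 4 * (eps * C1) * o by ring.
  rewrite epsC.
  by lra.
have h3 : 0 <= eps * A by rewrite mulr_ge0// ltW.
have h2 : 0 <= eps * A * (1 / 2 - del).
  by rewrite mulr_ge0//; lra.
by lra.
Qed.

Variables (H : R).
Hypothesis hH : forall a, hol H (G a).

Lemma G_le1 a x : G a x <= 1.
Proof. by have := G1 x; have := G0 false x; have := G0 true x; case: a; lra. Qed.

Lemma spectral_gap : exists C rho, [/\ 0 < C, 0 < rho < 1 &
  forall A psi n, hol A psi -> hol (C * A * rho ^+ n) (iter n N psi)].
Proof.
have [k [eps [rho [k0 eps0 /andP[rho0 rho1] hk]]]] := gap_step.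
have kapG n x : tr1 (kapw G) n x <= 1.
  rewrite -(tr1_markov n x); apply: iter_transfer_le2 => //; first exact: kapw_ge0.
  move=> a y; rewrite /kapw ler_piMr//.
  have -> : 1 = 1 `^ gam%:num :> R by rewrite powR1.
  by rewrite ge0_ler_powR ?nnegrE ?(ltW (kap_gt0 _ _))// kap_le1.
have [D D0 hD] : exists2 D, 0 <= D & forall r A o psi, (r <= k)%N -> 0 <= o ->
    hol A psi -> oscle o psi -> hol (A + D * o) (iter r N psi).
  elim: (k) => [|j [D D0 ih]].
    exists 0 => // -[|//] A o psi _ _ hA _; by rewrite mul0r addr0.
  have [E E0 hE] := @iter_transfer_hol R alpha gam G H 1 j.+1 G0 hH G_le1.
  exists (D + E); first by rewrite addr_ge0.
  move=> r A o psi; rewrite leq_eqVlt => /predU1P[->|rj] o0 hA ho; last first.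
    by apply: hol_le (ih r A o psi rj o0 hA ho); rewrite lerD2l ler_wpM2r// lerDl.
  pose v y := psi y - psi (I0 R).
  have hv : hol A v by move=> x y; rewrite opprB addrA addrNK.
  have hb x : `|v x| <= o by rewrite ler_norml ho andbT lerNl opprB ho.
  move=> x y; have := hE A o v hv hb x y; rewrite !iter_markov_shift opprB addrA addrNK.
  move/le_trans; apply; rewrite ler_wpM2r ?gdist_ge0// lerD//.
    by rewrite ler_piMl ?(hol_ge0 hA).
  by rewrite ler_wpM2r// lerDr.
have hj j A o psi : 0 <= o -> hol A psi -> oscle o psi -> exists o' A',
    [/\ 0 <= o', hol A' (iter (j * k) N psi), oscle o' (iter (j * k) N psi) &
     o' + eps * A' <= rho ^+ j * (o + eps * A)].
  move=> o0 hA ho; elim: j => [|j [p [A' [p0 hA' ho' h]]]].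
    by exists o, A; split => //; rewrite expr0 mul1r.
  have [p2 [A2 [a b c e]]] := hk p A' _ p0 hA' ho'.
  exists p2, A2; rewrite mulSn iterD; split => //.
  by rewrite (le_trans e)// exprS -mulrA ler_wpM2l// ltW.
pose r := expR (ln rho / k%:R).
have k0' : 0 < k%:R :> R by rewrite ltr0n.
have rk : r ^+ k = rho.
  by rewrite -expRM_natl mulrCA divff ?gt_eqF// mulr1 lnK.
have r0 : 0 < r by exact: expR_gt0.
have r1 : r < 1.
  rewrite expR_lt1 -oppr_gt0 -mulNr divr_gt0// oppr_gt0 ln_lt0//.
  by rewrite rho0.
pose C2 := (eps^-1 + D) * (1 + eps).
have C20 : 0 < C2.
  have ei : 0 < eps^-1 by rewrite invr_gt0.
  by apply: mulr_gt0; lra.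
exists (C2 / rho), r; split; first by rewrite divr_gt0.
  by rewrite r0.
move=> A psi n hA.
have A0 := hol_ge0 hA.
have ho : oscle A psi.
  move=> x y; rewrite (le_trans (ler_norm _))// (le_trans (hA x y))//.
  by rewrite ler_piMr// gdist_le1.
have [p [A' [p0 hA' ho' h]]] := hj (n %/ k)%N A A psi A0 hA ho.
have rkn : (n %% k <= k)%N by rewrite ltnW// ltn_mod.
have h4 := hD (n %% k)%N A' p _ rkn p0 hA' ho'.
rewrite -iterD addnC -divn_eq in h4; apply: hol_le h4.
have A0' := hol_ge0 hA'.
set Q := rho ^+ (n %/ k) * (A + eps * A) in h.
have pQ : p <= Q by rewrite (le_trans _ h)// lerDl mulr_ge0// ltW.
have A'Q : A' <= eps^-1 * Q.
  by rewrite ler_pdivlMl// (le_trans _ h)// lerDr.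
have Q0 : 0 <= Q by rewrite (le_trans p0).
apply: (@le_trans _ _ ((eps^-1 + D) * Q)).
  by rewrite mulrDl lerD// ler_wpM2l.
have -> : (eps^-1 + D) * Q = C2 * A * rho ^+ (n %/ k) by rewrite /Q /C2; ring.
have -> : C2 / rho * A * r ^+ n = C2 * A * (r ^+ n / rho) by ring.
apply: ler_wpM2l; first by rewrite mulr_ge0// ltW.
rewrite ler_pdivlMr// -exprSr -rk -exprM.
rewrite ler_wiXn2l ?(ltW r0) ?(ltW r1)//.
by rewrite {1}(divn_eq n k) mulnS mulnC addnC leq_add2r.
Qed.

End markov.

Section normalize.
Variables (A0 : R) (phi h : I -> R) (c K : R).
Hypotheses (phi_hol : hol A0 phi) (phi_P : Ptop alpha phi = 0) (phi_neg : phi (I0 R) < 0).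
Hypotheses (c0 : 0 < c) (K0 : 0 <= K) (hc : forall x, c <= h x <= 1) (hK : hol K h)
  (hh : forall x, transfer (wexp alpha phi) h x = h x).
Local Notation W := (wexp alpha phi).

(** The conjugate of the transfer operator by the eigenfunction, which makes the two weights add up
    to 1. *)
Definition gfun (a : bool) (x : I) : R := W a x * h (g a x) / h x.

Let h0 x : 0 < h x. Proof. by have /andP[/(lt_le_trans c0)] := hc x. Qed.

Lemma gfun_gt0 a x : 0 < gfun a x.
Proof. by rewrite divr_gt0// mulr_gt0// wexp_gt0. Qed.

Lemma gfun_ge0 : nonneg gfun. Proof. by move=> a x; exact: ltW (gfun_gt0 a x). Qed.

Lemma gfun_markov : markov gfun.
Proof.
move=> x; rewrite /gfun -mulrDl.
have -> : W false x * h (g false x) + W true x * h (g true x) = h x by rewrite -[RHS]hh.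
by rewrite divff// gt_eqF.
Qed.

Lemma wt_gfun w x : wt gfun w x = wt W w x * h (gw w x) / h x.
Proof.
elim: w => [|a w ih] /=; first by rewrite mul1r divff// gt_eqF.
by rewrite ih /gfun; field; rewrite !gt_eqF.
Qed.

Lemma wt_gfun_le w x : wt gfun w x <= c^-1 * wt W w x.
Proof.
have w0 : 0 <= wt W w x by apply: wt_ge0; exact: wexp_ge0.
rewrite wt_gfun mulrC; apply: ler_pM.
- by rewrite invr_ge0 ltW.
- by rewrite mulr_ge0// ltW.
- by rewrite lef_pV2 ?posrE//; have /andP[] := hc x.
- by rewrite ler_piMr//; have /andP[] := hc (gw w x).
Qed.

Lemma gfun_floor : exists2 d, 0 < d & forall a x, d <= gfun a x.
Proof.
have [B B1 hB] := wexp_bounds alpha phi_hol.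
exists (B^-1 * c); first by rewrite mulr_gt0// invr_gt0; lra.
move=> a x; rewrite /gfun -mulrA ler_pM ?invr_ge0 ?(ltW c0)//; first lra.
- by have /andP[] := hB a x.
- rewrite -[leLHS]mulr1 ler_pM ?(ltW c0)//; first by have /andP[] := hc (g a x).
  by rewrite -[leLHS]invr1 lef_pV2 ?posrE//; have /andP[] := hc x.
Qed.

Lemma gfun_hol : exists H, forall a, hol H (gfun a).
Proof.
have [H hH] := wexp_hol alpha phi_hol; have [B B1 hB] := wexp_bounds alpha phi_hol.
have hn x : `|h x| <= 1 by rewrite gtr0_norm//; have /andP[] := hc x.
have hW a x : `|W a x| <= B.
  by rewrite gtr0_norm ?wexp_gt0//; have /andP[] := hB a x.
have hV := holV c0 hK (fun x => (andP (hc x)).1).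
have hVn x : `|(h x)^-1| <= c^-1.
  by rewrite gtr0_norm ?invr_gt0// lef_pV2 ?posrE//; have /andP[] := hc x.
exists (((H * 1 + B * K) * c^-1) + (B * 1) * (K / c ^+ 2)) => a; rewrite /gfun.
have h1 : hol (H * 1 + B * K) (fun x => W a x * h (g a x)).
  by apply: (holM (u := W a) (v := fun x => h (g a x))) => //; exact: hol_inv_branch.
apply: (holM (u := fun x => W a x * h (g a x)) (v := fun x => (h x)^-1)) => // x.
by rewrite normrM ler_pM.
Qed.

Lemma gfun_LY : exists n0, (0 < n0)%N /\ exists2 C, 0 <= C & forall A B psi,
  hol A psi -> (forall x, `|psi x| <= B) -> hol (A / 2 + C * B) (iter n0 (transfer gfun) psi).
Proof.
(* Conjugation by [h] multiplies the weights of words by at most [c^-1], hence [c / 2] in place of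
   1/2. *)
have [n0 n00 hs] := kapw_small phi_hol phi_P phi_neg (ltac:(by rewrite divr_gt0) : 0 < c / 2).
exists n0; split => //.
have [H hH] := gfun_hol.
have [C C0 hC] := @iter_transfer_hol R alpha gam gfun H 1 n0 gfun_ge0 hH
  (G_le1 gfun_ge0 gfun_markov).
exists C => // A B psi hA hB x y.
rewrite (le_trans (hC A B psi hA hB x y))// ler_wpM2r ?gdist_ge0// lerD2r mulrC.
rewrite ler_wpM2l ?(hol_ge0 hA)//.
apply: (@le_trans _ _ (c^-1 * tr1 (kapw W) n0 x)); last first.
  by rewrite ler_pdivrMl// (le_trans (hs x)).
rewrite !tr1E mulr_sumr; apply: ler_sum => w _.
rewrite (wt_mul alpha gfun (fun a => kap alpha a `^ gam%:num)).
rewrite (wt_mul alpha W (fun a => kap alpha a `^ gam%:num)) mulrA.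
rewrite ler_wpM2r ?wt_gfun_le// prodr_ge0// => a _; exact: powR_ge0.
Qed.

Lemma gfun_gap : exists C rho, [/\ 0 < C, 0 < rho < 1 &
  forall A psi n, hol A psi -> hol (C * A * rho ^+ n) (iter n (transfer gfun) psi)].
Proof.
have [d d0 hd] := gfun_floor; have [n0 [n00 [C C0 LY]]] := gfun_LY.
have [H hH] := gfun_hol.
exact: (spectral_gap gfun_ge0 gfun_markov d0 hd n00 C0 LY hH).
Qed.

End normalize.
End spectral_gap.

(** * Bounded measurable functions *)

Section expectation.
Context d (T : measurableType d) (R : realType) (P : probability T R).
Implicit Types psi : T -> R.

Definition bmeas psi : Prop :=
  measurable_fun setT psi /\ exists B, forall x, `|psi x| <= B.

Definition Ex psi : R := \int[P]_x psi x.

Lemma bmeas_integrable psi : bmeas psi -> P.-integrable setT (EFin \o psi).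
Proof.
move=> [mp [B hB]]; apply: measurable_bounded_integrable => //.
  exact: (le_lt_trans (probability_le1 P measurableT) (ltry 1)).
exists B; split; first exact: num_real.
by move=> M BM x _ /=; rewrite (le_trans (hB x))// ltW.
Qed.

Lemma ExE psi : bmeas psi -> (\int[P]_x (psi x)%:E)%E = (Ex psi)%:E.
Proof.
move=> /bmeas_integrable ip; rewrite /Ex /Rintegral fineK//.
exact: integrable_fin_num.
Qed.

Lemma bmeas_cst c : bmeas (fun=> c).
Proof. by split; [exact: measurable_cst|exists `|c|]. Qed.

Lemma bmeasD u v : bmeas u -> bmeas v -> bmeas (fun x => u x + v x).
Proof.
move=> [mu [A hA]] [mv [B hB]]; split; first exact: measurable_funD.
by exists (A + B) => x; rewrite (le_trans (ler_normD _ _))// lerD.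
Qed.

Lemma bmeasM u v : bmeas u -> bmeas v -> bmeas (fun x => u x * v x).
Proof.
move=> [mu [A hA]] [mv [B hB]]; split; first exact: measurable_funM.
by exists (A * B) => x; rewrite normrM ler_pM.
Qed.

Lemma bmeasZ c u : bmeas u -> bmeas (fun x => c * u x).
Proof. exact: bmeasM (bmeas_cst c). Qed.

Lemma bmeasB u v : bmeas u -> bmeas v -> bmeas (fun x => u x - v x).
Proof.
move=> hu hv; have := bmeasD hu (bmeasZ (- 1) hv).
by under eq_fun do rewrite mulN1r.
Qed.

Lemma bmeas_indic A : measurable A -> bmeas (\1_A : T -> R).
Proof.
move=> mA; split; first exact: measurable_indic.
by exists 1 => x; rewrite indicE; case: (_ \in _) => /=; rewrite ?normr1 ?normr0.
Qed.

Lemma bmeas_sum (I : Type) (s : seq I) (F : I -> T -> R) :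
  (forall i, bmeas (F i)) -> bmeas (fun x => \sum_(i <- s) F i x).
Proof.
move=> hF; elim: s => [|i s ih].
  by under eq_fun do rewrite big_nil; exact: bmeas_cst.
by under eq_fun do rewrite big_cons; exact: bmeasD.
Qed.

Lemma ExD u v : bmeas u -> bmeas v -> Ex (fun x => u x + v x) = Ex u + Ex v.
Proof. by move=> hu hv; apply: RintegralD => //; exact: bmeas_integrable. Qed.

Lemma ExZ c u : bmeas u -> Ex (fun x => c * u x) = c * Ex u.
Proof. by move=> hu; apply: RintegralZl => //; exact: bmeas_integrable. Qed.

Lemma ExB u v : bmeas u -> bmeas v -> Ex (fun x => u x - v x) = Ex u - Ex v.
Proof. by move=> hu hv; apply: RintegralB => //; exact: bmeas_integrable. Qed.

Lemma Ex_cst c : Ex (fun=> c) = c.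
Proof.
by rewrite /Ex Rintegral_cst// [X in _ * fine X](probability_setT P) mulr1.
Qed.

Lemma Ex_indic A : measurable A -> Ex (\1_A) = fine (P A).
Proof. by move=> mA; rewrite /Ex /Rintegral integral_indic// setIT. Qed.

Lemma Ex_le u v : bmeas u -> bmeas v -> (forall x, u x <= v x) -> Ex u <= Ex v.
Proof. by move=> hu hv uv; apply: le_Rintegral => //; exact: bmeas_integrable. Qed.

Lemma Ex_sum (I : Type) (s : seq I) (F : I -> T -> R) : (forall i, bmeas (F i)) ->
  Ex (fun x => \sum_(i <- s) F i x) = \sum_(i <- s) Ex (F i).
Proof.
move=> hF; elim: s => [|i s ih].
  by under eq_fun do rewrite big_nil; rewrite Ex_cst big_nil.
under eq_fun do rewrite big_cons.
by rewrite ExD// ?ih ?big_cons//; exact: bmeas_sum.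
Qed.

Lemma Ex_close u v e : bmeas u -> bmeas v -> (forall x, `|u x - v x| <= e) ->
  `|Ex u - Ex v| <= e.
Proof.
move=> hu hv h; rewrite -ExB// ler_norml -[X in X <= _]Ex_cst -[X in _ && (_ <= X)]Ex_cst.
apply/andP; split; apply: Ex_le; do ?[exact: bmeas_cst|exact: bmeasB];
  by move=> x; have := h x; rewrite ler_norml => /andP[].
Qed.

Lemma sum_lt_min (K m : nat) : \sum_(j < K) (j < m)%:R = (minn K m)%:R :> R.
Proof.
elim: K => [|K ih]; first by rewrite big_ord0 min0n.
rewrite big_ord_recr ih; change ((minn K m)%:R + (K < m)%N%:R = (minn K.+1 m)%:R :> R).
rewrite -natrD; congr (_%:R); case: ltnP => /=; lia.
Qed.

Lemma layer_approx (K : nat) (t : R) : (0 < K)%N -> 0 <= t <= 1 ->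
  `|t - K%:R^-1 * \sum_(j < K) (nat_of_bool (j.+1%:R / K%:R <= t)%R)%:R| <= K%:R^-1.
Proof.
move=> K0 /andP[t0 t1]; have Kp : 0 < K%:R :> R by rewrite ltr0n.
have tK : 0 <= t * K%:R by rewrite mulr_ge0.
have h1 : (Num.truncn (t * K%:R))%:R <= t * K%:R by rewrite truncn_le.
under eq_bigr do rewrite ler_pdivrMr// -truncn_ge_nat//.
rewrite sum_lt_min (minn_idPr _); last first.
  by rewrite -(ler_nat R) (le_trans h1)// ler_piMl.
have h2 := truncnS_gt (t * K%:R).
set m := Num.truncn _ in h1 h2 *.
have -> : t - K%:R^-1 * m%:R = (t * K%:R - m%:R) / K%:R.
  by rewrite mulrBl mulfK ?gt_eqF// mulrC.
rewrite normrM normfV (gtr0_norm Kp) ler_piMl ?invr_ge0 ?(ltW Kp)//.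
by move: h2; rewrite -natr1 ler_norml => h2; apply/andP; split; lra.
Qed.

Lemma bmeas_level psi (t : R) : measurable_fun setT psi -> measurable [set x | t <= psi x].
Proof.
move=> mp; rewrite -[X in measurable X]setTI.
have := mp measurableT [set` `[t, +oo[] (measurable_itv _).
by congr (measurable (_ `&` _)); apply/seteqP; split=> x /=; rewrite in_itv/= andbT.
Qed.

(** Superlevel sets approximate a bounded measurable function uniformly by combinations of
    indicators. Stated for functionals because one of those compared is [u |-> Ex nu (N u)], which
    is not given as an integral. *)
Lemma functional_ext (F1 F2 : (T -> R) -> R) :
  (forall F, F = F1 \/ F = F2 -> [/\ forall u v, bmeas u -> bmeas v -> F (fun x => u x + v x) = F u + F v,
    forall c u, bmeas u -> F (fun x => c * u x) = c * F u &
    forall u v e, bmeas u -> bmeas v -> (forall x, `|u x - v x| <= e) -> `|F u - F v| <= e]) ->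
  (forall A, measurable A -> F1 (\1_A) = F2 (\1_A)) ->
  forall psi, bmeas psi -> F1 psi = F2 psi.
Proof.
move=> hF hA psi hpsi; have [mp [B hB]] := hpsi.
pose C := `|B| + 1; have C0 : 0 < C by rewrite ltr_wpDl.
have hC x : - C <= psi x <= C.
  rewrite -ler_norml (le_trans (hB x))// (le_trans (ler_norm _))//.
  by rewrite /C lerDl.
have [a1 z1 c1] := hF F1 (or_introl erefl).
have [a2 z2 c2] := hF F2 (or_intror erefl).
have hs F (s : seq nat) (u : nat -> T -> R) : F = F1 \/ F = F2 -> (forall j, bmeas (u j)) ->
    F (fun x => \sum_(j <- s) u j x) = \sum_(j <- s) F (u j).
  move=> /hF[a z _] hu; elim: s => [|j s ih].
    rewrite big_nil -[RHS](mul0r (F (fun=> 0))) -z; last exact: bmeas_cst.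
    by congr (F _); apply/funext => x; rewrite big_nil mul0r.
  rewrite big_cons -ih -a//; last exact: bmeas_sum.
  by congr (F _); apply/funext => x; rewrite big_cons.
have eqc : F1 (fun=> 1) = F2 (fun=> 1).
  by have := hA setT measurableT; rewrite indicT.
pose u x := (psi x + C) / (2 * C).
have u01 x : 0 <= u x <= 1.
  have := hC x; rewrite /u divr_ge0 ?ler_pdivrMr ?mulr_gt0//=; last 2 first.
  - by have := hC x; lra.
  - by rewrite mulr_ge0// ltW.
  by lra.
have bu : bmeas u.
  by apply: bmeasM; [exact: bmeasD hpsi (bmeas_cst _)|exact: bmeas_cst].
suff e : F1 u = F2 u.
  have -> : psi = (fun x => (2 * C) * u x + (- C) * 1).
    by apply/funext => x; rewrite /u; field; rewrite gt_eqF.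
  rewrite a1 ?a2 ?z1 ?z2 ?e ?eqc//; do ?exact: bmeas_cst; do ?exact: bmeasZ; exact: bu.
apply/eqP; rewrite -subr_eq0 -normr_le0; apply/ler_addgt0Pr => e e0; rewrite add0r.
pose K := (Num.truncn (2 / e)).+1.
have K0 : 0 < K%:R :> R by rewrite ltr0n.
have Ke : 2 * K%:R^-1 <= e.
  by rewrite ler_pdivrMr// mulrC -ler_pdivrMr// ltW// truncnS_gt.
pose A j := [set x | j.+1%:R / K%:R <= u x].
have mA j : measurable (A j) by apply: bmeas_level; exact: bu.1.
pose uK x := K%:R^-1 * \sum_(j <- index_iota 0 K) (\1_(A j) x : R).
have bI j : bmeas (\1_(A j) : T -> R) by exact: bmeas_indic.
have bK : bmeas uK by apply: bmeasZ; exact: bmeas_sum.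
have cl x : `|u x - uK x| <= K%:R^-1.
  have := @layer_approx K (u x) isT (u01 x); rewrite /uK big_mkord.
  congr (`|_ - _ * _| <= _); apply: eq_bigr => j _.
  by rewrite indicE; congr (nat_of_bool _)%:R; apply/idP/idP; rewrite inE.
have eK : F1 uK = F2 uK.
  rewrite z1 ?z2; do ?exact: bmeas_sum; rewrite !hs//; [|by right|by left].
  by congr (_ * _); apply: eq_bigr => j _; exact: hA.
have := c1 _ _ _ bu bK cl; have := c2 _ _ _ bu bK cl; rewrite eK.
rewrite !ler_norml => /andP[x1 x2] /andP[x3 x4]; apply/andP; split; lra.
Qed.

End expectation.

Section bounded_convergence.
Context d (T : measurableType d) (R : realType) (P : probability T R).

Lemma Ex_cvg (u : nat -> T -> R) (v : T -> R) (B : R) :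
  (forall n, measurable_fun setT (u n)) -> (forall n x, `|u n x| <= B) ->
  (forall x, u n x @[n --> \oo] --> v x) -> bmeas v ->
  Ex P (u n) @[n --> \oo] --> Ex P v.
Proof.
move=> mu uB uv bv.
have bu n : bmeas (u n) by split=> //; exists B.
have c : (\int[P]_x (u n x)%:E)%E @[n --> \oo] --> (\int[P]_x (v x)%:E)%E.
  have h1 n : measurable_fun setT (fun x => (u n x)%:E) by exact/measurable_EFinP.
  have h2 : measurable_fun setT (fun x => (v x)%:E) by apply/measurable_EFinP; case: bv.
  have h3 : {ae P, forall x, setT x -> (u n x)%:E @[n --> \oo] --> (v x)%:E}.
    by apply: aeW => x _; apply: cvg_EFin; [exact: nearW|exact: uv].
  have h4 : P.-integrable setT (cst B%:E).
    exact: (bmeas_integrable P (@bmeas_cst _ T R B)).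
  have h5 : {ae P, forall x n, setT x -> (`|(u n x)%:E| <= B%:E)%E}.
    by apply: aeW => x n _; rewrite /= lee_fin.
  by have [_ _] := dominated_convergence measurableT h1 h2 h3 h4 h5.
rewrite (ExE P bv) in c.
exact: fine_cvg c.
Qed.

End bounded_convergence.

(** * Measurability of Hölder functions and of the map *)

Section measurability.
Variables (R : realType) (alpha : {posnum R}).
Local Notation I := (unit_interval R).
Local Notation g := (inv_branch alpha).
Local Notation f := (intermittent_map alpha).

Lemma measurable_ival : measurable_fun [set: I] (@ival R).
Proof.
apply: (measurability _ (RGenOpens.measurableE R)) => _ [_ [a [b ->]] <-].
rewrite setTI; apply: sub_sigma_algebra.
by exists `]a, b[%classic => //; exact: itv_open.
Qed.

Lemma measurable_toI d (T : measurableType d) (F : T -> I) :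
  measurable_fun setT (fun t => ival (F t)) -> measurable_fun setT F.
Proof.
move=> mF; apply: (@measurability _ _ _ _ _ _ (@open I)) => // _ [_ [V oV <-] <-].
have := mF measurableT V (open_measurable oV).
by rewrite !setTI.
Qed.

Lemma clamp_itv (z : R) : 0 <= Num.max 0 (Num.min 1 z) <= 1.
Proof. by rewrite le_max lexx /= ge_max ler01 ge_min lexx. Qed.

(** The retraction of the line onto the interval: functions on [I] become functions on [R], where
    continuity gives measurability. *)
Definition clampI (z : R) : I := Imk (clamp_itv z).

Lemma clampIK x : clampI (ival x) = x.
Proof.
apply: ival_inj => /=; rewrite min_r ?ival_le1// max_r ?ival_ge0//.
Qed.

Lemma clampI_contr z w : `|ival (clampI z) - ival (clampI w)| <= `|z - w|.
Proof.
wlog wz : z w / w <= z => [hw|].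
  by case/orP: (le_total w z) => /hw //; rewrite distrC [X in _ <= X]distrC.
rewrite [leRHS]ger0_norm ?subr_ge0//= ler_norml.
have minD : 0 <= Order.min 1 z - Order.min 1 w <= z - w.
  by apply/andP; rewrite /Order.min; do 2!case: ltP => ?; split; lra.
move: minD; set a := Order.min 1 z; set b := Order.min 1 w => /andP[ab0 abzw].
by apply/andP; rewrite /Order.max; do 2!case: ltP => ?; split; lra.
Qed.

Lemma hol_measurable gam A (psi : I -> R) : hol gam A psi -> measurable_fun setT psi.
Proof.
move=> hA; pose u z := psi (clampI z).
have cu : continuous u.
  move=> z; apply/cvgrPdist_le => e e0.
  have A0 := hol_ge0 hA.
  have [r r0 hr] := @powR_small R gam (e / (A + 1)) (ltac:(by rewrite divr_gt0// ltr_wpDl)).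
  apply: filterS (nbhsx_ballx z r r0) => w zw; rewrite (le_trans (hA _ _))//.
  apply: (@le_trans _ _ ((A + 1) * (e / (A + 1)))).
    apply: ler_pM; [exact: A0|exact: powR_ge0|by rewrite lerDl|].
    apply: hr => //; rewrite (le_trans (clampI_contr _ _))//.
    exact: ltW.
  by rewrite mulrCA divff ?mulr1// gt_eqF// ltr_wpDl.
have -> : psi = u \o @ival R by apply/funext => x; rewrite /u /= clampIK.
exact: (measurableT_comp (continuous_measurable_fun cu) measurable_ival).
Qed.

Lemma hol_bmeas gam A (psi : I -> R) : hol gam A psi -> bmeas psi.
Proof.
move=> hA; split; first exact: hol_measurable hA.
by exists (A + `|psi (I0 R)|); exact: hol_bound hA.
Qed.

Lemma lip_hol gam k (psi : I -> R) : gam%:num <= 1 ->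
  (forall x y, `|psi x - psi y| <= k * `|ival x - ival y|) -> 0 <= k -> hol gam k psi.
Proof.
move=> g1 h k0 x y; rewrite (le_trans (h x y))// ler_wpM2l// /gdist.
have [->|xy] := eqVneq (ival x) (ival y); first by rewrite subrr normr0 powR_ge0.
by rewrite ger1_powR// dist_le1 andbT normr_gt0 subr_eq0.
Qed.

Lemma measurable_inv_branch a : measurable_fun setT (g a).
Proof.
apply: measurable_toI; apply: (@hol_measurable 1%:pos 1).
by apply: lip_hol => // x y; rewrite mul1r inv_branch_contr.
Qed.

Lemma measurable_lft : measurable_fun setT (fun y : I => lft alpha (ival y)).
Proof.
apply: (@hol_measurable 1%:pos (dfr alpha 1)); apply: lip_hol => //; last first.
  exact: ltW (dfr_gt0 _ _).
move=> x y; wlog yx : x y / ival y <= ival x => [hw|].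
  by case/orP: (le_total (ival y) (ival x)) => /hw //; rewrite distrC [X in _ * X]distrC.
rewrite !ger0_norm ?subr_ge0 ?lft_le ?ival_ge0//.
rewrite (le_trans (lft_diff_le _ _ yx)) ?ival_ge0// ler_wpM2r ?subr_ge0//.
by rewrite dfr_le ?ival_ge0 ?ival_le1.
Qed.

Lemma measurable_itin1 : measurable [set y : I | itin1 alpha y].
Proof.
rewrite -[X in measurable X]setTI.
have := measurable_lft measurableT (measurable_itv `]1, +oo[).
by congr (measurable (_ `&` _)); apply/seteqP; split=> x; rewrite /= in_itv/= andbT.
Qed.

Lemma measurable_map : measurable_fun setT f.
Proof.
apply: measurable_toI.
have -> : (fun t : I => ival (f t)) =
    (fun y => lft alpha (ival y) - \1_[set z | itin1 alpha z] y).
  apply/funext => y; rewrite /= /branch -/(lft _ _) indicE.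
  have -> : (y \in [set z | itin1 alpha z]) = itin1 alpha y.
    by apply/idP/idP; rewrite inE.
  by rewrite /itin1; case: leP => _ /=; rewrite ?subr0.
apply: measurable_funB; first exact: measurable_lft.
exact: measurable_indic measurable_itin1.
Qed.

Lemma measurable_iter_map n : measurable_fun setT (iter n f).
Proof.
elim: n => [|n ih]; first exact: measurable_id.
exact: (measurableT_comp measurable_map ih).
Qed.

Lemma bmeas_comp d (T : measurableType d) (psi : I -> R) (F : T -> I) : bmeas psi ->
  measurable_fun setT F -> bmeas (fun t => psi (F t)).
Proof.
move=> [mp [B hB]] mF; split; last by exists B.
exact: (measurableT_comp mp mF).
Qed.

Lemma bmeas_transfer G (psi : I -> R) : (forall a, bmeas (G a)) -> bmeas psi ->
  bmeas (transfer alpha G psi).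
Proof.
move=> bG bp; apply: bmeasD; apply: bmeasM => //;
  apply: bmeas_comp => //; exact: measurable_inv_branch.
Qed.

Lemma bmeas_iter_transfer G n (psi : I -> R) : (forall a, bmeas (G a)) -> bmeas psi ->
  bmeas (iter n (transfer alpha G) psi).
Proof. by move=> bG bp; elim: n => // n ih; exact: bmeas_transfer. Qed.

End measurability.

(** * Stationary measure *)

Section stationary_measure.
Variables (R : realType) (alpha gam : {posnum R}).
Hypothesis gam1 : gam%:num <= 1.
Local Notation I := (unit_interval R).
Local Notation g := (inv_branch alpha).
Local Notation transfer := (@transfer R alpha).
Local Notation hol := (@hol R gam).
Variables (G : bool -> I -> R) (H C rho : R).
Hypotheses (G0 : nonneg G) (G1 : markov G) (hH : forall a, hol H (G a)).
Hypotheses (C0 : 0 < C) (rho01 : 0 < rho < 1).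
Hypothesis gap : forall A psi n, hol A psi -> hol (C * A * rho ^+ n) (iter n (transfer G) psi).
Local Notation N := (transfer G).
Implicit Types psi : I -> R.

(** The spectral gap makes iterates of Hölder functions tend to constants; this functional is the
    integral against the invariant measure to be built. *)
Definition mean psi : R := limn (fun n => iter n N psi (I0 R)).

Lemma gap_osc A psi n x y : hol A psi ->
  iter n N psi x - iter n N psi y <= C * A * rho ^+ n.
Proof.
move=> hA; have h := gap n hA.
rewrite (le_trans (ler_norm _))// (le_trans (h x y))//.
by rewrite ler_piMr ?gdist_le1// (hol_ge0 h).
Qed.

Lemma gap_cvg0 A : C * A * rho ^+ n @[n --> \oo] --> (0 : R).
Proof.
rewrite -[X in _ --> X](mulr0 (C * A)); apply: cvgM; first exact: cvg_cst.
case/andP: rho01 => r0 r1.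
by apply: cvg_expr; rewrite gtr0_norm.
Qed.

Lemma gap_later A psi m n x y : hol A psi -> (n <= m)%N ->
  iter m N psi x - iter n N psi y <= C * A * rho ^+ n /\
  iter n N psi y - iter m N psi x <= C * A * rho ^+ n.
Proof.
move=> hA nm; rewrite -(subnK nm) iterD; split.
  rewrite lerBlDr; apply: iter_markov_ub => // z.
  by rewrite -lerBlDr; exact: gap_osc.
rewrite lerBlDr -lerBlDl; apply: iter_markov_lb => // z.
by rewrite lerBlDl -lerBlDr; exact: gap_osc.
Qed.

Lemma mean_close A psi n x : hol A psi -> `|iter n N psi x - mean psi| <= 2 * (C * A * rho ^+ n).
Proof.
move=> hA.
(* The iterates at 0 with their error terms are nested: every lower bound is below every upper
   bound, and the limit is the supremum of the lower ones. *)
pose l := sup [set iter k N psi (I0 R) - C * A * rho ^+ k | k in [set: nat]].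
have key k m : iter k N psi (I0 R) - C * A * rho ^+ k <= iter m N psi (I0 R) + C * A * rho ^+ m.
  have p j : 0 <= C * A * rho ^+ j := hol_ge0 (gap j hA).
  have [km|/ltnW mk] := leqP k m.
    by have [_] := gap_later (I0 R) (I0 R) hA km; have := p m; lra.
  by have [+ _] := gap_later (I0 R) (I0 R) hA mk; have := p k; lra.
have l1 k : iter k N psi (I0 R) - C * A * rho ^+ k <= l.
  apply: ub_le_sup; last by exists k.
  by exists (iter 0 N psi (I0 R) + C * A * rho ^+ 0) => _ [j _ <-].
have l2 k : l <= iter k N psi (I0 R) + C * A * rho ^+ k.
  by apply: ge_sup => [|_ [j _ <-]//]; exists (iter 0 N psi (I0 R) - C * A * rho ^+ 0), 0%N.
have cl : iter k N psi (I0 R) @[k --> \oo] --> l.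
  apply: (@squeeze_cvgr _ _ _ _ (fun k => l - C * A * rho ^+ k) (fun k => l + C * A * rho ^+ k)).
  - by apply: nearW => k; have := l1 k; have := l2 k; rewrite lerBlDr lerBlDr => -> ->.
  - by rewrite -[X in _ --> X]subr0; apply: cvgB; [exact: cvg_cst|exact: gap_cvg0].
  - by rewrite -[X in _ --> X]addr0; apply: cvgD; [exact: cvg_cst|exact: gap_cvg0].
have -> : mean psi = l by exact: cvg_lim cl.
have := l1 n; have := l2 n; have := gap_osc n x (I0 R) hA; have := gap_osc n (I0 R) x hA.
by rewrite ler_norml => *; apply/andP; split; lra.
Qed.

Lemma mean_cvg A psi x : hol A psi -> iter n N psi x @[n --> \oo] --> mean psi.
Proof.
move=> hA; apply/cvgrPdist_le => e e0.
have h0 : 2 * (C * A * rho ^+ n) @[n --> \oo] --> (0 : R).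
  rewrite -[X in _ --> X](mulr0 2); apply: cvgM; first exact: cvg_cst.
  exact: gap_cvg0.
have /cvgr0Pnorm_le /(_ e e0) := h0; apply: filterS => n hn.
by rewrite distrC (le_trans (mean_close n x hA))// (le_trans (ler_norm _)).
Qed.

Lemma mean_cst c : mean (fun=> c) = c.
Proof.
apply: cvg_lim => //.
under eq_fun do rewrite iter_markov_cst//; exact: cvg_cst.
Qed.

Lemma mean_lin A B c d u v : hol A u -> hol B v ->
  mean (fun x => c * u x + d * v x) = c * mean u + d * mean v.
Proof.
move=> hu hv; apply: cvg_lim => //.
under eq_fun do rewrite iter_transfer_lin.
by apply: cvgD; apply: cvgM; [exact: cvg_cst|exact: mean_cvg hu|exact: cvg_cst|exact: mean_cvg hv].
Qed.

Lemma mean_le A B u v : hol A u -> hol B v -> (forall x, u x <= v x) -> mean u <= mean v.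
Proof.
move=> hu hv uv; apply: (ler_cvg_to (mean_cvg (I0 R) hu) (mean_cvg (I0 R) hv)).
by apply: nearW => n; exact: iter_transfer_le.
Qed.

Lemma hol_transfer A psi : hol A psi -> exists B, hol B (N psi).
Proof.
move=> hA.
have bG a x : `|G a x| <= 1 by rewrite ger0_norm// G_le1.
have h a := holM (hH a) (hol_inv_branch alpha a hA) (bG a) (fun x => hol_bound hA (g a x)).
by eexists; exact: holD (h false) (h true).
Qed.

Lemma mean_transfer A psi : hol A psi -> mean (N psi) = mean psi.
Proof.
move=> hA; apply: cvg_lim => //.
under eq_fun do rewrite -iterSr.
by have := mean_cvg (I0 R) hA; rewrite -cvg_shiftS.
Qed.

Lemma mean_sum (J : Type) (s : seq J) (F : J -> I -> R) : (forall j, exists A, hol A (F j)) ->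
  (exists A, hol A (fun x => \sum_(j <- s) F j x)) /\
  mean (fun x => \sum_(j <- s) F j x) = \sum_(j <- s) mean (F j).
Proof.
move=> hF; elim: s => [|j s [[A hA] ih]].
  have -> : (fun x : I => \sum_(j <- [::]) F j x) = (fun=> 0).
    by apply/funext => x; rewrite big_nil.
  by split; [exists 0; exact: hol_cst|rewrite mean_cst big_nil].
have [B hB] := hF j.
have -> : (fun x : I => \sum_(i <- j :: s) F i x) =
    (fun x => 1 * F j x + 1 * \sum_(i <- s) F i x).
  by apply/funext => x; rewrite big_cons !mul1r.
split; last by rewrite (mean_lin _ _ hB hA) ih big_cons !mul1r.
by eexists; exact: holD (holZ 1 hB) (holZ 1 hA).
Qed.

Lemma mean_close_le A B u v e : hol A u -> hol B v -> (forall x, `|u x - v x| <= e) ->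
  `|mean u - mean v| <= e.
Proof.
move=> hu hv h; rewrite ler_distl.
have -> : mean v - e = mean (fun x => 1 * v x + (- e) * 1).
  by rewrite (mean_lin _ _ hv (@hol_cst _ _ 1)) mean_cst; ring.
have -> : mean v + e = mean (fun x => 1 * v x + e * 1).
  by rewrite (mean_lin _ _ hv (@hol_cst _ _ 1)) mean_cst; ring.
have hc c : hol (`|1| * B + `|c| * 0) (fun x => 1 * v x + c * 1).
  exact: holD (holZ 1 hv) (holZ c (@hol_cst _ _ 1)).
apply/andP; split; [apply: (mean_le (hc _) hu)|apply: (mean_le hu (hc _))] => x;
  have := h x; rewrite ler_norml => /andP[]; lra.
Qed.

(** Lipschitz majorants of the indicator of [0, x], falling from 1 to 0 on [x, x + 1/k] and
    decreasing to the indicator as [k] grows. *)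
Definition ramp (x : R) (k : nat) (y : I) : R :=
  Num.max 0 (Num.min 1 (1 - k%:R * (ival y - x))).

Lemma ramp01 x k y : 0 <= ramp x k y <= 1. Proof. exact: clamp_itv. Qed.

Lemma ramp_hol x k : hol k%:R (ramp x k).
Proof.
apply: lip_hol => // y z.
have := clampI_contr (1 - k%:R * (ival y - x)) (1 - k%:R * (ival z - x)).
rewrite /= -/(ramp x k y) -/(ramp x k z) => /le_trans; apply.
have -> : 1 - k%:R * (ival y - x) - (1 - k%:R * (ival z - x)) = k%:R * (ival z - ival y) by ring.
by rewrite normrM ger0_norm// distrC.
Qed.

Lemma clamp_mono (s t : R) : s <= t ->
  Num.max 0 (Num.min 1 s) <= Num.max 0 (Num.min 1 t).
Proof.
move=> st; rewrite ge_max !le_max lexx /=; apply/orP; right.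
by rewrite le_min !ge_min lexx st !orbT.
Qed.

Lemma ramp_mono x x' k y : x <= x' -> ramp x k y <= ramp x' k y.
Proof.
by move=> xx; apply: clamp_mono; rewrite lerD2l lerN2 ler_wpM2l// lerD2l lerN2.
Qed.

Lemma ramp1 x k y : ival y <= x -> ramp x k y = 1.
Proof.
move=> yx; rewrite /ramp min_l ?max_r// lerBrDr -lerBrDl subrr.
by rewrite mulr_ge0_le0// subr_le0.
Qed.

Lemma ramp0 x k y : 1 <= k%:R * (ival y - x) -> ramp x k y = 0.
Proof. by move=> h; rewrite /ramp min_r ?max_l//; lra. Qed.

Lemma ramp_antitone x k k' y : (k <= k')%N -> ramp x k' y <= ramp x k y.
Proof.
move=> kk; have [yx|xy] := leP (ival y) x; first by rewrite !ramp1.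
apply: clamp_mono; rewrite lerD2l lerN2 ler_wpM2r ?ler_nat// subr_ge0 ltW//.
Qed.

Lemma ramp_shift x x' k y : x <= x' -> ramp x' k y <= ramp x k y + k%:R * (x' - x).
Proof.
move=> xx; have := clampI_contr (1 - k%:R * (ival y - x')) (1 - k%:R * (ival y - x)).
rewrite /= -/(ramp x' k y) -/(ramp x k y) => h.
have := le_trans (ler_norm _) h.
have -> : 1 - k%:R * (ival y - x') - (1 - k%:R * (ival y - x)) = k%:R * (x' - x) by ring.
by rewrite ger0_norm ?mulr_ge0 ?subr_ge0//; lra.
Qed.

(** The distribution function of the measure to be built; the approximation from above makes it
    right continuous. *)
Definition cdfm (x : R) : R := inf [set mean (ramp x k) | k in [set: nat]].

Lemma mean_ramp01 x k : 0 <= mean (ramp x k) <= 1.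
Proof.
rewrite -{1}(mean_cst 0) -[X in _ && (_ <= X)](mean_cst 1).
by apply/andP; split; [apply: (mean_le (hol_cst _ _) (ramp_hol x k))|
  apply: (mean_le (ramp_hol x k) (hol_cst _ _))] => y; have /andP[] := ramp01 x k y.
Qed.

Lemma cdfm_le x k : cdfm x <= mean (ramp x k).
Proof.
apply: ge_inf; last by exists k.
by exists 0 => _ [j _ <-]; have /andP[] := mean_ramp01 x j.
Qed.

Lemma cdfm_approx x e : 0 < e -> exists k, mean (ramp x k) < cdfm x + e.
Proof.
move=> e0; have hs : has_inf [set mean (ramp x k) | k in [set: nat]].
  split; first by exists (mean (ramp x 0)), 0%N.
  by exists 0 => _ [j _ <-]; have /andP[] := mean_ramp01 x j.
have [_ [k _ <-] hk] := inf_adherent e0 hs.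
by exists k.
Qed.

Lemma mean_ramp_antitone x k k' : (k <= k')%N -> mean (ramp x k') <= mean (ramp x k).
Proof.
by move=> kk; apply: (mean_le (ramp_hol _ _) (ramp_hol _ _)) => y; exact: ramp_antitone.
Qed.

Lemma mean_ramp_cvg x : mean (ramp x k) @[k --> \oo] --> cdfm x.
Proof.
apply/cvgrPdist_le => e e0; have [k hk] := cdfm_approx x e0.
near=> j; have jk : (k <= j)%N by near: j; exact: nbhs_infty_ge.
have := mean_ramp_antitone x jk; have := cdfm_le x j.
by rewrite distrC ger0_norm ?subr_ge0 ?cdfm_le//; lra.
Unshelve. all: by end_near. Qed.

Lemma cdfm_nd : nondecreasing cdfm.
Proof.
move=> x y xy; apply: (ler_cvg_to (@mean_ramp_cvg x) (@mean_ramp_cvg y)).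
by apply: nearW => k; apply: (mean_le (ramp_hol _ _) (ramp_hol _ _)) => z; exact: ramp_mono.
Qed.

Lemma cdfm_neg x : x < 0 -> cdfm x = 0.
Proof.
move=> x0; apply/le_anti/andP; split; last first.
  apply: lb_le_inf; first by exists (mean (ramp x 0)), 0%N.
  by move=> _ [j _ <-]; have /andP[] := mean_ramp01 x j.
pose k := (Num.truncn (- x)^-1).+1.
have kx : 1 < k%:R * (- x).
  by rewrite -ltr_pdivrMr ?oppr_gt0// mul1r truncnS_gt.
rewrite (le_trans (cdfm_le x k))// -(mean_cst 0).
apply: (mean_le (ramp_hol x k) (hol_cst _ _)) => y.
rewrite ramp0//; have : k%:R * ival y >= 0 by rewrite mulr_ge0// ival_ge0.
by lra.
Qed.

Lemma cdfm_ge1 x : 1 <= x -> cdfm x = 1.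
Proof.
move=> x1; have c1 := @mean_ramp_cvg x.
have e : (fun k => mean (ramp x k)) = (fun=> 1).
  apply/funext => k; rewrite -[RHS](mean_cst 1); congr mean; apply/funext => y.
  by rewrite ramp1// (le_trans (ival_le1 _)).
by rewrite e in c1; exact: (cvg_unique _ c1 (cvg_cst _)).
Qed.

Lemma cdfm_rc : right_continuous cdfm.
Proof.
move=> x; apply/cvgrPdist_le => e e0.
have [k hk] := @cdfm_approx x (e / 2) (ltac:(by rewrite divr_gt0)).
have d0 : 0 < e / 2 / (k%:R + 1) by rewrite !divr_gt0// ltr_wpDl.
near=> y.
have xy : x < y by near: y; exact: nbhs_right_gt.
have yx : y < x + e / 2 / (k%:R + 1) by near: y; apply: nbhs_right_lt; rewrite ltrDl.
rewrite distrC ger0_norm ?subr_ge0 ?cdfm_nd ?(ltW xy)//.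
have h1 : mean (ramp y k) <= mean (fun z => 1 * ramp x k z + k%:R * (y - x) * 1).
  apply: (mean_le (ramp_hol _ _)) => [|z]; first exact: holD (holZ 1 (ramp_hol x k)) (holZ (k%:R * (y - x)) (hol_cst _ 1)).
  by rewrite mul1r mulr1 ramp_shift// ltW.
rewrite (mean_lin _ _ (ramp_hol x k) (hol_cst gam 1)) mean_cst mul1r mulr1 in h1.
have h2 : k%:R * (y - x) <= e / 2.
  apply: (@le_trans _ _ ((k%:R + 1) * (e / 2 / (k%:R + 1)))).
    by rewrite ler_pM ?lerDl ?subr_ge0 ?(ltW xy)//; lra.
  by rewrite mulrC divfK// gt_eqF// ltr_wpDl.
have := cdfm_le y k; lra.
Unshelve. all: by end_near. Qed.

Lemma measurable_sublevel (x : R) : measurable [set y : I | ival y <= x].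
Proof.
rewrite -[X in measurable X]setTI.
have := @measurable_ival R measurableT [set` `]-oo, x]] (measurable_itv _).
by congr (measurable (_ `&` _)); apply/seteqP; split=> y; rewrite /= in_itv.
Qed.

Lemma clampI_measurable : measurable_fun [set: measurableTypeR R] (@clampI R).
Proof.
apply: measurable_toI; apply: continuous_measurable_fun => z.
apply/cvgrPdist_le => e e0; apply: filterS (nbhsx_ballx z e e0) => w zw.
by rewrite (le_trans (clampI_contr _ _))// ltW.
Qed.

(** The Lebesgue-Stieltjes measure of [cdfm], pushed to the interval by [clampI]: with [Ex_mean]
    this plays the part of the Riesz representation of [mean]. *)
Lemma cdfm_measure : exists nu : probability I R,
  forall x, nu [set y | ival y <= x] = (cdfm x)%:E.
Proof.
have lNy : cdfm @ -oo --> (0 : R).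
  apply/cvgrPdist_le => e e0; near=> x.
  have x0 : x < 0 by near: x; apply: nbhs_ninfty_lt; exact: num_real.
  by rewrite cdfm_neg// subrr normr0 ltW.
have ly : cdfm @ +oo --> (1 : R).
  apply/cvgrPdist_le => e e0; near=> x.
  have x0 : 1 <= x by near: x; apply: nbhs_pinfty_ge; exact: num_real.
  by rewrite cdfm_ge1// subrr normr0 ltW.
pose c1 := isCumulative.Build R _ R cdfm cdfm_nd cdfm_rc.
pose c2 := isCumulativeBounded.Build R 0 1 cdfm lNy ly.
pose F : cumulativeBounded 0 1 := HB.pack cdfm c1 c2.
pose m := lebesgue_stieltjes_measure F.
pose cl : {mfun measurableTypeR R >-> I} :=
  HB.pack (@clampI R : measurableTypeR R -> I) (@isMeasurableFun.Build _ _ _ _ (@clampI R : measurableTypeR R -> I) clampI_measurable).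
exists (distribution m cl) => x.
have [x0|x0] := ltP x 0.
  rewrite cdfm_neg// (_ : [set y | ival y <= x] = set0) ?measure0//.
  by rewrite -subset0 => y /=; have := ival_ge0 y; lra.
have [x1|x1] := ltP x 1; last first.
  rewrite cdfm_ge1// (_ : [set y | ival y <= x] = setT) ?probability_setT//.
  by rewrite -subTset => y _ /=; rewrite (le_trans (ival_le1 _)).
have := @cdf_lebesgue_stieltjes_id R F x.
rewrite /cdf /distribution /pushforward /= => <-.
apply: (congr1 (lebesgue_stieltjes_measure F)).
apply/seteqP; split=> y /=; rewrite in_itv /= /Order.max /Order.min;
  by case: (ltP 1 y) => ?; case: (ltP 0 _) => ?; lra.
Unshelve. all: by end_near. Qed.

Lemma nat_div_clamp (K j : nat) : (0 < K)%N -> (j <= K)%N -> ival (clampI (j%:R / K%:R : R)) = j%:R / K%:R.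
Proof.
move=> K0 jK; rewrite /= min_r ?max_r ?divr_ge0//.
by rewrite ler_pdivrMr ?ltr0n// mul1r ler_nat.
Qed.

Section integral_is_mean.
Variable nu : probability I R.
Hypothesis nuE : forall x, nu [set y | ival y <= x] = (cdfm x)%:E.

Lemma bmeas_ramp x k : bmeas (ramp x k). Proof. exact: hol_bmeas (ramp_hol x k). Qed.

Lemma Ex_ramp_cvg x : Ex nu (ramp x k) @[k --> \oo] --> cdfm x.
Proof.
have -> : cdfm x = Ex nu (\1_[set y | ival y <= x]).
  by rewrite Ex_indic ?nuE//; exact: measurable_sublevel.
apply: (@Ex_cvg _ _ _ _ _ _ 1).
- by move=> k; case: (bmeas_ramp x k).
- by move=> k y; have /andP[a b] := ramp01 x k y; rewrite ger0_norm.
- move=> y; rewrite indicE; have [yx|xy] := leP (ival y) x.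
    rewrite mem_set//; under eq_fun do rewrite ramp1//; exact: cvg_cst.
  rewrite memNset /=; last by apply/negP; rewrite -ltNge.
  apply/cvgrPdist_le => e e0; near=> k.
  rewrite ramp0 ?subrr ?normr0 ?(ltW e0)//.
  rewrite -ler_pdivrMr ?subr_gt0//; near: k; exact: nbhs_infty_ger.
- by apply: bmeas_indic; exact: measurable_sublevel.
Unshelve. all: by end_near. Qed.

Lemma partition_close (K : nat) A psi (q : nat -> I -> R) y : (0 < K)%N -> hol A psi ->
  (forall j, 0 <= q j y) -> \sum_(0 <= j < K.+1) q j y = 1 ->
  (forall j, (j <= K)%N -> q j y != 0 -> `|j%:R / K%:R - ival y| <= K%:R^-1) ->
  `|\sum_(0 <= j < K.+1) psi (clampI (j%:R / K%:R)) * q j y - psi y| <=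
    A * K%:R^-1 `^ gam%:num.
Proof.
move=> K0 hA q0 q1 qK.
have eq c : c = \sum_(0 <= j < K.+1) c * q j y by rewrite -mulr_sumr q1 mulr1.
rewrite [X in _ - X]eq -sumrB.
rewrite (le_trans (ler_norm_sum _ _ _))//.
rewrite [leRHS]eq big_nat_cond [leRHS]big_nat_cond.
apply: ler_sum => j /andP[/andP[_ jK] _].
rewrite -mulrBl normrM (ger0_norm (q0 j)).
have [->|qj] := eqVneq (q j y) 0; first by rewrite !mulr0.
rewrite ler_wpM2r// (le_trans (hA _ _))// ler_wpM2l ?(hol_ge0 hA)//.
rewrite /gdist nat_div_clamp// ge0_ler_powR ?nnegrE ?invr_ge0//.
exact: qK.
Qed.

(** Differences of ramps at the points [j / K] form a partition of unity, so [psi] is uniformly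
    close to a combination of ramps; on ramps both functionals tend to [cdfm] as [k] grows. *)
Lemma Ex_mean A psi : hol A psi -> Ex nu psi = mean psi.
Proof.
move=> hA.
apply/eqP; rewrite -subr_eq0 -normr_le0; apply/ler_addgt0Pr => e e0; rewrite add0r.
have A0 := hol_ge0 hA.
have [r r0 hr] := @powR_small R gam (e / (4 * (A + 1)))
  (ltac:(by rewrite divr_gt0// mulr_gt0// ltr_wpDl)).
pose K := (Num.truncn r^-1).+1.
have K0 : 0 < K%:R :> R by rewrite ltr0n.
have Kr : K%:R^-1 <= r by rewrite -[leRHS]invrK lef_pV2 ?posrE ?invr_gt0// ltW// truncnS_gt.
have AK : A * K%:R^-1 `^ gam%:num <= e / 4.
  apply: (@le_trans _ _ ((A + 1) * (e / (4 * (A + 1))))).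
    by rewrite ler_pM ?powR_ge0 ?lerDl// hr// invr_ge0 ltW.
  by rewrite le_eqVlt; apply/orP; left; apply/eqP; field; rewrite gt_eqF// ltr_wpDl.
pose p k j y := ramp (j%:R / K%:R) k y - ramp ((j%:R - 1) / K%:R) k y.
have close k y : (K <= k)%N ->
    `|\sum_(0 <= j < K.+1) psi (clampI (j%:R / K%:R)) * p k j y - psi y| <= e / 4.
  move=> Kk; apply: le_trans AK; apply: partition_close => //.
  - move=> j; rewrite subr_ge0 ramp_mono// ler_wpM2r ?invr_ge0 ?(ltW K0)//.
    by rewrite gerBl.
  - have tel n : \sum_(0 <= j < n) p k j y = ramp ((n%:R - 1) / K%:R) k y - ramp (- 1 / K%:R) k y.
      elim: n => [|n ih]; first by rewrite big_nil sub0r subrr.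
      by rewrite big_nat_recr//= ih /p -natr1 addrK; ring.
    rewrite tel -natr1 addrK divff ?gt_eqF// ramp1 ?ival_le1// ramp0 ?subr0//.
    rewrite mulN1r opprK mulrDr (@le_trans _ _ (k%:R * K%:R^-1))//.
      by rewrite ler_pdivlMr// mul1r ler_nat.
    by rewrite lerDr mulr_ge0// ival_ge0.
  - move=> j jK pj.
    rewrite ler_norml; apply/andP; split.
      rewrite leNgt; apply/negP => h; move: pj; rewrite /p.
      have h2 : K%:R^-1 < ival y - j%:R / K%:R by lra.
      have kK : K%:R <= k%:R :> R by rewrite ler_nat.
      have h3 z : z <= j%:R / K%:R -> 1 <= k%:R * (ival y - z).
        move=> hz; apply: (@le_trans _ _ (K%:R * K%:R^-1)); first by rewrite divff// gt_eqF.
        rewrite ler_pM ?invr_ge0//; lra.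
      by rewrite !ramp0 ?subrr ?eqxx ?h3// ler_pM2r ?invr_gt0// gerBl.
    rewrite leNgt; apply/negP => h; move: pj; rewrite /p.
    have h3 : ival y <= (j%:R - 1) / K%:R by rewrite mulrBl mul1r; lra.
    rewrite ramp1; last by rewrite (le_trans h3)// ler_pM2r ?invr_gt0// gerBl.
    by rewrite ramp1// subrr eqxx.
have bp k j : exists B, hol B (p k j).
  exists (k%:R + `|-1| * k%:R) => x y.
  have := holD (ramp_hol (j%:R / K%:R) k) (holZ (-1) (ramp_hol ((j%:R - 1) / K%:R) k)) x y.
  by rewrite !mulN1r.
have bp2 k j : exists B, hol B (fun y => psi (clampI (j%:R / K%:R)) * p k j y).
  by have [B hB] := bp k j; eexists; exact: holZ hB.
pose S (Phi : (I -> R) -> R) k := \sum_(0 <= j < K.+1) psi (clampI (j%:R / K%:R)) *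
   (Phi (ramp (j%:R / K%:R) k) - Phi (ramp ((j%:R - 1) / K%:R) k)).
have hE k : (K <= k)%N -> `|S (Ex nu) k - Ex nu psi| <= e / 4.
  move=> Kk.
  have -> : S (Ex nu) k = Ex nu (fun y => \sum_(0 <= j < K.+1) psi (clampI (j%:R / K%:R)) * p k j y).
    rewrite Ex_sum => [|j]; last by have [B] := bp2 k j; exact: hol_bmeas.
    apply: eq_bigr => j _; rewrite ExZ; last by have [B] := bp k j; exact: hol_bmeas.
    by rewrite ExB//; exact: bmeas_ramp.
  apply: Ex_close => [| |y]; [|exact: hol_bmeas hA|exact: close].
  by apply: bmeas_sum => j; have [B] := bp2 k j; exact: hol_bmeas.
have hM k : (K <= k)%N -> `|S mean k - mean psi| <= e / 4.
  move=> Kk.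
  have [[B hB] eB] := mean_sum (index_iota 0 K.+1) (bp2 k).
  have -> : S mean k = mean (fun y => \sum_(0 <= j < K.+1) psi (clampI (j%:R / K%:R)) * p k j y).
    rewrite eB; apply: eq_bigr => j _.
    have [D hD] := bp k j.
    have -> : mean (fun y => psi (clampI (j%:R / K%:R)) * p k j y) =
      psi (clampI (j%:R / K%:R)) * mean (p k j).
      have := mean_lin (psi (clampI (j%:R / K%:R))) 0 hD hD.
      by under eq_fun do rewrite mul0r addr0; rewrite mul0r addr0.
    have := mean_lin 1 (-1) (ramp_hol (j%:R / K%:R) k) (ramp_hol ((j%:R - 1) / K%:R) k).
    by under eq_fun do rewrite mul1r mulN1r; rewrite mul1r mulN1r => ->.
  by apply: (mean_close_le hB hA) => y; exact: close.
have cS Phi : (forall x, Phi (ramp x k) @[k --> \oo] --> cdfm x) ->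
    S Phi k @[k --> \oo] --> \sum_(0 <= j < K.+1) psi (clampI (j%:R / K%:R)) *
     (cdfm (j%:R / K%:R) - cdfm ((j%:R - 1) / K%:R)).
  move=> hP; rewrite /S; elim: (index_iota 0 K.+1) => [|j s ih].
    by under eq_fun do rewrite big_nil; rewrite big_nil; exact: cvg_cst.
  under eq_fun do rewrite big_cons; rewrite big_cons; apply: cvgD; last exact: ih.
  by apply: cvgM; [exact: cvg_cst|apply: cvgB; exact: hP].
have cD : S (Ex nu) k - S mean k @[k --> \oo] --> (0 : R).
  rewrite -[X in _ --> X](subrr (\sum_(0 <= j < K.+1) psi (clampI (j%:R / K%:R)) *
     (cdfm (j%:R / K%:R) - cdfm ((j%:R - 1) / K%:R)))).
  by apply: cvgB; apply: cS => x; [exact: Ex_ramp_cvg|exact: mean_ramp_cvg].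
have /cvgr0Pnorm_le /(_ (e / 2) (ltac:(by rewrite divr_gt0))) [n _ hn] := cD.
have k1 := leq_maxl K n; have := hn _ (leq_maxr K n).
set k := maxn K n in k1 * => /= hk.
have := hE k k1; have := hM k k1.
rewrite !ler_norml in hk *; move=> /andP[? ?] /andP[? ?]; case/andP: hk => ? ?.
by apply/andP; split; lra.
Qed.

End integral_is_mean.

End stationary_measure.

Section indicator_limits.
Variable R : realType.
Local Notation I := (unit_interval R).

Lemma ramp_cvg (x : R) (y : I) :
  ramp x k y @[k --> \oo] --> (\1_[set y : I | ival y <= x] y : R).
Proof.
rewrite indicE; have [yx|xy] := leP (ival y) x.
  by rewrite mem_set//; under eq_fun do rewrite ramp1//; exact: cvg_cst.
rewrite memNset /=; last by apply/negP; rewrite -ltNge.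
apply/cvgrPdist_le => e e0; near=> k.
rewrite ramp0 ?subrr ?normr0 ?(ltW e0)//.
rewrite -ler_pdivrMr ?subr_gt0//; near: k; exact: nbhs_infty_ger.
Unshelve. all: by end_near. Qed.

Variables (T : Type) (F : (set T)^nat).
Hypothesis tF : trivIset setT F.

Lemma indic_sumE m x n : F m x -> \sum_(i <- iota 0 n) \1_(F i) x = (m < n)%N%:R :> R.
Proof.
move=> Fmx; elim: n => [|n ih]; first by rewrite big_nil.
rewrite -addn1 iotaD big_cat big_seq1 ih indicE add0n.
have -> : (x \in F n) = (n == m).
  apply/idP/eqP => [/set_mem Fnx|->]; last exact: mem_set.
  by apply: (tF (i := n) (j := m)) => //; exists x.
transitivity ((m < n)%N%:R + (n == m)%:R : R) => //; rewrite -natrD; congr (_%:R).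
by rewrite addn1 ltnS; case: ltngtP => //=; lia.
Qed.

Lemma indic_sum0 x n : ~ (\bigcup_k F k) x -> \sum_(i <- iota 0 n) \1_(F i) x = 0 :> R.
Proof.
move=> nF; rewrite big1// => i _; rewrite indicE memNset// => Fix.
by apply: nF; exists i.
Qed.

Lemma indic_sum_bound n x : `|\sum_(i <- iota 0 n) \1_(F i) x| <= 1 :> R.
Proof.
have [[m _ Fm]|nF] := pselect ((\bigcup_k F k) x); last by rewrite indic_sum0// normr0.
by rewrite (indic_sumE _ Fm); case: ltnP => /=; rewrite ?normr1 ?normr0.
Qed.

Lemma indic_sum_cvg x :
  (\sum_(i <- iota 0 n) \1_(F i) x : R) @[n --> \oo] --> (\1_(\bigcup_k F k) x : R).
Proof.
rewrite indicE; have [Fx|nF] := pselect ((\bigcup_k F k) x); last first.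
  by rewrite memNset//; under eq_fun do rewrite indic_sum0//; exact: cvg_cst.
rewrite mem_set//; case: Fx => m _ Fm.
under eq_fun do rewrite (indic_sumE _ Fm).
apply/cvgrPdist_le => e e0; near=> n.
have -> : (m < n)%N by near: n; exists m.+1.
by rewrite subrr normr0 ltW.
Unshelve. all: by end_near. Qed.

End indicator_limits.

(** * From Hölder to measurable test functions: invariance and mixing *)

Section transfer_invariance.
Variables (R : realType) (alpha gam : {posnum R}).
Hypothesis gam1 : gam%:num <= 1.
Local Notation I := (unit_interval R).
Local Notation g := (inv_branch alpha).
Local Notation gw := (gw alpha).
Local Notation f := (intermittent_map alpha).
Local Notation transfer := (@transfer R alpha).
Local Notation hol := (@hol R gam).
Variables (G : bool -> I -> R) (d : R).
Hypotheses (G0 : nonneg G) (G1 : markov G) (bG : forall a, bmeas (G a)).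
Hypotheses (d0 : 0 < d) (dG : forall a x, d <= G a x).
Variable nu : probability I R.
Hypothesis nuH : forall A psi, hol A psi -> Ex nu (transfer G psi) = Ex nu psi.
Local Notation N := (transfer G).
Implicit Types psi : I -> R.

Lemma Ex_transfer_sublevel (x : R) :
  Ex nu (N (\1_[set y | ival y <= x])) = Ex nu (\1_[set y | ival y <= x]).
Proof.
have b1 : bmeas (\1_[set y : I | ival y <= x] : I -> R).
  by apply: bmeas_indic; exact: measurable_sublevel.
have c1 : Ex nu (ramp x k) @[k --> \oo] --> Ex nu (\1_[set y | ival y <= x]).
  apply: (@Ex_cvg _ _ _ _ _ _ 1) => //; last exact: ramp_cvg.
  - by move=> k; case: (bmeas_ramp gam1 x k).
  - by move=> k y; have /andP[a b] := ramp01 x k y; rewrite ger0_norm.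
have c2 : Ex nu (N (ramp x k)) @[k --> \oo] --> Ex nu (N (\1_[set y | ival y <= x])).
  apply: (@Ex_cvg _ _ _ _ _ _ 1).
  - by move=> k; case: (bmeas_transfer alpha bG (bmeas_ramp gam1 x k)).
  - move=> k y; have h z : `|ramp x k z| <= 1.
      by have /andP[a b] := ramp01 x k z; rewrite ger0_norm.
    have := @iter_transfer_bnd R alpha G 1 _ 1 G0 h y.
    by rewrite tr1_markov// mulr1.
  - by move=> y; apply: cvgD; apply: cvgM; first exact: cvg_cst; do ?exact: cvg_cst; exact: ramp_cvg.
  - exact: bmeas_transfer.
have e : (fun k => Ex nu (N (ramp x k))) = (fun k => Ex nu (ramp x k)).
  by apply/funext => k; exact: nuH (ramp_hol gam1 x k).
by rewrite e in c2; exact: cvg_unique c2 c1.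
Qed.

Definition sublevels : set (set I) := [set A | exists x, A = [set y | ival y <= x]].

Lemma measurable_sublevelsE : @measurable _ I = <<s sublevels>>.
Proof.
apply/seteqP; split; last first.
  apply: smallest_sub; first exact: sigma_algebra_measurable.
  by move=> _ [x ->]; exact: measurable_sublevel.
apply: smallest_sub; first exact: smallest_sigma_algebra.
move=> _ [V oV <-].
pose J := g_sigma_algebraType sublevels.
have mi : measurable_fun [set: J] (@ival R : J -> R).
  apply: (measurability _ (RGenOInfty.measurableE R)) => _ [_ [x ->] <-].
  rewrite setTI -(setCK (_ @^-1` _)); apply: measurableC; apply: sub_sigma_algebra.
  exists x; apply/seteqP; split => y /=; rewrite in_itv /= andbT.
    by move=> /negP; rewrite -leNgt.
  by move=> h; apply/negP; rewrite -leNgt.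
have := mi measurableT V (open_measurable oV).
by rewrite setTI.
Qed.

(** Dynkin's theorem, starting from the intervals [0, x], where the identity follows from the one
    for ramps by bounded convergence. *)
Lemma Ex_transfer_indic A : measurable A -> Ex nu (N (\1_A)) = Ex nu (\1_A).
Proof.
rewrite measurable_sublevelsE; move: A.
apply: (@dynkin_induction _ I sublevels
  [set A | Ex nu (N (\1_A)) = Ex nu (\1_A)]) => /=.
- exact: measurable_sublevelsE.
- move=> _ _ [x ->] [y ->]; exists (Num.min x y).
  by apply/seteqP; split=> z /=; rewrite le_min => /andP.
- congr (Ex nu _); apply/funext => x; by rewrite !indicT -[LHS]/(G false x * 1 + G true x * 1) !mulr1 G1.
- by move=> _ [x ->]; exact: Ex_transfer_sublevel.
- move=> S mS hS.
  have bS := bmeas_indic R mS.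
  have -> : (\1_(~` S) : I -> R) = (fun x => 1 - \1_S x).
    apply/funext => x; rewrite indicC indicE; case: (x \in S) => /=; rewrite ?subr0 ?subrr//.
  have -> : N (fun x => 1 - \1_S x) = (fun x => 1 - N (\1_S) x).
    apply/funext => x; have e : G false x + G true x = 1 := G1 x.
    transitivity (G false x * (1 - \1_S (g false x)) + G true x * (1 - \1_S (g true x))) => //.
    transitivity (1 - (G false x * \1_S (g false x) + G true x * \1_S (g true x))) => //.
    by rewrite -[in RHS]e; ring.
  rewrite !ExB ?hS//; [exact: bmeas_cst|exact: bmeas_cst|exact: bmeas_transfer].
- move=> F mF tF hF.
  pose u n : I -> R := fun x => \sum_(i <- iota 0 n) \1_(F i) x.
  have bF i : bmeas (\1_(F i) : I -> R) by exact: bmeas_indic.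
  have bu n : bmeas (u n) by exact: bmeas_sum.
  have ub n x : `|u n x| <= 1 := indic_sum_bound R tF n x.
  have ul x : u n x @[n --> \oo] --> (\1_(\bigcup_k F k) x : R) := @indic_sum_cvg R _ _ tF x.
  have mU : measurable (\bigcup_k F k) by exact: bigcupT_measurable.
  have bU := bmeas_indic R mU.
  have c1 : Ex nu (u n) @[n --> \oo] --> Ex nu (\1_(\bigcup_k F k)).
    by apply: (@Ex_cvg _ _ _ _ _ _ 1) => // n; case: (bu n).
  have c2 : Ex nu (N (u n)) @[n --> \oo] --> Ex nu (N (\1_(\bigcup_k F k))).
    apply: (@Ex_cvg _ _ _ _ _ _ 1).
    - by move=> n; case: (bmeas_transfer alpha bG (bu n)).
    - move=> n y; have := @iter_transfer_bnd R alpha G 1 _ 1 G0 (ub n) y.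
      by rewrite tr1_markov// mulr1.
    - by move=> y; apply: cvgD; apply: cvgM; first exact: cvg_cst; do ?exact: cvg_cst; exact: ul.
    - exact: bmeas_transfer.
  have e n : Ex nu (N (u n)) = Ex nu (u n).
    have -> : N (u n) = (fun x => \sum_(i <- iota 0 n) N (\1_(F i)) x).
      apply/funext => x; rewrite /u; elim: (iota 0 n) => [|i s ih].
        rewrite big_nil -[LHS]/(G false x * _ + G true x * _) !big_nil !mulr0 addr0//.
      rewrite big_cons -ih -[LHS]/(G false x * _ + G true x * _) !big_cons.
      rewrite -[X in _ = X + _]/(G false x * \1_(F i) (g false x) + G true x * \1_(F i) (g true x)).
      rewrite -[X in _ = _ + X]/(G false x * _ + G true x * _); ring.
    rewrite Ex_sum => [|i]; last exact: bmeas_transfer.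
    by rewrite /u Ex_sum//; apply: eq_bigr => i _; exact: hF.
  have e' : (fun n => Ex nu (N (u n))) = (fun n => Ex nu (u n)) by exact/funext.
  by rewrite e' in c2; exact: cvg_unique c2 c1.
Qed.

Lemma Ex_transfer psi : bmeas psi -> Ex nu (N psi) = Ex nu psi.
Proof.
move: psi; apply: (functional_ext (F1 := fun u => Ex nu (N u)) (F2 := Ex nu)) => [|A mA].
  move=> F [->|->]; split.
  - move=> u v bu bv.
    have -> : N (fun x => u x + v x) = (fun x => N u x + N v x).
      apply/funext => x; have := iter_transfer_lin alpha G 1 1 1 u v x.
      by rewrite !mul1r /= => <-; congr (N _ x); apply/funext => y; rewrite !mul1r.
    by rewrite ExD//; exact: bmeas_transfer.
  - move=> c u bu.
    have -> : N (fun x => c * u x) = (fun x => c * N u x).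
      by apply/funext => x; exact: (iter_transferZ alpha G 1 c u x).
    by rewrite ExZ//; exact: bmeas_transfer.
  - move=> u v e bu bv h; apply: Ex_close; do ?exact: bmeas_transfer.
    move=> x; have := @iter_transfer_bnd R alpha G 1 _ e G0 h x.
    rewrite tr1_markov// mulr1; congr (`|_| <= _).
    have := iter_transfer_lin alpha G 1 1 (- 1) u v x.
    rewrite mul1r mulN1r /= => <-; congr (N _ x); apply/funext => y; ring.
  - by move=> u v bu bv; rewrite ExD.
  - by move=> c u bu; rewrite ExZ.
  - by move=> u v e bu bv h; exact: Ex_close.
exact: Ex_transfer_indic.
Qed.

Lemma Ex_iter_transfer n psi : bmeas psi -> Ex nu (iter n N psi) = Ex nu psi.
Proof.
move=> bp; elim: n => // n ih; rewrite iterS Ex_transfer//.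
exact: bmeas_iter_transfer.
Qed.

Lemma measurable_zero : measurable [set I0 R].
Proof.
rewrite (_ : [set I0 R] = [set y | ival y <= 0]); first exact: measurable_sublevel.
apply/seteqP; split => y /=; first by move=> ->.
by move=> y0; apply/ival_inj/le_anti; rewrite y0 /= ival_ge0.
Qed.

(** Invariance gives [nu {0} = G false 0 * nu {0}] with a factor below 1. This discards the one
    point over which the map does not invert the branch [true]. *)
Lemma zero_null : Ex nu (\1_[set I0 R]) = 0.
Proof.
have mz := measurable_zero; have bz := bmeas_indic R mz.
have := Ex_transfer bz.
have -> : N (\1_[set I0 R]) = (fun x => G false (I0 R) * \1_[set I0 R] x).
  apply/funext => x; rewrite -[LHS]/(G false x * _ + G true x * _) !indicE.
  have -> : (g true x \in [set I0 R]) = false.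
    apply/negbTE/negP; rewrite inE /= => e.
    by have := cut_le_true alpha x; have := cut_gt0 alpha; rewrite e /=; lra.
  rewrite mulr0 addr0; have [->|x0] := pselect (x = I0 R).
    by rewrite inv_branch0.
  rewrite [in RHS]memNset// memNset ?mulr0// => /= e; apply: x0.
  apply: ival_inj; have := inv_branchK alpha false x.
  by rewrite e /= lft0 addr0.
rewrite ExZ// => e.
have Glt : G false (I0 R) < 1.
  by have := G1 (I0 R); have := dG true (I0 R); have := d0; lra.
have : (1 - G false (I0 R)) * Ex nu (\1_[set I0 R]) = 0 by rewrite mulrBl mul1r e subrr.
by move=> /eqP; rewrite mulf_eq0 subr_eq0 gt_eqF//= => /eqP.
Qed.

Lemma Ex_off_zero u v : bmeas u -> bmeas v -> (forall x, x <> I0 R -> u x = v x) ->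
  Ex nu u = Ex nu v.
Proof.
move=> bu bv h; apply/eqP; rewrite -subr_eq0 -ExB//.
have -> : (fun x => u x - v x) = (fun x => (u (I0 R) - v (I0 R)) * \1_[set I0 R] x).
  apply/funext => x; rewrite indicE; have [->|x0] := pselect (x = I0 R).
    by rewrite mem_set// mulr1.
  by rewrite memNset// mulr0 h// subrr.
rewrite ExZ ?zero_null ?mulr0//; exact: bmeas_indic measurable_zero.
Qed.

Lemma iter_map_gw w x : 0 < ival x -> iter (size w) f (gw w x) = x.
Proof.
move=> x0; have gw0 v : 0 < ival (gw v x).
  elim: v => //= a v ih; rewrite (le_lt_trans _ (_ : ival (g a (I0 R)) < _)) ?ival_ge0//.
  by rewrite inv_branch_lt.
elim: w => //= a w ih; rewrite -iterS iterSr map_inv_branch ?ih//.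
by rewrite gw0 implybT.
Qed.

Lemma iter_transfer_koopman n psi psi' x : x <> I0 R ->
  iter n N (fun y => psi (iter n f y) * psi' y) x = psi x * iter n N psi' x.
Proof.
move=> x0; have xp : 0 < ival x.
  by rewrite lt_neqAle ival_ge0 andbT eq_sym; apply/eqP => e; apply/x0/ival_inj.
rewrite !iter_transferE mulr_sumr big_seq [RHS]big_seq; apply: eq_bigr => w wn.
by rewrite -{1}(size_words wn) iter_map_gw//; ring.
Qed.

Lemma Ex_koopman n psi psi' : bmeas psi -> bmeas psi' ->
  Ex nu (fun y => psi (iter n f y) * psi' y) = Ex nu (fun y => psi y * iter n N psi' y).
Proof.
move=> bp bp'.
have b1 : bmeas (fun y => psi (iter n f y) * psi' y).
  by apply: bmeasM => //; apply: bmeas_comp => //; exact: measurable_iter_map.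
rewrite -(Ex_iter_transfer n b1); apply: Ex_off_zero.
- exact: bmeas_iter_transfer.
- by apply: bmeasM => //; exact: bmeas_iter_transfer.
- by move=> x x0; exact: iter_transfer_koopman.
Qed.

Lemma stationary_invariant : invariant_measure alpha nu.
Proof.
move=> A mA.
have mfA : measurable (f @^-1` A).
  by have := measurable_map alpha measurableT mA; rewrite setTI.
have := Ex_koopman 1 (bmeas_indic R mA) (@bmeas_cst _ I R 1).
under eq_fun do rewrite mulr1.
have -> : (fun y => \1_A y * iter 1 N (fun=> 1) y) = \1_A.
  by apply/funext => y; rewrite iter_markov_cst// mulr1.
have -> : (fun x : I => \1_A (iter 1 f x) : R) = \1_(f @^-1` A).
  by apply/funext => y; rewrite !indicE; congr (nat_of_bool _)%:R; apply/idP/idP; rewrite !inE.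
rewrite !Ex_indic// => e.
by rewrite -(fineK (fin_num_measure nu _ mfA)) -(fineK (fin_num_measure nu _ mA)) e.
Qed.

(** By duality the correlation is the integral of [psi] against [N^n psi' - Ex nu psi'], whose sup
    norm is at most the oscillation of [N^n psi']. *)
Lemma stationary_mixing C rho : 0 < C -> 0 < rho < 1 ->
  (forall A psi n, hol A psi -> hol (C * A * rho ^+ n) (iter n N psi)) ->
  exponentially_mixing alpha nu.
Proof.
move=> C0 rho01 gap; exists C, rho; split => // psi psi' n mp [M [_ hM]] hp'.
pose ph : holder (real_scalars R) 1%:pos := Holder (mem_set hp' : psi' \in @holder_pred R (real_scalars R) 1%:pos).
set L := holder_seminorm _ _.
have L0 : 0 <= L by exact: (holder_seminorm_ge0 ph).
(* A Lipschitz function on a set of diameter 1 is Hölder with the same constant. *)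
have hL : hol L psi'.
  apply: lip_hol => // x y; have := holder_seminorm_ub ph x y.
  by rewrite powRr1.
have bp : bmeas psi.
  by split => //; exists (M + 1) => x; apply: hM => //; rewrite ltrDl.
have bp' : bmeas psi' := hol_bmeas hL.
set S := sup_norm _.
have hS x : `|psi x| <= S.
  apply: ub_le_sup; last by exists x.
  by case: bp => _ [B hB]; exists B => _ [y _ <-]; exact: hB.
have bN := bmeas_iter_transfer alpha n bG bp'.
have e1 : Ex nu psi' = Ex nu (iter n N psi') by rewrite Ex_iter_transfer.
rewrite -/(Ex nu (fun x => psi (iter n f x) * psi' x)) -/(Ex nu psi) -/(Ex nu psi').
rewrite Ex_koopman//.
have -> : Ex nu psi * Ex nu psi' = Ex nu (fun y => psi y * Ex nu psi').
  by rewrite mulrC -ExZ//; congr (Ex nu _); apply/funext => y; rewrite mulrC.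
apply: Ex_close; do ?[exact: bmeasM|apply: bmeasM => //; exact: bmeas_cst].
move=> x; rewrite -mulrBr normrM.
have -> : C * S * L * rho ^+ n = S * (C * L * rho ^+ n) by ring.
apply: ler_pM => //.
have hN := gap L psi' n hL.
have os y z : `|iter n N psi' y - iter n N psi' z| <= C * L * rho ^+ n.
  by rewrite (le_trans (hN y z))// ler_piMr ?gdist_le1// (hol_ge0 hN).
rewrite -(Ex_cst nu (iter n N psi' x)) e1; apply: Ex_close => //.
exact: bmeas_cst.
Qed.

End transfer_invariance.

(** * Variational principle *)

Section density.
Variables (R : realType) (gam : {posnum R}) (nu : probability (unit_interval R) R).
Hypothesis gam1 : gam%:num <= 1.
Local Notation I := (unit_interval R).
Local Notation hol := (@hol R gam).

Lemma bmeas_abs (u : I -> R) : bmeas u -> bmeas (fun x => `|u x|).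
Proof.
move=> [mu [B hB]]; split; last by exists B => x; rewrite normr_id.
exact: (measurableT_comp (@normr_measurable R setT) mu).
Qed.

Lemma hol_sum (T : Type) (s : seq T) (F : T -> I -> R) :
  (forall i, exists A, hol A (F i)) -> exists A, hol A (fun x => \sum_(i <- s) F i x).
Proof.
move=> hF; elim: s => [|i s [A hA]].
  by exists 0; under eq_fun do rewrite big_nil; exact: hol_cst.
have [B hB] := hF i; exists (B + A).
by under eq_fun do rewrite big_cons; exact: holD.
Qed.

(** Dynkin's theorem again; for a disjoint union the tolerance is halved between the tail and the
    finitely many sets kept, each of which gets an equal share. *)
Lemma hol_dense A : measurable A -> forall e, 0 < e ->
  exists v, (exists B, hol B v) /\ Ex nu (fun x => `|\1_A x - v x|) <= e.
Proof.
pose P : set (set I) := [set A | forall e, 0 < e ->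
  exists v, (exists B, hol B v) /\ Ex nu (fun x => `|\1_A x - v x|) <= e].
rewrite measurable_sublevelsE => sA; suff : P A by [].
move: A sA; apply: (@dynkin_induction _ I (@sublevels R) P); rewrite /P /=.
- exact: measurable_sublevelsE.
- move=> _ _ [x ->] [y ->]; exists (Num.min x y).
  by apply/seteqP; split=> z /=; rewrite le_min => /andP.
- move=> e e0; exists (fun=> 1); split; first by exists 0; exact: hol_cst.
  rewrite (_ : (fun x => _) = fun=> 0) ?Ex_cst ?(ltW e0)//.
  by apply/funext => x; rewrite indicT subrr normr0.
- move=> _ [x ->] e e0.
  have mx := @measurable_sublevel R x.
  pose S := [set y : I | ival y <= x]; pose u k (y : I) := `|\1_S y - ramp x k y|.
  have bu k : bmeas (u k).
    apply: bmeas_abs; apply: bmeasB; [exact: bmeas_indic|exact: (bmeas_ramp gam1)].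
  have : Ex nu (u k) @[k --> \oo] --> Ex nu (fun=> 0).
    apply: (@Ex_cvg _ _ _ _ _ _ 1); last exact: bmeas_cst.
    - by move=> k; case: (bu k).
    - move=> k y; rewrite /u normr_id; have := ramp01 x k y.
      by rewrite indicE; case: (_ \in _) => /=; rewrite ler_norml; lra.
    - move=> y; have -> : 0 = `|\1_S y - \1_S y : R| by rewrite subrr normr0.
      apply: cvg_norm.
      apply: cvgB; [exact: cvg_cst|exact: ramp_cvg].
  rewrite Ex_cst => /cvgrPdist_le /(_ e e0) [k _ /(_ k (leqnn k))] /=.
  rewrite sub0r normrN => h; exists (ramp x k); split.
    by exists k%:R; exact: ramp_hol gam1 x k.
  exact: le_trans (ler_norm _) h.
- move=> S mS hS e e0; have [v [[B hB] hv]] := hS e e0.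
  exists (fun x => 1 - v x); split.
    exists (0 + `|-1| * B); under eq_fun do rewrite -mulN1r.
    by apply: holD; [exact: hol_cst|exact: holZ].
  rewrite (_ : (fun x => `|_ - (1 - v x)|) = (fun x => `|\1_S x - v x|))//; apply/funext => x.
  rewrite -normrN; congr `|_|; rewrite indicC indicE; case: (x \in S) => /=; ring.
- move=> F mF tF hF e e0.
  pose U := \bigcup_k F k; pose u n (x : I) : R := \sum_(i <- iota 0 n) \1_(F i) x.
  have mU : measurable U by exact: bigcupT_measurable.
  have bF i : bmeas (\1_(F i) : I -> R) by exact: bmeas_indic.
  have bu n : bmeas (fun x => `|\1_U x - u n x|).
    by apply: bmeas_abs; apply: bmeasB; [exact: bmeas_indic|exact: bmeas_sum].
  have : Ex nu (fun x => `|\1_U x - u n x|) @[n --> \oo] --> Ex nu (fun=> 0).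
    apply: (@Ex_cvg _ _ _ _ _ _ (1 + 1)); last exact: bmeas_cst.
    - by move=> n; case: (bu n).
    - move=> n x; rewrite normr_id (le_trans (ler_normB _ _))// lerD//.
        by rewrite indicE; case: (_ \in _) => /=; rewrite ?normr1 ?normr0.
      exact: (@indic_sum_bound R _ _ tF n x).
    - move=> x; have -> : 0 = `|\1_U x - \1_U x : R| by rewrite subrr normr0.
      apply: cvg_norm.
      apply: cvgB; [exact: cvg_cst|exact: (@indic_sum_cvg R _ _ tF x)].
  rewrite Ex_cst => /cvgrPdist_le /(_ (e / 2)) []; first by rewrite divr_gt0.
  move=> n _ /(_ n (leqnn n)) /=; rewrite sub0r normrN => /(le_trans (ler_norm _)) hn.
  have en : 0 < e / 2 / n.+1%:R by rewrite !divr_gt0// ltr0n.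
  have /choice[v hv] := fun i => hF i _ en.
  have hvi i : exists B, hol B (v i) by case: (hv i).
  have bv i : bmeas (v i) by have [B hB] := hvi i; exact: hol_bmeas hB.
  have bd i : bmeas (fun x => `|\1_(F i) x - v i x|) by apply: bmeas_abs; exact: bmeasB.
  exists (fun x => \sum_(i <- iota 0 n) v i x); split; first exact: hol_sum.
  have bs : bmeas (fun x => \sum_(i <- iota 0 n) `|\1_(F i) x - v i x|) by exact: bmeas_sum.
  apply: (@le_trans _ _ (Ex nu (fun x => `|\1_U x - u n x| +
     \sum_(i <- iota 0 n) `|\1_(F i) x - v i x|))).
    apply: Ex_le; [|exact: bmeasD|].
      apply: bmeas_abs; apply: bmeasB; [exact: bmeas_indic|exact: bmeas_sum].
    move=> x; rewrite -[\1_U x - _](subrKA (u n x)) (le_trans (ler_normD _ _))// lerD2l.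
    by rewrite /u -sumrB; exact: ler_norm_sum.
  rewrite ExD// Ex_sum// [leRHS](splitr e) lerD//.
  apply: (@le_trans _ _ (\sum_(i <- iota 0 n) e / 2 / n.+1%:R)).
    by apply: ler_sum => i _; case: (hv i).
  rewrite big_const_seq count_predT size_iota iter_addr_0 -(mulr_natr (e / 2 / n.+1%:R)).
  by rewrite mulrAC ler_pdivrMr ?ltr0n// ler_wpM2l ?divr_ge0 ?(ltW e0)// ler_nat.
Qed.

Lemma hol_ln A c (u : I -> R) : 0 < c -> hol A u -> (forall x, c <= u x) ->
  hol (A / c) (fun x => ln (u x)).
Proof.
move=> c0 hA hc x y; have uc z : 1 <= u z / c by rewrite ler_pdivlMr// mul1r.
have u0 z : 0 < u z := lt_le_trans c0 (hc z).
have -> : ln (u x) - ln (u y) = ln (u x / c) - ln (u y / c).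
  by rewrite !ln_div ?posrE//; ring.
rewrite (le_trans (ln_dist (uc x) (uc y)))// -mulrBl normrM (@ger0_norm _ c^-1) ?invr_ge0 ?(ltW c0)//.
by rewrite mulrAC ler_wpM2r ?invr_ge0 ?(ltW c0).
Qed.

(* A labelling is replaced by a Hölder continuous random labelling: [expR (l b x)]
   is the probability of giving the label [b] to [x]. *)
Lemma soft_labels k (xi : I -> 'I_k) e :
  (forall i, measurable (xi @^-1` [set i])) -> 0 < e ->
  exists (l : 'I_k -> I -> R) kf, [/\ exists B, forall b, hol B (l b),
    forall x, \sum_b expR (l b x) = 1, forall x, - l (xi x) x <= kf x,
    bmeas kf & Ex nu kf <= e].
Proof.
move=> mxi e0.
have k0 : (0 < k)%N by apply: leq_ltn_trans (ltn_ord (xi (I0 R))).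
have kr : 0 < k%:R :> R by rewrite ltr0n.
(* The floor [d] keeps the label probabilities positive, so that their logarithms are Hölder; [e']
   is then small against [1 / d], the slope of the logarithm there. *)
pose d := e / 2 / k%:R.
have d0 : 0 < d by rewrite !divr_gt0.
pose e' := e / 2 / k%:R / (1 + d^-1).
have dd : 0 < 1 + d^-1 by rewrite addr_gt0// invr_gt0.
have e'0 : 0 < e' by rewrite divr_gt0.
have /choice[v0 hv0] := fun b => hol_dense (mxi b) e'0.
pose v b x := ival (clampI (v0 b x)).
have v01 b x : 0 <= v b x <= 1 := ival_itv _.
pose J b : I -> R := \1_(xi @^-1` [set b]).
have hv b : exists B, hol B (v b).
  have [[B hB] _] := hv0 b; exists B => x y.
  exact: le_trans (clampI_contr _ _) (hB x y).
have bv b : bmeas (v b) by have [B hB] := hv b; exact: hol_bmeas hB.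
have bJ b : bmeas (J b) by exact: bmeas_indic.
have bd b : bmeas (fun x => `|J b x - v b x|) by apply: bmeas_abs; exact: bmeasB.
have cv b : Ex nu (fun x => `|J b x - v b x|) <= e'.
  have [[B hB] h] := hv0 b; apply: le_trans h; apply: Ex_le => // [|x].
    by apply: bmeas_abs; exact: bmeasB (bJ b) (hol_bmeas hB).
  have -> : J b x = ival (clampI (J b x)).
    by rewrite /J indicE; case: (_ \in _); rewrite /= ?minxx ?min_r ?max_r.
  exact: clampI_contr.
pose Z x := \sum_b (d + v b x).
have Zd x : d <= Z x.
  rewrite /Z (bigD1 (xi x))//= -addrA lerDl addr_ge0//; first by case/andP: (v01 (xi x) x).
  by apply: sumr_ge0 => b _; rewrite addr_ge0 ?(ltW d0)//; case/andP: (v01 b x).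
have Z0 x : 0 < Z x := lt_le_trans d0 (Zd x).
have vd b x : d <= d + v b x by rewrite lerDl; case/andP: (v01 b x).
have vp b x : 0 < d + v b x := lt_le_trans d0 (vd b x).
have hdv b : exists B, hol B (fun x => d + v b x).
  by have [B hB] := hv b; exists (0 + B); apply: holD => //; exact: hol_cst.
have [BZ hZ] : exists B, hol B Z by exact: hol_sum.
exists (fun b x => ln (d + v b x) - ln (Z x)).
exists (fun x => k%:R * d + (1 + d^-1) * \sum_b `|J b x - v b x|); split.
- have /choice[B hB] := hdv.
  exists (\sum_b B b / d + `|-1| * (BZ / d)) => b.
  have h : hol (B b / d + `|-1| * (BZ / d)) (fun x => ln (d + v b x) - ln (Z x)).
    under eq_fun do rewrite -[- ln (Z _)]mulN1r.
    apply: holD; first exact: hol_ln.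
    by apply: holZ; exact: hol_ln.
  apply: hol_le h; rewrite lerD2r (bigD1 b)//= lerDl sumr_ge0// => c _.
  by rewrite divr_ge0 ?(ltW d0)// (hol_ge0 (hB c)).
- move=> x; under eq_bigr do rewrite expRB !lnK ?posrE//.
  by rewrite -mulr_suml -/(Z x) divff// gt_eqF.
- move=> x; rewrite opprB lerBlDr.
  set a := xi x; have Ja : J a x = 1 by rewrite /J indicE mem_set.
  have h1 : ln (Z x) <= k%:R * d + \sum_b `|J b x - v b x|.
    have h : ln (Z x) <= Z x - 1.
      rewrite -[X in ln X](subrKC 1); apply: le_ln1Dx; by rewrite ltrBrDl subrr.
    have ZE : Z x = k%:R * d + \sum_b v b x.
      by rewrite /Z big_split /= sumr_const card_ord mulr_natl.
    have s1 : \sum_b J b x = 1.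
      rewrite (bigD1 a)//= Ja big1 ?addr0// => b ba; rewrite /J indicE memNset//= => /esym/eqP.
      by rewrite (negbTE ba).
    have s2 : \sum_b v b x <= \sum_b J b x + \sum_b `|J b x - v b x|.
      rewrite -big_split /=; apply: ler_sum => b _.
      by rewrite -lerBlDl -normrN opprB ler_norm.
    move: h s2; rewrite ZE s1; lra.
  have h2 : - ln (d + v a x) <= d^-1 * \sum_b `|J b x - v b x|.
    apply: (@le_trans _ _ (d^-1 * `|J a x - v a x|)); last first.
      rewrite ler_wpM2l ?invr_ge0 ?(ltW d0)// (bigD1 a)//= lerDl.
      by apply: sumr_ge0.
    rewrite Ja ger0_norm; last by rewrite subr_ge0; case/andP: (v01 a x).
    rewrite -lnV ?posrE//.
    rewrite -[X in ln X](subrKC 1) (le_trans (le_ln1Dx _))//.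
      by rewrite ltrBrDl subrr invr_gt0.
    have -> : (d + v a x)^-1 - 1 = (1 - (d + v a x)) * (d + v a x)^-1.
      by rewrite mulrBl mul1r divff// gt_eqF.
    apply: (@le_trans _ _ ((1 - v a x) * (d + v a x)^-1)).
      by rewrite ler_wpM2r ?invr_ge0 ?(ltW (vp _ _))// lerD2l lerN2 lerDr ltW.
    rewrite mulrC ler_wpM2r ?subr_ge0 ?lef_pV2 ?posrE//; by case/andP: (v01 a x).
  rewrite mulrDl mul1r; lra.
- apply: bmeasD; first exact: bmeas_cst.
  by apply: bmeasZ; exact: bmeas_sum.
- have bs : bmeas (fun x => \sum_b `|J b x - v b x|) by exact: bmeas_sum.
  rewrite ExD ?Ex_cst ?ExZ ?Ex_sum//; [|exact: bmeas_cst|exact: bmeasZ].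
  rewrite [leRHS](splitr e) lerD//; first by rewrite /d mulrC divfK// gt_eqF.
  apply: (@le_trans _ _ ((1 + d^-1) * \sum_(b : 'I_k) e')).
    by rewrite ler_wpM2l ?(ltW dd)//; apply: ler_sum => b _; exact: cv.
  have e'E : (1 + d^-1) * e' = e / 2 / k%:R by rewrite /e' mulrC divfK// gt_eqF.
  by rewrite sumr_const card_ord mulrnAr e'E -mulr_natr divfK// gt_eqF.
Qed.

End density.

(** * Upper bound for the entropy by Gibbs' inequality *)

Section entropy_upper.
Variables (R : realType) (alpha gam : {posnum R}).
Hypothesis gam1 : gam%:num <= 1.
Local Notation I := (unit_interval R).
Local Notation g := (inv_branch alpha).
Local Notation gw := (gw alpha).
Local Notation f := (intermittent_map alpha).
Local Notation hol := (@hol R gam).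
Local Notation xs := (xs alpha).
Local Notation wexp := (wexp alpha).
Implicit Types phi : I -> R.

Lemma Ex_invariant nu psi : invariant_measure alpha nu -> bmeas psi ->
  Ex nu (fun x => psi (f x)) = Ex nu psi.
Proof.
move=> inv; move: psi.
have mf := measurable_map alpha.
have bf (u : I -> R) : bmeas u -> bmeas (fun x : I => u (f x)).
  by move=> bu; have := bmeas_comp bu mf.
apply: (functional_ext (F1 := fun u => Ex nu (fun x => u (f x))) (F2 := Ex nu)) => [F [->|->]|A mA].
- split => [u v bu bv|c u bu|u v e bu bv h].
  + by rewrite ExD//; exact: bf.
  + by rewrite ExZ//; exact: bf.
  + by apply: Ex_close => //; exact: bf.
- split => [u v bu bv|c u bu|u v e bu bv h].
  + by rewrite ExD.
  + by rewrite ExZ.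
  + exact: Ex_close.
have mfA : measurable (f @^-1` A) by have := mf measurableT A mA; rewrite setTI.
transitivity (Ex nu (\1_(f @^-1` A))); first by [].
by rewrite !Ex_indic// inv.
Qed.

Lemma Ex_iter_invariant nu psi n : invariant_measure alpha nu -> bmeas psi ->
  Ex nu (fun x => psi (iter n f x)) = Ex nu psi.
Proof.
move=> inv bp; elim: n => // n ih; under eq_fun do rewrite iterSr.
rewrite -[RHS]ih; apply: (@Ex_invariant nu (fun x => psi (iter n f x))) => //.
by apply: bmeas_comp => //; exact: measurable_iter_map.
Qed.

Lemma wt_wexpE phi i x : wt alpha (wexp phi) i x =
  expR (\sum_(j < size i) phi (gw (drop j i) x)).
Proof.
elim: i => [|a i ih]; first by rewrite big_ord0 expR0.
by rewrite /= big_ord_recl /= expRD ih mulrC.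
Qed.

Lemma gw_drop_itin n j y : (j <= n)%N -> gw (drop j (itin alpha n y)) (iter n f y) = iter j f y.
Proof.
elim: j n y => [|j ih] n y; first by rewrite drop0 gw_itin.
by case: n => // n jn; rewrite iterSr ih// -iterSr.
Qed.

(** As [xs] tends to 0, these sums are sublinear. They control the distortion of Birkhoff sums,
    which is enough for exponential rates. *)
Lemma sum_xs_sublinear A e : 0 <= A -> 0 < e -> exists C, forall n,
  \sum_(j < n) A * xs (n - j) `^ gam%:num <= C + n%:R * e.
Proof.
move=> A0 e0; have [d d0 hd] := powR_small gam (divr_gt0 e0 (ltr_pwDr ltr01 A0)).
have [M hM] := xs_small alpha d0.
exists (A * M%:R) => n.
have small m : A * xs m `^ gam%:num <= e + A * (m < M)%:R.
  case: ltnP => mM /=.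
    rewrite mulr1 ler_wpDl ?(ltW e0)// ler_piMr//.
    by rewrite powR_al_le1// xs_ge0 ival_le1.
  rewrite mulr0 addr0.
  have x1 : xs m `^ gam%:num <= e / (A + 1).
    apply: hd; [exact: xs_ge0|exact: le_trans (xs_antitone alpha mM) (ltW hM)].
  rewrite (le_trans (ler_wpM2l A0 x1))// mulrA ler_pdivrMr ?ltr_pwDr// mulrC ler_pM2l//.
  by rewrite lerDl.
rewrite (reindex_inj rev_ord_inj)/=.
apply: (@le_trans _ _ (\sum_(j < n) (e + A * (j < M)%:R))).
  apply: ler_sum => j _; have -> : (n - (n - j.+1))%N = j.+1 by have := ltn_ord j; lia.
  rewrite (le_trans (small _))// lerD2l ler_wpM2l// ler_nat.
  by case: (ltnP j.+1 M) => //= h; rewrite (ltn_trans _ h).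
rewrite big_split /= sumr_const card_ord -mulr_sumr sum_lt_min.
have h : A * (minn n M)%:R <= A * M%:R by rewrite ler_wpM2l// ler_nat geq_minr.
by have := lerD h (lexx (n%:R * e)); rewrite mulr_natl addrC.
Qed.

Lemma gibbs_inequality (T : finType) (p q : T -> R) : (forall t, 0 <= p t) ->
  (forall t, 0 < q t) -> \sum_t p t = 1 -> \sum_t q t <= 1 ->
  \sum_t - (p t * ln (p t)) <= \sum_t p t * (- ln (q t)).
Proof.
move=> p0 q0 p1 q1; rewrite -subr_le0 -sumrB.
apply: (@le_trans _ _ (\sum_t (q t - p t))); last by rewrite sumrB p1 subr_le0.
apply: ler_sum => t _; have := p0 t; rewrite le_eqVlt => /predU1P[<-|pt].
  by rewrite !mul0r oppr0 !addr0 ltW.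
have := @le_ln1Dx R (q t / p t - 1); rewrite subrKC ln_div ?posrE// => h.
have {}h : ln (q t) - ln (p t) <= q t / p t - 1 by apply: h; rewrite ltrBrDl subrr divr_gt0.
have := ler_wpM2l (ltW pt) h; rewrite !mulrBr mulrCA divff ?gt_eqF// mulr1.
by rewrite mulrN; lra.
Qed.

Lemma measurable_cylinder k (xi : I -> 'I_k) n w :
  (forall i, measurable (xi @^-1` [set i])) -> measurable (@cylinder R alpha k xi n w).
Proof.
move=> mxi; rewrite (_ : cylinder _ _ _ = \bigcap_(j in [set: 'I_n])
    (iter j f @^-1` (xi @^-1` [set w j]))); last first.
  by apply/seteqP; split => x /= h j; [move=> _|]; exact: h.
apply: fin_bigcap_measurable; first exact: finite_finset.
move=> j _; have := measurable_iter_map alpha j measurableT (mxi (w j)).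
by rewrite setTI.
Qed.

Definition label k (xi : I -> 'I_k) n (y : I) : {ffun 'I_n -> 'I_k} :=
  [ffun j : 'I_n => xi (iter j f y)].

Lemma cylinder_label k (xi : I -> 'I_k) n w y :
  cylinder alpha xi w y <-> w = label xi n y.
Proof.
split; first by move=> h; apply/ffunP => j; rewrite ffunE -h.
by move=> -> j; rewrite ffunE.
Qed.

Lemma simple_label k (xi : I -> 'I_k) n (F : {ffun 'I_n -> 'I_k} -> R) y :
  \sum_w F w * \1_(cylinder alpha xi w) y = F (label xi n y).
Proof.
rewrite (bigD1 (label xi n y))//= indicE mem_set ?mulr1; last exact/cylinder_label.
rewrite big1 ?addr0// => w; rewrite indicE => wn; rewrite memNset ?mulr0//.
by move/cylinder_label => e; rewrite e eqxx in wn.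
Qed.

Lemma Ex_label nu k (xi : I -> 'I_k) n (F : {ffun 'I_n -> 'I_k} -> R) :
  (forall i, measurable (xi @^-1` [set i])) ->
  bmeas (fun y => F (label xi n y)) /\
  Ex nu (fun y => F (label xi n y)) = \sum_w fine (nu (cylinder alpha xi w)) * F w.
Proof.
move=> mxi; have bw w : bmeas (fun y => F w * \1_(@cylinder R alpha k xi n w) y).
  by apply: bmeasZ; apply: bmeas_indic; exact: measurable_cylinder.
under eq_fun do rewrite -simple_label.
split; first exact: bmeas_sum.
rewrite Ex_sum//; apply: eq_bigr => w _.
have mw := @measurable_cylinder k xi n w mxi.
by rewrite ExZ ?Ex_indic// 1?mulrC//; exact: bmeas_indic.
Qed.

(* Gibbs' inequality against the random labelling of the preimages of a base point. *)
Lemma partition_entropy_bound nu k (xi : I -> 'I_k) A phi e :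
  invariant_measure alpha nu -> (forall i, measurable (xi @^-1` [set i])) ->
  hol A phi -> 0 < e ->
  exists C, forall n, partition_entropy alpha nu xi n <= C + n%:R * (Ptop alpha phi - Ex nu phi + e).
Proof.
move=> inv mxi hA e0; have e3 : 0 < e / 3 by rewrite divr_gt0.
have bphi := hol_bmeas hA.
have [l [kf [[B hl] l1 lk bk kE]]] := soft_labels nu gam1 mxi e3.
have [D hD] := @sum_xs_sublinear (A + `|B|) (e / 3) (addr_ge0 (hol_ge0 hA) (normr_ge0 _)) e3.
have bdphi : bdd phi by case: bphi => _.
have [|C0 hC0] := @Ptop_growth R alpha phi (Ptop alpha phi + e / 3) bdphi; first by rewrite ltrDl.
pose C := Num.max C0 1; have C1 : 0 < C by rewrite lt_max ltr01 orbT.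
pose x0 := I0 R.
exists (ln C + D) => n.
(* Draw a word [i] according to its weight, then labels along [gw i x0] and its successive images
   with the soft probabilities: [q w] is the resulting probability of [w]. *)
pose S (i : seq bool) (w : {ffun 'I_n -> 'I_k}) x :=
  \sum_(j < n) (phi (gw (drop j i) x) + l (w j) (gw (drop j i) x)).
pose Z := tr1 alpha (wexp phi) n x0.
have Zp : 0 < Z.
  have := @tr1_ge_word R alpha (wexp phi) n (nseq n false) x0 (@wexp_ge0 R alpha phi) (size_nseq n false).
  apply: lt_le_trans.
  by apply: wt_gt0 => a y; exact: wexp_gt0.
pose q w := (\sum_(i <- words n) expR (S i w x0)) / Z.
have q0 w : 0 < q w.
  rewrite divr_gt0// (big_rem (nseq n false)) ?mem_words ?size_nseq//=.
  by rewrite ltr_pwDl ?expR_gt0// sumr_ge0// => i _; exact: expR_ge0.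
have q1 : \sum_w q w = 1.
  rewrite -mulr_suml exchange_big /= -[RHS](divff (lt0r_neq0 Zp)); congr (_ / _).
  rewrite /Z tr1E big_seq [RHS]big_seq; apply: eq_bigr => i /size_words si.
  rewrite wt_wexpE si expR_sum -[RHS]mulr1.
  under eq_bigr do rewrite /S big_split /= expRD !expR_sum.
  rewrite -mulr_sumr; congr (_ * _).
  rewrite -(bigA_distr_bigA (fun (j : 'I_n) b => expR (l b (gw (drop j i) x0)))) /=.
  by apply: big1 => j _; exact: l1.
pose p w := fine (nu (@cylinder R alpha k xi n w)).
have p0 w : 0 <= p w by rewrite fine_ge0.
have p1 : \sum_w p w = 1.
  have [_] := Ex_label nu (fun _ : {ffun 'I_n -> 'I_k} => 1) mxi.
  by rewrite Ex_cst; under eq_bigr do rewrite mulr1.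
have q1' : \sum_w q w <= 1 by rewrite q1.
have := gibbs_inequality p0 q0 p1 q1'.
move=> /le_trans; apply.
have [bq <-] := Ex_label nu (fun w => - ln (q w)) mxi.
pose U j (y : I) := kf (iter j f y) - phi (iter j f y).
have bU j : bmeas (U j).
  by apply: (@bmeas_comp R _ _ (fun x => kf x - phi x)); [exact: bmeasB|exact: measurable_iter_map].
apply: (@le_trans _ _ (Ex nu (fun y => (ln Z + (D + n%:R * (e / 3))) + \sum_(j < n) U j y))).
  apply: Ex_le => //.
    by apply: bmeasD; [exact: bmeas_cst|exact: bmeas_sum].
  move=> y; pose w := label xi n y; pose i := itin alpha n y; rewrite -/w.
  have hS : expR (S i w x0) / Z <= q w.
    rewrite ler_pM2r ?invr_gt0// (big_rem i) ?mem_words ?size_itin//= lerDl.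
    by apply: sumr_ge0 => v _; exact: expR_ge0.
  have h1 : S i w x0 - ln Z <= ln (q w).
    rewrite -[S i w x0]expRK -ln_div ?posrE ?expR_gt0//.
    by rewrite ler_ln ?posrE// divr_gt0// expR_gt0.
  have h2 : \sum_(j < n) (phi (iter j f y) + l (w j) (iter j f y)) - S i w x0 <= D + n%:R * (e / 3).
    rewrite (le_trans _ (hD n))// -sumrB; apply: ler_sum => j _.
    rewrite -(@gw_drop_itin n j y (ltnW (ltn_ord j))).
    set u := gw _ _; set v := gw _ x0.
    have dist : gdist gam u v <= xs (n - j) `^ gam%:num.
      rewrite ge0_ler_powR ?nnegrE ?xs_ge0// (le_trans (gw_contr _ _ _ _))//.
      by rewrite size_drop size_itin.
    rewrite opprD addrACA mulrDl lerD//.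
      rewrite (le_trans (ler_norm _))// (le_trans (hA _ _))//.
      by rewrite ler_wpM2l ?(hol_ge0 hA).
    rewrite (le_trans (ler_norm _))// (le_trans (hl _ _ _))//.
    by rewrite (le_trans (ler_wpM2r (gdist_ge0 _ _ _) (ler_norm B)))// ler_wpM2l.
  have h3 : - \sum_(j < n) (phi (iter j f y) + l (w j) (iter j f y)) <= \sum_(j < n) U j y.
    rewrite -sumrN; apply: ler_sum => j _.
    by rewrite opprD addrC lerD2r /w ffunE lk.
  lra.
rewrite ExD; [|exact: bmeas_cst|exact: bmeas_sum].
rewrite Ex_cst Ex_sum//.
have -> : \sum_(j < n) Ex nu (U j) = n%:R * (Ex nu kf - Ex nu phi).
  rewrite -[n in n%:R]card_ord mulr_natl -sumr_const; apply: eq_bigr => j _.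
  rewrite -ExB//; apply: (@Ex_iter_invariant nu (fun x => kf x - phi x)) => //.
  exact: bmeasB.
have lnZ : ln Z <= ln C + n%:R * (Ptop alpha phi + e / 3).
  rewrite -[n%:R * _]expRK -lnM ?posrE ?expR_gt0// ler_ln ?posrE ?mulr_gt0 ?expR_gt0//.
  by rewrite (le_trans (hC0 n x0))// ler_wpM2r ?expR_ge0// le_max lexx.
have := ler_wpM2l (ler0n R n) kE; lra.
Qed.

End entropy_upper.

Section entropy.
Variables (R : realType) (alpha gam : {posnum R}).
Hypothesis gam1 : gam%:num <= 1.
Local Notation I := (unit_interval R).
Local Notation gw := (gw alpha).
Local Notation f := (intermittent_map alpha).
Local Notation hol := (@hol R gam).
Local Notation Ptop := (Ptop alpha).
Implicit Types (phi : I -> R) (nu : probability I R).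

Lemma sublinear_rate (u : nat -> R) B :
  (forall e, 0 < e -> exists C, forall n, u n <= C + n%:R * (B + e)) ->
  forall e, 0 < e -> \forall n \near \oo, u n / n%:R <= B + e.
Proof.
move=> h e e0; have e2 : 0 < e / 2 by rewrite divr_gt0.
have [C hC] := h _ e2; near=> n.
have n0 : 0 < n%:R :> R by rewrite ltr0n; near: n; exists 1%N.
rewrite ler_pdivrMr// (le_trans (hC n))//.
suff : C <= n%:R * (e / 2) by lra.
rewrite -ler_pdivrMr//; near: n; exact: nbhs_infty_ger.
Unshelve. all: by end_near. Qed.

Lemma partition_entropy1 nu (xi : I -> 'I_1) n : partition_entropy alpha nu xi n = 0.
Proof.
rewrite /partition_entropy big1// => w _.
rewrite (_ : cylinder _ _ _ = setT) ?probability_setT /= ?ln1 ?mulr0 ?oppr0//.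
by apply/seteqP; split => // x _ j; rewrite !ord1.
Qed.

Lemma entropy_wrt1 nu (xi : I -> 'I_1) : entropy_wrt alpha nu xi = 0%E.
Proof.
rewrite /entropy_wrt; under eq_fun do rewrite partition_entropy1 mul0r.
exact: lim_cst.
Qed.

Lemma measurable_label1 (xi : I -> 'I_1) i : measurable (xi @^-1` [set i]).
Proof.
rewrite (_ : _ @^-1` _ = setT); first exact: measurableT.
by apply/seteqP; split => // x _ /=; rewrite !ord1.
Qed.

Lemma entropy_ge0 nu : (0 <= entropy alpha nu)%E.
Proof.
apply: ereal_sup_ubound; exists 1%N, (fun=> ord0).
by rewrite entropy_wrt1; split => // i; exact: measurable_label1.
Qed.

(** The one-piece partition has zero entropy, so its entropy bound forces [Ptop phi - Ex nu phi + e]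
    to be nonnegative for every [e > 0]. *)
Lemma invariant_Ex_le nu A phi : invariant_measure alpha nu -> hol A phi ->
  Ex nu phi <= Ptop phi.
Proof.
move=> inv hA; apply/ler_addgt0Pr => e e0.
have [C hC] := partition_entropy_bound gam1 inv
  (measurable_label1 (fun=> ord0)) hA e0.
rewrite leNgt; apply/negP => hlt.
have d0 : 0 < Ex nu phi - (Ptop phi + e) by rewrite subr_gt0.
have := hC (Num.truncn (C / (Ex nu phi - (Ptop phi + e)))).+1.
rewrite partition_entropy1 leNgt => /negP; apply.
have := truncnS_gt (C / (Ex nu phi - (Ptop phi + e))).
rewrite ltr_pdivrMr// => h.
rewrite -ltrBrDr sub0r -mulrN (lt_le_trans h)// ler_wpM2l//; lra.
Qed.

Lemma entropy_le nu A phi : invariant_measure alpha nu -> hol A phi ->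
  (entropy alpha nu <= (Ptop phi - Ex nu phi)%:E)%E.
Proof.
move=> inv hA; apply: ge_ereal_sup => _ [k [xi [mxi ->]]].
(* If the rates do not converge, [limn] is the default value 0, and the bound is
   [invariant_Ex_le]. *)
rewrite /entropy_wrt; have [cu|/dvgP->] := pselect (cvgn (fun n =>
    (partition_entropy alpha nu xi n / n%:R)%:E)); last first.
  by rewrite -[point]/(0%:E) lee_fin subr_ge0; exact: invariant_Ex_le hA.
apply/lee_addgt0Pr => e e0; apply: lime_le => //.
have := sublinear_rate (fun e => partition_entropy_bound gam1 inv mxi hA (e := e)) e0.
by apply: filterS => n; rewrite -EFinD lee_fin.
Qed.

Lemma free_energy_le nu A phi : invariant_measure alpha nu -> hol A phi ->
  (entropy alpha nu + \int[nu]_x (phi x)%:E <= (Ptop phi)%:E)%E.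
Proof.
move=> inv hA; rewrite ExE; last exact: hol_bmeas hA.
by rewrite -leeBrDr// -EFinB; exact: entropy_le.
Qed.

Lemma delta0_invariant : invariant_measure alpha (delta0 R).
Proof.
have f0 : f (I0 R) = I0 R.
  by rewrite -{1}(inv_branch0 alpha) map_inv_branch.
move=> A mA; rewrite -[LHS]/(dirac (I0 R) (f @^-1` A)) -[RHS]/(dirac (I0 R) A) !diracE; congr (_%:R%:E).
by congr (nat_of_bool _); apply/idP/idP; rewrite !inE /= f0.
Qed.

Lemma Ex_delta0 A phi : hol A phi -> Ex (delta0 R) phi = phi (I0 R).
Proof.
move=> hA; apply: EFin_inj; rewrite -ExE; last exact: hol_bmeas hA.
rewrite integral_dirac ?diracT ?mul1e//.
by apply/measurable_EFinP; exact: hol_measurable hA.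
Qed.

Lemma itin1_inv_branch a x : 0 < ival x -> itin1 alpha (inv_branch alpha a x) = a.
Proof.
move=> x0; rewrite /itin1 inv_branchK; case: a => /=; first by rewrite ltrDr.
by rewrite addr0 ltNge ival_le1.
Qed.

Lemma itin_gw w x : 0 < ival x -> itin alpha (size w) (gw w x) = w.
Proof.
move=> x0; elim: w => //= a w ih.
have gw0 : 0 < ival (gw w x).
  elim: w {ih} => //= b w ih; rewrite (le_lt_trans _ (_ : ival (inv_branch alpha b (I0 R)) < _)) ?ival_ge0//.
  by rewrite inv_branch_lt.
by rewrite itin1_inv_branch// map_inv_branch ?ih// gw0 implybT.
Qed.

Lemma itinE n y : itin alpha n y = [seq itin1 alpha (iter j f y) | j : 'I_n].
Proof.
elim: n y => [|n ih] y; first by apply/esym/size0nil; rewrite size_map size_enum_ord.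
by rewrite /image_mem enum_ordSl /= ih /image_mem -map_comp; congr cons; apply: eq_map => j /=; rewrite add0n -iterS iterSr.
Qed.

Lemma wexp_distortion A phi i x y : hol A phi ->
  wt alpha (wexp alpha phi) i x <=
  expR (\sum_(j < size i) A * xs alpha (size i - j) `^ gam%:num) * wt alpha (wexp alpha phi) i y.
Proof.
move=> hA; rewrite !wt_wexpE -expRD ler_expR -lerBlDr -sumrB; apply: ler_sum => j _.
rewrite (le_trans (ler_norm _))// (le_trans (hA _ _))// ler_wpM2l ?(hol_ge0 hA)//.
by rewrite ge0_ler_powR ?nnegrE ?xs_ge0// (le_trans (gw_contr _ _ _ _))// size_drop.
Qed.

End entropy.

(** * Entropy of the stationary measure *)

Section gibbs_measure.
Variables (R : realType) (alpha gam : {posnum R}).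
Hypothesis gam1 : gam%:num <= 1.
Local Notation I := (unit_interval R).
Local Notation gw := (gw alpha).
Local Notation f := (intermittent_map alpha).
Local Notation hol := (@hol R gam).
Variables (A0 : R) (phi : I -> R).
Hypotheses (phi_hol : hol A0 phi) (phi_P : Ptop alpha phi = 0) (phi_neg : phi (I0 R) < 0).
Variables (h : I -> R) (c K : R).
Hypotheses (c0 : 0 < c) (hc : forall x, c <= h x <= 1) (hK : hol K h)
  (hh : forall x, transfer alpha (wexp alpha phi) h x = h x).
Local Notation G := (gfun alpha phi h).
Local Notation W := (wexp alpha phi).
Variable nu : probability I R.
Hypothesis nuH : forall A psi, hol A psi -> Ex nu (transfer alpha G psi) = Ex nu psi.

Let G0 : nonneg G := gfun_ge0 alpha phi c0 hc.
Let G1 : markov G := gfun_markov c0 hc hh.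
Let bG a : bmeas (G a).
Proof. by have [H hH] := gfun_hol alpha phi_hol c0 hc hK; exact: hol_bmeas (hH a). Qed.

Definition branch_label (y : I) : 'I_2 := inord (itin1 alpha y).

Lemma measurable_branch_label i : measurable (branch_label @^-1` [set i]).
Proof.
have m1 := measurable_itin1 alpha.
have [i0|i1] : i = ord0 \/ i = inord 1.
  by case: i => [[|[|//]] hi]; [left|right]; apply: ord_inj; rewrite //= inordK.
- rewrite (_ : _ @^-1` _ = ~` [set y : I | itin1 alpha y]); first exact: measurableC.
  apply/seteqP; split => y /=; rewrite i0 /branch_label; case: itin1 => //=.
    by move=> /(congr1 val) /=; rewrite inordK.
  by move=> _; apply: ord_inj; rewrite inordK.
- rewrite (_ : _ @^-1` _ = [set y : I | itin1 alpha y])//.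
  apply/seteqP; split => y /=; rewrite i1 /branch_label; case: itin1 => //=.
  by move=> /(congr1 val) /=; rewrite !inordK.
Qed.

Definition label_word n (w : {ffun 'I_n -> 'I_2}) : seq bool :=
  [seq w j == inord 1 | j : 'I_n].

Lemma size_label_word n (w : {ffun 'I_n -> 'I_2}) : size (label_word w) = n.
Proof. by rewrite size_map size_enum_ord. Qed.

Lemma label_word_label n y : label_word (label alpha branch_label n y) = itin alpha n y.
Proof.
rewrite itinE; apply: eq_map => j; rewrite ffunE /branch_label.
case: itin1; first by rewrite eqxx.
by apply/eqP => /(congr1 val) /=; rewrite !inordK.
Qed.

(** The measure of a cylinder is the integral of [N^n] of its indicator, and over a base point other
    than 0 only the word of that cylinder can contribute. *)
Lemma cylinder_measure_le n (w : {ffun 'I_n -> 'I_2}) B :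
  (forall x, wt alpha G (label_word w) x <= B) ->
  fine (nu (cylinder alpha branch_label w)) <= B.
Proof.
move=> hB; have [d d0 dG] := gfun_floor alpha phi_hol c0 hc.
have B0 : 0 <= B := le_trans (@wt_ge0 R alpha G (label_word w) (I0 R) G0) (hB (I0 R)).
set S := cylinder _ _ _.
have mS : measurable S := measurable_cylinder alpha w measurable_branch_label.
have bS := bmeas_indic R mS.
have mz := @measurable_zero R; have bz := bmeas_indic R mz.
rewrite -Ex_indic// -(Ex_iter_transfer gam1 G0 G1 bG nuH n bS).
have bN : bmeas (iter n (transfer alpha G) (\1_S)) by exact: bmeas_iter_transfer.
pose v (x : I) := iter n (transfer alpha G) (\1_S) x * (1 - \1_[set I0 R] x).
have bv : bmeas v.
  by apply: bmeasM => //; apply: bmeasB => //; exact: bmeas_cst.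
rewrite (Ex_off_zero gam1 G0 G1 bG d0 dG nuH bN bv); last first.
  by move=> x x0; rewrite /v [\1__ x]indicE memNset// subr0 mulr1.
rewrite -(Ex_cst nu B); apply: Ex_le => // [|x]; first exact: bmeas_cst.
rewrite /v; have [->|x0] := pselect (x = I0 R).
  by rewrite [\1_[set I0 R] _]indicE mem_set// subrr mulr0.
rewrite [\1_[set I0 R] _]indicE memNset// subr0 mulr1 iter_transferE.
have xp : 0 < ival x.
  by rewrite lt_neqAle ival_ge0 andbT eq_sym; apply/eqP => e; apply/x0/ival_inj.
apply: le_trans (hB x).
rewrite (big_rem (label_word w)) ?mem_words ?size_label_word//=.
rewrite [X in _ + X]big_seq big1 ?addr0 => [|i].
  rewrite ler_piMr ?wt_ge0// indicE; case: (_ \in _) => //.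
rewrite mem_rem_uniq ?uniq_words// inE => /andP[iw iwd].
rewrite indicE memNset ?mulr0// => /cylinder_label ew.
move: iw; rewrite ew label_word_label -(size_words iwd) itin_gw ?eqxx//.
Qed.

Local Notation H := (partition_entropy alpha nu branch_label).

Lemma partition_entropy_ge_bound n (b : {ffun 'I_n -> 'I_2} -> R) :
  (forall w, 0 < b w) -> (forall w, fine (nu (cylinder alpha branch_label w)) <= b w) ->
  Ex nu (fun y => - ln (b (label alpha branch_label n y))) <= H n.
Proof.
move=> b0 hb.
have [_ ->] := Ex_label alpha nu (fun w => - ln (b w)) measurable_branch_label (n := n).
apply: ler_sum => w _; rewrite -mulrN.
set p := fine _; have := fine_ge0 (measure_ge0 nu (cylinder alpha branch_label w)).
rewrite -/p le_eqVlt => /predU1P[<-|p0]; first by rewrite !mul0r.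
by rewrite ler_wpM2l ?(ltW p0)// lerN2 ler_ln ?posrE//; exact: hb.
Qed.

Lemma partition_entropy_linear : exists2 kp, 0 < kp & forall n, n%:R * kp <= H n.
Proof.
have [d d0 dG] := gfun_floor alpha phi_hol c0 hc.
(* The two weights add up to 1 and are at least [d], so neither exceeds [1 - d]; the maximum with
   1/2 makes positivity immediate. *)
pose r := Num.max (1 - d) (1 / 2).
have r0 : 0 < r by rewrite lt_max divr_gt0 ?orbT.
have r1 : r < 1 by rewrite gt_max ltrBlDr ltrDl d0; lra.
have Gr a x : G a x <= r.
  rewrite le_max; apply/orP; left.
  have e : G false x + G true x = 1 := G1 x.
  have := dG false x; have := dG true x; case: a; lra.
exists (- ln r) => [|n]; first by rewrite oppr_gt0 ln_lt0// r0.
have := @partition_entropy_ge_bound n (fun=> r ^+ n).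
rewrite Ex_cst => /(_ _ _)/(le_trans _); apply.
- by rewrite lnXn// mulr_natl mulNrn.
- by move=> w; rewrite exprn_gt0.
- move=> w; apply: cylinder_measure_le => x.
  by rewrite -[n in _ ^+ n](size_label_word w); exact: wt_le.
Qed.

(** Up to the factor [c^-1], the Markov weights of words are bounded by the weights of [phi], which
    are exponentials of Birkhoff sums up to a sublinear distortion; by invariance these sums
    integrate to [n * Ex nu phi]. *)
Lemma partition_entropy_lower e : 0 < e -> exists C, forall n,
  n%:R * (- Ex nu phi - e) - C <= H n.
Proof.
move=> e0; have e2 : 0 < e / 2 by rewrite divr_gt0.
have bphi := hol_bmeas phi_hol.
have [d d0 dG] := gfun_floor alpha phi_hol c0 hc.
have inv := stationary_invariant gam1 G0 G1 bG d0 dG nuH.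
have [C hC] := sum_xs_sublinear alpha gam1 (hol_ge0 phi_hol) e2.
exists (ln c^-1 + C + C) => n.
set D := \sum_(j < n) A0 * xs alpha (n - j) `^ gam%:num in hC *.
have ci : 0 < c^-1 by rewrite invr_gt0.
pose b (w : {ffun 'I_n -> 'I_2}) := c^-1 * (expR D * wt alpha W (label_word w) (I0 R)).
have W0 w : 0 < wt alpha W w (I0 R) by apply: wt_gt0 => a y; exact: wexp_gt0.
have b0 w : 0 < b w by rewrite !mulr_gt0 ?expR_gt0.
apply: le_trans (partition_entropy_ge_bound b0 _); last first.
  move=> w; apply: cylinder_measure_le => x.
  rewrite (le_trans (wt_gfun_le alpha phi c0 hc _ _))// ler_pM2l//.
  by have := wexp_distortion alpha (label_word w) x (I0 R) phi_hol; rewrite size_label_word.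
have bs : bmeas (fun y => \sum_(j < n) phi (iter j f y)).
  by apply: bmeas_sum => j; apply: bmeas_comp => //; exact: measurable_iter_map.
have [bb _] := Ex_label alpha nu (fun w => - ln (b w)) measurable_branch_label (n := n).
apply: (@le_trans _ _ (Ex nu (fun y => (- ln c^-1 - D - D) - \sum_(j < n) phi (iter j f y)))).
  have bj (j : 'I_n) : bmeas (fun x => phi (iter j f x)).
    by apply: bmeas_comp => //; exact: measurable_iter_map.
  rewrite ExB ?Ex_cst ?Ex_sum//; last exact: bmeas_cst.
  rewrite (eq_bigr (fun=> Ex nu phi)) => [|j _]; last exact: Ex_iter_invariant.
  have E : Ex nu phi *+ n = n%:R * Ex nu phi by rewrite mulr_natl.
  rewrite sumr_const card_ord E; have := hC n; rewrite -/D; lra.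
apply: Ex_le => //; first by apply: bmeasB => //; exact: bmeas_cst.
move=> y; rewrite /b label_word_label !lnM ?posrE ?mulr_gt0 ?expR_gt0// expRK.
have := wexp_distortion alpha (itin alpha n y) (I0 R) (iter n f y) phi_hol.
rewrite size_itin -/D => hd.
have : ln (wt alpha W (itin alpha n y) (I0 R)) <= D + \sum_(j < n) phi (iter j f y).
  rewrite -ler_expR lnK ?posrE// (le_trans hd)// expRD ler_pM2l ?expR_gt0//.
  rewrite wt_wexpE size_itin ler_expR; apply: ler_sum => j _.
  by rewrite gw_drop_itin// ltnW.
lra.
Qed.

Lemma entropy_stationary :
  entropy alpha nu = (- Ex nu phi)%:E /\ (0 < entropy alpha nu)%E.
Proof.
have [d d0 dG] := gfun_floor alpha phi_hol c0 hc.
have inv := stationary_invariant gam1 G0 G1 bG d0 dG nuH.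
have up e : 0 < e -> exists C, forall n, H n <= C + n%:R * (- Ex nu phi + e).
  move=> e0; have [C hC] := partition_entropy_bound gam1 inv measurable_branch_label phi_hol e0.
  by exists C => n; have := hC n; rewrite phi_P sub0r.
have lo e : 0 < e -> exists C, forall n, - H n <= C + n%:R * (Ex nu phi + e).
  move=> e0; have [C hC] := partition_entropy_lower e0.
  by exists C => n; rewrite lerNl opprD -mulrN opprD addrC; exact: hC.
(* The two bounds hold for every [e], so the rates converge and the [limn] in [entropy_wrt] is a
   genuine limit. *)
have cvH : H n / n%:R @[n --> \oo] --> - Ex nu phi.
  apply/cvgrPdist_le => e e0.
  have h1 := sublinear_rate up e0; have h2 := sublinear_rate lo e0.
  near=> n.
  have : H n / n%:R <= - Ex nu phi + e by near: n.
  have : - H n / n%:R <= Ex nu phi + e by near: n.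
  by rewrite mulNr ler_norml => a1 a2; apply/andP; split; lra.
have ent : entropy_wrt alpha nu branch_label = (- Ex nu phi)%:E.
  by apply: cvg_lim => //; apply: cvg_EFin => //; near=> n.
have e1 : entropy alpha nu = (- Ex nu phi)%:E.
  apply/le_anti/andP; split.
    by have := entropy_le gam1 inv phi_hol; rewrite phi_P sub0r.
  by rewrite -ent; apply: ereal_sup_ubound; exists 2%N, branch_label; split => //; exact: measurable_branch_label.
split => //; rewrite e1 lte_fin; have [kp kp0 hkp] := partition_entropy_linear.
apply: (lt_le_trans kp0); rewrite -(cvg_lim _ cvH)//; apply: limr_ge; first by apply/cvg_ex; exists (- Ex nu phi).
near=> n.
have n0 : 0 < n%:R :> R by rewrite ltr0n; near: n; exists 1%N.
by rewrite ler_pdivlMr// mulrC.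
Unshelve. all: by end_near. Qed.

End gibbs_measure.

Section pressure.
Variables (R : realType) (alpha gam : {posnum R}).
Hypothesis gam1 : gam%:num <= 1.
Local Notation I := (unit_interval R).
Local Notation hol := (@hol R gam).
Local Notation Ptop := (Ptop alpha).
Implicit Types (phi : I -> R) (nu : probability I R).

Lemma Ptop_shift phi t : bdd phi -> Ptop (fun x => phi x - t) = Ptop phi - t.
Proof.
move=> b; have [B hB] := b; have b' : bdd (fun x => phi x - t).
  by exists (B + `|t|) => x; rewrite (le_trans (ler_normB _ _))// lerD2r.
apply/le_anti/andP; split; first by apply: Ptop_lip.
rewrite lerBlDr; apply: Ptop_lip => // x; by rewrite subrK.
Qed.

Lemma exists_mixing_gibbs A phi : hol A phi -> phi (I0 R) < Ptop phi ->
  exists nu, [/\ invariant_measure alpha nu, exponentially_mixing alpha nu,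
    entropy alpha nu = (Ptop phi - Ex nu phi)%:E & (0 < entropy alpha nu)%E].
Proof.
move=> hA hP; have bphi := hol_bmeas hA; have bd : bdd phi by case: bphi.
pose phi' x := phi x - Ptop phi.
have hA' : hol A phi' by move=> x y; rewrite /phi' opprB addrA subrK; exact: hA.
have P' : Ptop phi' = 0 by rewrite Ptop_shift// subrr.
have n' : phi' (I0 R) < 0 by rewrite subr_lt0.
have [h [c c0 [K K0 [hc hK hh]]]] := eigenfunction hA' P' n'.
have [C [rho [C0 rho01 gap]]] := gfun_gap hA' P' n' c0 hc hK hh.
have G0 := gfun_ge0 alpha phi' c0 hc; have G1 := gfun_markov c0 hc hh.
have [H hH] := gfun_hol alpha hA' c0 hc hK.
have [d d0 dG] := gfun_floor alpha hA' c0 hc.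
have [nu nuE] := cdfm_measure gam1 G0 G1 rho01 gap.
have nuH B psi : hol B psi -> Ex nu (transfer alpha (gfun alpha phi' h) psi) = Ex nu psi.
  move=> hB; have [B' hB'] := hol_transfer alpha G0 G1 hH hB.
  rewrite (Ex_mean gam1 G0 G1 rho01 gap nuE hB') (Ex_mean gam1 G0 G1 rho01 gap nuE hB).
  by have := mean_transfer G0 G1 rho01 gap hB.
have bG a : bmeas (gfun alpha phi' h a) by exact: hol_bmeas (hH a).
have [e1 e2] := entropy_stationary gam1 hA' P' c0 hc hK hh nuH.
exists nu; split => //.
- by have := stationary_invariant gam1 G0 G1 bG d0 dG nuH.
- by have := stationary_mixing gam1 G0 G1 bG d0 dG nuH C0 rho01 gap.
- by rewrite e1 /phi' ExB ?Ex_cst//; [rewrite opprB|exact: bmeas_cst].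
Qed.

(** For the lower bound, the value is attained by the Dirac mass at 0 when [phi 0 = Ptop phi], and
    by the measure of [exists_mixing_gibbs] otherwise. *)
Lemma pressureE A phi : hol A phi -> pressure alpha phi = (Ptop phi)%:E.
Proof.
move=> hA; have bphi := hol_bmeas hA; have bd : bdd phi by case: bphi.
apply/le_anti/andP; split.
  by apply: ge_ereal_sup => _ [nu inv <-]; exact: free_energy_le hA.
have /predU1P[<-|hlt] : (phi (I0 R) == Ptop phi) || (phi (I0 R) < Ptop phi).
  by rewrite -le_eqVlt Ptop_ge0.
  apply: (@le_trans _ _ (entropy alpha (delta0 R) + \int[delta0 R]_x (phi x)%:E)%E).
    by rewrite ExE// (Ex_delta0 hA) leeDr// entropy_ge0.
  by apply: ereal_sup_ubound; exists (delta0 R) => //; exact: delta0_invariant.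
have [nu [inv _ e _]] := exists_mixing_gibbs hA hlt.
apply: ereal_sup_ubound; exists nu => //.
by rewrite e ExE// -EFinD subrK.
Qed.

End pressure.

(** * Power series *)

(** Course-of-values recursion: [tab n] lists the first [n] values, and [loc] says that [F k] reads
    only those below [k]. *)
Lemma strong_rec (T : Type) (t0 : T) (F : nat -> (nat -> T) -> T) :
  (forall k f g, (forall i, (i < k)%N -> f i = g i) -> F k f = F k g) ->
  exists f, forall k, f k = F k f.
Proof.
move=> loc; pose tab n := iter n (fun s => rcons s (F (size s) (nth t0 s))) [::].
have st n : size (tab n) = n by elim: n => // n ih; rewrite /tab /= size_rcons -/(tab n) ih.
pose f i := nth t0 (tab i.+1) i.
have tabE m i : (i < m)%N -> nth t0 (tab m) i = f i.
  elim: m => // m ih; rewrite ltnS leq_eqVlt => /predU1P[->//|im].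
  by rewrite /tab /= nth_rcons -/(tab m) st im ih.
exists f => k; rewrite {1}/f /tab /= nth_rcons -/(tab k) st ltnn eqxx.
by apply: loc => i ik; exact: tabE.
Qed.

Section power_series.
Variable R : realType.
Implicit Types (a b x y : nat -> R) (s q : R).

(** The ratio 1/16 leaves room for two factors [n + 1 <= 2^n]: coefficients of a product are
    O(8^-n), and the error of truncated products is O(4^-n). *)
Definition geom_bound x : Prop := exists C, forall n, `|x n| <= C * 16%:R^-1 ^+ n.

Lemma half16 : `|16%:R^-1| < 1 :> R.
Proof. by rewrite ger0_norm ?invr_ge0// invf_lt1 ?ltr1n ?ltr0n. Qed.

Lemma geom_bound_cvg x : geom_bound x -> cvgn (series x).
Proof.
move=> [C hC]; apply: normed_cvg.
apply: (@series_le_cvg _ _ (geometric C 16%:R^-1)) => [n|n|n|].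
- exact: normr_ge0.
- exact: le_trans (normr_ge0 _) (hC n).
- exact: hC.
- exact: is_cvg_geometric_series half16.
Qed.

Lemma natr_le_exp2 n : n.+1%:R <= 2 ^+ n :> R.
Proof. by rewrite -natrX ler_nat; exact: ltn_expl. Qed.

Lemma cauchy_product x y : geom_bound x -> geom_bound y ->
  series (fun n => \sum_(i < n.+1) x i * y (n - i)%N) @ \oo -->
    limn (series x) * limn (series y).
Proof.
move=> gx gy; have [C hC] := gx; have [D hD] := gy.
have C0 : 0 <= C by have := hC 0%N; rewrite expr0 mulr1; exact: le_trans.
have D0 : 0 <= D by have := hD 0%N; rewrite expr0 mulr1; exact: le_trans.
(* Partial sums are values at 1 of truncated polynomials, so their product differs from the partial
   sum of the convolution by the coefficients of degree at least [n]. *)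
pose p n := \poly_(i < n) x i; pose q n := \poly_(i < n) y i.
have pE n : (p n).[1] = series x n.
  rewrite (horner_coef_wide _ (size_poly n _)) /series /= big_mkord.
  by apply: eq_bigr => i _; rewrite coef_poly ltn_ord expr1n mulr1.
have qE n : (q n).[1] = series y n.
  rewrite (horner_coef_wide _ (size_poly n _)) /series /= big_mkord.
  by apply: eq_bigr => i _; rewrite coef_poly ltn_ord expr1n mulr1.
have bp n i : `|(p n)`_i| <= C * 16%:R^-1 ^+ i.
  by rewrite coef_poly; case: ifP => // _; rewrite normr0 mulr_ge0// exprn_ge0// invr_ge0.
have bq n i : `|(q n)`_i| <= D * 16%:R^-1 ^+ i.
  by rewrite coef_poly; case: ifP => // _; rewrite normr0 mulr_ge0// exprn_ge0// invr_ge0.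
have bpq n k : `|(p n * q n)`_k| <= C * D * 8%:R^-1 ^+ k.
  rewrite coefM (le_trans (ler_norm_sum _ _ _))//.
  apply: (@le_trans _ _ (\sum_(j < k.+1) C * D * 16%:R^-1 ^+ k)).
    apply: ler_sum => j _; rewrite normrM (le_trans (ler_pM _ _ (bp n j) (bq n _)))//.
    rewrite -mulrACA -exprD subnKC// -ltnS; exact: ltn_ord.
  rewrite sumr_const card_ord -(mulr_natr (C * D * _)) -mulrA ler_wpM2l ?mulr_ge0//.
  rewrite (_ : 8%:R^-1 = 16%:R^-1 * 2 :> R); last by field.
  by rewrite exprMn ler_wpM2l ?exprn_ge0 ?invr_ge0// natr_le_exp2.
have diff n : `|series x n * series y n -
    series (fun n => \sum_(i < n.+1) x i * y (n - i)%N) n| <= C * D * 4%:R^-1 ^+ n.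
  have sz : (size (p n * q n)%R <= n + n)%N.
    rewrite (leq_trans (size_polyMleq _ _))// (leq_trans (leq_pred _))//.
    by rewrite leq_add// size_poly.
  rewrite -pE -qE -hornerM (horner_coef_wide _ sz) big_split_ord /=.
  rewrite (_ : series _ n = \sum_(i < n) (p n * q n)`_i * 1 ^+ i); last first.
    rewrite /series /= big_mkord; apply: eq_bigr => k _.
    rewrite expr1n mulr1 coefM; apply: eq_bigr => j _.
    rewrite !coef_poly (leq_ltn_trans _ (ltn_ord k)) ?(leq_ltn_trans (leq_subr _ _))//.
    by rewrite -ltnS.
  rewrite addrAC subrr add0r (le_trans (ler_norm_sum _ _ _))//.
  apply: (@le_trans _ _ (\sum_(j < n) C * D * 8%:R^-1 ^+ n)).
    apply: ler_sum => j _; rewrite expr1n mulr1 (le_trans (bpq _ _))//.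
    rewrite ler_wpM2l ?mulr_ge0// ler_wiXn2l ?leq_addr ?invr_ge0//.
    by rewrite invf_le1 ?ler1n.
  rewrite sumr_const card_ord -(mulr_natr (C * D * _)) -mulrA ler_wpM2l ?mulr_ge0//.
  rewrite (_ : 4%:R^-1 = 8%:R^-1 * 2 :> R); last by field.
  rewrite exprMn ler_wpM2l ?exprn_ge0 ?invr_ge0// (le_trans _ (natr_le_exp2 n))//.
  by rewrite ler_nat.
have c0 : C * D * 4%:R^-1 ^+ n @[n --> \oo] --> (0 : R).
  apply: (@cvg_geometric R (C * D)).
  by rewrite ger0_norm ?invr_ge0// invf_lt1 ?ltr1n ?ltr0n.
have c1 : series x n * series y n @[n --> \oo] --> limn (series x) * limn (series y).
  by apply: cvgM; exact: geom_bound_cvg.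
apply/cvgrPdist_le => e e0; near=> n.
have h1 : `|limn (series x) * limn (series y) - series x n * series y n| <= e / 2.
  near: n; move/cvgrPdist_le : c1; apply; by rewrite divr_gt0.
have h2 : `|C * D * 4%:R^-1 ^+ n| <= e / 2.
  near: n; move/cvgr0Pnorm_le : c0; apply; by rewrite divr_gt0.
rewrite [e]splitr -[_ - _](subrKA (series x n * series y n)) (le_trans (ler_normD _ _))//.
rewrite lerD// (le_trans (diff n))// (le_trans _ h2)// ler_norm//.
Unshelve. all: by end_near. Qed.

Definition pser a s : R := limn (pseries a s).

Lemma pser0 a : pser a 0 = a 0%N.
Proof.
apply: cvg_lim => //; apply/cvg_ballP => e e0; near=> n.
have -> : pseries a 0 n = a 0%N; last exact: ballxx.
have n0 : (0 < n)%N by near: n; exists 1%N.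
rewrite /pseries /series /= -(prednK n0) big_nat_recl//= expr0 mulr1.
by rewrite big1 ?addr0// => i _; rewrite expr0n mulr0.
Unshelve. all: by end_near. Qed.

Lemma pser_cvg a s : geom_bound (fun n => a n * s ^+ n) ->
  series (fun n => a n * s ^+ n) @ \oo --> pser a s.
Proof. by move=> /geom_bound_cvg. Qed.

Lemma pow_bound a C q s : (forall n, `|a n| <= C * q ^+ n) -> 0 <= q -> q * `|s| <= 16%:R^-1 ->
  geom_bound (fun n => a n * s ^+ n).
Proof.
move=> ha q0 qs; exists C => n; rewrite normrM normrX.
have C0 : 0 <= C by have := ha 0%N; rewrite expr0 mulr1; exact: le_trans.
rewrite (le_trans (ler_wpM2r _ (ha n))) ?exprn_ge0// -mulrA -exprMn ler_wpM2l//.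
by rewrite lerXn2r// ?nnegrE ?mulr_ge0// invr_ge0.
Qed.

Lemma diffs_bound a C q : (forall n, `|a n| <= C * q ^+ n) -> 0 <= q ->
  forall n, `|pseries_diffs a n| <= C * q * (2 * q) ^+ n.
Proof.
move=> ha q0 n; rewrite /pseries_diffs normrM ger0_norm//.
have C0 : 0 <= C by have := ha 0%N; rewrite expr0 mulr1; exact: le_trans.
rewrite (le_trans (ler_pM _ _ (natr_le_exp2 n) (ha n.+1)))//.
by rewrite exprS exprMn; rewrite le_eqVlt; apply/orP; left; apply/eqP; ring.
Qed.

(** Two formal derivatives turn the growth rate [q] into [4 q], and [4 q / (64 q)] is the ratio 1/16
    of [geom_bound]. *)
Lemma pser_derive a C q s : (forall n, `|a n| <= C * q ^+ n) -> 0 < q ->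
  `|s| < (64%:R * q)^-1 -> is_derive s (1 : R) (pser a) (pser (pseries_diffs a) s).
Proof.
move=> ha q0 hs; pose K := (64%:R * q)^-1.
have K0 : 0 < K by rewrite invr_gt0 mulr_gt0.
have q2 : 0 < 2 * q by rewrite mulr_gt0.
have hd := diffs_bound ha (ltW q0); have hdd := diffs_bound hd (ltW q2).
have Kq : q * `|K| = 64%:R^-1 by rewrite gtr0_norm// /K invfM mulrCA divff ?mulr1// gt_eqF.
apply: (@pseries_snd_diffs R a K s); last by rewrite (gtr0_norm K0).
- by apply/geom_bound_cvg/(pow_bound ha (ltW q0)); rewrite Kq; lra.
- by apply/geom_bound_cvg/(pow_bound hd (ltW q2)); rewrite -mulrA Kq; lra.
- apply/geom_bound_cvg/(pow_bound hdd); first by rewrite mulr_ge0// ltW.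
  by rewrite -!mulrA Kq; lra.
Qed.

(* The coefficients come from the recursion [l' = c' l]. *)
Lemma pser_ln l q : 0 < q -> l 0%N = 1 -> (forall n, `|l n| <= q ^+ n) ->
  (forall s, `|s| < (256%:R * q)^-1 -> 0 < pser l s) ->
  exists c, (forall n, `|c n| <= (4 * q) ^+ n) /\
    forall s, `|s| < (256%:R * q)^-1 -> ln (pser l s) = pser c s.
Proof.
move=> q0 l0 hl lpos.
pose F n (d : nat -> R) := n.+1%:R * l n.+1 - \sum_(i < n) d i * l (n - i)%N.
have [|d hd] := @strong_rec R 0 F.
  by move=> k f g fg; rewrite /F; congr (_ - _); apply: eq_bigr => i _; rewrite fg.
have bd n : `|d n| <= q * (4 * q) ^+ n.
  elim/ltn_ind: n => n ih; rewrite hd /F (le_trans (ler_normB _ _))//.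
  apply: (@le_trans _ _ (2 ^+ n * q ^+ n.+1 + \sum_(i < n) q * (4 * q) ^+ i * q ^+ (n - i))).
    rewrite lerD//; first by rewrite normrM ger0_norm// ler_pM// natr_le_exp2.
    rewrite (le_trans (ler_norm_sum _ _ _))//; apply: ler_sum => i _.
    by rewrite normrM ler_pM// ih.
  have -> : \sum_(i < n) q * (4 * q) ^+ i * q ^+ (n - i) = q * q ^+ n * \sum_(i < n) 4 ^+ i.
    rewrite mulr_sumr; apply: eq_bigr => i _.
    have e : q ^+ n = q ^+ i * q ^+ (n - i) by rewrite -exprD subnKC// ltnW.
    by rewrite e exprMn; ring.
  have g4 : 3 * \sum_(i < n) 4 ^+ i = 4 ^+ n - 1 :> R.
    elim: n {ih} => [|n ih]; first by rewrite big_ord0 expr0 mulr0 subrr.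
    by rewrite big_ord_recr /= mulrDr ih exprS; ring.
  have q2n : 4 ^+ n = 2 ^+ n * 2 ^+ n :> R by rewrite -exprMn; congr (_ ^+ n); lra.
  have two : 1 <= 2 ^+ n :> R by rewrite exprn_ege1//; lra.
  have qn : 0 < q * q ^+ n by rewrite mulr_gt0// exprn_gt0.
  rewrite exprS exprMn.
  have -> : q * (4 ^+ n * q ^+ n) = q * q ^+ n * 4 ^+ n by ring.
  rewrite [2 ^+ n * _]mulrC -mulrDr ler_pM2l//.
  set u := 2 ^+ n in q2n two *; set S := \sum_(i < n) _ in g4 *.
  (* With [u = 2^n] this is the inequality 2^n + (4^n - 1) / 3 <= 4^n, which closes the
     induction. *)
  have : 0 <= (2 * u - 1) * (u - 1) by apply: mulr_ge0; lra.
  rewrite q2n; rewrite q2n in g4; nra.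
pose c n := if n is m.+1 then d m / m.+1%:R else 0.
have bc n : `|c n| <= (4 * q) ^+ n.
  case: n => [|n] /=; first by rewrite normr0 expr0.
  rewrite normrM (le_trans (ler_pM _ _ (bd n) (_ : _ <= 1)))//.
    by rewrite ger0_norm ?invr_ge0// invf_le1 ?ltr0n// ler1n.
  rewrite mulr1 exprS ler_pM ?exprn_ge0 ?mulr_ge0 ?(ltW q0)//; lra.
exists c; split => // s hs.
have dc : pseries_diffs c = d.
  by apply/funext => n; rewrite /pseries_diffs /c mulrC divfK// pnatr_eq0.
have dl n : pseries_diffs l n = \sum_(i < n.+1) d i * l (n - i)%N.
  by rewrite big_ord_recr /= subnn l0 mulr1 [X in _ + X]hd /F addrC subrK.
have q4 : 0 < 4 * q by rewrite mulr_gt0.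
have c1 n : `|c n| <= 1 * (4 * q) ^+ n by rewrite mul1r.
have l1 n : `|l n| <= 1 * (4 * q) ^+ n.
  by rewrite mul1r (le_trans (hl n))// lerXn2r ?nnegrE//; lra.
have r4 : (64%:R * (4 * q))^-1 = (256%:R * q)^-1 by congr (_^-1); lra.
have dl' t : `|t| < (256%:R * q)^-1 -> pser (pseries_diffs l) t = pser d t * pser l t.
  move=> ht.
  have q16 : 4 * q * `|t| <= 16%:R^-1.
    rewrite -(ler_pM2l (_ : 0 < 16%:R))// divff// mulrA.
    have : 256%:R * q * `|t| <= 1.
      have p : 0 < 256%:R * q by rewrite pmulr_rgt0 ?ltr0n.
      by rewrite -(ler_pdivlMl _ _ p) mulr1 ltW.
    have := mulr_ge0 (ltW q0) (normr_ge0 t); lra.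
  have gl := pow_bound l1 (ltW q4) q16; have gd := pow_bound bd (ltW q4) q16.
  have := cauchy_product gd gl => h.
  apply: cvg_lim => //; apply: cvg_trans h; apply: near_eq_cvg; near=> n.
  apply: eq_bigr => k _; rewrite -[RHS]/(pseries_diffs l k * t ^+ k) dl mulr_suml; apply: eq_bigr => i _.
  have -> : t ^+ k = t ^+ i * t ^+ (k - i).
    by rewrite -exprD subnKC// -ltnS; exact: ltn_ord.
  ring.
(* [pser l] and [expR (pser c)] solve the same linear differential equation, so their quotient is
   constant. *)
pose H t := pser l t * expR (- pser c t).
have dH t : `|t| < (256%:R * q)^-1 -> is_derive t (1 : R) H 0.
  move=> ht; have ht' : `|t| < (64%:R * (4 * q))^-1 by rewrite r4.
  have il := pser_derive l1 q4 ht'; have ic := pser_derive c1 q4 ht'.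
  rewrite dl'// in il; rewrite dc in ic.
  have ie : is_derive t (1 : R) (fun t => expR (- pser c t)) (expR (- pser c t) * (- pser d t)).
    by apply: (@is_derive1_comp _ expR (- pser c)).
  have := is_deriveM il ie; rewrite (_ : _ + _ = 0)//.
  rewrite -[X in X + _]/(pser l t * (expR (- pser c t) * (- pser d t))).
  rewrite -[X in _ + X]/(expR (- pser c t) * (pser d t * pser l t)); ring.
have H0 : H 0 = 1 by rewrite /H !pser0 l0 /= oppr0 expR0 mulr1.
have Hs : H s = 1.
  have key (a b : R) : a <= b -> `|a| < (256%:R * q)^-1 -> `|b| < (256%:R * q)^-1 -> H a = H b.
    move=> ab ha hb.
    have inside (x : R) : a <= x <= b -> `|x| < (256%:R * q)^-1.
      by move: ha hb; rewrite !ltr_norml; lra.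
    have [| |y _] := @MVT_segment R H (fun=> 0) a b ab.
    - move=> x; rewrite in_itv /= => /andP[ax xb]; apply: dH; apply: inside.
      by rewrite (ltW ax) (ltW xb).
    - apply: derivable_within_continuous => x; rewrite in_itv /= => axb.
      by have [] := dH x (inside x axb).
    - by rewrite mul0r => /eqP; rewrite subr_eq0 => /eqP ->.
  have z0 : `|0 : R| < (256%:R * q)^-1 by rewrite (@normr0 R R) invr_gt0 (pmulr_lgt0 _ q0) ltr0n.
  have [s0|/ltW s0] := leP 0 s; first by rewrite -(key 0 s).
  by rewrite (key s 0).
have e : pser l s = expR (pser c s).
  by apply: (mulIf (lt0r_neq0 (expR_gt0 (- pser c s)))); rewrite -expRD subrr expR0.
by rewrite e expRK.
Unshelve. all: by end_near. Qed.

End power_series.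

(** * Analyticity of the pressure *)

Section convolution.
Variable R : realType.

(* The weights [(i + 1)^-2] are stable under convolution up to a constant, which
   makes [radB^k / (k + 1)^2] a majorant for a quadratic recursion. *)
Definition sqw (i : nat) : R := (i.+1%:R ^+ 2)^-1.

Lemma sqw_gt0 i : 0 < sqw i.
Proof. by rewrite invr_gt0 exprn_gt0// ltr0n. Qed.

Lemma sum_sqw k : \sum_(i < k.+1) sqw i <= 2 - k.+1%:R^-1.
Proof.
elim: k => [|k ih]; first by rewrite big_ord_recl big_ord0 /sqw expr1n invr1; lra.
rewrite big_ord_recr /= (le_trans (lerD ih (lexx _)))// /sqw.
set z := k.+1%:R : R; have -> : k.+2%:R = z + 1 by rewrite /z -natr1.
have z1 : 1 <= z by rewrite ler1n.
have z0 : 0 < z by lra. have z2 : 0 < z + 1 by lra.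
rewrite -subr_ge0.
have -> : 2 - (z + 1)^-1 - (2 - z^-1 + ((z + 1) ^+ 2)^-1) = (z * (z + 1) ^+ 2)^-1.
  by field; rewrite !gt_eqF.
by rewrite invr_ge0 mulr_ge0 ?exprn_ge0// ltW.
Qed.

(** Clearing denominators with [x = i + 1] and [y = k - i + 1], what remains is (x + y - 1)^2 <= 2
    (x^2 + y^2). *)
Lemma sqw_mul i k : (i <= k)%N -> sqw i * sqw (k - i) <= 2 * (sqw i + sqw (k - i)) * sqw k.
Proof.
move=> ik; rewrite /sqw.
set x := i.+1%:R : R; set y := (k - i).+1%:R : R.
have -> : k.+1%:R = x + y - 1.
  rewrite /x /y -{1}(subnKC ik) -!natr1 natrD; lra.
have x1 : 1 <= x by rewrite ler1n.
have y1 : 1 <= y by rewrite ler1n.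
have x0 : 0 < x by lra. have y0 : 0 < y by lra. have xy : 0 < x + y - 1 by lra.
rewrite -subr_ge0.
have -> : 2 * ((x ^+ 2)^-1 + (y ^+ 2)^-1) * ((x + y - 1) ^+ 2)^-1 - (x ^+ 2)^-1 * (y ^+ 2)^-1
  = (2 * (x ^+ 2 + y ^+ 2) - (x + y - 1) ^+ 2) / (x ^+ 2 * y ^+ 2 * (x + y - 1) ^+ 2).
  by field; rewrite !gt_eqF.
rewrite divr_ge0 ?mulr_ge0 ?exprn_ge0 ?(ltW x0) ?(ltW y0) ?(ltW xy)//.
have := sqr_ge0 (x - y); rewrite !expr2; nra.
Qed.

Lemma sqw_conv k : \sum_(i < k) sqw (k - i) * sqw i <= 8 * sqw k.
Proof.
apply: (@le_trans _ _ (\sum_(i < k.+1) 2 * (sqw i + sqw (k - i)) * sqw k)).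
  rewrite [leRHS]big_ord_recr /= ler_wpDr ?mulr_ge0 ?addr_ge0 ?(ltW (sqw_gt0 _))//.
  by apply: ler_sum => i _; rewrite mulrC sqw_mul// ltnW.
rewrite -mulr_suml -mulr_sumr big_split /=.
have -> : \sum_(i < k.+1) sqw (k - i) = \sum_(i < k.+1) sqw i.
  by rewrite [RHS](reindex_inj rev_ord_inj) /=; apply: eq_bigr => i _; rewrite subSS.
rewrite ler_wpM2r ?(ltW (sqw_gt0 _))//.
have h1 := sum_sqw k; have h2 : 0 <= k.+1%:R^-1 :> R by rewrite invr_ge0.
set S := \sum_(i < k.+1) _ in h1 *; set w := _^-1 in h1 h2.
lra.
Qed.

End convolution.

Section limits.
Variable R : realType.
Implicit Types x : nat -> R.

Lemma limn_norm_le x (l B : R) : x n @[n --> \oo] --> l -> (forall n, `|x n| <= B) -> `|l| <= B.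
Proof.
move=> xl xB; apply: (ler_cvg_to (cvg_norm xl) (cvg_cst B)).
by apply: nearW => n; exact: xB.
Qed.

(** Confines a sum with leading term 1 to [1/2, 3/2], which keeps the perturbed eigenfunction and
    eigenvalue positive. *)
Lemma series_head x : (forall n, `|x n| <= 16%:R^-1 ^+ n) ->
  `|limn (series x) - x 0%N| <= 1 / 2.
Proof.
move=> hx; have cx : series x n @[n --> \oo] --> limn (series x).
  by apply: geom_bound_cvg; exists 1 => n; rewrite mul1r.
have c1 : series x n.+1 - x 0%N @[n --> \oo] --> limn (series x) - x 0%N.
  by apply: cvgB; [rewrite cvg_shiftS|exact: cvg_cst].
apply: (limn_norm_le c1) => n; rewrite /series /= big_nat_recl// addrAC subrr add0r.
rewrite big_mkord (le_trans (ler_norm_sum _ _ _))//.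
apply: (@le_trans _ _ (\sum_(i < n) 16%:R^-1 ^+ i.+1)); first by apply: ler_sum => i _; exact: hx.
under eq_bigr do rewrite exprS; rewrite -mulr_sumr.
have q1 : 0 <= (16%:R^-1 : R) < 1 by apply/andP; split; lra.
have e : (1 - 16%:R^-1)^-1 = 16%:R / 15%:R :> R by field.
have := geometric_sum_le n q1; rewrite e; lra.
Qed.

End limits.

(** * Perturbation series for the leading eigenvalue *)

Section perturbation.
Variables (R : realType) (alpha gam : {posnum R}).
Local Notation I := (unit_interval R).
Local Notation g := (inv_branch alpha).
Local Notation transfer := (@transfer R alpha).
Local Notation hol := (@hol R gam).
Variables (G : bool -> I -> R) (C rho : R).
Hypotheses (G0 : nonneg G) (G1 : markov G).
Hypotheses (C0 : 0 < C) (rho01 : 0 < rho < 1).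
Hypothesis gap : forall A psi n, hol A psi -> hol (C * A * rho ^+ n) (iter n (transfer G) psi).
Local Notation N := (transfer G).
Local Notation mean := (mean alpha G).
Implicit Types (u v r : I -> R).

(** Sup norm and seminorm share one constant, so that a product costs only the explicit factor 2 of
    [nbM]. *)
Definition nb (B : R) u : Prop := (forall x, `|u x| <= B) /\ hol B u.

Lemma nb_ge0 B u : nb B u -> 0 <= B. Proof. by case=> _ /hol_ge0. Qed.

Lemma nb_le A B u : A <= B -> nb A u -> nb B u.
Proof. by move=> AB [h1 h2]; split; [move=> x; exact: le_trans AB|exact: hol_le h2]. Qed.

Lemma nb_cst c : nb `|c| (fun=> c).
Proof. by split => //; apply: hol_le (hol_cst gam c). Qed.

Lemma nbM A B u v : nb A u -> nb B v -> nb (2 * (A * B)) (fun x => u x * v x).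
Proof.
move=> hu hv; have [u1 u2] := hu; have [v1 v2] := hv.
have AB := mulr_ge0 (nb_ge0 hu) (nb_ge0 hv); split.
  by move=> x; rewrite normrM (le_trans (ler_pM _ _ (u1 x) (v1 x)))//; lra.
have := holM u2 v2 u1 v1; apply: hol_le; lra.
Qed.

Lemma nbD A B u v : nb A u -> nb B v -> nb (A + B) (fun x => u x + v x).
Proof.
move=> [u1 u2] [v1 v2]; split; last exact: holD.
by move=> x; rewrite (le_trans (ler_normD _ _))// lerD.
Qed.

Lemma nbZ A c u : nb A u -> nb (`|c| * A) (fun x => c * u x).
Proof. by move=> [u1 u2]; split; [move=> x; rewrite normrM ler_wpM2l|exact: holZ]. Qed.

Lemma nb_sum k (A : 'I_k -> R) (F : 'I_k -> I -> R) : (forall i, nb (A i) (F i)) ->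
  nb (\sum_i A i) (fun x => \sum_i F i x).
Proof.
move=> h; split => [x|x y].
  by rewrite (le_trans (ler_norm_sum _ _ _))//; apply: ler_sum => i _; case: (h i).
rewrite -sumrB (le_trans (ler_norm_sum _ _ _))// mulr_suml.
by apply: ler_sum => i _; case: (h i).
Qed.

Lemma nb_transfer B u : nb B u -> nb ((1 + C) * B) (N u).
Proof.
move=> hu; have B0 := nb_ge0 hu; have [u1 u2] := hu; have CB := mulr_ge0 (ltW C0) B0.
split => [x|].
  have := iter_transfer_bnd alpha 1 G0 u1 x; rewrite (tr1_markov alpha G1) mulr1.
  by move/le_trans; apply; lra.
have := gap 1 u2; apply: hol_le; rewrite expr1; case/andP: rho01 => r0 r1.
rewrite mulrDl mul1r (le_trans (ler_piMr CB (ltW r1)))//; lra.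
Qed.

Lemma mean_bound B u : nb B u -> `|mean u| <= B.
Proof.
move=> [u1 u2]; have := mean_close_le G0 G1 rho01 gap u2 (hol_cst gam 0) (e := B).
rewrite (mean_cst alpha G1) subr0; apply => x; by rewrite subr0.
Qed.

(** Inverts [1 - N] on functions of mean 0, where the spectral gap makes the Neumann series
    converge; [poisson0] selects the solution of mean 0. *)
Definition poisson r (x : I) : R := limn (series (fun n => iter n N r x)).
Definition poisson0 r (x : I) : R := poisson r x - mean (poisson r).
Definition gapK : R := 2 * C / (1 - rho).

Lemma gapK_gt0 : 0 < gapK.
Proof. by case/andP: rho01 => _ r1; rewrite divr_gt0 ?mulr_gt0// subr_gt0. Qed.

Lemma poisson_cvg B r x : nb B r -> mean r = 0 ->
  series (fun n => iter n N r x) @ \oo --> poisson r x /\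
  forall n, `|series (fun n => iter n N r x) n| <= gapK * B.
Proof.
move=> hr r0; have B0 := nb_ge0 hr; have [r1 r2] := hr.
have b n : `|iter n N r x| <= 2 * C * B * rho ^+ n.
  have := mean_close G0 G1 rho01 gap n x r2; rewrite r0 subr0 => /le_trans; apply; lra.
case/andP: rho01 => rh0 rh1; split.
  apply: normed_cvg; apply: (@series_le_cvg _ _ (geometric (2 * C * B) rho)) => [n|n|n|].
  - exact: normr_ge0.
  - exact: le_trans (normr_ge0 _) (b n).
  - exact: b.
  - by apply: is_cvg_geometric_series; rewrite gtr0_norm.
move=> n; rewrite /series /= big_mkord (le_trans (ler_norm_sum _ _ _))//.
apply: (@le_trans _ _ (\sum_(i < n) 2 * C * B * rho ^+ i)); first by apply: ler_sum => i _.
rewrite -mulr_sumr /gapK [leRHS]mulrAC ler_wpM2l ?mulr_ge0 ?(ltW C0)//.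
by apply: geometric_sum_le; rewrite (ltW rh0).
Qed.

Lemma poisson_nb B r : nb B r -> mean r = 0 -> nb (gapK * B) (poisson r).
Proof.
move=> hr r0; have B0 := nb_ge0 hr; have [r1 r2] := hr.
case/andP: rho01 => rh0 rh1; split=> [x|x y].
  by have [h1 h2] := poisson_cvg x hr r0; exact: limn_norm_le h1 h2.
have [hx _] := poisson_cvg x hr r0; have [hy _] := poisson_cvg y hr r0.
apply: (limn_norm_le (cvgB hx hy)) => n.
rewrite /series /= big_mkord [X in _ - X]big_mkord -sumrB (le_trans (ler_norm_sum _ _ _))//.
apply: (@le_trans _ _ (\sum_(i < n) C * B * gdist gam x y * rho ^+ i)).
  by apply: ler_sum => i _; rewrite (le_trans (gap i r2 x y))// mulrAC.
have CB := mulr_ge0 (mulr_ge0 (ltW C0) B0) (gdist_ge0 gam x y).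
rewrite -mulr_sumr (le_trans (ler_wpM2l CB (geometric_sum_le n _)))// ?(ltW rh0)//.
have ri : 0 <= (1 - rho)^-1 by rewrite invr_ge0 subr_ge0 ltW.
have := mulr_ge0 CB ri; rewrite /gapK; lra.
Qed.

Lemma poisson_eq B r x : nb B r -> mean r = 0 -> poisson r x = r x + N (poisson r) x.
Proof.
move=> hr r0; have c z : series (fun n => iter n N r z) @ \oo --> poisson r z.
  by have [] := poisson_cvg z hr r0.
have c1 : series (fun n => iter n N r x) n.+1 @[n --> \oo] --> r x + N (poisson r) x.
  rewrite (_ : (fun n => _) = (fun n => r x + N (series (fun n => iter n N r) n) x)); last first.
    apply/funext => n; rewrite /series /= big_nat_recl//; congr (_ + _).
    rewrite -[RHS]/(G false x * (\sum_(0 <= k < n) iter k N r) (g false x) +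
      G true x * (\sum_(0 <= k < n) iter k N r) (g true x)).
    by rewrite !fct_sumE !mulr_sumr -big_split.
  apply: cvgD; first exact: cvg_cst.
  have c' z : series (fun n => iter n N r) n z @[n --> \oo] --> poisson r z.
    rewrite (_ : (fun n => _) = series (fun n => iter n N r z)); first exact: c.
    by apply/funext => n; rewrite /series /= fct_sumE.
  by apply: cvgD; apply: cvgM; [exact: cvg_cst|exact: c'|exact: cvg_cst|exact: c'].
have := c x; rewrite -cvg_shiftS => /cvg_unique; apply; last exact: c1.
exact: Rhausdorff.
Qed.

Lemma poisson0P B r : nb B r -> mean r = 0 ->
  [/\ nb (2 * gapK * B) (poisson0 r), mean (poisson0 r) = 0 &
    forall x, poisson0 r x - N (poisson0 r) x = r x].
Proof.
move=> hr r0; have hp := poisson_nb hr r0; have [p1 p2] := hp; split.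
- have := nbD hp (nb_cst (- mean (poisson r))); apply: nb_le.
  by rewrite normrN; have := mean_bound hp; lra.
- have := mean_lin G0 G1 rho01 gap 1 (- mean (poisson r)) p2 (hol_cst gam 1).
  rewrite (mean_cst alpha G1) mulr1 mul1r subrr => <-; congr mean.
  by apply/funext => x; rewrite /poisson0 mul1r.
- move=> x; rewrite /poisson0.
  have -> : N (fun x => poisson r x - mean (poisson r)) x = N (poisson r) x - mean (poisson r).
    by have := iter_markov_shift alpha G1 1 (mean (poisson r)) (poisson r) x.
  rewrite (poisson_eq x hr r0); ring.
Qed.

Variables (phi : I -> R) (M : R).
Hypotheses (M1 : 1 <= M) (hphi : nb M phi).

(* The eigenfunction [sum_k s^k eta k] and the eigenvalue [1 + sum_k s^k lam k eta]
   of [psi |-> N (exp (s phi) psi)] are found order by order; the normalisation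
   [mean (eta k) = 0] for [k > 0] determines [lam]. *)
Definition ecoef (j : nat) (x : I) : R := j`!%:R^-1 * phi x ^+ j.

Lemma ecoef_nb j : nb ((2 * M) ^+ j) (ecoef j).
Proof.
have hp : nb ((2 * M) ^+ j) (fun x => phi x ^+ j).
  elim: j => [|j ih]; first by rewrite expr0 -(@normr1 R); exact: nb_cst.
  under eq_fun do rewrite exprS.
  by have := nbM hphi ih; apply: nb_le; rewrite exprS mulrA.
have := nbZ j`!%:R^-1 hp; apply: nb_le.
rewrite ler_piMl ?(nb_ge0 hp)// ger0_norm ?invr_ge0// invf_le1 ?ler1n ?ltr0n ?fact_gt0//.
Qed.

Definition lam (k : nat) (f : nat -> I -> R) : R :=
  \sum_(i < k) mean (fun x => ecoef (k - i) x * f i x).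

Definition rhs (k : nat) (f : nat -> I -> R) (x : I) : R :=
  \sum_(i < k) (N (fun y => ecoef (k - i) y * f i y) x - lam (k - i) f * f i x).

Lemma lam_local k (f f' : nat -> I -> R) : (forall i, (i < k)%N -> f i = f' i) ->
  lam k f = lam k f'.
Proof. by move=> ff; apply: eq_bigr => i _; rewrite ff. Qed.

Lemma rhs_local k (f f' : nat -> I -> R) : (forall i, (i < k)%N -> f i = f' i) ->
  rhs k f = rhs k f'.
Proof.
move=> ff; apply/funext => x; apply: eq_bigr => i _; rewrite ff//.
rewrite (@lam_local _ f f')// => j jk; apply: ff.
by rewrite (leq_trans jk)// leq_subr.
Qed.

Lemma eigenseries_exists : exists eta : nat -> I -> R, eta 0%N = (fun=> 1) /\
  forall k, (0 < k)%N -> eta k = poisson0 (rhs k eta).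
Proof.
have [|eta h] := @strong_rec (I -> R) (fun=> 0)
    (fun k f => if k is 0%N then (fun=> 1) else poisson0 (rhs k f)).
  by move=> [//|k] f f' ff; rewrite (rhs_local ff).
by exists eta; split => [|[//|k] _]; rewrite h.
Qed.

(** The small factor that closes the induction of [eta_nb]: the term 16 serves the eigenvalue
    coefficients in [lcoef_le], and the other term pays for applying [N] and inverting [1 - N]. *)
Definition Keps : R := (16%:R * gapK * (2 * (1 + C) + 16%:R) + 16%:R)^-1.

Lemma Keps_gt0 : 0 < Keps.
Proof.
have := gapK_gt0 => K0; have := mulr_gt0 K0 C0 => KC.
by rewrite invr_gt0; lra.
Qed.

Lemma Keps_le : 16%:R * Keps <= 1 /\ 16%:R * gapK * (2 * (1 + C) + 16%:R) * Keps <= 1.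
Proof.
have K0 := gapK_gt0; have KC := mulr_gt0 K0 C0.
have p0 : 0 < 16%:R * gapK * (2 * (1 + C) + 16%:R) + 16%:R by lra.
by split; rewrite ler_pdivrMr// mul1r; lra.
Qed.

(** Large enough that [ecoef j] is below [Keps * maj j] for [j > 0]: each application of the
    perturbation then brings the factor [Keps]. *)
Definition radB : R := 8%:R * M / Keps.
Definition maj (k : nat) : R := radB ^+ k * sqw R k.

Lemma radB_gt0 : 0 < radB.
Proof. by rewrite divr_gt0 ?mulr_gt0 ?Keps_gt0//; have := M1; lra. Qed.

Lemma maj_ge0 k : 0 <= maj k.
Proof. by rewrite mulr_ge0 ?exprn_ge0 ?(ltW radB_gt0) ?(ltW (sqw_gt0 _ _)). Qed.

Lemma maj_conv k : \sum_(i < k) maj (k - i) * maj i <= 8 * maj k.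
Proof.
rewrite /maj mulrCA (le_trans _ (ler_wpM2l _ (sqw_conv R k))) ?exprn_ge0 ?(ltW radB_gt0)//.
rewrite mulr_sumr; apply: ler_sum => i _; rewrite mulrACA -exprD subnK//.
exact: ltnW (ltn_ord i).
Qed.

Lemma maj_le k : maj k <= radB ^+ k.
Proof.
rewrite ler_piMr ?exprn_ge0 ?(ltW radB_gt0)//.
by rewrite invf_le1 ?exprn_gt0 ?ltr0n// exprn_ege1// ler1n.
Qed.

Lemma sqr_le_exp4 j : (0 < j)%N -> (j.+1%:R : R) ^+ 2 <= 4 ^+ j.
Proof.
move=> j0; rewrite (_ : 4 = 2 ^+ 2 :> R); last by rewrite expr2; lra.
rewrite -exprM mulnC exprM lerXn2r ?nnegrE ?exprn_ge0//.
exact: natr_le_exp2.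
Qed.

Lemma ecoef_maj j : (0 < j)%N -> nb (Keps * maj j) (ecoef j).
Proof.
move=> j0; apply: nb_le (ecoef_nb j).
have K0 := Keps_gt0; have M0 : 0 < M by have := M1; lra.
rewrite /maj mulrA ler_pdivlMr ?exprn_gt0 ?ltr0n//.
apply: (@le_trans _ _ ((8%:R * M) ^+ j)).
  rewrite (_ : 8%:R * M = 2 * M * 4); last by lra.
  by rewrite [leRHS]exprMn ler_wpM2l ?exprn_ge0 ?sqr_le_exp4//; lra.
have -> : 8%:R * M = radB * Keps by rewrite /radB divfK// gt_eqF.
rewrite exprMn mulrC ler_wpM2r ?exprn_ge0 ?(ltW radB_gt0)//.
rewrite -(prednK j0) exprS ler_piMr ?(ltW K0)// exprn_ile1 ?(ltW K0)//.
by have [h _] := Keps_le; lra.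
Qed.

Section series.
Variable eta : nat -> I -> R.
Hypotheses (eta0 : eta 0%N = (fun=> 1))
  (etaS : forall k, (0 < k)%N -> eta k = poisson0 (rhs k eta)).

Lemma lam_bound k : (forall i, (i < k)%N -> nb (maj i) (eta i)) ->
  `|lam k eta| <= 16%:R * Keps * maj k.
Proof.
move=> h; rewrite (le_trans (ler_norm_sum _ _ _))//.
apply: (@le_trans _ _ (\sum_(i < k) 2 * Keps * (maj (k - i) * maj i))).
  apply: ler_sum => i _; apply: mean_bound.
  have := nbM (ecoef_maj (_ : (0 < k - i)%N)) (h i (ltn_ord i)).
  by rewrite subn_gt0 => /(_ (ltn_ord i)); apply: nb_le; rewrite !mulrA.
rewrite -mulr_sumr; have K0 := Keps_gt0; have := maj_conv k => hk.
have := ler_wpM2l (ltW K0) hk; lra.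
Qed.

Lemma eta_nb k : nb (maj k) (eta k) /\ ((0 < k)%N -> mean (eta k) = 0 /\
  forall x, eta k x - N (eta k) x = rhs k eta x).
Proof.
elim/ltn_ind: k => k ih; have [->|k0] := posnP k.
  rewrite eta0; split => //; rewrite /maj expr0 mul1r /sqw expr1n invr1.
  by have := nb_cst 1; rewrite normr1.
have hb i : (i < k)%N -> nb (maj i) (eta i) by move=> ik; case: (ih i ik).
have hl i : (i <= k)%N -> `|lam i eta| <= 16%:R * Keps * maj i.
  by move=> ik; apply: lam_bound => j ji; apply: hb; exact: leq_trans ji ik.
have K0 := Keps_gt0.
have h1 (i : 'I_k) : nb (2 * (Keps * maj (k - i) * maj i)) (fun y => ecoef (k - i) y * eta i y).
  apply: nbM; last exact: hb.
  by apply: ecoef_maj; rewrite subn_gt0.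
have h2 (i : 'I_k) : nb ((2 * (1 + C) + 16%:R) * Keps * (maj (k - i) * maj i))
    (fun x => N (fun y => ecoef (k - i) y * eta i y) x - lam (k - i) eta * eta i x).
  under eq_fun do rewrite -mulNr.
  have := nbD (nb_transfer (h1 i)) (nbZ (- lam (k - i) eta) (hb i (ltn_ord i))).
  apply: nb_le; rewrite normrN.
  have := ler_wpM2r (maj_ge0 i) (hl (k - i)%N (leq_subr _ _)); lra.
have hr := nb_sum h2.
(* Solvability at order [k]: as [eta i] has mean 0 for [i > 0], the subtracted terms contribute only
   [lam k eta], which is by definition the sum of the other means. *)
have r0 : mean (rhs k eta) = 0.
  have hA (i : 'I_k) : exists A, hol A (fun x => N (fun y => ecoef (k - i) y * eta i y) x - lam (k - i) eta * eta i x).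
    by eexists; case: (h2 i) => _; exact.
  have [_ ->] := mean_sum G0 G1 rho01 gap (index_enum _) hA.
  have e (i : 'I_k) : mean (fun x => N (fun y => ecoef (k - i) y * eta i y) x - lam (k - i) eta * eta i x) =
      mean (fun y => ecoef (k - i) y * eta i y) - lam (k - i) eta * (i == 0%N :> nat)%:R.
    have [_ a1] := nb_transfer (h1 i); have [_ a2] := hb i (ltn_ord i).
    have := mean_lin G0 G1 rho01 gap 1 (- lam (k - i) eta) a1 a2.
    have [_ a3] := h1 i; rewrite (mean_transfer G0 G1 rho01 gap a3) mul1r mulNr.
    have -> : mean (eta i) = (i == 0%N :> nat)%:R.
      have [i0|i0] := posnP i; first by rewrite i0 eta0 (mean_cst alpha G1).
      have [_ /(_ i0) [-> _]] := ih i (ltn_ord i).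
      by case: (nat_of_ord i) i0.
    move=> <-; congr mean; apply/funext => x; by rewrite mul1r mulNr.
  under eq_bigr do rewrite e.
  rewrite sumrB -/(lam k eta).
  case: k k0 {ih hb hl h1 h2 hr hA e} => // k _.
  rewrite big_ord_recl /= subn0 mulr1 [X in - (_ + X)]big1 ?addr0 ?subrr// => i _.
  by rewrite mulr0.
have [b1 b2 b3] := poisson0P hr r0; rewrite etaS//; split => //.
apply: nb_le b1; rewrite -mulr_sumr.
have [_ hK] := Keps_le; have := maj_conv k => hm.
have p0 : 0 <= 2 * gapK * ((2 * (1 + C) + 16%:R) * Keps).
  have c0 := C0; have g0 := gapK_gt0.
  by apply: mulr_ge0; apply: mulr_ge0; lra.
rewrite (_ : 2 * gapK * _ = 2 * gapK * ((2 * (1 + C) + 16%:R) * Keps) *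
  \sum_(i < k) maj (k - i) * maj i); last by rewrite !mulrA.
rewrite (le_trans (ler_wpM2l p0 hm))// [_ * (8 * _)]mulrA ler_piMl ?maj_ge0//.
by rewrite (le_trans _ hK)// le_eqVlt; apply/orP; left; apply/eqP; ring.
Qed.

Definition lcoef (k : nat) : R := if k is 0%N then 1 else lam k eta.

Lemma lcoef_le k : `|lcoef k| <= radB ^+ k.
Proof.
case: k => [|k]; first by rewrite normr1 expr0.
have h := lam_bound (fun i _ => (eta_nb i).1) (k := k.+1).
rewrite (le_trans h)// (le_trans _ (maj_le _))// ler_piMl ?maj_ge0//.
by have [] := Keps_le.
Qed.

Lemma eta_le k x : `|eta k x| <= radB ^+ k.
Proof. by have [[h _] _] := eta_nb k; exact: le_trans (h x) (maj_le k). Qed.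

Lemma ecoef_le k x : `|ecoef k x| <= radB ^+ k.
Proof.
have [h _] := ecoef_nb k; rewrite (le_trans (h x))// lerXn2r ?nnegrE ?(ltW radB_gt0)//; first by have := M1; lra.
rewrite ler_pdivlMr ?Keps_gt0//; have [h1 _] := Keps_le; have := Keps_gt0 => K0.
by have := M1; nra.
Qed.

Lemma eta_eq k x :
  N (fun y => \sum_(i < k.+1) eta i y * ecoef (k - i) y) x = \sum_(i < k.+1) eta i x * lcoef (k - i).
Proof.
have -> : N (fun y => \sum_(i < k.+1) eta i y * ecoef (k - i) y) x =
    \sum_(i < k.+1) N (fun y => ecoef (k - i) y * eta i y) x.
  rewrite -[LHS]/(G false x * _ + G true x * _) !mulr_sumr -big_split.
  by apply: eq_bigr => i _; rewrite -[RHS]/(G false x * _ + G true x * _) ![eta i _ * _]mulrC.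
rewrite !big_ord_recr /= subnn mulr1.
have -> : (fun y => ecoef 0 y * eta k y) = eta k.
  by apply/funext => y; rewrite /ecoef fact0 invr1 expr0 !mul1r.
have [k0|k0] := posnP k.
  by rewrite k0 !big_ord0 !add0r eta0; exact: (iter_markov_cst alpha G1 1 1 x).
have [_ /(_ k0) [_ /(_ x)]] := eta_nb k; rewrite /rhs sumrB => e.
have -> : \sum_(i < k) eta i x * lcoef (k - i) = \sum_(i < k) lam (k - i) eta * eta i x.
  apply: eq_bigr => i _; rewrite mulrC; congr (_ * _).
  have : (0 < k - i)%N by rewrite subn_gt0.
  by case: (k - i)%N.
lra.
Qed.

Lemma eigenseries s : `|s| < (256%:R * radB)^-1 ->
  exists u, [/\ forall x, 1 / 2 <= u x <= 3 / 2, 0 < pser lcoef s &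
    forall x, N (fun y => expR (s * phi y) * u y) x = pser lcoef s * u x].
Proof.
move=> hs; have B0 := radB_gt0.
have qs : radB * `|s| <= 256%:R^-1.
  by rewrite (le_trans (ler_wpM2l (ltW B0) (ltW hs)))// invfM mulrCA divff ?mulr1// gt_eqF.
have qs' : radB * `|s| <= 16%:R^-1 by rewrite (le_trans qs)//; lra.
have term a n : (forall k, `|a k| <= radB ^+ k) -> `|a n * s ^+ n| <= 16%:R^-1 ^+ n.
  move=> ha; rewrite normrM normrX (le_trans (ler_wpM2r _ (ha n))) ?exprn_ge0//.
  rewrite -exprMn; have bs0 : 0 <= radB * `|s| by rewrite mulr_ge0// ltW.
  by apply: lerXn2r; rewrite ?nnegrE// invr_ge0.
have gb a : (forall k, `|a k| <= radB ^+ k) -> geom_bound (fun n => a n * s ^+ n).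
  by move=> ha; exists 1 => n; rewrite mul1r; exact: term.
pose u x := pser (fun n => eta n x) s.
have hu x : 1 / 2 <= u x <= 3 / 2.
  have := @series_head R (fun n => eta n x * s ^+ n) (fun n => term _ n (fun k => eta_le k x)).
  have -> : limn (series (fun n => eta n x * s ^+ n)) = u x by [].
  rewrite eta0 expr0 mulr1 ler_norml => /andP[h1 h2].
  by apply/andP; split; lra.
have hl : 1 / 2 <= pser lcoef s.
  have := @series_head R (fun n => lcoef n * s ^+ n) (fun n => term _ n lcoef_le).
  by rewrite expr0 mulr1 -/(pser lcoef s) ler_norml => h; move: h; rewrite /=; lra.
exists u; split => // [|x]; first lra.
have ge x' := gb _ (fun k => eta_le k x').
have gl := gb _ lcoef_le.
have gc x' := gb _ (fun k => ecoef_le k x').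
have expE y : expR (s * phi y) = limn (series (fun n => ecoef n y * s ^+ n)).
  rewrite expRE; congr (limn _); apply/funext => n; apply: eq_bigr => k _.
  rewrite -[LHS]/(k`!%:R^-1 * (s * phi y) ^+ k) -[RHS]/(ecoef k y * s ^+ k).
  by rewrite /ecoef exprMn; ring.
have c1 y := cauchy_product (ge y) (gc y).
have c2 := cauchy_product (ge x) gl.
rewrite -[LHS]/(G false x * _ + G true x * _) !expE.
rewrite [RHS]mulrC.
suff c4 : series (fun n =>
    \sum_(i < n.+1) eta i x * s ^+ i * (lcoef (n - i) * s ^+ (n - i))) @ \oo -->
  G false x * (limn (series (fun n => ecoef n (g false x) * s ^+ n)) * u (g false x)) +
  G true x * (limn (series (fun n => ecoef n (g true x) * s ^+ n)) * u (g true x)).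
  by move: c4 => /cvg_unique; apply; [exact: Rhausdorff|exact: c2].
have c3 : (G false x * series (fun n => \sum_(i < n.+1) eta i (g false x) * s ^+ i *
      (ecoef (n - i) (g false x) * s ^+ (n - i))) n + G true x * series (fun n => \sum_(i < n.+1) eta i (g true x) * s ^+ i *
      (ecoef (n - i) (g true x) * s ^+ (n - i))) n) @[n --> \oo] -->
  G false x * (limn (series (fun n => ecoef n (g false x) * s ^+ n)) * u (g false x)) +
  G true x * (limn (series (fun n => ecoef n (g true x) * s ^+ n)) * u (g true x)).
  by apply: cvgD; apply: cvgM; do ?exact: cvg_cst; rewrite mulrC; exact: c1.
apply: cvg_trans c3; apply: near_eq_cvg; apply: nearW => n.
rewrite /series /= !mulr_sumr -big_split /=; apply: eq_bigr => k _.
have pw (a b : nat -> R) : \sum_(i < k.+1) a i * s ^+ i * (b (k - i)%N * s ^+ (k - i)) =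
    s ^+ k * \sum_(i < k.+1) a i * b (k - i)%N.
  rewrite mulr_sumr; apply: eq_bigr => i _.
  have -> : s ^+ k = s ^+ i * s ^+ (k - i).
    by rewrite -exprD subnKC// -ltnS; exact: ltn_ord.
  ring.
have e1 := pw (fun i => eta i (g false x)) (fun i => ecoef i (g false x)).
have e2 := pw (fun i => eta i (g true x)) (fun i => ecoef i (g true x)).
have e3 := pw (fun i => eta i x) lcoef.
have e : s ^+ k * (\sum_(i < k.+1) eta i x * lcoef (k - i)) =
  G false x * (s ^+ k * \sum_(i < k.+1) eta i (g false x) * ecoef (k - i) (g false x)) +
  G true x * (s ^+ k * \sum_(i < k.+1) eta i (g true x) * ecoef (k - i) (g true x)).
  by rewrite -eta_eq -[N _ x]/(G false x * _ + G true x * _); ring.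
by rewrite -e1 -e2 -e3 in e; exact: esym e.
Qed.

End series.
End perturbation.

Section analytic_pressure.
Variables (R : realType) (alpha gam : {posnum R}).
Hypothesis gam1 : gam%:num <= 1.
Local Notation I := (unit_interval R).
Local Notation g := (inv_branch alpha).
Local Notation transfer := (@transfer R alpha).
Local Notation hol := (@hol R gam).
Local Notation Ptop := (Ptop alpha).
Implicit Types (phi u : I -> R).

(** An eigenfunction bounded above and away from 0 is comparable with 1, so the iterates of 1 grow
    exactly like [l ^+ n]. *)
Lemma Ptop_eigen phi u (l c D : R) : bdd phi -> 0 < l -> 0 < c ->
  (forall x, c <= u x <= D) -> (forall x, transfer (wexp alpha phi) u x = l * u x) ->
  Ptop phi = ln l.
Proof.
move=> b l0 c0 hu hl; set W := wexp alpha phi in hl *.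
have W0 : nonneg W := @wexp_ge0 R alpha phi.
have cD : c <= D by have /andP[h1 h2] := hu (I0 R); exact: le_trans h2.
have D0 : 0 < D := lt_le_trans c0 cD.
have it n x : iter n (transfer W) u x = l ^+ n * u x.
  elim: n x => [|n ih] x; first by rewrite expr0 mul1r.
  rewrite iter_transferS !ih exprSr -mulrA -hl -[transfer W u x]/(W false x * u (g false x) + W true x * u (g true x)).
  ring.
have up n x : c * tr1 alpha W n x <= D * l ^+ n.
  rewrite -(iter_transfer_cst alpha W n c x) (@le_trans _ _ (iter n (transfer W) u x))//.
    by apply: iter_transfer_le => // y; case/andP: (hu y).
  by rewrite it mulrC ler_wpM2r ?exprn_ge0 ?(ltW l0)//; case/andP: (hu x).
have lo n x : c * l ^+ n <= D * tr1 alpha W n x.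
  rewrite -(iter_transfer_cst alpha W n D x) (@le_trans _ _ (iter n (transfer W) u x))//.
    by rewrite it mulrC ler_wpM2l ?exprn_ge0 ?(ltW l0)//; case/andP: (hu x).
  by apply: iter_transfer_le => // y; case/andP: (hu y).
have ex n : expR (n%:R * ln l) = l ^+ n by rewrite expRM_natl lnK.
apply/le_anti/andP; split.
  apply: Ptop_le; exists (D / c) => n x; rewrite ex mulrAC ler_pdivlMr// mulrC; exact: up.
rewrite leNgt; apply/negP => hlt.
have [p hp pl] : exists2 p, Ptop phi < p & p < ln l.
  by exists ((Ptop phi + ln l) / 2); lra.
have [C hC] := Ptop_growth b hp.
have [n] := @expR_unbounded R (ln l - p) (D * C / c) (ltac:(by rewrite subr_gt0)).
rewrite ltNge => /negP; apply.
rewrite mulrBr expRB ex ler_pdivrMr ?expR_gt0// mulrAC ler_pdivlMr// mulrC -mulrA.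
by rewrite (le_trans (lo n (I0 R)))// ler_wpM2l ?(ltW D0).
Qed.

Lemma hol_exists_nb A phi : hol A phi -> exists2 M, 1 <= M & nb gam M phi.
Proof.
move=> hA; exists (1 + A + `|phi (I0 R)|).
  by have := hol_ge0 hA; have := normr_ge0 (phi (I0 R)); lra.
split; last by apply: hol_le hA; have := normr_ge0 (phi (I0 R)); lra.
by move=> x; rewrite (le_trans (hol_bound hA x))//; lra.
Qed.

(** Undoing the conjugation, [h * u] is an eigenfunction for [(1 + s) * phi] with the eigenvalue of
    the perturbed Markov operator, whose logarithm is expanded by [pser_ln]. *)
Lemma Ptop_series_normalized A phi : hol A phi -> Ptop phi = 0 -> phi (I0 R) < 0 ->
  exists (c : nat -> R) r, 0 < r /\ forall s, `|s| < r ->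
    series (fun n => c n * s ^+ n) @ \oo --> Ptop (fun x => (1 + s) * phi x).
Proof.
move=> hA P n0; have [h [c c0 [K K0 [hc hK hh]]]] := eigenfunction hA P n0.
have [C [rho [C0 rho01 gap]]] := gfun_gap hA P n0 c0 hc hK hh.
have G0 := gfun_ge0 alpha phi c0 hc; have G1 := gfun_markov c0 hc hh.
have [M M1 nbphi] := hol_exists_nb hA.
have [eta [eta0 etaS]] := eigenseries_exists alpha (gfun alpha phi h) phi.
pose l := lcoef alpha (gfun alpha phi h) phi eta.
pose B := radB C rho M.
have B0 : 0 < B := radB_gt0 C0 rho01 M1.
have ES s := eigenseries G0 G1 C0 rho01 gap M1 nbphi eta0 etaS (s := s).
have hl n : `|l n| <= B ^+ n := lcoef_le G0 G1 C0 rho01 gap M1 nbphi eta0 etaS n.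
have [|cc [bc ccE]] := pser_ln B0 (erefl _ : l 0%N = 1) hl.
  by move=> s hs; have [u []] := ES s hs.
have r0 : 0 < (256%:R * B)^-1 by rewrite invr_gt0 (pmulr_lgt0 _ B0) ltr0n.
exists cc, (256%:R * B)^-1; split => // s hs.
have [u [hu l0 hN]] := ES s hs.
have -> : Ptop (fun x => (1 + s) * phi x) = pser cc s.
  rewrite -ccE//; apply: (@Ptop_eigen _ (fun x => h x * u x) _ (c * (1 / 2)) (3 / 2)) => //.
  - exists (`|1 + s| * M) => x; rewrite normrM ler_wpM2l//; by case: nbphi.
  - by rewrite mulr_gt0// divr_gt0.
  - move=> x; have /andP[h1 h2] := hc x; have /andP[u1 u2] := hu x; apply/andP; split.
      by apply: ler_pM => //; lra.
    rewrite -[leRHS]mul1r; apply: ler_pM => //; lra.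
  - move=> x; have hx : h x != 0 by rewrite gt_eqF//; have /andP[h1 _] := hc x; exact: lt_le_trans h1.
    have := hN x; rewrite -[LHS]/(gfun alpha phi h false x * (expR (s * phi (g false x)) * u (g false x)) +
      gfun alpha phi h true x * (expR (s * phi (g true x)) * u (g true x))) => e.
    rewrite mulrCA -e /gfun /wexp -[LHS]/(wexp alpha (fun x => (1 + s) * phi x) false x * (h (g false x) * u (g false x)) +
      wexp alpha (fun x => (1 + s) * phi x) true x * (h (g true x) * u (g true x))).
    have E a : wexp alpha (fun x => (1 + s) * phi x) a x = expR (phi (g a x)) * expR (s * phi (g a x)).
      by rewrite /wexp mulrDl mul1r expRD.
    by rewrite !E; field.
apply: pser_cvg; apply: (@pow_bound R cc 1 (4 * B) s) => [n||].
- by rewrite mul1r; exact: bc.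
- by rewrite mulr_ge0// ltW.
- have B4 : 0 <= 4 * B by rewrite mulr_ge0// ltW.
  rewrite (le_trans (ler_wpM2l B4 (ltW hs)))//.
  have -> : 4 * B * (256%:R * B)^-1 = 64%:R^-1 by field; rewrite gt_eqF.
  lra.
Qed.

Lemma Ptop_analytic1 A phi : hol A phi -> phi (I0 R) < Ptop phi ->
  analytic_at (fun t => Ptop (fun x => t * phi x)) 1.
Proof.
move=> hA hP; have bphi := hol_bmeas hA; have bd : bdd phi by case: bphi.
pose phi' x := phi x - Ptop phi.
have hA' : hol A phi' by move=> x y; rewrite /phi' opprB addrA subrK; exact: hA.
have P' : Ptop phi' = 0 by rewrite Ptop_shift// subrr.
have n' : phi' (I0 R) < 0 by rewrite subr_lt0.
have [c [r [r0 hc]]] := Ptop_series_normalized hA' P' n'.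
(* The Taylor coefficients of [y * Ptop phi] at 1, which undo the normalisation of the pressure. *)
pose b n := if n is 0%N then Ptop phi else if n is 1%N then Ptop phi else 0.
exists (fun n => c n + b n), r; split => // y hy.
have -> : Ptop (fun x => y * phi x) = Ptop (fun x => (1 + (y - 1)) * phi' x) + y * Ptop phi.
  have bd' : bdd (fun x => y * phi x).
    by case: bd => B hB; exists (`|y| * B) => x; rewrite normrM ler_wpM2l.
  rewrite subrKC /phi' -{1}[Ptop (fun x => y * phi x)](subrK (y * Ptop phi)); congr (_ + _).
  by rewrite -Ptop_shift//; congr Ptop; apply/funext => x; rewrite mulrBr.
have c2 : series (fun n => b n * (y - 1) ^+ n) n @[n --> \oo] --> y * Ptop phi.
  have fin m : series (fun n => b n * (y - 1) ^+ n) m.+2 = y * Ptop phi.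
    rewrite /series /= !big_nat_recl// big1 ?addr0 => [|i _]; last by rewrite mul0r.
    by rewrite /= expr0 expr1; ring.
  apply/cvg_ballP => e e0; near=> n.
  rewrite (_ : n = (n - 2).+2); first by rewrite fin; exact: ballxx.
  have : (1 < n)%N by near: n; exists 2%N.
  lia.
apply: cvg_trans (cvgD (hc _ hy) c2); apply: near_eq_cvg; apply: nearW => n.
have e : \sum_(0 <= i < n) (c i + b i) * (y - 1) ^+ i =
    \sum_(0 <= i < n) c i * (y - 1) ^+ i + \sum_(0 <= i < n) b i * (y - 1) ^+ i.
  by rewrite -big_split; apply: eq_bigr => i _; rewrite mulrDl.
by rewrite /series /= e.
Unshelve. all: by end_near. Qed.

End analytic_pressure.

(** * Phase diagram *)

Section holder_topology.
Variables (R : realType) (gam : {posnum R}).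
Local Notation I := (unit_interval R).
Local Notation hol := (@hol R gam).
Local Notation CR := (holderR gam).
Implicit Types phi psi : CR.

Definition hnorm (phi : CR) : R := @holder_norm R (real_scalars R) gam phi.

Lemma holder_hol phi : exists A, hol A phi.
Proof.
by exists (@holder_seminorm R (real_scalars R) gam phi) => x y; exact: (holder_seminorm_ub phi x y).
Qed.

Lemma hol_holder A (u : I -> R) : hol A u -> u \in @holder_pred R (real_scalars R) gam.
Proof. by move=> hA; apply/mem_set; exists A. Qed.

Lemma hnorm_le (phi : CR) A B : (forall x, `|phi x| <= A) -> hol B phi -> hnorm phi <= A + B.
Proof.
move=> hA hB; apply: lerD.
  exact: (@sup_norm_le R (real_scalars R) phi).
exact: (@holder_seminorm_le R (real_scalars R) gam phi).
Qed.

Lemma hnorm_ub phi x : `|phi x| <= hnorm phi.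
Proof.
apply: (le_trans (@sup_norm_ub R (real_scalars R) gam phi x)).
by rewrite lerDl; exact: (@holder_seminorm_ge0 R (real_scalars R) gam phi).
Qed.

Lemma hnormZ (t : R) phi : hnorm (t *: phi) = `|t| * hnorm phi.
Proof. exact: (@holder_normZ R (real_scalars R) gam t phi). Qed.

Lemma hnorm_ge0 phi : 0 <= hnorm phi.
Proof. exact: le_trans (normr_ge0 _) (hnorm_ub phi (I0 R)). Qed.

Lemma nbhs_holderP phi (U : set CR) :
  nbhs phi U <-> exists2 e, 0 < e & forall psi, hnorm (psi - phi) < e -> U psi.
Proof.
split.
  move=> /nbhs_normP [e /= e0 he]; exists e => // psi h; apply: he.
  by rewrite /ball_ /= distrC.
move=> [e e0 he]; apply: (nbhs_normP phi U).2; exists e => // psi; rewrite /ball_ /= distrC.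
exact: he.
Qed.

Lemma closure_holderP phi (U : set CR) :
  closure U phi <-> forall e, 0 < e -> exists2 psi, U psi & hnorm (psi - phi) < e.
Proof.
split.
  move=> h e e0; have [psi [Up hp]] : U `&` [set psi | hnorm (psi - phi) < e] !=set0.
    by apply: h; apply/nbhs_holderP; exists e.
  by exists psi.
move=> h V /nbhs_holderP [e e0 he]; have [psi Up hp] := h e e0.
by exists psi; split => //; exact: he.
Qed.

Lemma interior_holderP phi (U : set CR) :
  U° phi <-> exists2 e, 0 < e & forall psi, hnorm (psi - phi) < e -> U psi.
Proof. exact: nbhs_holderP. Qed.

End holder_topology.

(** * Power series that vanish on one side of their centre *)

Section one_sided_identity.
Variable R : realType.

(** Once the lower coefficients vanish, [a n * s ^+ n] is, up to sign, a tail of order [s ^+ n.+1],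
    which is negligible for small positive [s]. *)
Lemma pser_one_sided (a : nat -> R) (r : R) : 0 < r ->
  (forall s, 0 <= s < r -> series (fun n => a n * s ^+ n) @ \oo --> (0 : R)) ->
  forall n, a n = 0.
Proof.
move=> r0 h; have [s0 s00 s0r] : exists2 s0, 0 < s0 & s0 < r by exists (r / 2); lra.
have c0 : cvgn (series (fun n => a n * s0 ^+ n)).
  by apply/cvg_ex; exists 0; apply: h; rewrite (ltW s00).
have := cvg_seq_bounded (cvgP _ (cvg_series_cvg_0 c0)) => /pinfty_ex_gt0 [C C0 hC].
have {}hC k : `|a k| <= C / s0 ^+ k.
  rewrite ler_pdivlMr ?exprn_gt0//; have := hC k Logic.I.
  by rewrite /= normrM normrX (gtr0_norm s00).
elim/ltn_ind => n ih; apply/eqP; rewrite -normr_le0; apply/ler_addgt0Pr => e e0.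
pose D := C / s0 ^+ n; have D0 : 0 < D by rewrite divr_gt0// exprn_gt0.
pose q := Num.min (1 / 2) (e / (2 * D)).
have q0 : 0 < q by rewrite lt_min !divr_gt0// mulr_gt0.
have q2 : q <= 1 / 2 by rewrite ge_min lexx.
have qe : 2 * D * q <= e.
  have qq : q <= e / (2 * D) by rewrite ge_min lexx orbT.
  have dd : 0 < 2 * D by rewrite mulr_gt0.
  by move: qq; rewrite (ler_pdivlMr _ _ dd); lra.
pose s := q * s0; have sr : 0 <= s < r.
  by rewrite mulr_ge0 ?(ltW q0) ?(ltW s00)//= (le_lt_trans (ler_piMl (ltW s00) (le_trans q2 _)))//; lra.
have sp : 0 < s by rewrite mulr_gt0.
have lim : series (fun n => a n * s ^+ n) (k + n.+1)%N - a n * s ^+ n @[k --> \oo] --> 0 - a n * s ^+ n.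
  by apply: cvgB; [rewrite cvg_shiftn; exact: h|exact: cvg_cst].
have bound k : `|series (fun n => a n * s ^+ n) (k + n.+1)%N - a n * s ^+ n| <= D * (2 * q) * s ^+ n.
  rewrite /series /= (big_cat_nat (n := n.+1)) ?leq_addl//= big_nat_recr//=.
  rewrite [X in X + _ + _ - _]big_nat_cond [X in X + _ + _ - _]big1 ?add0r; last first.
    by move=> i /andP[/andP[_ il] _]; rewrite ih// mul0r.
  rewrite addrAC subrr add0r -{1}[n.+1]add0n big_addn addnK.
  rewrite big_mkord (le_trans (ler_norm_sum _ _ _))//.
  apply: (@le_trans _ _ (\sum_(i < k) D * q * s ^+ n * q ^+ i)).
    apply: ler_sum => i _; rewrite normrM normrX (gtr0_norm sp).
    rewrite (le_trans (ler_wpM2r _ (hC _))) ?exprn_ge0 ?(ltW sp)//.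
    rewrite /D /s !exprMn !exprD !exprS.
    have : s0 ^+ i != 0 by rewrite expf_neq0// gt_eqF.
    have : s0 ^+ n != 0 by rewrite expf_neq0// gt_eqF.
    have : s0 != 0 by rewrite gt_eqF.
    move=> z1 z2 z3; rewrite le_eqVlt; apply/orP; left; apply/eqP; field.
    by rewrite ?z1 ?z2 ?z3.
  rewrite -mulr_sumr.
  have q1 : 0 <= q < 1 by rewrite (ltW q0); apply: (le_lt_trans q2); lra.
  have g := geometric_sum_le k q1.
  have g2 : (1 - q)^-1 <= 2 by rewrite invf_ple ?posrE//; lra.
  have p0 : 0 <= D * q * s ^+ n.
    by apply: mulr_ge0; [apply: mulr_ge0; exact: ltW|apply: exprn_ge0; exact: ltW].
  have := ler_wpM2l p0 (le_trans g g2); lra.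
have := limn_norm_le lim bound; rewrite sub0r normrN normrM [`|s ^+ n|]gtr0_norm ?exprn_gt0//.
rewrite ler_pM2r ?exprn_gt0// add0r => /le_trans; apply; lra.
Qed.

End one_sided_identity.

Section phase_diagram.
Variables (R : realType) (alpha gam : {posnum R}).
Hypotheses (gam1 : gam%:num <= 1) (gamal : gam%:num < alpha%:num).
Local Notation I := (unit_interval R).
Local Notation hol := (@hol R gam).
Local Notation CR := (holderR gam).
Local Notation Ptop := (Ptop alpha).
Implicit Types (phi psi : CR) (nu : probability I R).

Lemma pressure_holder phi : pressure alpha phi = (Ptop phi)%:E.
Proof. by have [A hA] := holder_hol phi; exact: pressureE hA. Qed.

Lemma bdd_holder phi : bdd phi.
Proof. by exists (hnorm phi) => x; exact: hnorm_ub. Qed.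

Lemma bmeas_holder phi : bmeas (phi : I -> R).
Proof. by have [A hA] := holder_hol phi; exact: hol_bmeas hA. Qed.

Lemma Ptop_dist phi psi : Ptop psi <= Ptop phi + hnorm (psi - phi).
Proof.
apply: Ptop_lip; first exact: bdd_holder.
move=> x; rewrite -lerBlDl; apply: le_trans (hnorm_ub (psi - phi) x).
exact: ler_norm.
Qed.

Definition hyperbolic : set CR := [set phi | phi (I0 R) < Ptop phi].

Lemma hyperbolic_open phi : hyperbolic phi -> nbhs phi hyperbolic.
Proof.
move=> h; have d0 : 0 < (Ptop phi - phi (I0 R)) / 2 by rewrite divr_gt0// subr_gt0.
apply/nbhs_holderP; exists ((Ptop phi - phi (I0 R)) / 2) => // psi hp.
have h1 := Ptop_dist psi phi.
have h2 : hnorm (phi - psi) = hnorm (psi - phi).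
  by rewrite -opprB -scaleN1r hnormZ normrN1 mul1r.
have h3 : psi (I0 R) - phi (I0 R) <= hnorm (psi - phi).
  by apply: le_trans (hnorm_ub (psi - phi) (I0 R)); exact: ler_norm.
rewrite /hyperbolic /=; lra.
Qed.

Lemma not_hyperbolic phi : ~ hyperbolic phi -> Ptop phi = phi (I0 R).
Proof.
move=> /negP; rewrite -leNgt => h; apply/le_anti; rewrite h /=.
by apply: Ptop_ge0; exact: bdd_holder.
Qed.

Lemma free_energy_holder nu phi : invariant_measure alpha nu ->
  exists2 h, entropy alpha nu = h%:E & h + Ex nu phi <= Ptop phi.
Proof.
move=> inv; have [A hA] := holder_hol phi.
have h1 := entropy_le gam1 inv hA; have h0 := entropy_ge0 alpha nu.
have e : entropy alpha nu \is a fin_num.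
  by rewrite ge0_fin_numE// (le_lt_trans h1)// ltry.
exists (fine (entropy alpha nu)); first by rewrite fineK.
by move: h1; rewrite -[X in (X <= _)%E](fineK e) lee_fin; lra.
Qed.

Lemma hyperbolic_intermittent : hyperbolic `<=` @intermittent_phase R alpha gam.
Proof.
move=> phi hp; have [A hA] := holder_hol phi.
have [nu [inv mix ent pos]] := exists_mixing_gibbs gam1 hA hp.
exists nu; split => //; split => //.
by rewrite ent pressure_holder ExE ?subrK//; [rewrite -EFinD subrK|exact: bmeas_holder].
Qed.

Lemma powR_gam_dist (x y : I) :
  `|ival x `^ gam%:num - ival y `^ gam%:num| <= (Num.truncn gam%:num).+1%:R * gdist gam x y.
Proof. by apply: powR_dist => //; exact: ival_itv. Qed.

(** Adding a multiple of [omega] leaves the value at 0 unchanged and moves the integral for every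
    measure that charges (0, 1]. *)
Definition omega : CR := Holder (hol_holder powR_gam_dist).

Lemma omegaE x : omega x = ival x `^ gam%:num. Proof. by []. Qed.
Lemma omega0 : omega (I0 R) = 0. Proof. by rewrite omegaE /= powR0// gt_eqF. Qed.
Lemma omega_ge0 x : 0 <= omega x. Proof. exact: powR_ge0. Qed.

Local Notation phi0 := (neg_log_Df gam1 (ltW gamal)).

Lemma geo_lower x : - (1 + alpha%:num) * omega x <= phi0 x.
Proof.
rewrite neg_log_DfE mulNr lerN2 (le_trans (le_ln1Dx _))//.
  by rewrite (lt_le_trans (ltrN10 _))// mulr_ge0 ?powR_ge0// addr_ge0.
rewrite ler_wpM2l ?addr_ge0// omegaE; have := ival_ge0 x; rewrite le_eqVlt => /predU1P[<-|x0].
  by rewrite !powR0// gt_eqF.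
by apply: ger_powR; rewrite ?ival_le1 ?x0// ltW.
Qed.

(** Gibbs' inequality for - log Df, of pressure 0, bounds the entropy by the integral of log Df,
    which is at most (1 + al) x^al, hence at most (1 + al) x^gam on [0, 1]. *)
Lemma entropy_omega nu h : invariant_measure alpha nu -> entropy alpha nu = h%:E ->
  h <= (1 + alpha%:num) * Ex nu omega.
Proof.
move=> inv e; have [h' e' hle] := free_energy_holder phi0 inv.
have {e'} hh : h' = h by apply: EFin_inj; rewrite -e'.
rewrite hh (_ : Ptop phi0 = 0) in hle; last exact: Ptop_geo.
have : Ex nu (fun x => - (1 + alpha%:num) * omega x) <= Ex nu phi0.
  by apply: Ex_le; [apply: bmeasZ; exact: bmeas_holder|exact: bmeas_holder|exact: geo_lower].
rewrite ExZ; last exact: bmeas_holder.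
lra.
Qed.

Lemma ExDZ nu phi psi (t : R) : Ex nu (phi + t *: psi : CR) = Ex nu phi + t * Ex nu psi.
Proof.
transitivity (Ex nu (fun x => phi x + t * psi x)) => //.
have b := bmeas_holder phi; have b' := bmeas_holder psi.
by rewrite ExD ?ExZ//; exact: bmeasZ.
Qed.

Lemma hnorm_pos (e : R) phi : 0 < e -> exists2 t, 0 < t & hnorm (t *: phi) < e.
Proof.
move=> e0; have p := hnorm_ge0 phi; have p1 : 0 < 1 + hnorm phi by lra.
exists (e / (1 + hnorm phi)); first by rewrite divr_gt0.
rewrite hnormZ gtr0_norm ?divr_gt0// mulrAC ltr_pdivrMr//; nra.
Qed.

Lemma hnormN phi : hnorm (- phi) = hnorm phi.
Proof. by rewrite -scaleN1r hnormZ normrN1 mul1r. Qed.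

Lemma intermittent_entropy phi : @intermittent_phase R alpha gam phi ->
  exists nu h, [/\ invariant_measure alpha nu, entropy alpha nu = h%:E, 0 < h,
    h + Ex nu phi = Ptop phi & 0 < Ex nu omega].
Proof.
move=> [nu [[inv eq] _ pos]]; have [h e hle] := free_energy_holder phi inv.
have h0 : 0 < h by move: pos; rewrite e lte_fin.
have ho := entropy_omega inv e.
exists nu, h; split => //.
- apply: EFin_inj; rewrite -pressure_holder -eq e ExE//; exact: bmeas_holder.
- have a0 : 0 < 1 + alpha%:num by rewrite addr_gt0.
  by rewrite -(pmulr_rgt0 _ a0); exact: lt_le_trans ho.
Qed.

(* A potential of pressure [phi 0] is pushed out of the intermittent phase by
   subtracting a small multiple of [omega], as entropy is at most a multiple of the
   integral of [omega]. *)
Lemma interior_intermittent : (@intermittent_phase R alpha gam)° = hyperbolic.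
Proof.
apply/seteqP; split => phi; last first.
  by move=> /hyperbolic_open; apply: filterS; exact: hyperbolic_intermittent.
move=> /interior_holderP [e e0 he]; apply: contrapT => /not_hyperbolic P0.
have [t t0 ht] := hnorm_pos omega e0.
have : @intermittent_phase R alpha gam (phi + (- t) *: omega).
  by apply: he; rewrite addrAC subrr add0r scaleNr hnormN.
move=> /intermittent_entropy [nu [h [inv en h0 eq om]]].
rewrite ExDZ in eq.
have [h' e' hle] := free_energy_holder phi inv.
have hh : h' = h by apply: EFin_inj; rewrite -e' en.
have : Ptop (phi + (- t) *: omega : CR) = phi (I0 R).
  apply/le_anti/andP; split.
    rewrite -P0 -[leRHS]addr0; apply: Ptop_lip; first exact: bdd_holder.
    move=> x; rewrite addr0 -[leLHS]/(phi x + - t * omega x).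
    by rewrite gerDl mulNr oppr_le0 mulr_ge0 ?omega_ge0// ltW.
  apply: le_trans (Ptop_ge0 alpha (bdd_holder _)).
  by rewrite -[leRHS]/(phi (I0 R) + - t * omega (I0 R)) omega0 mulr0 addr0.
rewrite hh P0 in hle; have := mulr_gt0 t0 om; lra.
Qed.

(** Positive entropy forces a positive integral of [omega], so adding a small multiple of [omega]
    raises the free energy of the Gibbs state above [Ptop phi], while the value at 0 stays. *)
Lemma intermittent_closure : @intermittent_phase R alpha gam `<=` closure hyperbolic.
Proof.
move=> phi /intermittent_entropy [nu [h [inv en h0 eq om]]].
apply/closure_holderP => e e0; have [t t0 ht] := hnorm_pos omega e0.
exists (phi + t *: omega); last by rewrite addrAC subrr add0r.
have [h' e' hle] := free_energy_holder (phi + t *: omega) inv.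
have hh : h' = h by apply: EFin_inj; rewrite -e' en.
rewrite ExDZ hh in hle.
rewrite /hyperbolic /= -[ltLHS]/(phi (I0 R) + t * omega (I0 R)) omega0 mulr0 addr0.
have := Ptop_ge0 alpha (bdd_holder phi); have := mulr_gt0 t0 om; lra.
Qed.

Lemma transition_locusP phi :
  transition_locus alpha gam phi <-> closure hyperbolic phi /\ ~ hyperbolic phi.
Proof.
rewrite /transition_locus /boundary interior_intermittent.
have -> : closure (@intermittent_phase R alpha gam) = closure hyperbolic; last by [].
apply/seteqP; split.
  have e : closure (closure hyperbolic) = closure hyperbolic.
    by apply/esym/closure_id; exact: closed_closure.
  rewrite -[X in _ `<=` X]e.
  exact: closure_subset intermittent_closure.
exact: closure_subset hyperbolic_intermittent.
Qed.

Lemma pressure_scale (t : R) phi : fine (pressure alpha (t *: phi)) = Ptop (fun x => t * phi x).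
Proof. by rewrite pressure_holder. Qed.

Lemma analytic_scale (h : R -> R) (b : R) : 0 < b ->
  analytic_at (fun s => h (s * b)) 1 -> analytic_at h b.
Proof.
move=> b0 [a [r [r0 hr]]]; exists (fun n => a n / b ^+ n), (r * b).
split => [|y hy]; first by rewrite mulr_gt0.
have := hr (y / b); rewrite divfK ?gt_eqF//.
have -> : y / b - 1 = (y - b) / b by rewrite mulrBl divff// gt_eqF.
rewrite normrM [`|b^-1|]gtr0_norm ?invr_gt0// ltr_pdivrMr// => /(_ hy).
have -> : (fun n => a n * ((y - b) / b) ^+ n) = (fun n => a n / b ^+ n * (y - b) ^+ n).
  by apply/funext => n; rewrite expr_div_n mulrA mulrAC.
by [].
Qed.

Lemma analytic_germ (h h' : R -> R) (b : R) :
  (exists2 r, 0 < r & forall t, `|t - b| < r -> h t = h' t) ->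
  analytic_at h b -> analytic_at h' b.
Proof.
move=> [r r0 e] [a [r' [r'0 hr]]]; exists a, (Num.min r r'); split; first by rewrite lt_min r0.
by move=> y; rewrite lt_min => /andP[h1 h2]; rewrite -e//; exact: hr.
Qed.

Lemma analytic_linear (c b : R) : analytic_at (fun t => t * c) b.
Proof.
exists (fun n => if n is 0%N then b * c else if n is 1%N then c else 0), 1; split => // y _.
set u := fun n : nat => _ * _.
have fin m : series u m.+2 = y * c.
  rewrite /series /= !big_nat_recl// big1 => [|i _]; last by rewrite /u mul0r.
  by rewrite /u expr0 expr1; ring.
apply/cvg_ballP => e e0; near=> n.
rewrite (_ : n = (n - 2).+2); first by rewrite fin; exact: ballxx.
have : (1 < n)%N by near: n; exists 2%N.
lia.
Unshelve. all: by end_near. Qed.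

Lemma analytic_hyperbolic phi (b : R) : 0 < b -> hyperbolic (b *: phi) ->
  analytic_at (fun t : R => fine (pressure alpha (t *: phi))) b.
Proof.
move=> b0 h; apply: (analytic_scale b0).
have [A hA] := holder_hol (b *: phi); have := Ptop_analytic1 gam1 hA h.
apply: analytic_germ; exists 1 => // t _; rewrite pressure_scale; congr Ptop.
by apply/funext => x; rewrite -[(b *: phi) x]/(b * phi x) mulrA.
Qed.

Lemma analytic_flat phi (b : R) :
  (exists2 r, 0 < r & forall t, `|t - b| < r -> ~ hyperbolic (t *: phi)) ->
  analytic_at (fun t : R => fine (pressure alpha (t *: phi))) b.
Proof.
move=> [r r0 hr]; apply: (analytic_germ _ (analytic_linear (phi (I0 R)) b)).
by exists r => // t /hr /not_hyperbolic; rewrite pressure_holder => ->.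
Qed.

(** Were no hyperbolic multiple of [phi] close to [b *: phi], the pressure would be [t * phi 0] for
    [t] around [b], hence analytic there. *)
Lemma transition_param_locus phi (b : R) :
  transition_param_set alpha phi b -> transition_locus alpha gam (b *: phi).
Proof.
move=> [b0 na]; apply/transition_locusP; split; last by move=> /(analytic_hyperbolic b0).
apply/closure_holderP => e e0; apply: contrapT => hn; apply: na; apply: analytic_flat.
have p := hnorm_ge0 phi; have p1 : 0 < 1 + hnorm phi by lra.
exists (e / (1 + hnorm phi)) => [|t ht hh]; first by rewrite divr_gt0.
apply: hn; exists (t *: phi) => //; rewrite -scalerBl hnormZ.
rewrite (le_lt_trans (_ : _ <= `|t - b| * (1 + hnorm phi)))//.
  by rewrite ler_wpM2l//; lra.
by rewrite -ltr_pdivlMr.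
Qed.

Lemma beta_crit_mem phi (b : R) : beta_crit alpha gam phi = b%:E ->
  transition_param_set alpha phi b.
Proof.
rewrite /beta_crit; case: asboolP => // u [<-].
have [c hc] : exists c, transition_param_set alpha phi c.
  apply: contrapT => /forallNP h; apply: u => c c0; apply: contrapT => na.
  by apply: (h c).
exact: (xgetPex 0 (ex_intro _ c hc)).
Qed.

Lemma geo_not_hyperbolic (t : R) : 1 <= t -> ~ hyperbolic (t *: phi0).
Proof.
move=> t1; rewrite /hyperbolic /= -[X in X < _]/(t * geo alpha (I0 R)) geo0 mulr0.
apply/negP; rewrite -leNgt -(Ptop_geo alpha) -[leRHS]addr0; apply: Ptop_lip; first exact: geo_bdd.
move=> x; rewrite addr0 -[leLHS]/(t * geo alpha x) ler_neMl//.
exact: geo_le0.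
Qed.

Lemma geo_hyperbolic (t : R) : 0 < t < 1 -> hyperbolic (t *: phi0).
Proof.
move=> t01; rewrite /hyperbolic /= -[X in X < _]/(t * geo alpha (I0 R)) geo0 mulr0.
exact: Ptop_beta_geo.
Qed.

Lemma geo_pressure_flat (t : R) : 1 <= t -> fine (pressure alpha (t *: phi0)) = 0.
Proof.
move=> t1; rewrite pressure_holder /= (not_hyperbolic (geo_not_hyperbolic t1)).
by rewrite -[LHS]/(t * geo alpha (I0 R)) geo0 mulr0.
Qed.

Lemma geo_pressure_pos (t : R) : 0 < t < 1 -> 0 < fine (pressure alpha (t *: phi0)).
Proof. by move=> t01; rewrite pressure_holder /=; exact: Ptop_beta_geo. Qed.

(** The pressure is 0 to the right of 1, so all coefficients of an expansion at 1 would vanish by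
    [pser_one_sided]; but it is positive to the left. *)
Lemma geo_not_analytic : ~ analytic_at (fun t : R => fine (pressure alpha (t *: phi0))) 1.
Proof.
move=> [a [r [r0 hr]]].
have a0 : forall n, a n = 0.
  apply: (pser_one_sided r0) => s /andP[s0 sr].
  have := hr (1 + s); rewrite addrAC subrr add0r ger0_norm// => /(_ sr).
  by rewrite geo_pressure_flat// lerDl.
pose m := Num.min r 1 / 2; have m0 : 0 < m by rewrite divr_gt0// lt_min r0 ltr01.
have mr : m < r by rewrite ltr_pdivrMr// (le_lt_trans (_ : _ <= r)) ?ge_min ?lexx//; lra.
have m1 : m < 1 by rewrite ltr_pdivrMr// (le_lt_trans (_ : _ <= 1)) ?ge_min ?lexx ?orbT//; lra.
have := hr (1 - m); rewrite addrAC subrr add0r normrN gtr0_norm// => /(_ mr) h.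
have : 0 < fine (pressure alpha ((1 - m) *: phi0)) by apply: geo_pressure_pos; apply/andP; split; lra.
suff -> : fine (pressure alpha ((1 - m) *: phi0)) = 0 by rewrite ltxx.
have z : series (fun n => a n * (- m) ^+ n) @ \oo --> (0 : R).
  rewrite (_ : series _ = fun=> 0); first exact: cvg_cst.
  by apply/funext => n; rewrite /series /= big1// => i _; rewrite a0 mul0r.
by move: h => /cvg_unique; apply; [exact: Rhausdorff|exact: z].
Qed.

Lemma geo_param_set : transition_param_set alpha phi0 = [set 1].
Proof.
apply/seteqP; split => b /=; last first.
  by move=> ->; split => //; exact: geo_not_analytic.
move=> [b0 na]; have [b1|b1|//] := ltgtP b 1.
  by exfalso; apply: na; apply: analytic_hyperbolic => //; apply: geo_hyperbolic; rewrite b0.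
exfalso; apply: na; apply: analytic_flat; exists (b - 1); first by rewrite subr_gt0.
move=> t; rewrite ltr_norml => /andP[h1 h2]; apply: geo_not_hyperbolic; lra.
Qed.

Lemma geo_undergoes : undergoes_transition alpha phi0.
Proof. by move=> h; apply: geo_not_analytic; exact: h. Qed.

Lemma geo_beta_crit : beta_crit alpha gam phi0 = 1%:E.
Proof.
rewrite /beta_crit asboolT; last exact: geo_undergoes.
congr EFin; rewrite /transition_param geo_param_set.
by have := @xgetPex _ 0 [set (1 : R)] (ex_intro _ 1 erefl).
Qed.

Section flattening.
Variable d : R.
Hypothesis d01 : 0 < d <= 1.

Definition bump_fun (x : I) : R := ln (dfr alpha (Num.min (ival x) d)).
Definition bumpC : R := (1 + alpha%:num) * (Num.truncn alpha%:num).+1%:R.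

(** On [0, d] write z^al = d^al (z / d)^al: rescaling costs d^-gam in the seminorm, and the
    remaining exponent [al - gam] is positive. *)
Lemma bump_hol : hol (bumpC * d `^ (alpha%:num - gam%:num)) bump_fun.
Proof.
case/andP: d01 => d0 d1 x y; rewrite /bump_fun (le_trans (ln_dist _ _)) ?dfr_ge1//.
set u := Num.min _ _; set v := Num.min _ _.
have u01 : 0 <= u / d <= 1.
  by rewrite divr_ge0 ?le_min ?ival_ge0 ?(ltW d0)//= ler_pdivrMr// mul1r ge_min lexx orbT.
have v01 : 0 <= v / d <= 1.
  by rewrite divr_ge0 ?le_min ?ival_ge0 ?(ltW d0)//= ler_pdivrMr// mul1r ge_min lexx orbT.
have pw (z : R) : 0 <= z / d -> z `^ alpha%:num = d `^ alpha%:num * (z / d) `^ alpha%:num.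
  by move=> z0; rewrite -powRM ?(ltW d0)// mulrC divfK// gt_eqF.
rewrite /dfr opprD addrACA subrr add0r -mulrBr normrM ger0_norm ?addr_ge0// /bumpC -!mulrA.
rewrite ler_wpM2l ?addr_ge0//.
have [/andP[u0 _] /andP[v0 _]] := (u01, v01).
rewrite (pw u)// (pw v)// -mulrBr normrM ger0_norm ?powR_ge0//.
have h := @powR_dist R alpha%:num gam%:num (u / d) (v / d) (ltac:(by [])) gam1 (ltW gamal) u01 v01.
rewrite (le_trans (ler_wpM2l (powR_ge0 _ _) h))// mulrCA ler_wpM2l//.
rewrite -mulrBl normrM [`|d^-1|]gtr0_norm ?invr_gt0// powRM ?invr_ge0 ?(ltW d0)//.
have -> : d^-1 `^ gam%:num = (d `^ gam%:num)^-1.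
  by rewrite -powR_inv1 ?(ltW d0)// powRAC powR_inv1// powR_ge0.
rewrite powRB ?(gt_eqF d0) ?implybT//.
have -> : d `^ alpha%:num / d `^ gam%:num * gdist gam x y = d `^ alpha%:num * (gdist gam x y / d `^ gam%:num).
  by ring.
apply: ler_wpM2l; first exact: powR_ge0.
apply: ler_wpM2r; first by rewrite invr_ge0 powR_ge0.
rewrite ge0_ler_powR ?nnegrE//.
rewrite /u /v; have [x1|x1] := leP (ival x) d; have [y1|y1] := leP (ival y) d => //.
- rewrite ler0_norm ?subr_le0// ler0_norm ?subr_le0 ?(le_trans x1 (ltW y1))//; lra.
- rewrite ger0_norm ?subr_ge0// ger0_norm ?subr_ge0 ?(le_trans y1 (ltW x1))//; lra.
- by rewrite subrr normr0.
Qed.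

Definition bump : CR := Holder (hol_holder bump_hol).

Lemma bump_norm : hnorm bump <= (1 + alpha%:num + bumpC) * d `^ (alpha%:num - gam%:num).
Proof.
case/andP: d01 => d0 d1; rewrite [leRHS]mulrDl; apply: hnorm_le; last exact: bump_hol.
move=> x; rewrite -[bump x]/(bump_fun x) ger0_norm ?ln_ge0 ?dfr_ge1//.
rewrite (le_trans (le_ln1Dx _))//.
  by rewrite (lt_le_trans (ltrN10 _))// mulr_ge0 ?powR_ge0// addr_ge0.
rewrite ler_wpM2l ?addr_ge0//.
apply: (@le_trans _ _ (d `^ alpha%:num)).
  by rewrite ge0_ler_powR ?nnegrE ?le_min ?ival_ge0 ?(ltW d0)// ge_min lexx orbT.
by rewrite ger_powR ?d0// gerBl.
Qed.

Definition flat : CR := phi0 + bump.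

Lemma flat_zero x : ival x <= d -> flat x = 0.
Proof.
move=> xd; rewrite -[LHS]/(- ln (dfr alpha (ival x)) + ln (dfr alpha (Num.min (ival x) d))).
by rewrite min_l// addNr.
Qed.

Lemma flat0 : flat (I0 R) = 0.
Proof. by rewrite flat_zero//; case/andP: d01 => /ltW. Qed.

Lemma flat_hyperbolic (t : R) : hyperbolic (t *: flat).
Proof.
rewrite /hyperbolic /= -[ltLHS]/(t * flat (I0 R)) flat0 mulr0.
case/andP: d01 => d0 _; apply: (@pressure_lower_flat R alpha _ d (bdd_holder (t *: flat)) d0).
by move=> x xd; rewrite -[(t *: flat) x]/(t * flat x) flat_zero// mulr0.
Qed.

Lemma flat_beta_crit : ~ undergoes_transition alpha flat /\ beta_crit alpha gam flat = +oo%E.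
Proof.
have nu : ~ undergoes_transition alpha flat.
  by apply; move=> b b0; apply: analytic_hyperbolic => //; exact: flat_hyperbolic.
by split => //; rewrite /beta_crit asboolF.
Qed.

End flattening.

Lemma bump_small (e : R) : 0 < e -> exists d (d01 : 0 < d <= 1), hnorm (bump d01) < e.
Proof.
move=> e0; have ag : 0 < alpha%:num - gam%:num by rewrite subr_gt0.
have K0 : 0 < 1 + alpha%:num + bumpC.
  by rewrite ltr_pwDl ?addr_gt0// mulr_ge0// addr_ge0.
have e2 : 0 < e / 2 by rewrite divr_gt0.
have [r r0 hr] := powR_small (PosNum ag) (divr_gt0 e2 K0).
have d01 : 0 < Num.min r 1 <= 1 by rewrite lt_min r0 ltr01 ge_min lexx orbT.
exists (Num.min r 1), d01; rewrite (le_lt_trans (bump_norm d01))//.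
have h : Num.min r 1 `^ (alpha%:num - gam%:num) <= e / 2 / (1 + alpha%:num + bumpC).
  by apply: hr; [case/andP: d01 => /ltW|rewrite ge_min lexx].
rewrite (le_lt_trans (ler_wpM2l (ltW K0) h))// mulrC divfK ?gt_eqF//; lra.
Qed.

Lemma hnormD phi psi : hnorm (phi + psi) <= hnorm phi + hnorm psi.
Proof. exact: (@holder_normD R (real_scalars R) gam phi psi). Qed.

Lemma flat_near (e : R) : 0 < e -> exists d (d01 : 0 < d <= 1), hnorm (flat d01 - phi0) < e.
Proof.
move=> e0; have [d [d01 hd]] := bump_small e0.
by exists d, d01; rewrite /flat addrAC subrr add0r.
Qed.

Lemma geo_transition_locus (t : R) : 0 < t -> transition_locus alpha gam (t *: phi0) <-> 1 <= t.
Proof.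
move=> t0; split => [/transition_locusP [_ nh]|t1].
  by rewrite leNgt; apply/negP => t1; apply/nh/geo_hyperbolic; rewrite t0.
apply/transition_locusP; split; last exact: geo_not_hyperbolic.
apply/closure_holderP => e e0; have [d [d01 hd]] := flat_near (divr_gt0 e0 t0).
exists (t *: flat d01); first exact: flat_hyperbolic.
by rewrite -scalerBr hnormZ gtr0_norm// mulrC -ltr_pdivlMr.
Qed.

Lemma geo_ground : ground_delta0 alpha gam phi0.
Proof.
have [A hA] := holder_hol phi0.
have inv0 := delta0_invariant alpha.
have e0 : (\int[delta0 R]_x (phi0 x)%:E = 0)%E.
  rewrite ExE; last exact: bmeas_holder.
  by rewrite (Ex_delta0 hA) -[phi0 _]/(geo alpha (I0 R)) geo0.
split; first exact: inv0.
apply/le_anti/andP; split; first by apply: ereal_sup_ubound; exists (delta0 R).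
rewrite e0; apply: ge_ereal_sup => _ [nu inv <-].
rewrite ExE; last exact: bmeas_holder.
rewrite lee_fin -(Ex_cst nu 0); apply: Ex_le; [exact: bmeas_holder|exact: bmeas_cst|].
by move=> x; exact: geo_le0.
Qed.

(** Take a Gibbs state of [s * flat] with [s = (1 + al) / t]. By [entropy_omega] its entropy is at
    most [s * t] times the integral of [omega], so [s] times the integral of
    [psi = flat + t * omega] is at least the pressure of [s * flat], which is positive, whereas
    [psi 0 = 0]. *)
Lemma geo_ground_boundary : boundary (ground_delta0 alpha gam) phi0.
Proof.
split; first by apply: subset_closure; exact: geo_ground.
move=> /interior_holderP [e e0 he]; have e2 : 0 < e / 2 by rewrite divr_gt0.
have [d [d01 hd]] := flat_near e2; have [t t0 ht] := hnorm_pos omega e2.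
pose psi : CR := flat d01 + t *: omega.
have [inv0 eq] : ground_delta0 alpha gam psi.
  apply: he; rewrite /psi addrAC; apply: le_lt_trans (hnormD _ _) _.
  by rewrite [e]splitr ltrD.
have p0 : psi (I0 R) = 0.
  by rewrite -[LHS]/(flat d01 (I0 R) + t * omega (I0 R)) flat0 omega0 mulr0 addr0.
have a0 : 0 < 1 + alpha%:num by rewrite addr_gt0.
pose s := (1 + alpha%:num) / t; have s0 : 0 < s by rewrite divr_gt0.
have hyp := flat_hyperbolic d01 s; have [A hA] := holder_hol (s *: flat d01).
have [nu [inv _ ent pos]] := exists_mixing_gibbs gam1 hA hyp.
have ho := entropy_omega inv ent.
have es : Ex nu (s *: flat d01 : CR) = s * Ex nu (flat d01).
  by rewrite -ExZ//; exact: bmeas_holder.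
have pp : 0 < Ptop (s *: flat d01 : CR).
  move: hyp; rewrite /hyperbolic /= -[ltLHS]/(s * flat d01 (I0 R)) flat0 mulr0 //.
have : Ex nu psi <= 0.
  have [B hB] := holder_hol psi.
  rewrite -lee_fin -ExE; last exact: bmeas_holder.
  rewrite -[leRHS]/(0%:E) -p0 -(Ex_delta0 hB) -ExE; last exact: bmeas_holder.
  by rewrite eq; apply: ereal_sup_ubound; exists nu.
rewrite /psi ExDZ; apply/negP; rewrite -ltNge.
rewrite -(pmulr_rgt0 _ s0) mulrDr mulrA /s divfK ?gt_eqF// -/s -es.
lra.
Qed.

Lemma geo_beta_crit_discontinuous : ~ {for phi0, continuous (beta_crit alpha gam)}.
Proof.
move=> h.
have : nbhs (beta_crit alpha gam phi0) [set y | (y < 2%:E)%E].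
  apply: open_nbhs_nbhs; split; first exact: open_ereal_lt_ereal.
  by rewrite /= geo_beta_crit lte_fin ltr1n.
move=> /h /nbhs_holderP [e e0 he]; have [d [d01 hd]] := flat_near e0.
by have := he _ hd; rewrite /= (flat_beta_crit d01).2.
Qed.

Lemma geo_nonpersistent : nonpersistent alpha phi0.
Proof.
split; first exact: geo_undergoes.
move=> [/nbhs_holderP [e e0 he] _]; have [d [d01 hd]] := flat_near e0.
by have [nu _] := flat_beta_crit d01; exact: nu (he _ hd).
Qed.

Lemma beta_crit_one_proper :
  [set phi : CR | beta_crit alpha gam phi = 1%:E] `<` transition_locus alpha gam.
Proof.
rewrite properEneq; split; last first.
  by move=> phi /beta_crit_mem /transition_param_locus; rewrite scale1r.
(* The potential [2 *: phi0] is in the locus, but its pressure function vanishes near the parameter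
   1 and is analytic there. *)
apply/eqP => e; have : transition_locus alpha gam ((2 : R) *: phi0).
  by apply/geo_transition_locus => //; rewrite ler1n.
rewrite -e /= => /beta_crit_mem [_]; apply; apply: analytic_flat.
exists (1 / 2) => [|t]; first by rewrite divr_gt0.
rewrite ltr_norml => /andP[h1 h2]; rewrite scalerA; apply: geo_not_hyperbolic; lra.
Qed.

End phase_diagram.

(** * Goursat lemma and one-sided uniqueness *)

Section goursat.
Variable R : realType.
Implicit Types (u U : R -> R) (a b c d x y e m : R).

Lemma primitive_exists u : (forall x, -3 < x < 3 -> {for x, continuous u}) ->
  exists U, forall x, -2 < x < 2 -> is_derive x (1 : R) U (u x).
Proof.
move=> cu; exists (fun x => \int[lebesgue_measure]_(t in `[(-2 : R), x]) u t)%R => x /andP[x2 x2'].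
have iu : (@lebesgue_measure R).-integrable `[(-2 : R), 2] (EFin \o u).
  apply: continuous_compact_integrable; first exact: segment_compact.
  apply: continuous_in_subspaceT => y; rewrite inE /= in_itv /= => /andP[y1 y2].
  by apply: cu; apply/andP; split; lra.
have [|d1 d2] := continuous_FTC1_closed x2' iu x2.
  by apply: cu; apply/andP; split; lra.
rewrite derive1E in d2; exact: DeriveDef d1 d2.
Qed.

(* Only the primitives of a 1-form [P dx + Q dy] along the horizontal and
   vertical lines are used, never an integral. *)
Variables (P Q A B : R -> R -> R).
Definition in_square x y : Prop := -2 < x < 2 /\ -2 < y < 2.
Hypothesis hA : forall y x, in_square x y -> is_derive x (1 : R) (A y) (P x y).
Hypothesis hB : forall x y, in_square x y -> is_derive y (1 : R) (B x) (Q x y).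

(* The integral of [P dx + Q dy] along the boundary of [a, b] x [c, d]. *)
Definition circ a b c d : R :=
  (A c b - A c a) + (B b d - B b c) - (A d b - A d a) - (B a d - B a c).

(** The mean value theorem for [U] minus a primitive of the affine function. *)
Lemma mean_bound1 U u a b M (al be : R) : a <= b ->
  (forall x, a <= x <= b -> is_derive x (1 : R) U (u x)) ->
  (forall x, a <= x <= b -> `|u x - (al + be * x)| <= M) ->
  `|U b - U a - (al * (b - a) + be * (b ^+ 2 - a ^+ 2) / 2)| <= M * (b - a).
Proof.
move=> ab hU hM; pose V x := U x - (al * x + be / 2 * (x * x)).
have dV x : a <= x <= b -> is_derive x (1 : R) V (u x - (al + be * x)).
  move=> axb; have h1 := hU x axb.
  have hid : is_derive x (1 : R) (@id R) 1 := is_derive_id x 1.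
  have h2 : is_derive x (1 : R) (fun x => al * x + be / 2 * (x * x)) (al + be * x).
    have h3 := is_deriveM hid hid.
    have h4 := is_deriveD (is_deriveZ al hid) (is_deriveZ (be / 2) h3).
    apply: (is_derive_eq h4); by rewrite -[LHS]/(al * 1 + be / 2 * (x * 1 + x * 1)); lra.
  exact: is_deriveB h1 h2.
have [| |c cab e] := @MVT_segment R V (fun x => u x - (al + be * x)) a b ab.
- move=> x; rewrite in_itv /= => /andP[x1 x2]; apply: dV; by rewrite (ltW x1) (ltW x2).
- apply: derivable_within_continuous => x; rewrite in_itv /= => axb.
  by have [] := dV x axb.
have -> : U b - U a - (al * (b - a) + be * (b ^+ 2 - a ^+ 2) / 2) = V b - V a.
  by rewrite /V; field.
rewrite e normrM [`|b - a|]ger0_norm ?subr_ge0// ler_wpM2r ?subr_ge0//.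
by apply: hM; move: cab; rewrite in_itv.
Qed.

Lemma mean_bound0 U u a b M : a <= b ->
  (forall x, a <= x <= b -> is_derive x (1 : R) U (u x)) ->
  (forall x, a <= x <= b -> `|u x| <= M) -> `|U b - U a| <= M * (b - a).
Proof.
move=> ab hU hM; have := mean_bound1 (al := 0) (be := 0) (M := M) ab hU.
rewrite !mul0r !(addr0, subr0); apply => x axb.
by rewrite mul0r addr0 subr0; exact: hM.
Qed.

(** Both coefficients are differentiable at the point with equal cross derivatives [be]: the form is
    closed there, with no continuity asked of the derivatives. *)
Definition closed_at x0 y0 : Prop := exists al be ga : R, forall e, 0 < e ->
  exists2 dl, 0 < dl & forall x y, `|x - x0| <= dl -> `|y - y0| <= dl ->
    `|P x y - (P x0 y0 + al * (x - x0) + be * (y - y0))| <= e * (`|x - x0| + `|y - y0|) /\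
    `|Q x y - (Q x0 y0 + be * (x - x0) + ga * (y - y0))| <= e * (`|x - x0| + `|y - y0|).

Lemma itv_dist a b x x0 : a <= x <= b -> a <= x0 <= b -> `|x - x0| <= b - a.
Proof. by move=> /andP[h1 h2] /andP[h3 h4]; rewrite ler_norml; lra. Qed.

Lemma norm_add4 (x1 x2 x3 x4 e1 e2 e3 e4 : R) : `|x1| <= e1 -> `|x2| <= e2 ->
  `|x3| <= e3 -> `|x4| <= e4 -> `|x1 + x2 - x3 - x4| <= e1 + e2 + e3 + e4.
Proof.
move=> h1 h2 h3 h4; rewrite (le_trans (ler_normB _ _))// lerD//.
rewrite (le_trans (ler_normB _ _))// lerD//.
by rewrite (le_trans (ler_normD _ _))// lerD.
Qed.

(** The affine part of a closed form has circulation 0, so only error terms of second order in the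
    side lengths remain. *)
Lemma circ_small a b c d x0 y0 : -2 < a -> b < 2 -> -2 < c -> d < 2 ->
  a <= x0 <= b -> c <= y0 <= d -> closed_at x0 y0 -> forall e, 0 < e ->
  exists2 dl, 0 < dl & forall a' b' c' d', a <= a' -> b' <= b -> c <= c' -> d' <= d ->
    a' <= x0 <= b' -> c' <= y0 <= d' -> b' - a' <= dl -> d' - c' <= dl ->
    `|circ a' b' c' d'| <= 2 * e * (b' - a' + (d' - c')) ^+ 2.
Proof.
move=> a2 b2 c2 d2 x0ab y0cd [al [be [ga h]]] e e0; have [dl dl0 hd] := h e e0.
exists dl => // a' b' c' d' aa bb cc dd /andP[x1 x2] /andP[y1 y2] bl dl'.
set l := b' - a'; set m := d' - c'.
have near x y : a' <= x <= b' -> c' <= y <= d' -> [/\ in_square x y,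
   `|x - x0| <= dl, `|y - y0| <= dl & `|x - x0| + `|y - y0| <= l + m].
  move=> /andP[p1 p2] /andP[q1 q2]; split.
  - split; apply/andP; split.
    + exact: lt_le_trans a2 (le_trans aa p1).
    + exact: le_lt_trans p2 (le_lt_trans bb b2).
    + exact: lt_le_trans c2 (le_trans cc q1).
    + exact: le_lt_trans q2 (le_lt_trans dd d2).
  - by apply: le_trans bl; apply: itv_dist; rewrite ?x1 ?p1.
  - by apply: le_trans dl'; apply: itv_dist; rewrite ?y1 ?q1.
  - by apply: lerD; apply: itv_dist; rewrite ?x1 ?p1 ?y1 ?q1.
have hP y : c' <= y <= d' -> `|A y b' - A y a' -
    ((P x0 y0 - al * x0 + be * (y - y0)) * (b' - a') + al * (b' ^+ 2 - a' ^+ 2) / 2)| <= e * (l + m) * l.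
  move=> yc; apply: (mean_bound1 (u := fun x => P x y)); first exact: le_trans x1 x2.
    by move=> x xa; apply: hA; case: (near x y xa yc).
  move=> x xa; have [_ n1 n2 n3] := near x y xa yc.
  have [k1 _] := hd x y n1 n2.
  have -> : P x y - (P x0 y0 - al * x0 + be * (y - y0) + al * x) =
    P x y - (P x0 y0 + al * (x - x0) + be * (y - y0)) by ring.
  by rewrite (le_trans k1)// ler_wpM2l// ltW.
have hQ x : a' <= x <= b' -> `|B x d' - B x c' -
    ((Q x0 y0 - ga * y0 + be * (x - x0)) * (d' - c') + ga * (d' ^+ 2 - c' ^+ 2) / 2)| <= e * (l + m) * m.
  move=> xa; apply: (mean_bound1 (u := fun y => Q x y)); first exact: le_trans y1 y2.
    by move=> y yc; apply: hB; case: (near x y xa yc).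
  move=> y yc; have [_ n1 n2 n3] := near x y xa yc.
  have [_ k1] := hd x y n1 n2.
  have -> : Q x y - (Q x0 y0 - ga * y0 + be * (x - x0) + ga * y) =
    Q x y - (Q x0 y0 + be * (x - x0) + ga * (y - y0)) by ring.
  by rewrite (le_trans k1)// ler_wpM2l// ltW.
have ab' : a' <= b' := le_trans x1 x2.
have cd' : c' <= d' := le_trans y1 y2.
have ma : a' <= a' <= b' by rewrite lexx.
have mb : a' <= b' <= b' by rewrite lexx ab'.
have mc : c' <= c' <= d' by rewrite lexx.
have md : c' <= d' <= d' by rewrite lexx cd'.
have := norm_add4 (hP _ mc) (hQ _ mb) (hP _ md) (hQ _ ma).
set X1 := A c' b' - A c' a'; set X2 := A d' b' - A d' a'.
set X3 := B a' d' - B a' c'; set X4 := B b' d' - B b' c'.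
congr (`|_| <= _); first by rewrite /circ -/X1 -/X2 -/X3 -/X4; ring.
by rewrite -/l -/m; ring.
Qed.

Lemma circ_split a b c d x y :
  circ a b c d = circ a x c y + circ x b c y + circ a x y d + circ x b y d.
Proof. by rewrite /circ; ring. Qed.

Record rect := Rect { rl : R; rr : R; rb : R; rt : R }.

Definition rcirc (r : rect) := circ (rl r) (rr r) (rb r) (rt r).

Definition quarter (r s : rect) : Prop :=
  [/\ rl r <= rl s, rr s <= rr r, rb r <= rb s & rt s <= rt r] /\
  [/\ rr s - rl s = (rr r - rl r) / 2, rt s - rb s = (rt r - rb r) / 2 &
   `|rcirc r| <= 4 * `|rcirc s|].

Lemma quarter_exists r : rl r <= rr r -> rb r <= rt r -> exists s, quarter r s.
Proof.
case: r => a b c d /= ab cd; pose x := (a + b) / 2; pose y := (c + d) / 2.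
have e := circ_split a b c d x y.
apply: contrapT => /forallNP h.
have n s : [/\ a <= rl s, rr s <= b, c <= rb s & rt s <= d] ->
   rr s - rl s = (b - a) / 2 -> rt s - rb s = (d - c) / 2 -> 4 * `|rcirc s| < `|circ a b c d|.
  by move=> h1 h2 h3; rewrite ltNge; apply/negP => h4; apply: (h s); split.
have n1 := n (Rect a x c y) (ltac:(rewrite /x /y; split => /=; lra))
  (ltac:(rewrite /x /y /=; lra)) (ltac:(rewrite /x /y /=; lra)).
have n2 := n (Rect x b c y) (ltac:(rewrite /x /y; split => /=; lra))
  (ltac:(rewrite /x /y /=; lra)) (ltac:(rewrite /x /y /=; lra)).
have n3 := n (Rect a x y d) (ltac:(rewrite /x /y; split => /=; lra))
  (ltac:(rewrite /x /y /=; lra)) (ltac:(rewrite /x /y /=; lra)).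
have n4 := n (Rect x b y d) (ltac:(rewrite /x /y; split => /=; lra))
  (ltac:(rewrite /x /y /=; lra)) (ltac:(rewrite /x /y /=; lra)).
move: n1 n2 n3 n4; rewrite /rcirc /= => n1 n2 n3 n4.
have := ler_normD (circ a x c y + circ x b c y + circ a x y d) (circ x b y d).
have := ler_normD (circ a x c y + circ x b c y) (circ a x y d).
have := ler_normD (circ a x c y) (circ x b c y).
rewrite -e; lra.
Qed.

Lemma nested_point (a b : nat -> R) : (forall n, a n <= b n) ->
  (forall n, a n <= a n.+1) -> (forall n, b n.+1 <= b n) -> exists x, forall n, a n <= x <= b n.
Proof.
move=> ab ai bd.
have am (n m : nat) : (n <= m)%N -> a n <= a m.
  by move=> /subnK <-; elim: (m - n)%N => // k ih; exact: le_trans ih (ai _).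
have bm (n m : nat) : (n <= m)%N -> b m <= b n.
  by move=> /subnK <-; elim: (m - n)%N => // k ih; exact: le_trans (bd _) ih.
have key (n m : nat) : a n <= b m.
  have [nm|/ltnW mn] := leqP n m; first exact: le_trans (am _ _ nm) (ab m).
  exact: le_trans (ab n) (bm _ _ mn).
exists (sup (range a)) => n; apply/andP; split.
  by apply: ub_le_sup; [exists (b 0%N) => _ [k _ <-]|exists n].
by apply: ge_sup => [|_ [k _ <-]//]; exists (a 0%N), 0%N.
Qed.

Lemma goursat a b c d : -2 < a -> a <= b -> b < 2 -> -2 < c -> c <= d -> d < 2 ->
  (forall x y, a <= x <= b -> c <= y <= d -> closed_at x y) -> circ a b c d = 0.
Proof.
move=> a2 ab b2 c2 cd d2 hc.
have [step hstep] : exists step : rect -> rect, forall r, rl r <= rr r -> rb r <= rt r -> quarter r (step r).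
  have /choice[st hs] : forall r, exists s, rl r <= rr r -> rb r <= rt r -> quarter r s.
    move=> r; have [h1|h1] := pselect (rl r <= rr r /\ rb r <= rt r).
      by have [s hs] := quarter_exists h1.1 h1.2; exists s.
    by exists r => p q; exfalso; apply: h1.
  by exists st.
pose s n := iter n step (Rect a b c d).
have ord n : rl (s n) <= rr (s n) /\ rb (s n) <= rt (s n).
  elim: n => // n [h1 h2]; have [_ [e1 e2 _]] := hstep _ h1 h2.
  by split; rewrite -subr_ge0 /s /= ?e1 ?e2 divr_ge0// subr_ge0.
have st n : quarter (s n) (s n.+1) by have [h1 h2] := ord n; exact: hstep.
have size n : rr (s n) - rl (s n) = (b - a) / 2 ^+ n /\ rt (s n) - rb (s n) = (d - c) / 2 ^+ n.
  elim: n => [|n [i1 i2]]; first by rewrite expr0 !divr1.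
  have [_ [-> -> _]] := st n; rewrite i1 i2 exprSr !invfM !mulrA; split; ring.
have big n : `|circ a b c d| <= 4 ^+ n * `|rcirc (s n)|.
  elim: n => [|n ih]; first by rewrite expr0 mul1r.
  have [_ [_ _ h]] := st n; rewrite (le_trans ih)// exprSr -mulrA ler_wpM2l// exprn_ge0//.
have [x0 hx] : exists x, forall n, rl (s n) <= x <= rr (s n).
  by apply: nested_point => n; [case: (ord n)|case: (st n) => [[]]|case: (st n) => [[]]].
have [y0 hy] : exists y, forall n, rb (s n) <= y <= rt (s n).
  by apply: nested_point => n; [case: (ord n)|case: (st n) => [[]]|case: (st n) => [[]]].
have inc n : [/\ a <= rl (s n), rr (s n) <= b, c <= rb (s n) & rt (s n) <= d].
  elim: n => // n [i1 i2 i3 i4]; have [[j1 j2 j3 j4] _] := st n.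
  by split; [exact: le_trans j1|exact: le_trans i2|exact: le_trans j3|exact: le_trans i4].
apply/eqP; rewrite -normr_le0; apply/ler_addgt0Pr => e e0; rewrite add0r.
pose L := b - a + (d - c); have L0 : 0 <= L by rewrite /L; lra.
(* After [n] bisections, 4^n times a circulation of at most 2 e' (L / 2^n)^2 is left, that is, at
   most 2 e' L^2. *)
pose e' := e / (2 * (L ^+ 2 + 1)).
have L1 : 0 < L ^+ 2 + 1 by rewrite ltr_wpDl ?sqr_ge0.
have e'0 : 0 < e' by rewrite divr_gt0// mulr_gt0.
have [dl dl0 hdl] := circ_small a2 b2 c2 d2 (hx 0%N) (hy 0%N) (hc x0 y0 (hx 0%N) (hy 0%N)) e'0.
have [n hn] := pow_unbounded (L / dl) (ltr1n R 2).
have n0 : 0 < 2 ^+ n :> R by rewrite exprn_gt0.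
have small z : 0 <= z -> z <= L -> z / 2 ^+ n <= dl.
  move=> z0 zL; rewrite ler_pdivrMr// mulrC -ler_pdivrMr// (le_trans _ (ltW hn))//.
  by rewrite ler_wpM2r// invr_ge0 ltW.
have [s1 s2] := size n; have [i1 i2 i3 i4] := inc n.
have := hdl _ _ _ _ i1 i2 i3 i4 (hx n) (hy n).
rewrite s1 s2 => /(_ (small _ _ _) (small _ _ _)).
have z1 : 0 <= b - a by lra. have z2 : 0 <= d - c by lra.
have z3 : b - a <= L by rewrite /L; lra. have z4 : d - c <= L by rewrite /L; lra.
move=> /(_ z1 z3 z2 z4) h; rewrite (le_trans (big n))//.
rewrite (le_trans (ler_wpM2l _ h)) ?exprn_ge0//.
have -> : 4 ^+ n * (2 * e' * ((b - a) / 2 ^+ n + (d - c) / 2 ^+ n) ^+ 2) = 2 * e' * L ^+ 2.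
  have q : 4 ^+ n = 2 ^+ n * 2 ^+ n :> R by rewrite -exprMn; congr (_ ^+ n); lra.
  by rewrite q /L; field; rewrite gt_eqF.
have -> : e = 2 * e' * (L ^+ 2 + 1) by rewrite /e'; field; rewrite gt_eqF.
have e'1 : 0 <= 2 * e' by have := e'0; lra.
by apply: ler_wpM2l => //; rewrite lerDl.
Qed.

(** The four rectangles around a small central square have circulation 0, and the square of side
    [2 * t] has perimeter [8 * t] and a form bounded by [M]. *)
Lemma goursat_punctured M : 0 <= M ->
  (forall x y, -1 <= x <= 1 -> -1 <= y <= 1 -> (x, y) <> (0, 0) -> closed_at x y) ->
  (exists2 r, 0 < r & forall x y, `|x| <= r -> `|y| <= r -> `|P x y| <= M /\ `|Q x y| <= M) ->
  circ (-1) 1 (-1) 1 = 0.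
Proof.
move=> M0 hc [r r0 hM]; apply/eqP; rewrite -normr_le0; apply/ler_addgt0Pr => e e0; rewrite add0r.
pose t := Num.min (1 / 2) (Num.min r (e / (8%:R * (M + 1)))).
have M1 : 0 < 8%:R * (M + 1) by lra.
have t0 : 0 < t by rewrite !lt_min r0 !divr_gt0.
have t1 : t <= 1 / 2 by rewrite ge_min lexx.
have tr : t <= r by rewrite !ge_min lexx !orbT.
have te : t * (8%:R * (M + 1)) <= e by rewrite -ler_pdivlMr// !ge_min lexx !orbT.
have {t1} [t1 t2] : t < 1 /\ t < 2 by lra.
clearbody t.
have nz x y : (x, y) <> (0, 0) <-> (x <> 0 \/ y <> 0).
  split; last by case=> h [xx yy]; apply: h.
  move=> h; have [x0|] := eqVneq x 0; last by move/eqP; left.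
  by right => y0; apply: h; rewrite x0 y0.
have sub (a b c d : R) : -1 <= a -> a <= b -> b <= 1 -> -1 <= c -> c <= d -> d <= 1 ->
    (forall x y, a <= x <= b -> c <= y <= d -> x <> 0 \/ y <> 0) -> circ a b c d = 0.
  clear -hc nz hA hB => h1 h2 h3 h4 h5 h6 hz; apply: goursat; try lra.
  move=> x y hx hy; apply: hc; last exact/nz/hz.
    by clear -hx h1 h3; move/andP: hx => [? ?]; apply/andP; split; lra.
  by clear -hy h4 h6; move/andP: hy => [? ?]; apply/andP; split; lra.
have g1 : circ (-1) 1 (-1) (- t) = 0.
  clear -sub t0 t1; apply: sub; try lra; move=> x y _ /andP[y1 y2]; right; lra.
have g2 : circ (-1) 1 t 1 = 0.
  clear -sub t0 t1; apply: sub; try lra; move=> x y _ /andP[y1 y2]; right; lra.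
have g3 : circ (-1) (- t) (- t) t = 0.
  clear -sub t0 t1; apply: sub; try lra; move=> x y /andP[x1 x2] _; left; lra.
have g4 : circ t 1 (- t) t = 0.
  clear -sub t0 t1; apply: sub; try lra; move=> x y /andP[x1 x2] _; left; lra.
have -> : circ (-1) 1 (-1) 1 = circ (- t) t (- t) t.
  by move: g1 g2 g3 g4; rewrite /circ; lra.
have bx x : - t <= x <= t -> `|x| <= r.
  by move=> /andP[h1 h2]; rewrite ler_norml; apply/andP; split; lra.
have sq x y : - t <= x <= t -> - t <= y <= t -> in_square x y.
  by move=> /andP[h1 h2] /andP[h3 h4]; split; apply/andP; split; lra.
have tt : - t <= t by lra.
have bA y : - t <= y <= t -> `|A y t - A y (- t)| <= M * (t - - t).
  move=> hy; apply: (mean_bound0 (u := fun x => P x y)) => // x hx; first exact/hA/sq.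
  by have [] := hM x y (bx x hx) (bx y hy).
have bB x : - t <= x <= t -> `|B x t - B x (- t)| <= M * (t - - t).
  move=> hx; apply: (mean_bound0 (u := fun y => Q x y)) => // y hy; first exact/hB/sq.
  by have [] := hM x y (bx x hx) (bx y hy).
have m1 : - t <= - t <= t by rewrite lexx tt. have m2 : - t <= t <= t by rewrite lexx tt.
have := bA _ m1; have := bA _ m2; have := bB _ m1; have := bB _ m2.
rewrite /circ !ler_norml => /andP[p1 p2] /andP[p3 p4] /andP[p5 p6] /andP[p7 p8].
have Mt : 0 <= t * M by rewrite mulr_ge0// ltW.
apply/andP; split; lra.
Qed.

End goursat.

(** * Complex differentiability with a real modulus *)

Section complex_modulus.
Variable R : realType.
Implicit Types (z w a b : R[i]) (f g : R[i] -> R[i]) (e d r : R).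

Definition cabs z : R := @abs R (complex_scalars R) z.

Lemma cabs_ge0 z : 0 <= cabs z. Proof. exact: abs_ge0. Qed.
Lemma cabs0 : cabs 0 = 0. Proof. exact: abs0. Qed.
Lemma cabs_eq0 z : cabs z = 0 -> z = 0. Proof. exact: abs_eq0. Qed.
Lemma cabsD z w : cabs (z + w) <= cabs z + cabs w. Proof. exact: absD. Qed.
Lemma cabsM z w : cabs (z * w) = cabs z * cabs w. Proof. exact: absM. Qed.
Lemma cabs_real (x : R) : cabs x%:C%C = `|x|.
Proof. exact: (abs_of_real (complex_scalars R) x). Qed.

Lemma cabsN z : cabs (- z) = cabs z.
Proof. by rewrite -mulN1r cabsM -(rmorph1 (real_complex R)) -rmorphN cabs_real normrN1 mul1r. Qed.

Lemma cabs_gt0 z : z != 0 -> 0 < cabs z.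
Proof.
by move=> z0; rewrite lt_neqAle cabs_ge0 andbT eq_sym; apply: contra z0 => /eqP/cabs_eq0/eqP.
Qed.

Lemma cabsV z : cabs z^-1 = (cabs z)^-1. Proof. exact: ComplexField.Normc.normcV. Qed.

Lemma Re_le_cabs z : `|complex.Re z| <= cabs z.
Proof.
case: z => x y /=; rewrite -sqrtr_sqr /cabs /= ler_sqrt ?addr_ge0 ?sqr_ge0//.
by rewrite lerDl sqr_ge0.
Qed.

Lemma Im_le_cabs z : `|complex.Im z| <= cabs z.
Proof.
case: z => x y /=; rewrite -sqrtr_sqr /cabs /= ler_sqrt ?addr_ge0 ?sqr_ge0//.
by rewrite lerDr sqr_ge0.
Qed.

Lemma cabs_i : cabs 'i%C = 1.
Proof. by rewrite /cabs /= expr0n /= add0r expr1n sqrtr1. Qed.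

Lemma cabs_le z : cabs z <= `|complex.Re z| + `|complex.Im z|.
Proof.
by rewrite {1}[z]complexE (le_trans (cabsD _ _))// cabsM cabs_i mul1r !cabs_real.
Qed.

(* As [derivable f z 1], with a modulus valued in [R] instead of [R[i]]. *)
Definition cdiff f z : Prop := exists c, forall e, 0 < e ->
  exists2 d, 0 < d & forall w, cabs (w - z) <= d ->
    cabs (f w - f z - c * (w - z)) <= e * cabs (w - z).

Lemma derivable_cdiff (h : R[i]^o -> R[i]^o) (z : R[i]^o) : derivable h z 1 -> cdiff h z.
Proof.
have E (t l' x : R[i]) : t != 0 -> x - l' * t = - (t * (l' - t^-1 * x)).
  by move=> t0; rewrite mulrBr mulVKf// opprB [l' * _]mulrC.
move=> /cvg_ex [l hl]; exists l => e e0.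
have e0' : 0 < e%:C%C :> R[i] by rewrite ltcR.
move/cvgrPdist_le: hl => /(_ _ e0') /nbhs_normP [dl /= d0 hd].
have /andP[Imd Red] : (complex.Im dl == 0) && (0 < complex.Re dl) by move: d0; rewrite ltcE.
exists (complex.Re dl / 2); first by rewrite divr_gt0.
move=> w hw; have [->|wz] := eqVneq w z; first by rewrite !subrr mulr0 subrr cabs0 mulr0.
have t0 : w - z != 0 by rewrite subr_eq0.
have : `|l - (w - z)^-1 *: (h ((w - z) *: 1 + z) - h z)| <= e%:C%C.
  apply: (hd (w - z)) => //; rewrite /ball_ /= sub0r normrN.
  rewrite -[`|_|]/((cabs (w - z))%:C%C) ltcE /= Imd /=.
  by rewrite (le_lt_trans hw)// ltr_pdivrMr// ltr_pMr// ltr1n.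
rewrite -[`|_|]/((cabs (l - (w - z)^-1 * (h ((w - z) * 1 + z) - h z)))%:C%C) lecR mulr1 subrK => h1.
have -> : h w - h z - l * (w - z) = - ((w - z) * (l - (w - z)^-1 * (h w - h z))).
  exact: E t0.
by rewrite cabsN cabsM mulrC ler_wpM2r ?cabs_ge0.
Qed.

Lemma cdiff_lipschitz f z : cdiff f z -> exists L d, [/\ 0 < L, 0 < d &
  forall w, cabs (w - z) <= d -> cabs (f w - f z) <= L * cabs (w - z)].
Proof.
move=> [c hc]; have [d d0 hd] := hc 1 ltr01; exists (1 + cabs c), d; split => //.
  by have := cabs_ge0 c; lra.
move=> w hw; rewrite -[f w - f z](subrK (c * (w - z))) (le_trans (cabsD _ _))//.
by rewrite cabsM mulrDl lerD// hd.
Qed.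

Lemma cdiff_continuous f z e : cdiff f z -> 0 < e ->
  exists2 d, 0 < d & forall w, cabs (w - z) <= d -> cabs (f w - f z) <= e.
Proof.
move=> /cdiff_lipschitz [L [d [L0 d0 hd]]] e0; exists (Num.min d (e / L)).
  by rewrite lt_min d0 divr_gt0.
move=> w; rewrite le_min => /andP[h1 h2]; rewrite (le_trans (hd w h1))//.
by rewrite mulrC -ler_pdivlMr.
Qed.

Lemma cdiff_germ f g z r : 0 < r -> (forall w, cabs (w - z) <= r -> f w = g w) ->
  cdiff f z -> cdiff g z.
Proof.
move=> r0 fg [c hc]; exists c => e e0; have [d d0 hd] := hc e e0.
exists (Num.min d r); first by rewrite lt_min d0.
move=> w; rewrite le_min => /andP[h1 h2].
by rewrite -!fg ?subrr ?cabs0 ?(ltW r0)//; exact: hd.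
Qed.

Lemma cdiff_subc f a z : cdiff f z -> cdiff (fun w => f w - a) z.
Proof.
move=> [c hc]; exists c => e e0; have [d d0 hd] := hc e e0; exists d => // w hw.
by have := hd w hw; congr (cabs _ <= _); ring.
Qed.

Lemma cdiff_affine f a b z : cdiff f (a * z + b) -> cdiff (fun w => f (a * w + b)) z.
Proof.
move=> [c hc]; exists (c * a) => e e0.
have a1 : 0 < cabs a + 1 by have := cabs_ge0 a; lra.
have [d d0 hd] := hc (e / (cabs a + 1)) (divr_gt0 e0 a1).
exists (d / (cabs a + 1)); first by rewrite divr_gt0.
move=> w hw; have E : a * w + b - (a * z + b) = a * (w - z) by ring.
have small : cabs (a * w + b - (a * z + b)) <= d.
  rewrite E cabsM (@le_trans _ _ ((cabs a + 1) * cabs (w - z)))//.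
    by rewrite ler_wpM2r ?cabs_ge0// lerDl.
  by rewrite mulrC -ler_pdivlMr.
have := hd _ small; rewrite E mulrA => /le_trans; apply.
rewrite cabsM mulrA ler_wpM2r ?cabs_ge0// mulrAC ler_pdivrMr// ler_wpM2l ?(ltW e0)//.
by rewrite lerDl.
Qed.

Lemma cdiffM f g z : cdiff f z -> cdiff g z -> cdiff (fun w => f w * g w) z.
Proof.
move=> hf hg; have [c hc] := hf; have [c' hc'] := hg.
exists (c * g z + f z * c') => e e0; have e3 : 0 < e / 3 by rewrite divr_gt0.
have p a : 0 < cabs a + 1 by have := cabs_ge0 a; lra.
have [d1 d10 h1] := hc _ (divr_gt0 e3 (p (g z))).
have [d2 d20 h2] := cdiff_continuous hg (divr_gt0 e3 (p c)).
have [d3 d30 h3] := hc' _ (divr_gt0 e3 (p (f z))).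
have [d4 d40 h4] := cdiff_continuous hg ltr01.
exists (Num.min (Num.min d1 d2) (Num.min d3 d4)); first by rewrite !lt_min d10 d20 d30.
move=> w; rewrite !le_min => /andP[/andP[/h1 k1 /h2 k2] /andP[/h3 k3 /h4 k4]].
set t := w - z in k1 k3 *; have t0 := cabs_ge0 t.
have -> : f w * g w - f z * g z - (c * g z + f z * c') * t =
  (f w - f z - c * t) * g w + (c * t * (g w - g z) + f z * (g w - g z - c' * t)) by ring.
have gw : cabs (g w) <= cabs (g z) + 1.
  by rewrite -[g w](subrK (g z)) (le_trans (cabsD _ _))// addrC lerD2l.
have b1 : cabs ((f w - f z - c * t) * g w) <= e / 3 * cabs t.
  rewrite cabsM (le_trans (ler_pM (cabs_ge0 _) (cabs_ge0 _) k1 gw))//.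
  by rewrite mulrAC divfK// gt_eqF.
have b2 : cabs (c * t * (g w - g z)) <= e / 3 * cabs t.
  rewrite !cabsM mulrAC ler_wpM2r// (@le_trans _ _ ((cabs c + 1) * (e / 3 / (cabs c + 1))))//.
    by rewrite ler_pM ?cabs_ge0// lerDl.
  by rewrite mulrC divfK// gt_eqF.
have b3 : cabs (f z * (g w - g z - c' * t)) <= e / 3 * cabs t.
  rewrite cabsM (@le_trans _ _ ((cabs (f z) + 1) * (e / 3 / (cabs (f z) + 1) * cabs t)))//.
    by rewrite ler_pM ?cabs_ge0// lerDl.
  by rewrite mulrA [(_ + 1) * _]mulrC divfK// gt_eqF.
rewrite (le_trans (cabsD _ _))// (le_trans (lerD b1 (cabsD _ _)))//.
have := lerD b2 b3; lra.
Qed.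

Lemma cdiff_inv z : z != 0 -> cdiff (fun w => w^-1) z.
Proof.
move=> z0; exists (- (z ^+ 2)^-1) => e e0; have Z := cabs_gt0 z0.
exists (Num.min (cabs z / 2) (e * cabs z ^+ 3 / 2)).
  by rewrite lt_min !divr_gt0// mulr_gt0// exprn_gt0.
move=> w; rewrite le_min => /andP[h1 h2]; set t := w - z in h1 h2 *.
have hw : cabs z / 2 <= cabs w.
  have -> : w = z - - t by rewrite /t opprK addrC subrK.
  have := cabsD (z - - t) (- t); rewrite subrK cabsN; lra.
have w0 : w != 0.
  by apply/eqP => w0; move: hw; rewrite w0 cabs0; lra.
have -> : w^-1 - z^-1 - - (z ^+ 2)^-1 * t = t * t * (w^-1 * (z^-1 * z^-1)).
  by rewrite /t; field; rewrite w0 z0.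
rewrite !cabsM !cabsV.
have wi : (cabs w)^-1 <= 2 / cabs z.
  rewrite -[2 / _]invrK lef_pV2 ?posrE ?invr_gt0 ?divr_gt0 ?cabs_gt0//.
  by rewrite invf_div.
have t0 := cabs_ge0 t.
rewrite -mulrA [e * _]mulrC ler_wpM2l// (le_trans (ler_pM t0 _ h2 (_ : _ <= 2 / cabs z * ((cabs z)^-1 * (cabs z)^-1))))//.
- by rewrite !mulr_ge0 ?invr_ge0 ?cabs_ge0.
- by rewrite ler_wpM2r ?mulr_ge0 ?invr_ge0 ?cabs_ge0.
- rewrite le_eqVlt; apply/orP; left; apply/eqP; field; by rewrite gt_eqF.
Qed.

End complex_modulus.

(** * Vanishing on squares and on segments *)

Section squares.
Variable R : realType.
Implicit Types (f k : R[i] -> R[i]) (z w v : R[i]) (x y : R).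

Definition pt x y : R[i] := (x +i* y)%C.

Lemma pt_dist x y x' y' : cabs (pt x y - pt x' y') <= `|x - x'| + `|y - y'|.
Proof. exact: cabs_le. Qed.

Lemma pt_neq0 x y : (x, y) <> (0, 0) -> pt x y != 0.
Proof. by move=> h; apply/eqP => -[x0 y0]; apply: h; rewrite x0 y0. Qed.

(* With [h = (f - f 0) / z] the form [Im (h dz)] is closed off [0], and on the
   boundary of the square [h dz = - f 0 dz / z], whose imaginary part integrates
   to a nonzero multiple of [Re (f 0)]. *)
Lemma square_Re f : (forall x y, -3 < x < 3 -> -3 < y < 3 -> cdiff f (pt x y)) ->
  (forall x y, -1 <= x <= 1 -> -1 <= y <= 1 -> `|x| = 1 \/ `|y| = 1 -> f (pt x y) = 0) ->
  complex.Re (f 0) = 0.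
Proof.
move=> df fb; have i3 : -3 < (0 : R) < 3 by apply/andP; split; lra.
have [c0 hc0] := df 0 0 i3 i3; rewrite -[pt 0 0]/(0 : R[i]) in hc0.
(* The value [c0], the derivative of [f] at 0, makes [h] continuous there; [goursat_punctured] asks
   for no differentiability at 0. *)
pose h z := if z == 0 then c0 else (f z - f 0) / z.
have hE z : z != 0 -> h z * z = f z - f 0 by move=> z0; rewrite /h (negbTE z0) divfK.
have h0 e : 0 < e -> exists2 d, 0 < d & forall w, cabs (w - 0) <= d -> cabs (h w - h 0) <= e.
  move=> e0; have [d d0 hd] := hc0 e e0; exists d => // w hw.
  rewrite {2}/h eqxx; have [->|w0] := eqVneq w 0; first by rewrite /h eqxx subrr cabs0 ltW.
  rewrite -(ler_pM2r (cabs_gt0 w0)) -cabsM mulrBl hE//.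
  by have := hd w hw; rewrite subr0.
have dh x y : -3 < x < 3 -> -3 < y < 3 -> (x, y) <> (0, 0) -> cdiff h (pt x y).
  move=> hx hy /pt_neq0 nz.
  have := cdiffM (cdiff_subc (f 0) (df x y hx hy)) (cdiff_inv nz).
  have Z := cabs_gt0 nz; have Z2 : 0 < cabs (pt x y) / 2 by rewrite divr_gt0.
  apply: (cdiff_germ Z2) => w hw; rewrite /h; case: eqP => // w0.
  by exfalso; move: hw; rewrite w0 sub0r cabsN; clear -Z; lra.
have hcont x y e : -3 < x < 3 -> -3 < y < 3 -> 0 < e ->
    exists2 d, 0 < d & forall w, cabs (w - pt x y) <= d -> cabs (h w - h (pt x y)) <= e.
  move=> hx hy e0; have [[-> ->]|ne] := pselect ((x, y) = (0, 0)); first exact: h0.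
  exact: cdiff_continuous (dh x y hx hy ne) e0.
pose P x y := complex.Im (h (pt x y)); pose Q x y := complex.Re (h (pt x y)).
have cP y : -3 < y < 3 -> forall x, -3 < x < 3 -> {for x, continuous (fun x => P x y)}.
  move=> hy x hx; apply/cvgrPdist_le => e e0; have [d d0 hd] := hcont x y e hx hy e0.
  apply/nbhs_normP; exists d => //= t; rewrite /ball_ /= => ht; rewrite distrC.
  have : cabs (pt t y - pt x y) <= d.
    by rewrite (le_trans (pt_dist _ _ _ _))// subrr normr0 addr0 distrC ltW.
  by move=> /hd; apply: le_trans; rewrite -raddfB; exact: Im_le_cabs.
have cQ x : -3 < x < 3 -> forall y, -3 < y < 3 -> {for y, continuous (fun y => Q x y)}.
  move=> hx y hy; apply/cvgrPdist_le => e e0; have [d d0 hd] := hcont x y e hx hy e0.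
  apply/nbhs_normP; exists d => //= t; rewrite /ball_ /= => ht; rewrite distrC.
  have : cabs (pt x t - pt x y) <= d.
    by rewrite (le_trans (pt_dist _ _ _ _))// subrr normr0 add0r distrC ltW.
  by move=> /hd; apply: le_trans; rewrite -raddfB; exact: Re_le_cabs.
have /choice[A hA] : forall y, exists U : R -> R, -3 < y < 3 -> forall x, -2 < x < 2 ->
    is_derive x (1 : R) U (P x y).
  move=> y.
  have [hy|hy] := pselect (-3 < y < 3); last by exists (fun=> 0).
  by have [U hU] := primitive_exists (cP y hy); exists U.
have /choice[B hB] : forall x, exists U : R -> R, -3 < x < 3 -> forall y, -2 < y < 2 ->
    is_derive y (1 : R) U (Q x y).
  move=> x.
  have [hx|hx] := pselect (-3 < x < 3); last by exists (fun=> 0).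
  by have [U hU] := primitive_exists (cQ x hx); exists U.
have w23 x : -2 < x < 2 -> -3 < x < 3 by clear => /andP[? ?]; apply/andP; split; lra.
have w13 x : -1 <= x <= 1 -> -3 < x < 3 by clear => /andP[? ?]; apply/andP; split; lra.
have w12 x : -1 <= x <= 1 -> -2 < x < 2 by clear => /andP[? ?]; apply/andP; split; lra.
have sA y x : in_square x y -> is_derive x (1 : R) (A y) (P x y).
  by move=> [hx hy]; apply: hA => //; exact: w23.
have sB x y : in_square x y -> is_derive y (1 : R) (B x) (Q x y).
  by move=> [hx hy]; apply: hB => //; exact: w23.
have hcl x y : -1 <= x <= 1 -> -1 <= y <= 1 -> (x, y) <> (0, 0) -> closed_at P Q x y.
  move=> hx hy ne; have [c hc] := dh x y (w13 _ hx) (w13 _ hy) ne.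
  exists (complex.Im c), (complex.Re c), (- complex.Im c) => e e0.
  have [d d0 hd] := hc e e0; exists (d / 2); first by rewrite divr_gt0.
  move=> x' y' hx' hy'.
  have dist : cabs (pt x' y' - pt x y) <= `|x' - x| + `|y' - y| := pt_dist _ _ _ _.
  have small : cabs (pt x' y' - pt x y) <= d by rewrite (le_trans dist)// [d]splitr lerD.
  have := hd _ small; set E := h _ - h _ - _ => hE'.
  have {}hE' : cabs E <= e * (`|x' - x| + `|y' - y|).
    by rewrite (le_trans hE')// ler_wpM2l// ltW.
  have [RE IE] : complex.Re E = Q x' y' - (Q x y + complex.Re c * (x' - x) + - complex.Im c * (y' - y)) /\
      complex.Im E = P x' y' - (P x y + complex.Im c * (x' - x) + complex.Re c * (y' - y)).
    rewrite /E /Q /P; case: (h (pt x' y')) => a1 a2; case: (h (pt x y)) => b1 b2.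
    by clear; case: c => c1 c2 /=; split; ring.
  by rewrite -RE -IE; split; apply: le_trans hE'; [exact: Im_le_cabs|exact: Re_le_cabs].
have [d1 d10 hd1] := h0 1 ltr01.
have circ0 : circ A B (-1) 1 (-1) 1 = 0.
  apply: (goursat_punctured sA sB (M := cabs (h 0) + 1)) => //.
    by have := cabs_ge0 (h 0); lra.
  exists (d1 / 2); first by rewrite divr_gt0.
  move=> x y hx hy.
  have small : cabs (pt x y - 0) <= d1.
    by rewrite subr0 (le_trans (cabs_le _))//= [d1]splitr lerD.
  have b : cabs (h (pt x y)) <= cabs (h 0) + 1.
    by rewrite -[h (pt x y)](subrK (h 0)) (le_trans (cabsD _ _))// addrC lerD2l hd1.
  by split; apply: le_trans b; [exact: Im_le_cabs|exact: Re_le_cabs].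
set g1 := complex.Re (f 0); set g2 := complex.Im (f 0).
have bd x y : -1 <= x <= 1 -> -1 <= y <= 1 -> `|x| = 1 \/ `|y| = 1 ->
    Q x y * x - P x y * y = - g1 /\ Q x y * y + P x y * x = - g2.
  move=> hx hy b1; have nz : pt x y != 0.
    apply: pt_neq0 => -[x0 y0]; move: b1; rewrite x0 y0 normr0.
    by case=> /esym/eqP; rewrite oner_eq0.
  have := hE _ nz; rewrite (fb x y)// sub0r /Q /P /g1 /g2.
  case: (h (pt x y)) => a1 a2; case: (f 0) => b1' b2' /= e.
  have := congr1 (@complex.Re R) e; have := congr1 (@complex.Im R) e => /= <- <-.
  by split; ring.
(* The four sides are traversed with one parameter: [T 1 - T (-1)] is the circulation, which is 0,
   so [T'] vanishes at some [xi]. There the boundary values give T'(xi) (1 + xi^2) = - 4 Re (f 0),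
   which spares the integral of 1/z. *)
pose T (t : R) : R := A (-1) t + B 1 t - A 1 t - B (-1) t.
pose T' (t : R) : R := P t (-1) + Q 1 t - P t 1 - Q (-1) t.
have m1 : -1 <= (1 : R) <= 1 by apply/andP; split; lra.
have m2 : -1 <= (-1 : R) <= 1 by apply/andP; split; lra.
have dT (t : R) : -1 <= t <= 1 -> is_derive t (1 : R) T (T' t).
  move=> ht; have k := w12 _ ht.
  have k1 := hA (-1) (w13 _ m2) t k; have k2 := hB 1 (w13 _ m1) t k.
  have k3 := hA 1 (w13 _ m1) t k; have k4 := hB (-1) (w13 _ m2) t k.
  exact: is_deriveB (is_deriveB (is_deriveD k1 k2) k3) k4.
have [| | |xi hxi eT] := @MVT_segment R T T' (-1) 1.
- by lra.
- move=> t; rewrite in_itv /= => /andP[t1 t2]; apply: dT; by rewrite (ltW t1) (ltW t2).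
- by apply: derivable_within_continuous => t; rewrite in_itv /= => ht; have [] := dT t ht.
have hxi' : -1 <= xi <= 1 by move: hxi; rewrite in_itv.
have T0 : T' xi = 0.
  have e : T 1 - T (-1) = circ A B (-1) 1 (-1) 1 by rewrite /T /circ; ring.
  by move: eT; rewrite e circ0; lra.
have n1 : `|1 : R| = 1 by rewrite normr1.
have n2 : `|-1 : R| = 1 by rewrite normrN1.
have [p1 p2] := bd xi (-1) hxi' m2 (or_intror n2).
have [q1 q2] := bd 1 xi m1 hxi' (or_introl n1).
have [r1 r2] := bd xi 1 hxi' m1 (or_intror n1).
have [s1 s2] := bd (-1) xi m2 hxi' (or_introl n2).
have E1 : P xi (-1) * (1 + xi * xi) = - g1 + xi * - g2 by rewrite -p1 -p2; ring.
have E2 : Q 1 xi * (1 + xi * xi) = - g1 + xi * - g2 by rewrite -q1 -q2; ring.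
have E3 : P xi 1 * (1 + xi * xi) = - - g1 + xi * - g2 by rewrite -r1 -r2; ring.
have E4 : Q (-1) xi * (1 + xi * xi) = - - g1 + xi * - g2 by rewrite -s1 -s2; ring.
have : T' xi * (1 + xi * xi) = - (4 * g1).
  have -> : T' xi * (1 + xi * xi) = P xi (-1) * (1 + xi * xi) + Q 1 xi * (1 + xi * xi)
      - P xi 1 * (1 + xi * xi) - Q (-1) xi * (1 + xi * xi) by rewrite /T'; ring.
  by rewrite E1 E2 E3 E4; ring.
rewrite T0 mul0r; clear; lra.
Qed.

Lemma square_vanish f : (forall x y, -3 < x < 3 -> -3 < y < 3 -> cdiff f (pt x y)) ->
  (forall x y, -1 <= x <= 1 -> -1 <= y <= 1 -> `|x| = 1 \/ `|y| = 1 -> f (pt x y) = 0) ->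
  f 0 = 0.
Proof.
move=> df fb; have r0 := square_Re df fb.
have i0 : complex.Re ('i%C * f 0) = 0.
  apply: (@square_Re (fun z => 'i%C * f z)) => [x y hx hy|x y hx hy b].
    apply: (@cdiffM R (fun=> 'i%C)); last exact: df.
    by exists 0 => e e0; exists 1 => // w _; rewrite subrr mul0r subrr cabs0 mulr_ge0 ?cabs_ge0// ltW.
  by rewrite fb// mulr0.
move: r0 i0; case: (f 0) => a b /= -> h; congr (_ +i* _)%C.
by move: h; clear; lra.
Qed.

(* The product of [f] and its three quarter-turn rotations vanishes on all sides. *)
Lemma square_side f : (forall x y, -3 < x < 3 -> -3 < y < 3 -> cdiff f (pt x y)) ->
  (forall x, -1 <= x <= 1 -> f (pt x (-1)) = 0) -> f 0 = 0.
Proof.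
move=> df fb.
pose F z := (f z * f ('i%C * z + 0)) * (f (-1 * z + 0) * f (- 'i%C * z + 0)).
have iz x y : 'i%C * pt x y + 0 = pt (- y) x.
  by rewrite addr0 /pt; congr (_ +i* _)%C; ring.
have mz x y : -1 * pt x y + 0 = pt (- x) (- y).
  by rewrite addr0 mulN1r.
have miz x y : - 'i%C * pt x y + 0 = pt y (- x).
  by rewrite addr0 /pt; congr (_ +i* _)%C; ring.
have F0 : F 0 = 0.
  apply: square_vanish => [x y hx hy|x y hx hy b].
    have hx' : -3 < - x < 3 by clear -hx; move/andP: hx => [? ?]; apply/andP; split; lra.
    have hy' : -3 < - y < 3 by clear -hy; move/andP: hy => [? ?]; apply/andP; split; lra.
    apply: cdiffM; apply: cdiffM; first exact: df.
    - by apply: cdiff_affine; rewrite iz; exact: df.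
    - by apply: cdiff_affine; rewrite mz; exact: df.
    - by apply: cdiff_affine; rewrite miz; exact: df.
  have hx' : -1 <= - x <= 1 by clear -hx; move/andP: hx => [? ?]; apply/andP; split; lra.
  have hy' : -1 <= - y <= 1 by clear -hy; move/andP: hy => [? ?]; apply/andP; split; lra.
  have n1 (t : R) : `|t| = 1 -> t = 1 \/ t = -1.
    clear => e; have [h|h] := leP 0 t; [left|right]; move: e.
      by rewrite ger0_norm.
    by rewrite ltr0_norm// => e; lra.
  rewrite /F iz mz miz.
  case: b => /n1 [] e; rewrite e ?opprK in hx hy hx' hy' *.
  - by rewrite (fb y)// !mulr0.
  - by rewrite (fb (- y))// mulr0 mul0r.
  - by rewrite (fb (- x))// mul0r mulr0.
  - by rewrite (fb x)// !mul0r.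
move: F0; rewrite /F !mulr0 !addr0 => /eqP.
by rewrite !mulf_eq0 !orbb => /eqP.
Qed.

Definition cc : R[i] := pt (1 / 2) (1 / 2).

Lemma cabs_cc : cabs cc <= 1.
Proof. by rewrite (le_trans (cabs_le _))//= ger0_norm ?divr_ge0//; lra. Qed.

(** The square with the segment from [p] to [p + v] as a side has centre [p + v * cc], where
    [square_side] applies after an affine change of variable. The factor 4 covers the three times
    larger square on which differentiability is required. *)
Lemma segment_vanish k (p v : R[i]) (r : R) : (forall z, cabs (z - p) < r -> cdiff k z) ->
  4 * cabs v < r -> (forall t : R, 0 <= t <= 1 -> k (p + t%:C%C * v) = 0) -> k (p + v * cc) = 0.
Proof.
move=> dk vr hk; pose a := v * (2^-1)%:C%C; pose b := p + v * cc.
have := @square_side (fun z => k (a * z + b)); rewrite mulr0 add0r; apply => [x y hx hy|x hx].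
  apply: cdiff_affine; apply: dk; apply: le_lt_trans vr.
  have -> : a * pt x y + b - p = v * ((2^-1)%:C%C * pt x y + cc) by rewrite /a /b; ring.
  rewrite cabsM mulrC ler_wpM2r ?cabs_ge0// (le_trans (cabsD _ _))// cabsM cabs_real.
  have h1 := cabs_cc; have h2 := cabs_le (pt x y).
  have h3 : `|x| <= 3 by clear -hx; move/andP: hx => [? ?]; rewrite ler_norml; apply/andP; split; lra.
  have h4 : `|y| <= 3 by clear -hy; move/andP: hy => [? ?]; rewrite ler_norml; apply/andP; split; lra.
  rewrite ger0_norm ?invr_ge0//; rewrite /= in h2; clear -h1 h2 h3 h4; lra.
have -> : a * pt x (-1) + b = p + ((x + 1) / 2)%:C%C * v.
  have e : (2^-1)%:C%C * pt x (-1) + cc = ((x + 1) / 2)%:C%C.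
    by rewrite /cc /pt; apply/eqP; rewrite eq_complex /=; apply/andP; split; apply/eqP; field.
  by rewrite -e /a /b; ring.
by apply: hk; clear -hx; move/andP: hx => [? ?]; apply/andP; split; lra.
Qed.

(* Four steps of [segment_vanish] turn the segment by the angle [pi], as
   [((1 + i) / 2)^4 = - 1/4]. *)
Lemma one_sided_vanish k (r : R) : 0 < r -> (forall z, cabs (z - 1) < r -> cdiff k z) ->
  (forall t : R, 1 <= t < 1 + r -> k t%:C%C = 0) -> k (1 - r / 32%:R)%:C%C = 0.
Proof.
move=> r0 dk hk.
pose Z (v : R[i]) := 4 * cabs v < r /\ forall t : R, 0 <= t <= 1 -> k (1 + t%:C%C * v) = 0.
(* Applied to every [t * v], [segment_vanish] gives zeros along the whole segment in the direction
   [v * cc], so that the step can be repeated. *)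
have step v : Z v -> Z (v * cc).
  move=> [vr hv]; split.
    rewrite (le_lt_trans _ vr)// ler_wpM2l// cabsM ler_piMr ?cabs_ge0//; exact: cabs_cc.
  move=> t /andP[t0 t1]; rewrite mulrA; apply: (@segment_vanish k 1 _ r) => //.
    by rewrite (le_lt_trans _ vr)// ler_wpM2l// cabsM cabs_real ger0_norm// ler_piMl ?cabs_ge0.
  move=> s /andP[s0 s1]; rewrite mulrA -rmorphM; apply: hv.
  by rewrite mulr_ge0//= mulr_ile1.
have Z0 : Z (r / 8%:R)%:C%C.
  have r8 : 0 < r / 8%:R by rewrite divr_gt0.
  split; first by rewrite cabs_real gtr0_norm//; lra.
  move=> t /andP[t0 t1]; rewrite -rmorphM -(rmorph1 (real_complex R)) -rmorphD; apply: hk.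
  rewrite lerDl mulr_ge0 ?(ltW r8)//= ltrD2l (le_lt_trans (ler_piMl (ltW r8) t1))//; lra.
have [_ h] := step _ (step _ (step _ (step _ Z0))).
have := h 1 (ltac:(by rewrite ler01 lexx)); rewrite rmorph1 mul1r => <-; congr k.
apply/eqP; rewrite /cc /pt eq_complex /=; apply/andP; split; apply/eqP; lra.
Qed.

End squares.

(** * Codimension *)

Section codimension.
Variables (R : realType) (alpha gam : {posnum R}).
Hypotheses (gam1 : gam%:num <= 1) (gamal : gam%:num < alpha%:num).
Local Notation CR := (holderR gam).
Local Notation CC := (holderC gam).
Local Notation phi0 := (neg_log_Df gam1 (ltW gamal)).

Definition cnorm (phi : CC) : R := @holder_norm R (complex_scalars R) gam phi.

Lemma cnorm_ge0 phi : 0 <= cnorm phi.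
Proof.
by apply: addr_ge0; [exact: (sup_norm_ge0 phi)|exact: (holder_seminorm_ge0 phi)].
Qed.

Lemma cnormZ (a : R[i]) phi : cnorm (a *: phi) = cabs a * cnorm phi.
Proof. exact: (@holder_normZ R (complex_scalars R) gam a phi). Qed.

Lemma nbhs_cholder phi (W : set CC) : nbhs phi W ->
  exists2 e, 0 < e & forall psi, cnorm (psi - phi) < e -> W psi.
Proof.
move=> /nbhs_normP [d /= d0 hd].
have /andP[Imd Red] : (complex.Im d == 0) && (0 < complex.Re d) by move: d0; rewrite ltcE.
exists (complex.Re d) => // psi h; apply: hd; rewrite /ball_ /= distrC.
by rewrite -[`|_|]/((cnorm (psi - phi))%:C%C) ltcE /= Imd.
Qed.

Lemma line_derivable (v : CC) (z : R[i]^o) : derivable (fun z : R[i]^o => z *: v : CC) z 1.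
Proof.
apply/cvg_ex; exists v; apply: cvg_near_cst; near=> t.
have t0 : t != 0 by near: t; exact: nbhs_dnbhs_neq.
rewrite /= -scalerBl addrK scalerA.
by rewrite -[t *: 1]/(t * 1) mulr1 mulVf// scale1r.
Unshelve. all: by end_near. Qed.

Lemma complexifyZ (t : R) (phi : CR) : complexify (t *: phi) = t%:C%C *: complexify phi.
Proof. by apply/val_inj/funext => x; rewrite /= -[LHS]/((t * phi x)%:C%C) rmorphM. Qed.

Lemma geo_not_codim1 : ~ codim1_at (transition_locus alpha gam) phi0.
Proof.
move=> [U [h [oU Uphi [W [h' [oW holo hU]]] _ hz]]].
pose v := complexify phi0; pose H (z : R[i]^o) : CC := z *: v.
have [eW eW0 hW] : exists2 e, 0 < e & forall psi : CC, cnorm (psi - v) < e -> W psi.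
  by apply/nbhs_cholder/open_nbhs_nbhs; split => //; exact: (hU _ Uphi).1.
have [eU eU0 hUe] : exists2 e, 0 < e & forall psi : CR, hnorm (psi - phi0) < e -> U psi.
  by apply/nbhs_holderP/open_nbhs_nbhs; split.
have n1 : 0 < cnorm v + 1 by have := cnorm_ge0 v; lra.
have n2 : 0 < hnorm phi0 + 1 by have := hnorm_ge0 phi0; lra.
(* Keeps [z *: phi0] in [W] for complex [z], and in [U] for real [z], at distance less than [r] from
   1; [r <= 1] makes [1 - r / 32] positive. *)
pose r := Num.min 1 (Num.min (eW / (cnorm v + 1)) (eU / (hnorm phi0 + 1))).
have r0 : 0 < r by rewrite !lt_min ltr01 !divr_gt0.
have r1 : r <= 1 by rewrite ge_min lexx.
have rW : r * (cnorm v + 1) <= eW by rewrite -ler_pdivlMr// !ge_min lexx !orbT.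
have rU : r * (hnorm phi0 + 1) <= eU by rewrite -ler_pdivlMr// !ge_min lexx !orbT.
clearbody r.
have r0' : 0 < r%:C%C :> R[i] by rewrite ltcR.
pose D : set (R[i]^o) := ball (1 : R[i]^o) r%:C%C.
have DE z : D z <-> cabs (z - 1) < r.
  rewrite /D -ball_normE /ball_ /= distrC.
  by rewrite -[`|_|]/((cabs (z - 1))%:C%C) ltcR.
have WH z : D z -> W (H z).
  move=> /DE hz'; apply: hW; rewrite /H -[X in _ - X]scale1r -scalerBl cnormZ.
  apply: lt_le_trans rW; rewrite (@le_lt_trans _ _ (cabs (z - 1) * (cnorm v + 1)))//.
    by rewrite ler_wpM2l ?cabs_ge0// lerDl.
  by rewrite ltr_pM2r.
have dk z : cabs (z - 1) < r -> cdiff (h' \o H) z.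
  move=> /DE Dz; apply: derivable_cdiff; apply: (holo D H _ _ WH z Dz).
    exact: ball_open.
  by move=> w _; exact: line_derivable.
have hreal (t : R) : `|t - 1| < r -> (h' \o H) t%:C%C = (h (t *: phi0))%:C%C /\ U (t *: phi0).
  move=> ht; have Ut : U (t *: phi0).
    apply: hUe; rewrite -[X in _ - X]scale1r -scalerBl hnormZ.
    apply: lt_le_trans rU; rewrite (@le_lt_trans _ _ (`|t - 1| * (hnorm phi0 + 1)))//.
      by rewrite ler_wpM2l// lerDl.
    by rewrite ltr_pM2r.
  by split => //; rewrite /= /H /v -complexifyZ; exact: (hU _ Ut).2.
have hkz (t : R) : 1 <= t < 1 + r -> (h' \o H) t%:C%C = 0.
  move=> /andP[t1 t2].
  have [-> Ut] : (h' \o H) t%:C%C = (h (t *: phi0))%:C%C /\ U (t *: phi0).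
    by apply: hreal; rewrite ger0_norm ?subr_ge0//; lra.
  rewrite (_ : h (t *: phi0) = 0)//; apply/hz => //.
  by apply/geo_transition_locus => //; lra.
have := one_sided_vanish r0 dk hkz.
have [|-> Ut] := hreal (1 - r / 32%:R).
  by rewrite addrAC subrr add0r normrN gtr0_norm ?divr_gt0//; lra.
move=> h0; have {}h0 : h ((1 - r / 32%:R) *: phi0) = 0 by move: h0 => [].
have p : 0 < 1 - r / 32%:R by lra.
by move/hz : h0 => /(_ Ut) /(geo_transition_locus _ _ p); lra.
Qed.

End codimension.

Theorem proposition4p4 (R : realType) (alpha gamma : {posnum R})
    (gamma_le1 : gamma%:num <= 1) (gamma_lt_alpha : gamma%:num < alpha%:num) :
  let phi0 : holderR gamma := neg_log_Df gamma_le1 (ltW gamma_lt_alpha) in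
  let PT : set (holderR gamma) := transition_locus alpha gamma in
  let G : set (holderR gamma) := ground_delta0 alpha gamma in
  let bcrit : holderR gamma -> \bar R := beta_crit alpha gamma in
  [/\ (* 1 *)
      nonpersistent alpha phi0 /\ ~ {for phi0, continuous bcrit},
      (* 2 *)
      boundary G phi0 /\
      (forall beta : R, 0 < beta -> (PT (beta *: phi0) <-> 1 <= beta)),
      (* 3 *)
      fails_codim1_at PT phi0 &
      (* in particular *)
      [/\ ~ (PT `<=` G°),
          ~ continuous bcrit &
          [set phi | bcrit phi = 1%:E] `<` PT]].
Proof.
move=> phi0 PT G bcrit.
have PT0 : PT phi0.
  by rewrite -[phi0]scale1r; apply/geo_transition_locus.
have bG : boundary G phi0 := geo_ground_boundary gamma_le1 gamma_lt_alpha.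
have nc : ~ {for phi0, continuous bcrit} := @geo_beta_crit_discontinuous _ _ _ gamma_le1 gamma_lt_alpha.
split.
- by split => //; exact: geo_nonpersistent.
- by split => // beta; exact: geo_transition_locus.
- by split => //; exact: geo_not_codim1.
- split => [sub|cb|].
  + by case: bG => _; apply; exact: sub.
  + by apply: nc; exact: cb.
  + exact: beta_crit_one_proper.
Qed.
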